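(* Let $B$ be a one-dimensional standard Brownian motion with respect to the filtration of a complete filtered probability space $(\Omega,\mathcal{F},\{\mathcal{F}(t)\}_{t\ge 0},\mathbb{P})$, and let $x_0\in\mathbb{R}$ be deterministic. Suppose that $f:\mathbb{R}\times[0,\infty)\to\mathbb{R}$, $(x,t)\mapsto f(x,t)$, is locally Lipschitz continuous. Suppose that $g:\mathbb{R}\to\mathbb{R}$ is locally Lipschitz continuous, even, satisfies $g(x)\neq 0$ for all $x\in\mathbb{R}$, and that there is $\sigma\in\mathbb{R}\setminus\{0\}$ with $$\lim_{|x|\to\infty} g(x)=\sigma .$$ Suppose also that there exists $\rho>0$ such that $$\sup_{(x,t)\in\mathbb{R}\times[0,\infty)} x f(x,t)\le \rho .$$ Then there is a unique continuous adapted process $X=\{X(t)\}_{t\ge 0}$ satisfying $$dX(t)=f(X(t),t)\,dt+g(X(t))\,dB(t),\quad t\ge 0,\qquad X(0)=x_0 .$$ If, moreover, $$\mu:=\inf_{(x,t)\in\mathbb{R}\times[0,\infty)}\frac{x f(x,t)}{g^2(x)}>-\frac12 ,$$ then $$\limsup_{t\to\infty}\frac{|X(t)|}{\sqrt{2t\log\log t}}=|\sigma|\quad\text{almost surely.}$$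
   Context: A complete filtered probability space means that $\mathcal{F}$ is $\mathbb{P}$-complete and each $\mathcal{F}(t)$ contains all $\mathbb{P}$-null sets. The stochastic differential equation is understood in the Itô sense: $X$ is a continuous $\{\mathcal{F}(t)\}$-adapted process defined for all $t\ge0$ (no explosion) such that, almost surely, $X(t)=x_0+\int_0^t f(X(s),s)\,ds+\int_0^t g(X(s))\,dB(s)$ for all $t\ge 0$. Uniqueness means that any two such processes (for the same $B$ and $x_0$) are indistinguishable. Here $g^2(x)=(g(x))^2$, and ''even'' means $g(-x)=g(x)$ for all $x\in\mathbb{R}$. *)

(* Defs.v *)
From HB Require Import structures.
From mathcomp Require Import all_boot all_order all_algebra.
From mathcomp Require Import all_classical all_reals all_analysis.
From mathcomp Require Import measurable_realfun.

Set Implicit Arguments.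
Unset Strict Implicit.
Unset Printing Implicit Defensive.

Import Order.TTheory GRing.Theory Num.Theory.
Import numFieldNormedType.Exports.

Local Open Scope classical_set_scope.
Local Open Scope ring_scope.

(* Processes are functions [X : R -> Omega -> R] and filtrations are functions
   [F : R -> set_system Omega]; only times [t >= 0] are ever constrained. *)

Definition measurable_wrt (R : realType) (Omega : Type)
    (G : set_system Omega) (Y : Omega -> R) : Prop :=
  forall C : set R, measurable C -> G (Y @^-1` C).

(* The filtration is not required to be right-continuous. [P.-negligible] are the
   subsets of [P]-null measurable sets, hence themselves events of probability 0
   since [P] is complete. *)
Definition complete_filtered_probability_space (R : realType)
    (d : measure_display) (Omega : measurableType d) (P : probability Omega R)
    (F : R -> set_system Omega) : Prop :=
  [/\ measure_is_complete P,
      forall t : R, 0 <= t -> sigma_algebra setT (F t),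
      forall t : R, 0 <= t -> F t `<=` measurable,
      forall s t : R, 0 <= s -> s <= t -> F s `<=` F t &
      forall t : R, 0 <= t -> P.-negligible `<=` F t].

Definition adapted (R : realType) (Omega : Type) (F : R -> set_system Omega)
    (X : R -> Omega -> R) : Prop :=
  forall t : R, 0 <= t -> measurable_wrt (F t) (X t).

Definition continuous_process (R : realType) (Omega : Type)
    (X : R -> Omega -> R) : Prop :=
  forall w, {within [set t : R | 0 <= t], continuous (fun t => X t w)}.

Definition indistinguishable (R : realType) (d : measure_display)
    (Omega : measurableType d) (P : probability Omega R)
    (X Y : R -> Omega -> R) : Prop :=
  {ae P, forall w, forall t : R, 0 <= t -> X t w = Y t w}.

Definition independent_of (R : realType) (d : measure_display)
    (Omega : measurableType d) (P : probability Omega R)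
    (G : set_system Omega) (Y : Omega -> R) : Prop :=
  forall (A : set Omega) (C : set R), G A -> measurable C ->
    P (A `&` Y @^-1` C) = (P A * P (Y @^-1` C))%E.

(* The second parameter of [normal_prob] is the standard deviation. *)
Definition brownian_motion (R : realType) (d : measure_display)
    (Omega : measurableType d) (P : probability Omega R)
    (F : R -> set_system Omega) (B : R -> Omega -> R) : Prop :=
  [/\ continuous_process B,
      adapted F B,
      {ae P, forall w, B 0 w = 0},
      forall s t : R, 0 <= s -> s < t ->
        independent_of P (F s) (fun w => B t w - B s w) &
      forall s t : R, 0 <= s -> s < t -> forall C : set R, measurable C ->
        P ((fun w => B t w - B s w) @^-1` C)
        = normal_prob 0 (Num.sqrt (t - s)) C].

(* The process sum_(i < sp_size) sp_coef i * 1_(]sp_time i, sp_time i.+1]]. *)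
Record simple_process (R : realType) (Omega : Type)
    (F : R -> set_system Omega) := SimpleProcess {
  sp_size : nat ;
  sp_time : nat -> R ;
  sp_coef : nat -> Omega -> R ;
  sp_time_ge0 : 0 <= sp_time 0%N ;
  sp_time_le : {homo sp_time : i j / (i <= j)%N >-> i <= j} ;
  sp_coef_measurable : forall i, measurable_wrt (F (sp_time i)) (sp_coef i) ;
  sp_coef_bounded : forall i, exists M : R, forall w, `|sp_coef i w| <= M }.

Definition simple_value (R : realType) (Omega : Type)
    (F : R -> set_system Omega) (S : simple_process F) (s : R) (w : Omega) : R :=
  \sum_(i < sp_size S)
    sp_coef S i w * \1_(`]sp_time S i, sp_time S i.+1]) s.

Definition simple_integral (R : realType) (Omega : Type)
    (F : R -> set_system Omega) (B : R -> Omega -> R) (S : simple_process F)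
    (t : R) (w : Omega) : R :=
  \sum_(i < sp_size S) sp_coef S i w *
    (B (Num.min (sp_time S i.+1) t) w - B (Num.min (sp_time S i) t) w).

(* For nonnegative [Y]. Measurability is required because the value of [P] on
   a nonmeasurable set is unspecified. *)
Definition cvg_in_probability0 (R : realType) (d : measure_display)
    (Omega : measurableType d) (P : probability Omega R)
    (Y : nat -> Omega -> \bar R) : Prop :=
  (forall n, measurable_fun setT (Y n)) /\
  forall e : R, 0 < e ->
    P [set w | (e%:E <= Y n w)%E] @[n --> \oo] --> 0%E.

(* [I] is a continuous version of the Ito integral t |-> int_0^t H dB of an
   adapted integrand H with int_0^t H^2 ds finite almost surely for all t: the
   limit in probability of the integrals of simple processes approximating [H]
   in L^2([0, t]) in probability. The limit does not depend on the
   approximating sequence, and finiteness of int_0^t H^2 ds is forced by the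
   existence of one. *)
Definition is_ito_integral (R : realType) (d : measure_display)
    (Omega : measurableType d) (P : probability Omega R)
    (F : R -> set_system Omega) (B H I : R -> Omega -> R) : Prop :=
  [/\ adapted F H, continuous_process I, adapted F I &
      exists S : nat -> simple_process F, forall t : R, 0 <= t ->
        cvg_in_probability0 P (fun n w =>
          \int[lebesgue_measure]_(s in `[0%R, t])
            ((simple_value (S n) s w - H s w) ^+ 2)%:E)%E /\
        cvg_in_probability0 P (fun n w =>
          `|simple_integral B (S n) t w - I t w|%:E)].

(* dX = f(X, t) dt + g(X) dB for t >= 0, X(0) = x0. *)
Definition sde_solution (R : realType) (d : measure_display)
    (Omega : measurableType d) (P : probability Omega R)
    (F : R -> set_system Omega) (B : R -> Omega -> R)
    (f : R * R -> R) (g : R -> R) (x0 : R) (X : R -> Omega -> R) : Prop :=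
  [/\ continuous_process X,
      adapted F X &
      exists2 I : R -> Omega -> R,
        is_ito_integral P F B (fun s w => g (X s w)) I &
        {ae P, forall w, forall t : R, 0 <= t ->
          X t w = x0 + \int[lebesgue_measure]_(s in `[0, t]) f (X s w, s)
                  + I t w}].

(* R x [0, oo). The library's [locally [lipschitz f p | p in A]] asks for a
   Lipschitz estimate near every pair of points of [A * A]; on the diagonal this
   is the usual local Lipschitz condition, which implies the rest. *)
Definition space_time (R : realType) : set (R * R) :=
  setT `*` [set t | 0 <= t].
Arguments space_time : clear implicits.

(* Main.v *)
(** No stochastic calculus is used: all estimates are made for the Euler scheme on
    dyadic grids, one Gaussian increment at a time, and then passed to the limit.

    Existence: as [x f(x, t) <= rho] and [g] is bounded, the second moment of the scheme
    grows at most linearly, so that it leaves [[-N, N]] with probability [O(1 / N^2)];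
    stopped at such an exit, two schemes differ by the order of the coarser mesh in mean
    square, and a maximal inequality makes a subsequence converge locally uniformly.
    Uniqueness: the Ito integral is a limit of Riemann sums, and [E (X - Y)^2], restricted
    to the event that both paths stay bounded, satisfies a Gronwall inequality.

    By uniqueness the law of the iterated logarithm is only needed for the limit of the
    scheme. Upper bound: the outward drift [x f] is bounded, hence [E cosh(l X)] grows at a
    rate close to [l^2 sigma^2 / 2], and Borel-Cantelli applies along a geometric sequence of
    times. Lower bound: [x f >= - m g^2] with [m < 1/2] is what makes [E (l X sinh(l X))]
    grow at least at that same rate, since [V(y) = y sinh y] satisfies
    [V'' - (2 m / y) V' >= V + 2 (1 - 2 m) cosh y]. Comparing [V] with [cosh] at
    slightly smaller and larger [l] forces [|X|] to be near [|sigma| sqrt(2 T ln ln T)] at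
    time [T] with conditional probability at least [1 / ln T], which is not summable along
    [T = q^n]. *)
Require Import Defs.
From HB Require Import structures.
From mathcomp Require Import all_boot all_order all_algebra.
From mathcomp Require Import all_classical all_reals all_analysis.
From mathcomp Require Import measurable_realfun.
From mathcomp Require Import ring lra.

Set Implicit Arguments.
Unset Strict Implicit.
Unset Printing Implicit Defensive.

Import Order.TTheory GRing.Theory Num.Theory.
Import numFieldNormedType.Exports.

Local Open Scope classical_set_scope.
Local Open Scope ring_scope.

(** * Gaussian integrals as weighted Lebesgue integrals *)

Section gaussian.
Context (R : realType).
Implicit Types (s z y : R) (h : R -> \bar R).
Local Notation mu := (@lebesgue_measure R).

Import HBNNSimple.

(** The drift is locally Lipschitz with only one-sided bounds, so a plain Euler step could be
    arbitrarily large. On the grid of mesh [2^-n] it is truncated at [n]: as [n^2 2^-n] tends to 0,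
    a squared drift step is of lower order than the mesh, and shrinking towards 0 preserves both
    bounds on [x f]. The test functions [x^2], [cosh] and [y sinh y] have Gaussian averages that are
    controlled by evenness and addition formulas alone. For the lower bound [cosh] would lose the
    rate: near 0 a drift [- m g^2 / x] costs it [m sinh y / y], a fixed fraction of its growth. With
    [y sinh y] the full rate survives and a multiple of [cosh y] is gained; this gain also pays for
    the region [|x| <= K], where [g^2] is not yet close to [sigma^2]. The conditioning event in the
    lower bound is that all earlier levels were missed. It is known at the start of the block, and
    since [q] is large it makes [|X|] small there compared with the next level, which is exactly the
    starting condition of the estimate for one block. *)

Lemma integral_normal_prob (s : R) h : s != 0 -> measurable_fun setT h ->
  (forall z, 0 <= h z)%E ->
  (\int[normal_prob 0%R s]_z h z = \int[mu]_z (h z * (normal_pdf 0 s z)%:E))%E.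
Proof.
move=> s0 mh h0.
have mpdf : measurable_fun setT (fun z => (normal_pdf 0 s z)%:E).
  by apply/measurable_EFinP; exact: measurable_normal_pdf.
have pdf0 z : (0 <= (normal_pdf 0 s z)%:E)%E by rewrite lee_fin normal_pdf_ge0.
have mh' : measurable_fun (setT : set (measurableTypeR R)) h := mh.
pose k := nnsfun_approx measurableT mh'.
have kh z : (k n z)%:E @[n --> \oo] --> h z.
  by apply: (cvg_nnsfun_approx measurableT mh').
(* On a simple function the identity unfolds the definition of [normal_prob]; everything is
   nonnegative, so monotone convergence carries both sides to [h]. *)
have step n : (\int[normal_prob 0%R s]_z (k n z)%:E =
               \int[mu]_z ((k n z)%:E * (normal_pdf 0 s z)%:E))%E.
  have := @integralT_nnsfun _ (measurableTypeR R) _ (normal_prob 0 s) (k n).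
  move=> ->; rewrite sintegralE.
  under [in RHS]eq_integral => z _.
    rewrite (fimfunE (k n) z) -fsumEFin// ge0_mule_fsuml; last first.
      by move=> r; rewrite lee_fin; exact: nnfun_muleindic_ge0.
    over.
  rewrite ge0_integral_fsum//=; last 2 first.
    - move=> r; apply: emeasurable_funM => //; apply/measurable_EFinP.
      exact: measurable_funM.
    - by move=> r z _; rewrite mule_ge0 ?nnfun_muleindic_ge0.
  apply: eq_fsbigr => r; rewrite inE => -[z _ <-].
  under eq_integral => x _ do rewrite EFinM -muleA.
  rewrite ge0_integralZl//=; last 3 first.
    - by apply: emeasurable_funM => //; exact/measurable_EFinP.
    - by move=> x _; rewrite mule_ge0// lee_fin.
    - by rewrite lee_fin.
  congr *%E; rewrite /normal_prob integral_mkcond.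
  apply: eq_integral => x _; rewrite patchE indicE.
  by case: ifPn => xi; rewrite ?mul1e ?mul0e.
rewrite [LHS](_ : _ = limn (fun n => \int[normal_prob 0%R s]_z (k n z)%:E)%E).
  rewrite [RHS](_ : _ = limn (fun n =>
      \int[mu]_z ((k n z)%:E * (normal_pdf 0 s z)%:E))%E).
    by congr (limn _); apply/funext => n; exact: step.
  rewrite -monotone_convergence//.
  - apply: eq_integral => z _; apply/esym/cvg_lim => //.
    by apply: cvgeZr => //; exact: kh.
  - move=> n; apply: emeasurable_funM => //; exact/measurable_EFinP.
  - by move=> n z _; rewrite mule_ge0// lee_fin.
  - move=> z _ a b ab; rewrite lee_wpmul2r// lee_fin.
    exact/lefP/nd_nnsfun_approx.
rewrite -monotone_convergence//.
- by apply: eq_integral => z _; apply/esym/cvg_lim => //; exact: kh.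
- by move=> n; exact/measurable_EFinP.
- by move=> n z _; rewrite lee_fin.
- by move=> z _ a b ab; rewrite lee_fin; exact/lefP/nd_nnsfun_approx.
Qed.

Lemma ge0_integralT_opp (k : R -> R) : (forall z, 0 <= k z) -> continuous k ->
  (\int[mu]_z (k (- z))%:E = \int[mu]_z (k z)%:E)%E.
Proof.
move=> k0 ck.
have half (q : R -> R) : (forall z, 0 <= q z) -> continuous q ->
    (\int[mu]_z (q z)%:E = \int[mu]_(z in `[0%R, +oo[) (q (- z))%:E +
       \int[mu]_(z in `[0%R, +oo[) (q z)%:E)%E.
  move=> q0 cq.
  have mq : measurable_fun [set: R] q by exact: continuous_measurable_fun.
  have -> : [set: R] = `]-oo, 0%R[ `|` `[0%R, +oo[.
    by rewrite -setCitvl setUv.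
  rewrite ge0_integral_setU//=; last 3 first.
    - exact/measurable_EFinP/measurable_funTS.
    - by move=> x _; rewrite lee_fin.
    - by rewrite -setCitvl; apply/disj_setPCl.
  congr (_ + _)%E.
  rewrite integral_itv_bndo_bndc; last exact/measurable_EFinP/measurable_funTS.
  rewrite (@ge0_integration_by_substitution0 R (fun z => (q (- z))%:E)).
  - by apply: eq_integral => z _; rewrite opprK.
  - apply/measurable_EFinP; exact: (measurableT_comp mq).
  - by move=> r; rewrite lee_fin.
rewrite half//; last first.
  by move=> z; apply: continuous_comp; [exact: opp_continuous|exact: ck].
rewrite [RHS]half// [RHS]addeC; congr (_ + _)%E.
by apply: eq_integral => z _; rewrite opprK.
Qed.

Lemma normal_pdf0N s z : s != 0 -> normal_pdf 0 s (- z) = normal_pdf 0 s z.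
Proof. by move=> s0; rewrite !normal_pdfE// /normal_fun !subr0 sqrrN. Qed.

(** Averaging over [z] and [- z] removes the odd part of an integrand while keeping it nonnegative,
    so the moments below involve no subtraction of possibly infinite integrals. *)
Lemma integral_normal_prob_sym (s : R) (k : R -> R) : s != 0 -> continuous k ->
  (forall z, 0 <= k z) ->
  (\int[normal_prob 0%R s]_z (k z)%:E =
   \int[normal_prob 0%R s]_z ((k z + k (- z)) / 2)%:E)%E.
Proof.
move=> s0 ck k0.
have mk : measurable_fun [set: R] k by exact: continuous_measurable_fun.
have ckN : continuous (fun z => k (- z)).
  by move=> z; apply: continuous_comp; [exact: opp_continuous|exact: ck].
have mkN : measurable_fun [set: R] (fun z => k (- z)).
  exact: continuous_measurable_fun.
have cp := @continuous_normal_pdf R 0 s s0.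
have mp := measurable_normal_pdf 0 s.
rewrite !integral_normal_prob//; last 3 first.
- apply/measurable_EFinP; apply: measurable_funM => //; exact: measurable_funD.
- by move=> z; rewrite lee_fin divr_ge0// addr_ge0.
- exact/measurable_EFinP.
under [in RHS]eq_integral => z _.
  rewrite -EFinM (_ : _ * _ =
    2^-1 * (k z * normal_pdf 0 s z + k (- z) * normal_pdf 0 s (- z))); last first.
    by rewrite normal_pdf0N//; ring.
  rewrite EFinM EFinD; over.
have m1 : measurable_fun (setT : set (measurableTypeR R))
    (fun z => (k z * normal_pdf 0 s z)%:E).
  by apply/measurable_EFinP; exact: measurable_funM.
have m2 : measurable_fun (setT : set (measurableTypeR R))
    (fun z => (k (- z) * normal_pdf 0 s (- z))%:E).
  by apply/measurable_EFinP; apply: measurable_funM => //;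
    exact: (measurableT_comp mp).
have p1 z : (0 <= (k z * normal_pdf 0 s z)%:E)%E.
  by rewrite lee_fin mulr_ge0// normal_pdf_ge0.
have p2 z := p1 (- z).
rewrite (@ge0_integralZl _ (measurableTypeR R) _ mu setT measurableT _
  (emeasurable_funD m1 m2))//; last by move=> z _; exact: adde_ge0.
rewrite (@ge0_integralD _ (measurableTypeR R) _ mu setT measurableT _ _
  (fun z _ => p1 z) m1 (fun z _ => p2 z) m2).
have := @ge0_integralT_opp (fun z => k z * normal_pdf 0 s z).
move=> /(_ (fun z => mulr_ge0 (k0 z) (normal_pdf_ge0 _ _ _))).
move=> /(_ (fun z => @continuousM _ _ _ _ _ (ck z) (cp z))) E.
rewrite E {E}; set J := (\int[mu]_z _)%E.

(* [J] may be infinite, in which case halving [J + J] needs its own argument. *)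
have : (0 <= J)%E.
  by apply: integral_ge0 => z _; exact: p1.
case: J => [r _|_|//]; first by rewrite -EFinD -EFinM; congr EFin; rewrite mulrDr ![2^-1 * _]mulrC -splitr.
by rewrite addye// gt0_muley// lte_fin invr_gt0.
Qed.

(** Completing the square: [expR (c * z)] times the centred density is a constant times the density
    centred at [c * s ^+ 2], which has total mass 1. *)
Lemma integral_normal_prob_expR (s c : R) : s != 0 ->
  (\int[normal_prob 0%R s]_z (expR (c * z))%:E = (expR (c ^+ 2 * s ^+ 2 / 2))%:E)%E.
Proof.
move=> s0; rewrite integral_normal_prob//; last first.
- apply/measurable_EFinP; exact: measurableT_comp.
rewrite -[RHS]mule1 -(integral_normal_pdf (c * s ^+ 2) s).
have mp : measurable_fun (setT : set (measurableTypeR R))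
    (fun z => (normal_pdf (c * s ^+ 2) s z)%:E).
  by apply/measurable_EFinP; exact: measurable_normal_pdf.
rewrite -(@ge0_integralZl _ (measurableTypeR R) _ mu setT measurableT _ mp);
  [|by move=> z _; rewrite lee_fin normal_pdf_ge0|by rewrite lee_fin expR_ge0].
apply: eq_integral => z _; rewrite -!EFinM; congr EFin.
rewrite !normal_pdfE// mulrCA [RHS]mulrCA; congr (_ * _).
rewrite /normal_fun -!expRD; congr expR.
by rewrite subr0 -mulr_natr; field.
Qed.

End gaussian.

(** * Inequalities for hyperbolic functions *)

Section hyperbolic.
Context (R : realType).
Implicit Types (x y z a b c : R).

Definition cosh x := (expR x + expR (- x)) / 2.
Definition sinh x := (expR x - expR (- x)) / 2.

Lemma MVT_any (f df : R -> R) a b : (forall x, is_derive x 1 f (df x)) ->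
  exists2 c : R, Num.min a b <= c <= Num.max a b & f b - f a = df c * (b - a).
Proof.
move=> fdf; have cf : continuous f.
  by move=> x; apply/differentiable_continuous/derivable1_diffP; have [] := fdf x.
have [ab|ba|->] := ltgtP a b.
- have [c] := MVT ab (fun x _ => fdf x) (continuous_subspaceT cf).
  by rewrite in_itv/= => /andP[ac cb] E; exists c => //; rewrite !ltW.
- have [c] := MVT ba (fun x _ => fdf x) (continuous_subspaceT cf).
  rewrite in_itv/= => /andP[bc ca] E; exists c; first by rewrite !ltW.
  by lra.
- by exists b; rewrite ?lexx// !subrr mulr0.
Qed.

Lemma coshN x : cosh (- x) = cosh x.
Proof. by rewrite /cosh opprK addrC. Qed.

Lemma sinhN x : sinh (- x) = - sinh x.
Proof. by rewrite /sinh opprK -mulNr opprB. Qed.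

Lemma sinh0 : sinh 0 = 0.
Proof. by rewrite /sinh oppr0 subrr mul0r. Qed.

Lemma coshD a b : cosh (a + b) = cosh a * cosh b + sinh a * sinh b.
Proof. by rewrite /cosh /sinh opprD !expRD; field. Qed.

Lemma sinhD a b : sinh (a + b) = sinh a * cosh b + cosh a * sinh b.
Proof. by rewrite /cosh /sinh opprD !expRD; field. Qed.

Global Instance is_derive_expRN x : is_derive x 1 (fun y => expR (- y)) (- expR (- x)).
Proof.
have := @is_derive1_comp R expR -%R x (expR (- x)) (-1).
by rewrite mulrN1; apply.
Qed.

Global Instance is_derive_cosh x : is_derive x 1 cosh (sinh x).
Proof.
rewrite (_ : cosh = 2^-1 \*: (expR + (fun y => expR (- y)))); last first.
  by apply/funext => y; rewrite /cosh/= mulrC.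
by apply: is_derive_eq; rewrite /sinh mulrC.
Qed.

Global Instance is_derive_sinh x : is_derive x 1 sinh (cosh x).
Proof.
rewrite (_ : sinh = 2^-1 \*: (expR - (fun y => expR (- y)))); last first.
  by apply/funext => y; rewrite /sinh/= mulrC.
by apply: is_derive_eq; rewrite /cosh mulrC opprK.
Qed.

Lemma continuous_cosh : continuous cosh.
Proof. by move=> x; apply/differentiable_continuous/derivable1_diffP. Qed.

Lemma continuous_sinh : continuous sinh.
Proof. by move=> x; apply/differentiable_continuous/derivable1_diffP. Qed.

Lemma cosh_ge1 x : 1 <= cosh x.
Proof. by rewrite /cosh; have := expR_ge1Dx x; have := expR_ge1Dx (- x); lra. Qed.

Lemma cosh_gt0 x : 0 < cosh x.
Proof. exact: lt_le_trans ltr01 (cosh_ge1 x). Qed.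

(** Convexity, read off from [1 + b <= expR b] and [1 - b <= expR (- b)]. *)
Lemma cosh_ge_tangent a b : cosh a + b * sinh a <= cosh (a + b).
Proof.
have h1 : expR a * (1 + b) <= expR (a + b).
  by rewrite expRD ler_wpM2l ?expR_ge0// expR_ge1Dx.
have h2 : expR (- a) * (1 - b) <= expR (- (a + b)).
  by rewrite opprD expRD ler_wpM2l ?expR_ge0// expR_ge1Dx.
by rewrite /cosh /sinh; lra.
Qed.

Lemma expR_le_cosh x : expR x <= 2 * cosh x.
Proof. by rewrite /cosh; have := expR_ge0 (- x); lra. Qed.

Lemma expR_norm_le_cosh x : expR `|x| <= 2 * cosh x.
Proof.
by case: (ger0P x) => _; rewrite ?expR_le_cosh// -coshN expR_le_cosh.
Qed.

Lemma sinh_ge0 x : 0 <= x -> 0 <= sinh x.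
Proof. by move=> x0; rewrite /sinh divr_ge0// subr_ge0 ler_expR; lra. Qed.

Lemma mul_sinh_ge0 x : 0 <= x * sinh x.
Proof.
have [x0|/ltW x0] := leP 0 x; first by rewrite mulr_ge0// sinh_ge0.
by rewrite -mulrNN -sinhN mulr_ge0 ?oppr_ge0// sinh_ge0 ?oppr_ge0.
Qed.

Lemma cosh_norm x : cosh `|x| = cosh x.
Proof. by case: (ger0P x) => _; rewrite ?coshN. Qed.

Lemma mul_sinh_norm x : `|x| * sinh `|x| = x * sinh x.
Proof. by case: (ger0P x) => _; rewrite ?sinhN ?mulrNN. Qed.

Lemma ler_cosh x y : `|x| <= `|y| -> cosh x <= cosh y.
Proof.
rewrite -(cosh_norm x) -(cosh_norm y) => xy.
rewrite -[in leRHS](subrK `|x| `|y|) addrC.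
apply: le_trans (cosh_ge_tangent _ _).
by rewrite lerDl mulr_ge0 ?sinh_ge0 ?subr_ge0.
Qed.

Lemma cosh_le_expR_norm x : cosh x <= expR `|x|.
Proof.
have h : expR x <= expR `|x| by rewrite ler_expR ler_norm.
have : expR (- x) <= expR `|x| by rewrite ler_expR -normrN ler_norm.
by rewrite /cosh; lra.
Qed.

Lemma sinh_MVT y : 0 <= y -> exists2 c : R, 0 <= c <= y & sinh y = y * cosh c.
Proof.
move=> y0; have [c] := @MVT_any sinh cosh 0 y is_derive_sinh.
rewrite (min_idPl y0) (max_idPr y0) => cy E; exists c => //.
by move: E; rewrite sinh0 !subr0 mulrC.
Qed.

Lemma sinh_ge_id y : 0 <= y -> y <= sinh y.
Proof.
by move=> y0; have [c _ ->] := sinh_MVT y0; rewrite ler_peMr// cosh_ge1.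
Qed.

Lemma mul_sinh_le_cosh x : x * sinh x <= x ^+ 2 * cosh x.
Proof.
rewrite -mul_sinh_norm -real_normK ?num_real// -(cosh_norm x).
have [c /andP[c0 cx] ->] := sinh_MVT (normr_ge0 x).
rewrite mulrA -expr2 ler_wpM2l ?sqr_ge0// ler_cosh//.
by rewrite ger0_norm// normr_id.
Qed.

Lemma abs_sinh_le_cosh x : `|sinh x| <= cosh x.
Proof.
by rewrite ler_norml /sinh /cosh; have := expR_ge0 x; have := expR_ge0 (- x); lra.
Qed.

Lemma cosh_half x : cosh x = 1 + 2 * sinh (x / 2) ^+ 2.
Proof.
have {1}-> : x = x / 2 + x / 2 by lra.
have e : expR (- (x / 2)) = (expR (x / 2))^-1 by rewrite expRN.
have e0 : expR (x / 2) != 0 by rewrite gt_eqF// expR_gt0.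
by rewrite /cosh /sinh opprD !expRD !e; field.
Qed.

Lemma cosh_ge_sqr x : 1 + x ^+ 2 / 2 <= cosh x.
Proof.
rewrite -cosh_norm -real_normK ?num_real//.
set y : R := `|x|; have y0 : 0 <= y / 2 by rewrite divr_ge0// normr_ge0.
rewrite cosh_half; have h := sinh_ge_id y0.
have : (y / 2) ^+ 2 <= sinh (y / 2) ^+ 2 by rewrite lerXn2r// nnegrE ?sinh_ge0.
by rewrite expr_div_n; lra.
Qed.

Lemma cosh_le_sqr x : `|x| <= 1 -> cosh x <= 1 + 2 * x ^+ 2.
Proof.
rewrite -cosh_norm -(real_normK (num_real x)) => x1.
set y : R := `|x|; have y0 : 0 <= y by exact: normr_ge0.
have y1 : y <= 1 by [].
have [c /andP[c0 cy] E] := sinh_MVT (divr_ge0 y0 (ler0n R 2)).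
rewrite cosh_half E.
have c2 : cosh c <= 2.
  apply: le_trans (cosh_le_expR_norm c) _; rewrite ger0_norm//.
  have : c <= 2^-1 by lra.
  rewrite -ler_expR => /le_trans; apply.
  have h : 2^-1 <= expR (- 2^-1) :> R by have := expR_ge1Dx (- 2^-1 : R); lra.
  by rewrite -[leRHS]invrK -[leLHS]invrK -expRN lef_pV2// posrE ?expR_gt0.
rewrite lerD2l exprMn expr_div_n.
have : cosh c ^+ 2 <= 2 ^+ 2 by rewrite lerXn2r// nnegrE// ltW// cosh_gt0.
have y2 : 0 <= y ^+ 2 by exact: sqr_ge0.
by nra.
Qed.

(** After halving the argument both sides are multiples of [sinh (x / 2)], and what remains is
    [sinh h <= h cosh h] for [h >= 0]. *)
Lemma mul_sinh_ge_cosh x : 2 * (cosh x - 1) <= x * sinh x.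
Proof.
rewrite -cosh_norm -mul_sinh_norm; set y : R := `|x|.
have y0 : 0 <= y / 2 by rewrite divr_ge0// normr_ge0.
have -> : sinh y = 2 * (sinh (y / 2) * cosh (y / 2)).
  have {1}-> : y = y / 2 + y / 2 by lra.
  by rewrite sinhD; ring.
rewrite cosh_half.
have [c /andP[c0 cy] E] := sinh_MVT y0.
have : sinh (y / 2) <= (y / 2) * cosh (y / 2).
  by rewrite E ler_wpM2l// ler_cosh// !ger0_norm.
have s0 := sinh_ge0 y0.
move=> /(ler_wpM2l s0) h.
have -> : y * (2 * (sinh (y / 2) * cosh (y / 2))) =
  4 * (sinh (y / 2) * ((y / 2) * cosh (y / 2))) by field.
by rewrite expr2; lra.
Qed.

(** The derivative of [cosh (l x)] in the tilt [l], at [l = 1]. *)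
Definition xsinh x := x * sinh x.

Lemma xsinh_ge0 x : 0 <= xsinh x. Proof. exact: mul_sinh_ge0. Qed.

Lemma continuous_xsinh : continuous xsinh.
Proof.
by move=> x; apply: (@continuousM R R id sinh x) => //; exact: continuous_sinh.
Qed.

Lemma is_derive_xsinh x : is_derive x 1 xsinh (sinh x + x * cosh x).
Proof.
rewrite (_ : xsinh = id * sinh)//; apply: is_derive_eq.
by rewrite /= addrC -[x *: _]/(x * _) -[sinh x *: _]/(sinh x * _) mulr1.
Qed.

Lemma xcosh_homo : {homo (fun x => x * cosh x) : x y / x <= y}.
Proof.
move=> x y xy.
have [z|c _ E] := @MVT_any (fun x => x * cosh x) (fun x => cosh x + x * sinh x) x y.
  rewrite (_ : (fun x => x * cosh x) = id * cosh)//; apply: is_derive_eq.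
  by rewrite /= addrC -[z *: _]/(z * _) -[cosh z *: _]/(cosh z * _) mulr1.
rewrite -subr_ge0 E mulr_ge0 ?subr_ge0// addr_ge0 ?mul_sinh_ge0//.
exact/ltW/cosh_gt0.
Qed.

Lemma sinh_homo : {homo sinh : x y / x <= y}.
Proof.
move=> x y xy; rewrite /sinh ler_pM2r// lerB// ler_expR//; lra.
Qed.

(** Convexity: the derivative [sinh x + x cosh x] is nondecreasing, and the sign of [b] decides on
    which side of [a] the mean value point lies. *)
Lemma xsinh_ge_tangent a b : xsinh a + b * (sinh a + a * cosh a) <= xsinh (a + b).
Proof.
have [c cab E] := MVT_any a (a + b) is_derive_xsinh.
rewrite -lerBrDl E (_ : a + b - a = b); last by lra.
rewrite mulrC; have [b0|/ltW b0] := leP 0 b.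
  have ac : a <= c by move: cab; rewrite (min_idPl _) ?lerDl// => /andP[].
  by rewrite ler_wpM2r// lerD ?sinh_homo ?xcosh_homo.
have ca : c <= a by move: cab; rewrite (max_idPl _) ?gerDl// => /andP[].
by rewrite ler_wnM2r// lerD ?sinh_homo ?xcosh_homo.
Qed.

End hyperbolic.

(** * Moments of affine functions of a Gaussian variable *)

Section gaussian_moments.
Context (R : realType) (s : R).
Hypothesis s0 : s != 0.
Implicit Types (y z c : R) (k : R -> R).
Local Notation N := (normal_prob (0 : R) s).
Local Open Scope ereal_scope.

Let measurable_cont k : continuous k ->
  measurable_fun (setT : set (measurableTypeR R)) (fun z => (k z)%:E).
Proof.
by move=> ck; apply/measurable_EFinP; exact: continuous_measurable_fun.
Qed.

Let integral_scale k c : (0 <= c)%R -> continuous k -> (forall z, 0 <= k z)%R ->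
  \int[N]_z (c * k z)%:E = c%:E * \int[N]_z (k z)%:E.
Proof.
move=> c0 ck k0; under eq_integral => z _ do rewrite EFinM.
rewrite (@ge0_integralZl _ (measurableTypeR R) _ N setT measurableT _
  (measurable_cont ck))// => z _; by rewrite lee_fin.
Qed.

Let integral_shift k c : (0 <= c)%R -> continuous k -> (forall z, 0 <= k z)%R ->
  \int[N]_z (c + k z)%:E = c%:E + \int[N]_z (k z)%:E.
Proof.
move=> c0 ck k0; under eq_integral => z _ do rewrite EFinD.
rewrite (@ge0_integralD _ (measurableTypeR R) _ N setT measurableT (cst c%:E) _
  _ _ _ (measurable_cont ck))//; last by move=> z _; rewrite lee_fin.
rewrite (integral_cst N measurableT).
by rewrite [X in (_ * X)%E](_ : _ = 1) ?mule1//; exact: (probability_setT N).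
Qed.

Let le_integral_cont k1 k2 : continuous k1 -> continuous k2 ->
  (forall z, 0 <= k1 z)%R -> (forall z, k1 z <= k2 z)%R ->
  \int[N]_z (k1 z)%:E <= \int[N]_z (k2 z)%:E.
Proof.
move=> c1 c2 k0 k12.
apply: (@ge0_le_integral _ (measurableTypeR R) _ N setT measurableT).
- by move=> z _; rewrite lee_fin.
- exact: measurable_cont.
- exact: measurable_cont.
- by move=> z _; rewrite lee_fin.
Qed.

Let cont_affine y c : continuous (fun z : R => y + c * z)%R.
Proof.
move=> z; apply: (@continuousD R R R (cst y) (fun z => c * z)%R); first exact: cst_continuous.
by apply: (@continuousM R R (cst c) id); [exact: cst_continuous|].
Qed.

Let cont_comp k y c : continuous k -> continuous (fun z : R => k (y + c * z))%R.
Proof. by move=> ck z; apply: continuous_comp; [exact: cont_affine|exact: ck]. Qed.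

Let contZ k c : continuous k -> continuous (fun z : R => c * k z)%R.
Proof.
by move=> ck z; apply: (@continuousM R R (cst c) k z);
  [exact: cst_continuous|exact: ck].
Qed.

Let contDc k c : continuous k -> continuous (fun z : R => c + k z)%R.
Proof.
by move=> ck z; apply: (@continuousD R R R (cst c) k z);
  [exact: cst_continuous|exact: ck].
Qed.

Lemma integral_normal_prob_cosh c :
  \int[N]_z (cosh (c * z))%:E = (expR (c ^+ 2 * s ^+ 2 / 2))%:E.
Proof.
have ce : continuous (fun z => expR (c * z)).
  have := @cont_comp (@expR R) 0 c (@continuous_expR R).
  by under eq_fun do rewrite add0r.
rewrite -integral_normal_prob_expR// (integral_normal_prob_sym s0 ce).
  by apply: eq_integral => z _; rewrite /cosh mulrN.
by move=> z; exact: expR_ge0.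
Qed.

(** The second moment is extracted from the exact moment of [cosh (c z)]: integrate
    [1 + c^2 z^2 / 2 <= cosh (c z)] and let [c] tend to 0. *)
Lemma integral_normal_prob_sqr : \int[N]_z (z ^+ 2)%:E <= (s ^+ 2)%:E.
Proof.
have csq : continuous (fun z : R => z ^+ 2)%R by exact: exprn_continuous.
have ccosh c : continuous (fun z : R => cosh (c * z)).
  have := @cont_comp _ 0 c (@continuous_cosh R).
  by under eq_fun do rewrite add0r.
have bound c : (0 < c)%R ->
    1 + (c ^+ 2 / 2)%:E * \int[N]_z (z ^+ 2)%:E <= (expR (c ^+ 2 * s ^+ 2 / 2))%:E.
  move=> c0; rewrite -integral_normal_prob_cosh.
  have c20 : (0 <= c ^+ 2 / 2)%R by rewrite divr_ge0// sqr_ge0.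
  have sq0 z : (0 <= z ^+ 2 :> R)%R by exact: sqr_ge0.
  rewrite -(integral_scale c20 csq sq0) -integral_shift//.
  - apply: le_integral_cont => //.
    + exact/contDc/contZ.
    + by move=> z; rewrite addr_ge0// mulr_ge0.
    + by move=> z; have := cosh_ge_sqr (c * z); rewrite exprMn mulrAC.
  - exact: contZ.
  - by move=> z; rewrite mulr_ge0.
set J := \int[N]_z _ in bound *.
have J0 : 0 <= J by apply: integral_ge0 => z _; rewrite lee_fin sqr_ge0.
move: J J0 bound => [j| |]//=; last first.
  by move=> _ /(_ 1%R ltr01); rewrite gt0_muley ?lte_fin ?divr_gt0 ?exprn_gt0// addey.
rewrite !lee_fin => j0 bound.
(* [u] stands for [c^2 s^2 / 2], and [expR u <= 1 / (1 - u)] makes the bound algebraic in [u]. *)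
have bd (u : R) : (0 < u < 1)%R -> (j * (1 - u) <= s ^+ 2)%R.
  move=> /andP[u0 u1].
  have ss0 : (0 < s ^+ 2)%R by rewrite exprn_even_gt0//= orbT.
  have sp : (0 < 2 * u / s ^+ 2)%R by apply: divr_gt0 => //; rewrite mulr_gt0.
  have := bound (Num.sqrt (2 * u / s ^+ 2))%R; rewrite sqrtr_gt0 => /(_ sp).
  rewrite sqr_sqrtr ?(ltW sp)//.
  rewrite divfK ?gt_eqF// (_ : 2 * u / 2 = u)%R; last by field.
  rewrite -EFinM -EFinD lee_fin => h.
  have e1 : (expR u * (1 - u) <= 1)%R.
    rewrite -[leRHS](_ : expR u * expR (- u) = 1)%R; last first.
      by rewrite -expRD subrr expR0.
    by rewrite ler_wpM2l ?expR_ge0// expR_ge1Dx.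
  have := ler_wpM2r (_ : 0 <= 1 - u)%R h; rewrite subr_ge0 ltW// => /(_ isT).
  move=> /le_trans/(_ e1) h2.
  have -> : (j = (2 * u / s ^+ 2 / 2 * j) * (s ^+ 2 / u))%R.
    by field; rewrite s0 gt_eqF.
  set q := (2 * u / s ^+ 2 / 2 * j)%R in h2 *.
  have : (q * (1 - u) <= u)%R by lra.
  move=> /(ler_wpM2r (_ : 0 <= s ^+ 2 / u)%R).
  rewrite divr_ge0 ?sqr_ge0 ?(ltW u0)// => /(_ isT).
  rewrite (_ : u * (s ^+ 2 / u) = s ^+ 2)%R; last by field; rewrite gt_eqF.
  by lra.
rewrite leNgt; apply/negP => jlt.
have jp : (0 < j)%R by apply: le_lt_trans jlt; exact: sqr_ge0.
have ss0 : (0 < s ^+ 2)%R by rewrite exprn_even_gt0//= orbT.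
(* For this [u] the number [j (1 - u)] is the midpoint of [j] and [s^2], which exceeds [s^2] if [j]
   does. *)
have u0 : (0 < (j - s ^+ 2) / (2 * j) < 1)%R.
  by rewrite divr_gt0 ?subr_gt0 ?mulr_gt0//= ltr_pdivrMr ?mulr_gt0//; lra.
have := bd _ u0.
by rewrite (_ : j * (1 - _) = (j + s ^+ 2) / 2)%R; [lra|field; rewrite gt_eqF].
Qed.

Lemma integral_normal_prob_affine_sqr y c :
  \int[N]_z ((y + c * z) ^+ 2)%:E <= (y ^+ 2 + c ^+ 2 * s ^+ 2)%:E.
Proof.
have csq : continuous (fun z : R => z ^+ 2)%R by exact: exprn_continuous.
have csq2 : continuous (fun z : R => c ^+ 2 * z ^+ 2)%R.
  exact: contZ.
rewrite integral_normal_prob_sym//; last 2 first.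
- exact: (@cont_comp (fun z : R => z ^+ 2)%R).
- by move=> z; rewrite sqr_ge0.
rewrite (_ : \int[N]_z _ = \int[N]_z (y ^+ 2 + c ^+ 2 * z ^+ 2)%:E); last first.
  by apply: eq_integral => z _; congr EFin; field.
rewrite integral_shift ?sqr_ge0//; last by move=> z; rewrite mulr_ge0 ?sqr_ge0.
rewrite integral_scale ?sqr_ge0//; last by move=> z; rewrite sqr_ge0.
by rewrite [leRHS]EFinD leeD2l// [leRHS]EFinM lee_wpmul2l ?lee_fin ?sqr_ge0// integral_normal_prob_sqr.
Qed.

(** Symmetrization cancels [sinh y sinh (c z)], so a Gaussian step acts on [cosh] exactly as
    multiplication by a number. *)
Lemma integral_normal_prob_affine_cosh y c :
  \int[N]_z (cosh (y + c * z))%:E = (cosh y * expR (c ^+ 2 * s ^+ 2 / 2))%:E.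
Proof.
rewrite integral_normal_prob_sym//; last 2 first.
- exact: (@cont_comp _ y c (@continuous_cosh R)).
- by move=> z; exact/ltW/cosh_gt0.
rewrite (_ : \int[N]_z _ = \int[N]_z (cosh y * cosh (c * z))%:E); last first.
  by apply: eq_integral => z _; congr EFin; rewrite mulrN !coshD coshN sinhN; field.
rewrite integral_scale ?integral_normal_prob_cosh//.
- exact/ltW/cosh_gt0.
- have := @cont_comp _ 0 c (@continuous_cosh R).
  by under eq_fun do rewrite add0r.
- by move=> z; exact/ltW/cosh_gt0.
Qed.

(** Differentiating the [cosh] formula in the tilt would give the exact value. Instead, with
    [u = c z], symmetrization leaves [xsinh y cosh u + cosh y (u sinh u)], and
    [u sinh u >= 2 (cosh u - 1)] reduces everything to the moment of [cosh u]. *)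
Lemma integral_normal_prob_affine_xsinh y c :
  (xsinh y * expR (c ^+ 2 * s ^+ 2 / 2) +
   2 * (expR (c ^+ 2 * s ^+ 2 / 2) - 1) * cosh y)%:E
  <= \int[N]_z (xsinh (y + c * z))%:E.
Proof.
set q := expR _.
have cx := @cont_comp _ y c (@continuous_xsinh R).
have ccosh : continuous (fun z : R => cosh (c * z)).
  have := @cont_comp _ 0 c (@continuous_cosh R).
  by under eq_fun do rewrite add0r.
(* Adding [2 cosh y] to both sides makes the two integrands nonnegative, so integrals are only
   compared and never subtracted. *)
suff : (2 * cosh y)%:E + \int[N]_z (xsinh (y + c * z))%:E >=
       ((xsinh y + 2 * cosh y) * q)%:E.
  rewrite addeC -leeBlDr// => /(le_trans _); apply.
  by rewrite -EFinB lee_fin; lra.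
have ch0 := @cosh_gt0 R.
have cs : continuous (fun z : R => (xsinh (y + c * z) + xsinh (y + c * - z)) / 2)%R.
  move=> z; apply: (@continuousM R R _ (cst 2^-1%R) z); last exact: cst_continuous.
  apply: (@continuousD R R R (fun z => xsinh (y + c * z))
    (fun z => xsinh (y + c * - z)) z); first exact: cx.
  have := @cont_comp _ y (- c) (@continuous_xsinh R) z.
  by under eq_fun do rewrite mulNr -mulrN.
rewrite integral_normal_prob_sym//; last by move=> z; exact: xsinh_ge0.
rewrite -integral_shift//; last 2 first.
- by rewrite mulr_ge0// ltW.
- by move=> z; rewrite divr_ge0// addr_ge0// xsinh_ge0.
rewrite EFinM -integral_normal_prob_cosh -integral_scale//; last 2 first.
- by rewrite addr_ge0 ?xsinh_ge0 ?mulr_ge0// ltW.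
- by move=> z; rewrite ltW.
apply: le_integral_cont.
- exact: contZ.
- exact: contDc.
- by move=> z; rewrite mulr_ge0 ?addr_ge0 ?xsinh_ge0 ?mulr_ge0// ltW.
- move=> z; rewrite mulrN /xsinh !sinhD !coshN !sinhN.
  set u := (c * z)%R; have := mul_sinh_ge_cosh u.
  move=> /(ler_wpM2l (ltW (ch0 y))); set A := sinh y; set C := cosh y.
  by lra.
Qed.

End gaussian_moments.

(** * Integration against an independent Gaussian variable *)

Section independence.
Context (R : realType) (d : measure_display) (Omega : measurableType d).
Context (P : probability Omega R) (G : set_system Omega).
Hypothesis sG : sigma_algebra setT G.
Hypothesis Gm : G `<=` measurable.
Local Notation GT := (g_sigma_algebraType G).

Lemma measurable_wrtP (Y : Omega -> R) :
  measurable_wrt G Y <-> measurable_fun (setT : set GT) (Y : GT -> R).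
Proof.
split=> mY.
  move=> _ C mC; rewrite setTI.
  by apply: sub_sigma_algebra; exact: mY.
move=> C mC; have := mY measurableT C mC; rewrite setTI.
by rewrite /measurable/= sigma_algebra_id.
Qed.

Lemma measurable_gE (A : set Omega) : (measurable : set_system GT) A <-> G A.
Proof. by rewrite /measurable/= sigma_algebra_id. Qed.

Lemma measurable_wrt_fun (Y : Omega -> R) :
  measurable_wrt G Y -> measurable_fun setT Y.
Proof. by move=> mY _ C mC; rewrite setTI; apply/Gm/mY. Qed.

Lemma sub_measurable : measurable_fun (setT : set Omega) (id : Omega -> GT).
Proof. by move=> _ A /measurable_gE GA; rewrite setTI; exact: Gm. Qed.

Context (W : Omega -> R) (s : R).
Hypothesis mW : measurable_fun setT W.
Hypothesis indepW : independent_of P G W.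
Hypothesis lawW : forall C : set R, measurable C ->
  P (W @^-1` C) = normal_prob 0 s C.

Local Open Scope ereal_scope.

Let X0 : Omega -> (GT * measurableTypeR R)%type := fun w => (w, W w).
Let id0 : Omega -> GT := id.

Let mX : measurable_fun setT X0.
Proof.
apply/measurable_fun_pairP; split; first exact: sub_measurable.
by rewrite [X in measurable_fun _ X](_ : _ = W)//; exact: mW.
Qed.

Let Xf : {mfun Omega >-> (GT * measurableTypeR R)%type} :=
  HB.pack X0 (isMeasurableFun.Build _ _ _ _ X0 mX).
Let idf : {mfun Omega >-> GT} :=
  HB.pack id0 (isMeasurableFun.Build _ _ _ _ id0 sub_measurable).

(** With [w] regarded as a point of the space equipped with [G], independence says that the law of
    the pair [(w, W w)] is the product of [P] on [G] and the normal law. This is conditioning on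
    [G], expressed by Tonelli's theorem. *)
Lemma integral_indep (h : GT * measurableTypeR R -> \bar R) :
  measurable_fun setT h -> (forall x, 0 <= h x) ->
  \int[P]_w h (w, W w) = \int[P]_w \int[normal_prob 0%R s]_z h (w, z).
Proof.
move=> mh h0.
have -> : \int[P]_w h (w, W w) = \int[distribution P Xf]_x h x.
  by rewrite ge0_integral_distribution.
have -> : \int[P]_w \int[normal_prob 0%R s]_z h (w, z) =
    \int[distribution P idf]_w \int[normal_prob 0%R s]_z h (w, z).
  rewrite ge0_integral_distribution//.
  - exact: (@measurable_fun_fubini_tonelli_F _ _ _ _ _ (normal_prob 0 s)).
  - by move=> w; apply: integral_ge0.
rewrite -(@fubini_tonelli1 _ _ _ _ _ (distribution P idf) (normal_prob 0 s))//.
apply: eq_measure_integral => A mA _.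
apply/esym; apply: product_measure_unique => // C1 C2 mC1 mC2.
transitivity (P (C1 `&` W @^-1` C2)); first by [].
by rewrite indepW ?lawW//; exact/measurable_gE.
Qed.

Let h_affine (A : set Omega) (phi : R -> R) (Y1 Y2 : Omega -> R)
  (x : GT * measurableTypeR R) : \bar R :=
  ((\1_A : Omega -> R) x.1 * phi (Y1 x.1 + Y2 x.1 * x.2)%R)%:E.

Section affine.
Context (A : set Omega) (phi : R -> R) (Y1 Y2 : Omega -> R).
Hypothesis GA : G A.
Hypothesis cphi : continuous phi.
Hypothesis phi0 : forall y, (0 <= phi y)%R.
Hypothesis mY1 : measurable_wrt G Y1.
Hypothesis mY2 : measurable_wrt G Y2.

Let m_affine : measurable_fun setT (h_affine A phi Y1 Y2).
Proof.
have f1 : measurable_fun (setT : set (GT * measurableTypeR R)) fst by exact: measurable_fst.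
have f2 : measurable_fun (setT : set (GT * measurableTypeR R)) snd by exact: measurable_snd.
have m1 : measurable_fun (setT : set (GT * measurableTypeR R)) (Y1 \o fst).
  by apply: measurableT_comp f1; exact/measurable_wrtP.
have m2 : measurable_fun (setT : set (GT * measurableTypeR R)) (Y2 \o fst).
  by apply: measurableT_comp f1; exact/measurable_wrtP.
apply/measurable_EFinP; apply: measurable_funM.
  apply: (measurableT_comp _ f1); apply: measurable_indic; exact/measurable_gE.
apply: (measurableT_comp (continuous_measurable_fun cphi)).
by apply: measurable_funD => //; exact: measurable_funM.
Qed.

Let affine_ge0 x : 0 <= h_affine A phi Y1 Y2 x.
Proof. by rewrite lee_fin mulr_ge0. Qed.

Let affineE : \int[P]_(w in A) (phi (Y1 w + Y2 w * W w))%:E =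
  \int[P]_w \int[normal_prob 0%R s]_z h_affine A phi Y1 Y2 (w, z).
Proof.
rewrite -integral_indep// integral_mkcond; apply: eq_integral => w _.
rewrite patchE /h_affine/= indicE.
by case: (w \in A); rewrite ?mul1r ?mul0r.
Qed.

Let inner w : \int[normal_prob 0%R s]_z h_affine A phi Y1 Y2 (w, z) =
  if w \in A then \int[normal_prob 0%R s]_z (phi (Y1 w + Y2 w * z))%:E else 0.
Proof.
rewrite /h_affine/= indicE; case: (w \in A).
  by apply: eq_integral => z _; rewrite mul1r.
under eq_integral do rewrite mul0r.
by rewrite integral0.
Qed.

Let m_inner : measurable_fun setT
  (fun w : Omega => \int[normal_prob 0%R s]_z h_affine A phi Y1 Y2 (w, z)).
Proof.
have := @measurable_fun_fubini_tonelli_F _ _ _ _ _ (normal_prob 0 s)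
  (h_affine A phi Y1 Y2) m_affine affine_ge0.
by move=> m; exact: (measurableT_comp m sub_measurable).
Qed.

Lemma integral_affine_le (psi : Omega -> R) :
  measurable_fun setT psi ->
  (forall w, A w ->
    \int[normal_prob 0%R s]_z (phi (Y1 w + Y2 w * z))%:E <= (psi w)%:E) ->
  \int[P]_(w in A) (phi (Y1 w + Y2 w * W w))%:E <= \int[P]_(w in A) (psi w)%:E.
Proof.
move=> mpsi le; rewrite affineE [leRHS]integral_mkcond.
have psiA : measurable_fun setT ((EFin \o psi) \_ A).
  apply/(measurable_restrictT _ _).1; first exact: Gm.
  by apply/measurable_EFinP; exact: measurable_funTS.
apply: ge0_le_integral => //.
- by move=> w _; apply: integral_ge0.
- by move=> w _; rewrite inner patchE; case: ifPn => // /set_mem; exact: le.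
Qed.

Lemma integral_affine_ge (psi : Omega -> R) :
  measurable_fun setT psi -> (forall w, 0 <= psi w)%R ->
  (forall w, A w ->
    (psi w)%:E <= \int[normal_prob 0%R s]_z (phi (Y1 w + Y2 w * z))%:E) ->
  \int[P]_(w in A) (psi w)%:E <= \int[P]_(w in A) (phi (Y1 w + Y2 w * W w))%:E.
Proof.
move=> mpsi psi0 le; rewrite affineE [leLHS]integral_mkcond.
have psiA : measurable_fun setT ((EFin \o psi) \_ A).
  apply/(measurable_restrictT _ _).1; first exact: Gm.
  by apply/measurable_EFinP; exact: measurable_funTS.
apply: ge0_le_integral => //.
- by move=> w _; rewrite patchE; case: ifPn; rewrite ?lee_fin.
- by move=> w _; rewrite inner patchE; case: ifPn => // /set_mem; exact: le.
Qed.

End affine.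

End independence.

(** * Local Lipschitz conditions and bounds on the coefficients *)

Section lipschitz_compact.
Context (R : realType) (V : normedModType R).
Implicit Types (h : V -> R) (A K : set V).

(** The local estimate is available near every pair of points, so compactness of the square of [K]
    yields one constant for close and distant pairs alike. *)
Lemma locally_lipschitz_compact h A K : [locally [lipschitz h x | x in A]] ->
  compact K -> K `<=` A ->
  exists2 L : R, 0 < L & forall x y, K x -> K y -> `|h x - h y| <= L * `|x - y|.
Proof.
move=> lh cK KA.
have cKK : compact (K `*` K) by exact: compact_setX.
have /compact_near_coveringP cov := cKK.
have /(_ _) := cov R (pinfty_nbhs R)
  (fun M p => (K `*` K) p -> `|h p.1 - h p.2| <= M * `|p.1 - p.2|).
move=> /(_ _) H.
have : \forall M \near +oo, forall p, (K `*` K) p ->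
    (K `*` K) p -> `|h p.1 - h p.2| <= M * `|p.1 - p.2|.
  apply: H => p [Kp1 Kp2].
  have Ap : (A `*` A) p by split; exact: KA.
  have := lh p Ap; rewrite /lipschitz_on => lp.
  have [M0 [_ M0P]] : exists M0 : R, True /\
      within (A `*` A) (nbhs p) [set q | `|h q.1 - h q.2| <= M0 * `|q.1 - q.2| ].
    have [M1 [M1r M1P]] := lp.
    exists (M1 + 1); split => //; apply: (M1P (M1 + 1)).
    by rewrite ltrDl.
  exists ([set q | (A `*` A) q -> `|h q.1 - h q.2| <= M0 * `|q.1 - q.2| ],
          [set M | M0 < M]).
    by split => //=; exists M0; split => //; exact: num_real.
  move=> [q M] /= [qA M0M] [Kq1 Kq2].
  apply: le_trans (qA _) _; first by split; exact: KA.
  by rewrite ler_wpM2r// ltW.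
move=> [L0 [_ LP]].
exists (Num.max L0 0 + 1).
  by rewrite ltr_pwDr// le_max lexx orbT.
move=> x y Kx Ky; apply: (LP (Num.max L0 0 + 1) _ (x, y)) => //.
by rewrite ltr_pwDr// le_max lexx.
Qed.

End lipschitz_compact.

Section coefficients.
Context (R : realType) (f : R * R -> R) (g : R -> R).

Lemma drift_lipschitz : [locally [lipschitz f p | p in space_time R]] ->
  forall N : R, exists2 L : R, 0 < L & forall x y s t,
    `|x| <= N -> `|y| <= N -> 0 <= s <= N -> 0 <= t <= N ->
    `|f (x, s) - f (y, t)| <= L * (`|x - y| + `|s - t|).
Proof.
move=> lf N.
pose K := `[- N, N]%classic `*` `[0, N]%classic : set (R * R).
have cK : compact K by apply: compact_setX; exact: segment_compact.
have [|L L0 HL] := locally_lipschitz_compact lf cK.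
  move=> [x t] [/= _]; rewrite in_itv/= => /andP[t0 _].
  by split.
exists L => // x y s t xN yN sN tN.
apply: le_trans (HL (x, s) (y, t) _ _) _.
- by split; rewrite /= in_itv/= // -ler_norml.
- by split; rewrite /= in_itv/= // -ler_norml.
rewrite ler_wpM2l ?(ltW L0)//.
rewrite [leLHS]/Num.Def.normr/= ge_max/=.
by rewrite lerDl lerDr !normr_ge0.
Qed.

Lemma diffusion_lipschitz : [locally [lipschitz g x | x in [set: R]]] ->
  forall N : R, exists2 L : R, 0 < L & forall x y,
    `|x| <= N -> `|y| <= N -> `|g x - g y| <= L * `|x - y|.
Proof.
move=> lg N.
have [|L L0 HL] := locally_lipschitz_compact lg (segment_compact (a := - N) (b := N)).
  by [].
exists L => // x y xN yN; apply: HL; by rewrite /= in_itv/= -ler_norml.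
Qed.

Hypothesis g_lip : forall N : R, exists2 L : R, 0 < L & forall x y,
  `|x| <= N -> `|y| <= N -> `|g x - g y| <= L * `|x - y|.

Lemma lip_continuous : continuous g.
Proof.
move=> x; have [L L0 HL] := g_lip (`|x| + 1).
apply/cvgrPdist_le => /= e e0.
near=> y.
have xy : `|x - y| <= Num.min 1 (e / L).
  near: y; exists (Num.min 1 (e / L)) => /=.
    by rewrite lt_min ltr01 divr_gt0.
  by move=> z /= /ltW.
move: xy; rewrite le_min => /andP[xy1 xye].
apply: le_trans (HL _ _ _ _) _; first by rewrite lerDl.
  have -> : y = x - (x - y) by lra.
  by apply: le_trans (ler_normB _ _) _; rewrite lerD2l.
by move: xye; rewrite ler_pdivlMr// mulrC.
Unshelve. all: by end_near. Qed.

Context (sigma : R).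
Hypothesis sigma_neq0 : sigma != 0.
Hypothesis g_neq0 : forall x, g x != 0.
Hypothesis g_py : g x @[x --> +oo] --> sigma.
Hypothesis g_ny : g x @[x --> -oo] --> sigma.

Lemma diffusion_tail e : 0 < e ->
  exists2 K : R, 0 < K & forall x, K < `|x| -> `|g x - sigma| <= e.
Proof.
move=> e0.
have [K1 [_ H1]] : \forall x \near +oo, `|sigma - g x| <= e.
  by move/cvgrPdist_le : g_py; exact.
have [K2 [_ H2]] : \forall x \near -oo, `|sigma - g x| <= e.
  by move/cvgrPdist_le : g_ny; exact.
exists (Num.max 1 (Num.max K1 (- K2))); first by rewrite lt_max ltr01.
move=> x; rewrite !gt_max => /and3P[_ x1 x2]; rewrite distrC.
have [x0|x0] := leP 0 x.
  by apply: H1; move: x1; rewrite ger0_norm.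
by apply: H2; move: x2; rewrite ltr0_norm//= ltrN2.
Qed.

Lemma diffusion_bounded : exists2 G : R, 0 < G & forall x, `|g x| <= G.
Proof.
have [K K0 HK] := diffusion_tail ltr01.
have [L L0 HL] := g_lip K.
exists (`|g 0| + L * K + `|sigma| + 1).
  by rewrite ltr_wpDl// addr_ge0// addr_ge0// mulr_ge0// ltW.
move=> x; have [xK|Kx] := leP `|x| K.
  have := HL x 0 xK; rewrite normr0 (ltW K0) subr0 => /(_ isT) h.
  have -> : g x = g x - g 0 + g 0 by lra.
  apply: le_trans (ler_normD _ _) _.
  have : L * `|x| <= L * K by rewrite ler_wpM2l// ltW.
  have := normr_ge0 sigma; lra.
have := HK x Kx => h.
have -> : g x = g x - sigma + sigma by lra.
apply: le_trans (ler_normD _ _) _.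
have := normr_ge0 (g 0); have : 0 <= L * K by rewrite mulr_ge0// ltW.
lra.
Qed.

Lemma diffusion_sqr_tail e : 0 < e -> exists2 K : R, 0 < K & forall x, K < `|x| ->
  sigma ^+ 2 - e <= g x ^+ 2 <= sigma ^+ 2 + e.
Proof.
move=> e0; have [G G0 HG] := diffusion_bounded.
pose c := G + `|sigma| + 1.
have c0 : 0 < c by rewrite ltr_wpDl// addr_ge0// ltW.
have [K K0 HK] := diffusion_tail (divr_gt0 e0 c0).
exists K => // x /HK h.
have : `|g x ^+ 2 - sigma ^+ 2| <= e.
  rewrite subr_sqr normrM.
  have -> : e = (e / c) * c by rewrite divfK// gt_eqF.
  apply: ler_pM => //; apply: le_trans (ler_normD _ _) _.
  by have := HG x; rewrite /c; lra.
by rewrite ler_norml; lra.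
Qed.

Lemma diffusion_sqr_lower : exists2 g0 : R, 0 < g0 & forall x, g0 <= g x ^+ 2.
Proof.
have s20 : 0 < sigma ^+ 2 by rewrite exprn_even_gt0//= sigma_neq0 orbT.
have [K K0 HK] := diffusion_sqr_tail (divr_gt0 s20 (ltr0Sn R 1)).
have cg2 : {within `[- K, K], continuous (fun x => g x ^+ 2)}.
  apply: continuous_subspaceT => x.
  by apply: (@continuous_comp _ _ _ g (fun y => y ^+ 2));
    [exact: lip_continuous|exact: exprn_continuous].
have KK : - K <= K by lra.
have [c _ Hc] := EVT_min KK cg2.
exists (Num.min (sigma ^+ 2 / 2) (g c ^+ 2)).
  rewrite lt_min divr_gt0//= exprn_even_gt0//=.
move=> x; have [xK|Kx] := leP `|x| K.
  by rewrite ge_min Hc ?orbT// in_itv/= -ler_norml.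
by rewrite ge_min; have /andP[h _] := HK x Kx; apply/orP; left; lra.
Qed.

End coefficients.

(** * Filtrations and a maximal inequality *)

Section filtered.
Context (R : realType) (d : measure_display) (Omega : measurableType d).
Context (P : probability Omega R) (F : R -> set_system Omega).
Hypothesis PF : complete_filtered_probability_space P F.
Implicit Types (s t : R) (A : set Omega) (Y : Omega -> R).

Lemma filt_salg t : 0 <= t -> sigma_algebra setT (F t).
Proof. by case: PF => _ h _ _ _; exact: h. Qed.

Lemma filt_measurable t : 0 <= t -> F t `<=` measurable.
Proof. by case: PF => _ _ h _ _; exact: h. Qed.

Lemma filt_mono s t : 0 <= s -> s <= t -> F s `<=` F t.
Proof. by case: PF => _ _ _ h _; exact: h. Qed.

Lemma filt_negligible t : 0 <= t -> P.-negligible `<=` F t.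
Proof. by case: PF => _ _ _ _ h; exact: h. Qed.

Lemma filtE t A : 0 <= t ->
  (measurable : set_system (g_sigma_algebraType (F t))) A <-> F t A.
Proof. by move=> t0; apply: measurable_gE; exact: filt_salg. Qed.

Lemma filtT t : 0 <= t -> F t setT.
Proof. by move=> t0; apply/filtE. Qed.

Lemma filtI t A1 A2 : 0 <= t -> F t A1 -> F t A2 -> F t (A1 `&` A2).
Proof.
by move=> t0 h1 h2; apply/(filtE _ t0); apply: measurableI; exact/(filtE _ t0).
Qed.

Lemma filtC t A : 0 <= t -> F t A -> F t (~` A).
Proof. by move=> t0 h; apply/(filtE _ t0); apply: measurableC; exact/(filtE _ t0). Qed.

Lemma filt_bigcap t (D : set nat) (E : nat -> set Omega) : 0 <= t ->
  (forall k, D k -> F t (E k)) -> F t (\bigcap_(k in D) E k).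
Proof.
move=> t0 h; apply/filtE => //.
by apply: bigcap_measurableType => // k Dk; apply/filtE => //; exact: h.
Qed.

Local Notation mw t := (measurable_wrt (F t)).

Lemma mw_mono s t Y : 0 <= s -> s <= t -> mw s Y -> mw t Y.
Proof. by move=> s0 st mY C mC; apply: (filt_mono s0 st); exact: mY. Qed.

Lemma mw_fun t Y : 0 <= t -> mw t Y -> measurable_fun setT Y.
Proof. by move=> t0; apply: measurable_wrt_fun; exact: filt_measurable. Qed.

Lemma mw_cst t (c : R) : 0 <= t -> mw t (fun=> c).
Proof. by move=> t0; apply/measurable_wrtP; [exact: filt_salg|exact: measurable_cst]. Qed.

Lemma mwD t Y1 Y2 : 0 <= t -> mw t Y1 -> mw t Y2 -> mw t (fun w => Y1 w + Y2 w).
Proof.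
move=> t0 /measurable_wrtP h1 /measurable_wrtP h2; apply/measurable_wrtP.
  exact: filt_salg.
by apply: measurable_funD; [apply: h1|apply: h2]; exact: filt_salg.
Qed.

Lemma mwM t Y1 Y2 : 0 <= t -> mw t Y1 -> mw t Y2 -> mw t (fun w => Y1 w * Y2 w).
Proof.
move=> t0 /measurable_wrtP h1 /measurable_wrtP h2; apply/measurable_wrtP.
  exact: filt_salg.
by apply: measurable_funM; [apply: h1|apply: h2]; exact: filt_salg.
Qed.

Lemma mw_comp t (k : R -> R) Y : 0 <= t -> measurable_fun setT k -> mw t Y ->
  mw t (fun w => k (Y w)).
Proof.
move=> t0 mk mY C mC.
have := mk measurableT C mC; rewrite setTI => mkC.
exact: (mY _ mkC).
Qed.

Lemma mw_ccomp t (k : R -> R) Y : 0 <= t -> continuous k -> mw t Y ->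
  mw t (fun w => k (Y w)).
Proof. by move=> t0 ck; apply: mw_comp => //; exact: continuous_measurable_fun. Qed.

Lemma mwN t Y : 0 <= t -> mw t Y -> mw t (fun w => - Y w).
Proof. by move=> t0; apply: mw_ccomp => //; exact: opp_continuous. Qed.

Lemma mwB t Y1 Y2 : 0 <= t -> mw t Y1 -> mw t Y2 -> mw t (fun w => Y1 w - Y2 w).
Proof. by move=> t0 h1 h2; apply: mwD => //; exact: mwN. Qed.

Lemma mwX t Y n : 0 <= t -> mw t Y -> mw t (fun w => Y w ^+ n).
Proof. by move=> t0; apply: (@mw_ccomp t (fun y => y ^+ n)) => //; exact: exprn_continuous. Qed.

Lemma mw_norm t Y : 0 <= t -> mw t Y -> mw t (fun w => `|Y w|).
Proof. by move=> t0; apply: (@mw_ccomp t (fun y => `|y|)) => //; exact: norm_continuous. Qed.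

Lemma mw_sum t (I : Type) (r : seq I) (p : pred I) (Y : I -> Omega -> R) : 0 <= t ->
  (forall i, p i -> mw t (Y i)) -> mw t (fun w => \sum_(i <- r | p i) Y i w).
Proof.
move=> t0 h; elim: r => [|i r ih].
  by under eq_fun do rewrite big_nil; exact: mw_cst.
under eq_fun do rewrite big_cons.
by case: (boolP (p i)) => // pi; apply: mwD => //; exact: h.
Qed.

Lemma mw_indic t A : 0 <= t -> F t A -> mw t (\1_A : Omega -> R).
Proof.
move=> t0 FA; apply/measurable_wrtP; first exact: filt_salg.
by apply: measurable_indic; exact/filtE.
Qed.

Lemma filt_le t Y (c : R) : 0 <= t -> mw t Y -> F t [set w | Y w <= c].
Proof.
move=> t0 mY; rewrite [X in F t X](_ : _ = Y @^-1` `]-oo, c]%classic).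
  by apply: mY; exact: measurable_itv.
by apply/seteqP; split => w /=; rewrite in_itv/=.
Qed.

Lemma filt_lt t Y (c : R) : 0 <= t -> mw t Y -> F t [set w | Y w < c].
Proof.
move=> t0 mY; rewrite [X in F t X](_ : _ = Y @^-1` `]-oo, c[%classic).
  by apply: mY; exact: measurable_itv.
by apply/seteqP; split => w /=; rewrite in_itv/=.
Qed.

(** Markov's inequality on the part of [A] where [Y] reaches [y], with the integral over the
    remaining part retained so that the estimate can be iterated in time. *)
Lemma markov_split A Y (y : R) : measurable A -> measurable_fun setT Y ->
  (forall w, 0 <= Y w) -> 0 < y ->
  (y%:E * P (A `&` [set w | (y <= Y w)%R]) + \int[P]_(w in A `&` [set w | (Y w < y)%R]) (Y w)%:E
    <= \int[P]_(w in A) (Y w)%:E)%E.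
Proof.
move=> mA mY Y0 y0.
have mle : measurable [set w | y <= Y w].
  by rewrite -[X in measurable X]setTI; exact: measurable_fun_le.
have mlt : measurable [set w | Y w < y].
  rewrite (_ : [set w | _] = ~` [set w | y <= Y w]); first exact: measurableC.
  by apply/seteqP; split => w /=; rewrite ltNge => /negP.
have {3}-> : A = (A `&` [set w | y <= Y w]) `|` (A `&` [set w | Y w < y]).
  rewrite -setIUr [X in A `&` X](_ : _ = setT) ?setIT//.
  apply/seteqP; split => // w _ /=.
  by have [|] := leP y (Y w); [left|right].
have mYE : measurable_fun setT (EFin \o Y) by exact/measurable_EFinP.
rewrite ge0_integral_setU//=; last 5 first.
- exact: measurableI.
- exact: measurableI.
- exact: measurable_funTS.
- by move=> w _; rewrite lee_fin.
- apply/disj_setPS => w [[_ /= h1] [_ /= h2]].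
  by move: (lt_le_trans h2 h1); rewrite ltxx.
rewrite leeD2r// -integral_cst ?ge0_le_integral//; last exact: measurableI.
- exact: measurableI.
- by move=> w _; rewrite lee_fin ltW.
- exact: measurable_funTS.
- by move=> w [_ /=]; rewrite lee_fin.
Qed.

Section maximal.
Context (u : nat -> R) (V : nat -> Omega -> R) (alpha c y v0 : R) (K : nat).
Hypothesis u0 : forall k, 0 <= u k.
Hypothesis u_le : forall k, u k <= u k.+1.
Hypothesis V0 : forall k w, 0 <= V k w.
Hypothesis mV : forall k, (k <= K)%N -> mw (u k) (V k).
Hypothesis alpha0 : 0 <= alpha.
Hypothesis c0 : 0 <= c.
Hypothesis y0 : 0 < y.
Hypothesis EV0 : (\int[P]_w (V 0%N w)%:E <= v0%:E)%E.
Hypothesis step : forall k A, (k < K)%N -> F (u k) A ->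
  (\int[P]_(w in A) (V k.+1 w)%:E <=
   (1 + alpha)%:E * \int[P]_(w in A) (V k w)%:E + c%:E)%E.

Let Ak k := [set w | forall i, (i <= k)%N -> V i w < y].

Let u_homo i k : (i <= k)%N -> u i <= u k.
Proof. by apply: (@homo_leq _ u <=%R) => //; exact: le_trans. Qed.

Let FAk k : (k <= K)%N -> F (u k) (Ak k).
Proof.
move=> kK; rewrite (_ : Ak k = \bigcap_(i in [set i | (i <= k)%N]) [set w | V i w < y]).
  apply: filt_bigcap => // i /= ik; apply: filt_lt => //.
  by apply: mw_mono (mV (leq_trans ik kK)); [exact: u0|exact: u_homo].
by apply/seteqP; split => w.
Qed.

Let mAk k : (k <= K)%N -> measurable (Ak k).
Proof. by move=> kK; apply: (filt_measurable (u0 k)); exact: FAk. Qed.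

Let AkS k : Ak k.+1 = Ak k `&` [set w | V k.+1 w < y].
Proof.
apply/seteqP; split => w /=.
  by move=> h; split => [i ik|]; apply: h => //; exact: leqW.
move=> [h1 h2] i; rewrite leq_eqVlt => /orP[/eqP->//|]; exact: h1.
Qed.

(** A stopped process is avoided by following [y P(crossed) + E[V; not crossed]]. Since [Ak k] is
    known at time [u k], one step costs a factor [1 + alpha] and a summand [c], and [markov_split]
    moves the mass that has just crossed into the first term. *)
Let bound k : (k <= K)%N ->
  (y%:E * P (~` Ak k) + \int[P]_(w in Ak k) (V k w)%:E <=
   ((1 + alpha) ^+ k * (v0 + k%:R * c))%:E)%E.
Proof.
elim: k => [_|k ih kK].
  rewrite expr0 mul1r mul0r addr0; apply: le_trans EV0.
  have A0 : Ak 0 = [set w | V 0%N w < y].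
    apply/seteqP; split => w /=; first exact.
    by move=> h i; rewrite leqn0 => /eqP->.
  have := @markov_split setT (V 0%N) y measurableT (mw_fun (u0 0) (mV (leq0n _))) (V0 0) y0.
  rewrite !setTI A0 => /(le_trans _); apply; rewrite leeD2r//.
  rewrite lee_wpmul2l ?lee_fin ?(ltW y0)//.
  rewrite [X in P X](_ : _ = [set w | y <= V 0%N w])//.
  by apply/seteqP; split => w /=; rewrite ?leNgt => /negP.
have kK' := ltnW kK.
have mV1 := mw_fun (u0 k.+1) (mV kK).
have mS : measurable [set w | y <= V k.+1 w].
  by rewrite -[X in measurable X]setTI; exact: measurable_fun_le.
have -> : ~` Ak k.+1 = ~` Ak k `|` (Ak k `&` [set w | y <= V k.+1 w]).
  rewrite AkS setCI; apply/seteqP; split => w /=.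
    move=> [h|/negP]; first by left.
    by rewrite -leNgt => h; case: (pselect (Ak k w)) => hA; [right|left].
  by move=> [h|[_ h]]; [left|right; apply/negP; rewrite -leNgt].
have h1 : (P (~` Ak k `|` (Ak k `&` [set w | (y <= V k.+1 w)%R])) <=
    P (~` Ak k) + P (Ak k `&` [set w | (y <= V k.+1 w)%R]))%E.
  apply: (@measureU2 _ _ _ P); first exact/measurableC/mAk.
  by apply: measurableI => //; exact: mAk.
have := @markov_split (Ak k) (V k.+1) y (mAk kK') mV1 (V0 _) y0.
rewrite -AkS => h2.
have yE : (0 <= y%:E)%E by rewrite lee_fin ltW.
apply: le_trans (leeD (lee_wpmul2l yE h1) (lexx _)) _.
rewrite (ge0_muleDr _ (measure_ge0 _ _) (measure_ge0 _ _)) -addeA.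
apply: le_trans (leeD (lexx _) h2) _.
apply: le_trans (leeD (lexx _) (step kK (FAk kK'))) _.
rewrite addeA; have ihk := ih kK'.
have : (0 <= \int[P]_(w in Ak k) (V k w)%:E)%E.
  by apply: integral_ge0 => w _; rewrite lee_fin.
move: ihk; move: (\int[P]_(w in Ak k) (V k w)%:E)%E => J ihk J0.
have h3 : ((y%:E * P (~` Ak k) + (1 + alpha)%:E * J) <=
   (1 + alpha)%:E * ((1 + alpha) ^+ k * (v0 + k%:R * c))%:E)%E.
  apply: le_trans (lee_wpmul2l _ ihk); last by rewrite lee_fin addr_ge0.
  rewrite ge0_muleDr ?mule_ge0//.
  rewrite leeD2r// -[leLHS]mul1e lee_wpmul2r ?mule_ge0// lee_fin.
  by rewrite lerDl.
apply: le_trans (leeD h3 (lexx _)) _.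
rewrite -EFinM -EFinD lee_fin exprS -natr1.
have : 1 <= (1 + alpha) ^+ k.+1 by apply: exprn_ege1; rewrite lerDl.
rewrite exprS => /(ler_wpM2r c0); lra.
Qed.

Lemma almost_supermartingale_maximal :
  (P [set w | exists2 k, (k <= K)%N & (y <= V k w)%R] <=
   ((1 + alpha) ^+ K * (v0 + K%:R * c) / y)%:E)%E.
Proof.
rewrite (_ : [set w | _] = ~` Ak K); last first.
  apply/seteqP; split => w /=.
    by move=> [k kK yV] h; move: yV; rewrite leNgt h.
  move=> h; apply: contrapT => h2; apply: h => i iK.
  by rewrite ltNge; apply/negP => yV; apply: h2; exists i.
rewrite EFinM lee_pdivlMr// muleC.
apply: le_trans (bound (leqnn K)).
by rewrite leeDl// integral_ge0// => w _; rewrite lee_fin.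
Qed.

End maximal.

End filtered.

(** * One Brownian increment with coefficients known at its start *)

Section brownian_steps.
Context (R : realType) (d : measure_display) (Omega : measurableType d).
Context (P : probability Omega R) (F : R -> set_system Omega).
Context (B : R -> Omega -> R).
Hypothesis PF : complete_filtered_probability_space P F.
Hypothesis BM : brownian_motion P F B.
Implicit Types (s t : R) (A : set Omega) (Y : Omega -> R).

Local Notation mw t := (measurable_wrt (F t)).

Lemma brownian_mw t : 0 <= t -> mw t (B t).
Proof. by case: BM => _ h _ _ _; exact: h. Qed.

Lemma increment_mw s t : 0 <= s -> s <= t -> mw t (fun w => B t w - B s w).
Proof.
move=> s0 st; have t0 := le_trans s0 st.
apply: (mwB PF t0); first exact: brownian_mw.
by apply: (mw_mono PF s0 st); exact: brownian_mw.
Qed.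

Section step.
Context (s t : R) (A : set Omega) (Y1 Y2 : Omega -> R).
Hypothesis s0 : 0 <= s.
Hypothesis st : s < t.
Hypothesis FA : F s A.
Hypothesis mY1 : mw s Y1.
Hypothesis mY2 : mw s Y2.

Let t0 : 0 <= t := le_trans s0 (ltW st).
Let salg := filt_salg PF s0.
Let Fm := filt_measurable PF s0.
Let W w := B t w - B s w.
Let mW : measurable_fun setT W.
Proof. by apply: (mw_fun PF t0); exact/increment_mw/ltW. Qed.
Let indW : independent_of P (F s) W.
Proof. by case: BM => _ _ _ h _; exact: h. Qed.
Let lawW C : measurable C -> P (W @^-1` C) = normal_prob 0 (Num.sqrt (t - s)) C.
Proof. by case: BM => _ _ _ _ h; exact: h. Qed.
Let sd0 : Num.sqrt (t - s) != 0.
Proof. by rewrite gt_eqF// sqrtr_gt0 subr_gt0. Qed.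
Let sdE : Num.sqrt (t - s) ^+ 2 = t - s.
Proof. by rewrite sqr_sqrtr// subr_ge0 ltW. Qed.
Let mY1' := mw_fun PF s0 mY1.
Let mY2' := mw_fun PF s0 mY2.

Lemma step_sqr :
  (\int[P]_(w in A) ((Y1 w + Y2 w * (B t w - B s w)) ^+ 2)%:E <=
   \int[P]_(w in A) (Y1 w ^+ 2 + Y2 w ^+ 2 * (t - s))%:E)%E.
Proof.
apply: (integral_affine_le salg Fm mW indW lawW FA
  (phi := fun y => y ^+ 2)) => //.
- exact: exprn_continuous.
- by move=> y; exact: sqr_ge0.
- apply: measurable_funD; first exact: measurable_funX.
  by apply: measurable_funM => //; exact: measurable_funX.
- move=> w _; have := integral_normal_prob_affine_sqr sd0 (Y1 w) (Y2 w).
  by rewrite sdE.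
Qed.

Lemma step_cosh :
  (\int[P]_(w in A) (cosh (Y1 w + Y2 w * (B t w - B s w)))%:E <=
   \int[P]_(w in A) (cosh (Y1 w) * expR (Y2 w ^+ 2 * (t - s) / 2))%:E)%E.
Proof.
apply: (integral_affine_le salg Fm mW indW lawW FA (phi := @cosh R)) => //.
- exact: continuous_cosh.
- by move=> y; exact/ltW/cosh_gt0.
- apply: measurable_funM.
    exact: (measurableT_comp (continuous_measurable_fun (@continuous_cosh R))).
  apply: (measurableT_comp (@measurable_expR R)).
  by do 2 apply: measurable_funM => //; exact: measurable_funX.
- move=> w _; have := integral_normal_prob_affine_cosh sd0 (Y1 w) (Y2 w).
  by rewrite sdE => ->.
Qed.

Lemma step_xsinh :
  (\int[P]_(w in A) (xsinh (Y1 w) * expR (Y2 w ^+ 2 * (t - s) / 2) +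
      2 * (expR (Y2 w ^+ 2 * (t - s) / 2) - 1) * cosh (Y1 w))%:E <=
   \int[P]_(w in A) (xsinh (Y1 w + Y2 w * (B t w - B s w)))%:E)%E.
Proof.
have me : measurable_fun setT (fun w => expR (Y2 w ^+ 2 * (t - s) / 2)).
  apply: (measurableT_comp (@measurable_expR R)).
  by do 2 apply: measurable_funM => //; exact: measurable_funX.
apply: (integral_affine_ge salg Fm mW indW lawW FA (phi := @xsinh R)) => //.
- exact: continuous_xsinh.
- by move=> y; exact: xsinh_ge0.
- apply: measurable_funD; apply: measurable_funM => //.
  + exact: (measurableT_comp (continuous_measurable_fun (@continuous_xsinh R))).
  + apply: measurable_funM => //; exact: measurable_funB.
  + exact: (measurableT_comp (continuous_measurable_fun (@continuous_cosh R))).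
- move=> w; apply: addr_ge0; apply: mulr_ge0.
  + exact: xsinh_ge0.
  + exact: expR_ge0.
  + rewrite mulr_ge0// subr_ge0 -expR0 ler_expR divr_ge0// mulr_ge0 ?sqr_ge0//.
    by rewrite subr_ge0 ltW.
  + exact/ltW/cosh_gt0.
- move=> w _; have := integral_normal_prob_affine_xsinh sd0 (Y1 w) (Y2 w).
  by rewrite sdE.
Qed.

End step.

Lemma increment_sqr s t : 0 <= s -> s <= t ->
  (\int[P]_w ((B t w - B s w) ^+ 2)%:E <= (t - s)%:E)%E.
Proof.
move=> s0; rewrite le_eqVlt => /orP[/eqP<-|st].
  by under eq_integral do rewrite subrr expr0n/=; rewrite integral0 subrr.
have := @step_sqr s t setT (fun=> 0) (fun=> 1) s0 st (filtT PF s0)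
  (mw_cst PF _ s0) (mw_cst PF _ s0).
under eq_integral do rewrite add0r mul1r.
move=> /le_trans; apply.
under eq_integral do rewrite expr0n/= add0r expr1n mul1r.
by rewrite integral_cst//= probability_setT mule1.
Qed.

End brownian_steps.

(** * Continuity on the half-line, dyadic grids, truncation *)

Section within_continuity.
Context (R : realType).
Implicit Types (h : R -> R) (t : R).

(** The map [Num.max 0] retracts the line onto the half-line, so continuity on the subspace becomes
    ordinary continuity, which composes freely. *)
Lemma within_ge0_continuousP h :
  {within [set t : R | 0 <= t], continuous h} <->
  continuous (fun t => h (Num.max 0 t)).
Proof.
have cmax : continuous (fun t : R => Num.max 0 t).
  move=> t; apply: (@continuous_max _ _ (cst 0) id) => //; exact: cst_continuous.
split.
  move=> /subspace_continuousP ch t.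
  have t0 : 0 <= Num.max 0 t by rewrite le_max lexx.
  have := ch _ t0 => /cvgrPdist_lt H.
  apply/cvgrPdist_lt => e e0.
  have := H e e0; rewrite near_withinE => He.
  near=> s.
  suff : 0 <= Num.max 0 s -> `|h (Num.max 0 t) - h (Num.max 0 s)| < e.
    by apply; rewrite le_max lexx.
  by near: s; exact: (cmax t _ He).
move=> ch; apply/subspace_continuousP => t /= t0.
apply/cvgrPdist_lt => e e0; rewrite near_withinE.
have := ch t => /cvgrPdist_lt/(_ e e0).
apply: filterS => s + s0; by rewrite (max_idPr t0) (max_idPr s0).
Unshelve. all: by end_near. Qed.

Lemma within_ge0_continuous_epsP h :
  {within [set t : R | 0 <= t], continuous h} <->
  forall t, 0 <= t -> forall e, 0 < e -> exists2 a, 0 < a &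
    forall s, 0 <= s -> `|t - s| < a -> `|h t - h s| < e.
Proof.
split.
  move=> /subspace_continuousP ch t t0 e e0.
  have := ch _ t0 => /cvgrPdist_lt/(_ e e0); rewrite near_withinE.
  by move=> [a /= a0 aP]; exists a => // s s0 /aP; exact.
move=> H; apply/subspace_continuousP => t /= t0.
apply/cvgrPdist_lt => e e0; rewrite near_withinE.
have [a a0 aP] := H t t0 e e0.
by exists a => //= s /= ts s0; exact: aP.
Qed.

End within_continuity.

Section dyadic.
Context (R : realType).
Implicit Types (n m k : nat) (t : R).

Definition mesh n : R := (2 ^+ n)^-1.
Definition dy n k : R := k%:R * mesh n.

Lemma mesh_gt0 n : 0 < mesh n.
Proof. by rewrite invr_gt0 exprn_gt0. Qed.

Lemma mesh_ge0 n : 0 <= mesh n. Proof. exact/ltW/mesh_gt0. Qed.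

Lemma mesh_le1 n : mesh n <= 1.
Proof. by rewrite invf_le1 ?exprn_gt0// exprn_ege1// ler1n. Qed.

Lemma mesh_nincr n m : (n <= m)%N -> mesh m <= mesh n.
Proof. by move=> nm; rewrite lef_pV2 ?posrE ?exprn_gt0// ler_weXn2l// ler1n. Qed.

Lemma dy_ge0 n k : 0 <= dy n k.
Proof. by rewrite mulr_ge0// mesh_ge0. Qed.

Lemma dy0 n : dy n 0 = 0. Proof. by rewrite /dy mul0r. Qed.

Lemma dyS n k : dy n k.+1 = dy n k + mesh n.
Proof. by rewrite /dy -natr1 mulrDl mul1r. Qed.

Lemma dyS_sub n k : dy n k.+1 - dy n k = mesh n.
Proof. by rewrite dyS addrC addKr. Qed.

Lemma dy_lt n k : dy n k < dy n k.+1.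
Proof. by rewrite dyS ltrDl mesh_gt0. Qed.

Lemma dy_homo n k k' : (k <= k')%N -> dy n k <= dy n k'.
Proof. by move=> kk; rewrite ler_pM2r ?mesh_gt0// ler_nat. Qed.

Lemma dy_le n k k' : (dy n k <= dy n k') = (k <= k')%N.
Proof. by rewrite ler_pM2r ?mesh_gt0// ler_nat. Qed.

Lemma mesh_mul n m : (n <= m)%N -> mesh n = (2 ^ (m - n))%:R * mesh m.
Proof.
move=> nm; rewrite /mesh natrX -{2}(subnK nm) exprD invfM mulrA mulfV ?mul1r//.
Qed.

Lemma dy_refine n m k : (n <= m)%N -> dy n k = dy m (k * 2 ^ (m - n)).
Proof. by move=> nm; rewrite /dy (mesh_mul nm) mulrA natrM. Qed.

Lemma dy_nat n k : dy n (k * 2 ^ n) = k%:R.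
Proof. by rewrite /dy /mesh natrM natrX mulfK// expf_neq0// pnatr_eq0. Qed.

Lemma mesh_cvg0 : mesh n @[n --> \oo] --> 0.
Proof.
rewrite (_ : (fun n => mesh n) = (fun n => 2^-1 ^+ n)).
  by apply: cvg_expr; rewrite ger0_norm//; lra.
by apply/funext => n; rewrite /mesh exprVn.
Qed.

Lemma dyadic_floor n t : 0 <= t -> exists k, dy n k <= t < dy n k.+1.
Proof.
move=> t0; exists (Num.truncn (t * 2 ^+ n)).
have tn : 0 <= t * 2 ^+ n by rewrite mulr_ge0// exprn_ge0.
have /andP[h1 h2] := Num.Theory.truncn_itv tn.
rewrite /dy /mesh; apply/andP; split.
  by rewrite ler_pdivrMr ?exprn_gt0.
by rewrite ltr_pdivlMr ?exprn_gt0.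
Qed.

End dyadic.

Section clamp.
Context (R : realType).
Implicit Types (c x y rho : R).

Definition clamp c y := Num.max (- c) (Num.min c y).

Lemma clamp_norm c y : 0 <= c -> `|clamp c y| <= c.
Proof.
move=> c0; rewrite ler_norml /clamp le_max lexx/= ge_max ge_min lexx andbT.
by lra.
Qed.

Lemma clamp_id c y : `|y| <= c -> clamp c y = y.
Proof.
rewrite ler_norml => /andP[h1 h2].
by rewrite /clamp (min_idPr h2) (max_idPr h1).
Qed.

(** Clamping replaces [y] by a value between 0 and [y], hence shrinks the product [x * y] towards 0
    without changing its sign; the same holds for the lower bound that follows. *)
Lemma clamp_mul_le c x y rho : 0 <= c -> 0 <= rho -> x * y <= rho ->
  x * clamp c y <= rho.
Proof.
move=> c0 r0 xy; rewrite /clamp.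
have [h|h] := leP c y.
  rewrite (max_idPr _); last by lra.
  by case: (leP 0 x) => hx; nra.
have [h2|h2] := leP (- c) y => //.
by case: (leP 0 x) => hx; nra.
Qed.

Lemma clamp_mul_ge c x y rho : 0 <= c -> 0 <= rho -> - rho <= x * y ->
  - rho <= x * clamp c y.
Proof.
move=> c0 r0 xy; rewrite /clamp.
have [h|h] := leP c y.
  rewrite (max_idPr _); last by lra.
  by case: (leP 0 x) => hx; nra.
have [h2|h2] := leP (- c) y => //.
by case: (leP 0 x) => hx; nra.
Qed.

Lemma continuous_clamp c : continuous (clamp c).
Proof.
move=> y; apply: (@continuous_max _ _ (cst (- c)) (fun y => Num.min c y)).
  exact: cst_continuous.
by apply: (@continuous_min _ _ (cst c) id) => //; exact: cst_continuous.
Qed.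

Lemma clamp_lip c x y : `|clamp c x - clamp c y| <= `|x - y|.
Proof.
wlog xy : x y / x <= y.
  move=> H; case: (leP x y) => [|/ltW] h; first exact: H.
  by rewrite distrC [leRHS]distrC H.
rewrite distrC [leRHS]distrC (ger0_norm (_ : 0 <= y - x)) ?subr_ge0//.
rewrite /clamp.
by case: (leP c x); case: (leP c y) => h1 h2; case: (leP (- c) c) => h3;
  rewrite ?subrr ?normr0 ?subr_ge0//;
  case: (leP (- c) x) => h4; rewrite ?subrr ?normr0 ?subr_ge0//;
  case: (leP (- c) y) => h5; rewrite ?subrr ?normr0 ?subr_ge0// ger0_norm; lra.
Qed.

End clamp.

(** * The truncated Euler scheme *)

Section euler.
Context (R : realType) (d : measure_display) (Omega : measurableType d).
Context (P : probability Omega R) (F : R -> set_system Omega).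
Context (B : R -> Omega -> R) (f : R * R -> R) (g : R -> R) (x0 : R).
Implicit Types (n k i : nat) (t : R) (w : Omega).

Definition drift n x t := clamp n%:R (f (x, t)).

Fixpoint euler n k w : R :=
  if k is k'.+1 then
    euler n k' w + drift n (euler n k' w) (dy R n k') * mesh R n
    + g (euler n k' w) * (B (dy R n k'.+1) w - B (dy R n k') w)
  else x0.

(** Between grid points the noise follows [B] itself, so this is the Ito process with piecewise
    constant coefficients and not a polygon. With [n * 2 ^ n] steps of length [mesh n] it is frozen
    after time [n]. *)
Definition euler_path n t w : R :=
  x0 + \sum_(i < n * 2 ^ n)
    (drift n (euler n i w) (dy R n i)
       * (Num.min (dy R n i.+1) t - Num.min (dy R n i) t)
     + g (euler n i w)
       * (B (Num.min (dy R n i.+1) t) w - B (Num.min (dy R n i) t) w)).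

Lemma eulerE n k w : euler n k w = x0 + \sum_(i < k)
  (drift n (euler n i w) (dy R n i) * mesh R n
   + g (euler n i w) * (B (dy R n i.+1) w - B (dy R n i) w)).
Proof.
elim: k => [|k ih]; first by rewrite big_ord0 addr0.
by rewrite big_ord_recr/= {1}ih -!addrA.
Qed.

Lemma euler_path_local n k t w : (k < n * 2 ^ n)%N ->
  dy R n k <= t <= dy R n k.+1 ->
  euler_path n t w = euler n k w + drift n (euler n k w) (dy R n k) * (t - dy R n k)
    + g (euler n k w) * (B t w - B (dy R n k) w).
Proof.
move=> kn /andP[kt tk]; rewrite /euler_path.
pose T i := drift n (euler n i w) (dy R n i)
       * (Num.min (dy R n i.+1) t - Num.min (dy R n i) t)
     + g (euler n i w)
       * (B (Num.min (dy R n i.+1) t) w - B (Num.min (dy R n i) t) w).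
rewrite -(big_mkord xpredT T) (@big_cat_nat _ _ _ k)//=; last exact: ltnW.
rewrite (big_ltn kn) [X in _ + (_ + (_ + X))](_ : _ = 0) ?addr0; last first.
  apply: big1_seq => i; rewrite mem_index_iota => /= /andP[ki _]; rewrite /T.
  have h1 : t <= dy R n i by apply: le_trans tk _; exact: dy_homo.
  have h2 : t <= dy R n i.+1 by apply: le_trans h1 _; exact/ltW/dy_lt.
  by rewrite (min_idPr h1) (min_idPr h2) !subrr !mulr0 addr0.
rewrite {2}/T (min_idPl kt) (min_idPr tk) addrA addrA; congr (_ + _ + _).
rewrite eulerE big_mkord; congr (_ + _); apply: eq_bigr => i _; rewrite /T.
have h1 : dy R n i.+1 <= t by apply: le_trans kt; exact: dy_homo.
have h2 : dy R n i <= t by apply: le_trans h1; exact/ltW/dy_lt.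
by rewrite (min_idPl h1) (min_idPl h2) dyS_sub.
Qed.

Lemma euler_path_dy n k w : (k < n * 2 ^ n)%N -> euler_path n (dy R n k) w = euler n k w.
Proof.
move=> kn; rewrite (@euler_path_local n k) ?lexx ?(ltW (dy_lt _ _ _))//.
by rewrite !subrr !mulr0 !addr0.
Qed.

Hypothesis PF : complete_filtered_probability_space P F.
Hypothesis BM : brownian_motion P F B.
Hypothesis cf : forall t, 0 <= t -> continuous (fun x => f (x, t)).
Hypothesis cg : continuous g.

Local Notation mw t := (measurable_wrt (F t)).

Lemma drift_mw n s t Y : 0 <= s -> 0 <= t -> mw s Y -> mw s (fun w => drift n (Y w) t).
Proof.
move=> s0 t0; apply: (mw_ccomp (k := fun x => drift n x t)) => // x.
apply: (@continuous_comp _ _ _ (fun x => f (x, t)) (clamp n%:R)).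
  exact: cf.
exact: continuous_clamp.
Qed.

Lemma euler_mw n k : mw (dy R n k) (euler n k).
Proof.
elim: k => [|k ih]; first exact/(mw_cst PF)/dy_ge0.
have d0 := dy_ge0 R n k.+1; have d0' := dy_ge0 R n k.
have dd := ltW (dy_lt R n k).
have ih' := mw_mono PF d0' dd ih.
apply: (mwD PF d0); last first.
  by apply: (mwM PF d0); [exact: (mw_ccomp d0)|exact: (increment_mw PF BM)].
apply: (mwD PF d0) => //; apply: (mwM PF d0); last exact: (mw_cst PF).
by apply: drift_mw => //; exact: dy_ge0.
Qed.

Lemma euler_path_adapted n : adapted F (euler_path n).
Proof.
move=> t t0; apply: (mwD PF t0); first exact: (mw_cst PF).
pose T (i : 'I_(n * 2 ^ n)) w : R := drift n (euler n i w) (dy R n i)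
       * (Num.min (dy R n i.+1) t - Num.min (dy R n i) t)
     + g (euler n i w)
       * (B (Num.min (dy R n i.+1) t) w - B (Num.min (dy R n i) t) w).
apply: (@mw_sum _ _ _ _ _ PF t _ (index_enum 'I_(n * 2 ^ n)) xpredT T t0) => i _; rewrite /T.
have [ti|] := boolP (t <= dy R n i).
  have h2 : t <= dy R n i.+1 by apply: le_trans ti _; exact/ltW/dy_lt.
  rewrite (min_idPr ti) (min_idPr h2).
  rewrite (_ : (fun w => _) = (fun=> 0)); first exact: (mw_cst PF).
  by apply/funext => w; rewrite !subrr !mulr0 addr0.
rewrite -ltNge => it; have d0 := dy_ge0 R n i.
have ei : mw t (euler n i) by apply: (mw_mono PF d0 (ltW it)); exact: euler_mw.
have m1 : 0 <= Num.min (dy R n i) t by rewrite le_min d0.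
have m2 : 0 <= Num.min (dy R n i.+1) t by rewrite le_min dy_ge0.
apply: (mwD PF t0); apply: (mwM PF t0).
- by apply: drift_mw.
- exact: (mw_cst PF).
- exact: (mw_ccomp t0).
- apply: (mwB PF t0).
    by apply: (mw_mono PF m2); [rewrite ge_min lexx orbT|exact: (brownian_mw BM)].
  by apply: (mw_mono PF m1); [rewrite ge_min lexx orbT|exact: (brownian_mw BM)].
Qed.

Lemma brownian_min_continuous (a : R) w : 0 <= a ->
  {within [set t : R | 0 <= t], continuous (fun t => B (Num.min a t) w)}.
Proof.
move=> a0; apply/within_ge0_continuousP.
case: BM => /(_ w)/within_ge0_continuousP cB _ _ _ _.
rewrite (_ : (fun t => _) = (fun t => B (Num.max 0 t) w) \o
  (fun t => Num.min a (Num.max 0 t))).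
  move=> t; apply: continuous_comp; last exact: cB.
  apply: (@continuous_min _ _ (cst a) (fun t => Num.max 0 t)).
    exact: cst_continuous.
  by apply: (@continuous_max _ _ (cst 0) id) => //; exact: cst_continuous.
apply/funext => t /=; congr (B _ w); apply/esym/max_idPr.
by rewrite le_min a0 le_max lexx.
Qed.

Lemma euler_path_continuous n : continuous_process (euler_path n).
Proof.
move=> w; apply/within_ge0_continuousP => t.
apply: (@continuousD R R R (cst x0)); first exact: cst_continuous.
pose T (i : 'I_(n * 2 ^ n)) (t : R) := drift n (euler n i w) (dy R n i)
       * (Num.min (dy R n i.+1) (Num.max 0 t) - Num.min (dy R n i) (Num.max 0 t))
     + g (euler n i w)
       * (B (Num.min (dy R n i.+1) (Num.max 0 t)) w -
          B (Num.min (dy R n i) (Num.max 0 t)) w).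
apply: (@continuous_big R _ +%R 0 xpredT add_continuous R _ T _ t) => i _.
have cmin (a : R) : continuous (fun t => Num.min a (Num.max 0 t) : R).
  move=> u; apply: (@continuous_min _ _ (cst a) (fun t => Num.max 0 t)).
    exact: cst_continuous.
  by apply: (@continuous_max _ _ (cst 0) id) => //; exact: cst_continuous.
have cB (a : R) : 0 <= a -> continuous (fun t => B (Num.min a (Num.max 0 t)) w).
  move=> a0.
  exact: ((within_ge0_continuousP _).1 (@brownian_min_continuous a w a0)).
move=> u.
apply: (@continuousD R R R (fun t => drift n (euler n i w) (dy R n i)
    * (Num.min (dy R n i.+1) (Num.max 0 t) - Num.min (dy R n i) (Num.max 0 t)))
  (fun t => g (euler n i w) * (B (Num.min (dy R n i.+1) (Num.max 0 t)) w -
    B (Num.min (dy R n i) (Num.max 0 t)) w)) u).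
  apply: (@continuousM R R (cst _) (fun t => Num.min (dy R n i.+1) (Num.max 0 t)
    - Num.min (dy R n i) (Num.max 0 t)) u); first exact: cst_continuous.
  apply: (@continuousB R R R (fun t => Num.min (dy R n i.+1) (Num.max 0 t))
    (fun t => Num.min (dy R n i) (Num.max 0 t)) u); exact: cmin.
apply: (@continuousM R R (cst _) (fun t =>
  B (Num.min (dy R n i.+1) (Num.max 0 t)) w -
  B (Num.min (dy R n i) (Num.max 0 t)) w) u); first exact: cst_continuous.
by apply: (@continuousB R R R (fun t => B (Num.min (dy R n i.+1) (Num.max 0 t)) w)
  (fun t => B (Num.min (dy R n i) (Num.max 0 t)) w) u); apply: cB; exact: dy_ge0.
Qed.

End euler.

(** * Integrals of real functions over events *)

Section integral_tools.
Context (R : realType) (d : measure_display) (Omega : measurableType d).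
Context (P : probability Omega R).
Implicit Types (A : set Omega) (Y k : Omega -> R) (a c : R).

Lemma integral_le A k1 k2 : measurable A ->
  measurable_fun setT k1 -> measurable_fun setT k2 ->
  (forall w, A w -> 0 <= k1 w) -> (forall w, A w -> k1 w <= k2 w) ->
  (\int[P]_(w in A) (k1 w)%:E <= \int[P]_(w in A) (k2 w)%:E)%E.
Proof.
move=> mA m1 m2 k0 k12; apply: ge0_le_integral => //.
- by apply/measurable_EFinP; exact: measurable_funTS.
- by apply/measurable_EFinP; exact: measurable_funTS.
Qed.

Lemma integral_subset A Y : measurable A -> measurable_fun setT Y ->
  (forall w, 0 <= Y w) -> (\int[P]_(w in A) (Y w)%:E <= \int[P]_w (Y w)%:E)%E.
Proof.
move=> mA mY Y0; apply: ge0_subset_integral => //.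
- exact/measurable_EFinP.
- by move=> w _; rewrite lee_fin.
Qed.

Lemma integral_addR A k1 k2 : measurable A ->
  measurable_fun setT k1 -> measurable_fun setT k2 ->
  (forall w, 0 <= k1 w) -> (forall w, 0 <= k2 w) ->
  (\int[P]_(w in A) (k1 w + k2 w)%:E =
   \int[P]_(w in A) (k1 w)%:E + \int[P]_(w in A) (k2 w)%:E)%E.
Proof.
move=> mA m1 m2 k10 k20; under eq_integral do rewrite EFinD.
rewrite ge0_integralD//.
- by move=> w Aw; rewrite lee_fin k10.
- by apply/measurable_EFinP; exact: measurable_funTS.
- by move=> w Aw; rewrite lee_fin k20.
- by apply/measurable_EFinP; exact: measurable_funTS.
Qed.

Lemma integral_scale A k a : measurable A -> measurable_fun setT k ->
  (forall w, 0 <= k w) -> 0 <= a ->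
  (\int[P]_(w in A) (a * k w)%:E = a%:E * \int[P]_(w in A) (k w)%:E)%E.
Proof.
move=> mA m k0 a0; under eq_integral do rewrite EFinM.
rewrite ge0_integralZl//.
- by apply/measurable_EFinP; exact: measurable_funTS.
- by move=> w Aw; rewrite lee_fin k0.
Qed.

Lemma integral_const A c : measurable A ->
  (\int[P]_(w in A) c%:E = c%:E * P A)%E.
Proof. by move=> mA; rewrite integral_cst. Qed.

Lemma integral_affine A k a c : measurable A -> measurable_fun setT k ->
  (forall w, 0 <= k w) -> 0 <= a -> 0 <= c ->
  (\int[P]_(w in A) (a * k w + c)%:E = a%:E * \int[P]_(w in A) (k w)%:E + c%:E * P A)%E.
Proof.
move=> mA m k0 a0 c0; rewrite (integral_addR mA _ (measurable_cst c))//.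
- by rewrite integral_scale// integral_const.
- exact: measurable_funM.
- by move=> w; rewrite mulr_ge0.
Qed.

End integral_tools.

(** * Mean square estimates for the scheme *)

Section euler_estimates.
Context (R : realType) (d : measure_display) (Omega : measurableType d).
Context (P : probability Omega R) (F : R -> set_system Omega).
Context (B : R -> Omega -> R) (f : R * R -> R) (g : R -> R) (x0 G rho : R).
Implicit Types (n k i : nat) (t N : R) (w : Omega).

Hypothesis PF : complete_filtered_probability_space P F.
Hypothesis BM : brownian_motion P F B.
Hypothesis f_lip : forall N : R, exists2 L : R, 0 < L & forall x y s t,
  `|x| <= N -> `|y| <= N -> 0 <= s <= N -> 0 <= t <= N ->
  `|f (x, s) - f (y, t)| <= L * (`|x - y| + `|s - t|).
Hypothesis g_lip : forall N : R, exists2 L : R, 0 < L & forall x y,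
  `|x| <= N -> `|y| <= N -> `|g x - g y| <= L * `|x - y|.
Hypothesis G0 : 0 < G.
Hypothesis gG : forall x, `|g x| <= G.
Hypothesis rho0 : 0 < rho.
Hypothesis xf_le : forall x t, 0 <= t -> x * f (x, t) <= rho.

Local Notation mw t := (measurable_wrt (F t)).
Local Notation e := (euler B f g x0).
Local Notation D := (drift f).
Local Notation X := (euler_path B f g x0).
Local Notation dy := (dy R).
Local Notation mesh := (mesh R).

Lemma sqr_le_norm (a c : R) : `|a| <= c -> a ^+ 2 <= c ^+ 2.
Proof.
move=> ac; rewrite -(real_normK (num_real a)) lerXn2r// nnegrE.
exact: le_trans ac.
Qed.

Lemma norm_ge_sqr (a c : R) : 0 <= c -> (c ^+ 2 <= a ^+ 2) = (c <= `|a|).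
Proof.
by move=> c0; rewrite -(real_normK (num_real a)) ler_sqr// nnegrE.
Qed.

Lemma f_continuous t : 0 <= t -> continuous (fun x => f (x, t)).
Proof.
move=> t0; apply: (@lip_continuous R (fun x => f (x, t))) => N.
have [L L0 HL] := f_lip (Num.max N t).
exists L => // x y xN yN.
have := HL x y t t; rewrite subrr normr0 addr0; apply.
- by rewrite le_max xN.
- by rewrite le_max yN.
- by rewrite t0 le_max lexx orbT.
- by rewrite t0 le_max lexx orbT.
Qed.

Lemma g_continuous : continuous g.
Proof. exact: (@lip_continuous R g). Qed.

Lemma sqr_le_exp2 n : n%:R ^+ 2 <= 2 * 2 ^+ n :> R.
Proof.
elim: n => [|n ih]; first by rewrite expr0 expr0n/=; lra.
have [n3|n3] := leqP 3 n; last first.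
  by move: n n3 {ih} => [|[|[|n]]]//= _; rewrite !exprS !expr0; lra.
have : 3 <= n%:R :> R by rewrite ler_nat.
by rewrite (exprS 2 n) -natr1 => h; nra.
Qed.

Lemma sqr_mesh_le n : n%:R ^+ 2 * mesh n <= 2.
Proof. by rewrite ler_pdivrMr ?exprn_gt0// sqr_le_exp2. Qed.

Lemma drift_norm n x t : `|D n x t| <= n%:R.
Proof. exact: clamp_norm. Qed.

Lemma drift_sqr n x t : D n x t ^+ 2 <= n%:R ^+ 2.
Proof. by apply: sqr_le_norm; exact: drift_norm. Qed.

Lemma g_sqr x : g x ^+ 2 <= G ^+ 2.
Proof. exact: sqr_le_norm. Qed.

Lemma e_mw n k : mw (dy n k) (e n k).
Proof. by apply: (euler_mw _ PF BM); [exact: f_continuous|exact: g_continuous]. Qed.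

Lemma eS_mw n k : mw (dy n k) (fun w => e n k w + D n (e n k w) (dy n k) * mesh n).
Proof.
have d0 := dy_ge0 R n k; apply: (mwD PF d0); first exact: e_mw.
apply: (mwM PF d0); last exact: (mw_cst PF).
by apply: (drift_mw f_continuous) => //; exact: e_mw.
Qed.

Lemma ge_mw n k : mw (dy n k) (fun w => g (e n k w)).
Proof. by apply: (mw_ccomp (dy_ge0 R n k)); [exact: g_continuous|exact: e_mw]. Qed.

(** One step raises the second moment by at most [(2 rho + 2 + G^2) * mesh n]: the cross term is
    bounded by [rho], the squared drift by the truncation since [n^2 * mesh n <= 2], the noise by
    [G^2]. The maximal inequality applies with growth factor 1. *)
Lemma euler_exit n K N : 0 < N ->
  (P [set w | exists2 k, (k <= K)%N & (N <= `|e n k w|)%R] <=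
   ((x0 ^+ 2 + K%:R * ((2 * rho + 2 + G ^+ 2) * mesh n)) / N ^+ 2)%:E)%E.
Proof.
move=> N0; set c := (2 * rho + 2 + G ^+ 2) * mesh n.
have h0 := mesh_ge0 R n.
have c0 : 0 <= c.
  by rewrite mulr_ge0// addr_ge0 ?sqr_ge0// addr_ge0// mulr_ge0// ltW.
rewrite (_ : [set w | _] = [set w | exists2 k, (k <= K)%N & N ^+ 2 <= e n k w ^+ 2]); last first.
  apply/seteqP; split => w [k kK h]; exists k => //.
    by rewrite norm_ge_sqr// ltW.
  by rewrite -norm_ge_sqr// ltW.
have := @almost_supermartingale_maximal R d Omega P F PF (fun k => dy n k)
  (fun k w => e n k w ^+ 2) 0 c (N ^+ 2) (x0 ^+ 2) K.
rewrite addr0 expr1n mul1r; apply.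
- by move=> k; exact: dy_ge0.
- by move=> k; exact/ltW/dy_lt.
- by move=> k w; exact: sqr_ge0.
- by move=> k _; apply: (mwX _ (dy_ge0 R n k)); exact: e_mw.
- by [].
- by [].
- by rewrite exprn_gt0.
- by rewrite /= integral_const// probability_setT mule1.
- move=> k A kK FA; rewrite mul1e.
  have mA := filt_measurable PF (dy_ge0 R n k) FA.
  have mek := mw_fun PF (dy_ge0 R n k) (e_mw n k).
  have mgk := mw_fun PF (dy_ge0 R n k) (ge_mw n k).
  have meS := mw_fun PF (dy_ge0 R n k) (eS_mw n k).
  apply: le_trans (step_sqr PF BM (dy_ge0 R n k) (dy_lt R n k) FA (eS_mw n k) (ge_mw n k)) _.
  rewrite dyS_sub.
  apply: (@le_trans _ _ (\int[P]_(w in A) (1 * e n k w ^+ 2 + c)%:E)%E).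
    apply: integral_le => //.
    + apply: measurable_funD; first exact: measurable_funX.
      by apply: measurable_funM => //; exact: measurable_funX.
    + by apply: measurable_funD => //; apply: measurable_funM => //; exact: measurable_funX.
    + by move=> w _; rewrite addr_ge0 ?sqr_ge0// mulr_ge0 ?sqr_ge0.
    + move=> w _; rewrite mul1r.
      have xf : e n k w * D n (e n k w) (dy n k) <= rho.
        by apply: clamp_mul_le => //; [exact: ltW|exact/xf_le/dy_ge0].
      have := drift_sqr n (e n k w) (dy n k).
      have := g_sqr (e n k w); have := sqr_mesh_le n.
      move: xf; move: (D n (e n k w) (dy n k)) => a; move: (g (e n k w)) => b.
      move: (e n k w) => x xf nh bG an.
      have : a ^+ 2 * mesh n <= 2.
        by apply: le_trans nh; rewrite ler_wpM2r.
      rewrite /c sqrrD; move: h0; set h := mesh n => h0 ah.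
      have : a ^+ 2 * h ^+ 2 <= 2 * h by rewrite expr2 [h ^+ 2]expr2 mulrA ler_wpM2r// -expr2.
      have : b ^+ 2 * h <= G ^+ 2 * h by rewrite ler_wpM2r.
      have : x * a * h <= rho * h by rewrite ler_wpM2r.
      rewrite exprMn; nra.
  rewrite integral_affine//; last 2 first.
  + exact: measurable_funX.
  + by move=> w; exact: sqr_ge0.
  rewrite mul1e leeD2l// -[leRHS]mule1 lee_wpmul2l// probability_le1//.
Qed.

Lemma euler_path0 n w : X n 0 w = x0.
Proof.
rewrite /euler_path big1 ?addr0// => i _.
by rewrite !(min_idPr (dy_ge0 R _ _)) !subrr !mulr0 addr0.
Qed.

Lemma measurable_ex_le (Y : nat -> Omega -> R) (c : R) K :
  (forall k, (k <= K)%N -> measurable_fun setT (Y k)) ->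
  measurable [set w | exists2 k, (k <= K)%N & c <= Y k w].
Proof.
move=> mY; rewrite (_ : [set w | _] = \bigcup_(k in [set k | (k <= K)%N])
    [set w | c <= Y k w]); last by apply/seteqP; split => w [k ? ?]; exists k.
apply: bigcup_measurable => k /= kK; rewrite -[X in measurable X]setTI.
by apply: measurable_fun_le => //; exact: mY.
Qed.

Lemma measure_union_le (U : nat -> set Omega) (c : \bar R) :
  (forall k, measurable (U k)) -> (forall k, U k `<=` U k.+1) ->
  (forall k, P (U k) <= c)%E -> (P (\bigcup_k U k) <= c)%E.
Proof.
move=> mU ndU Uc.
have cU : P (U k) @[k --> \oo] --> P (\bigcup_k U k).
  apply: nondecreasing_cvg_mu => //; first exact: bigcup_measurable.
  by apply/nondecreasing_seqP => k; apply/subsetPset; exact: ndU.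
rewrite -(cvg_lim _ cU)//; apply: lime_le; first by apply/cvg_ex; eexists; exact: cU.
exact: nearW.
Qed.

(** The cell of the level [k] grid that contains the cell [j] of the finer level [M]. *)
Definition coarse (M k j : nat) : nat := (j %/ 2 ^ (M - k))%N.

Lemma coarse_itv M k j : (k <= M)%N ->
  dy k (coarse M k j) <= dy M j /\ dy M j.+1 <= dy k (coarse M k j).+1.
Proof.
move=> kM; rewrite !(dy_refine R _ kM) !dy_le; split; first exact: leq_divM.
by apply: ltn_ceil; rewrite expn_gt0.
Qed.

Lemma coarse_lt M k j K : (k <= M)%N -> (j < K * 2 ^ M)%N ->
  (coarse M k j < K * 2 ^ k)%N.
Proof.
move=> kM jK; rewrite ltn_divLR ?expn_gt0//.
by rewrite -mulnA -expnD subnKC.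
Qed.

Lemma coarse_homo M k i j : (i <= j)%N -> (coarse M k i <= coarse M k j)%N.
Proof. exact: leq_div2r. Qed.

Lemma path_step M k j w : (k <= M)%N -> (j < k * 2 ^ M)%N ->
  X k (dy M j.+1) w = X k (dy M j) w
    + D k (e k (coarse M k j) w) (dy k (coarse M k j)) * mesh M
    + g (e k (coarse M k j) w) * (B (dy M j.+1) w - B (dy M j) w).
Proof.
move=> kM jk; have [h1 h2] := coarse_itv j kM.
have qk := coarse_lt kM jk.
have h3 := ltW (dy_lt R M j).
rewrite !(@euler_path_local _ _ _ _ _ _ _ k (coarse M k j))//.
- by rewrite -(dyS_sub R M j); ring.
- by rewrite h1 (le_trans h3).
- by rewrite (le_trans h1)//.
Qed.

(** The coefficients of the scheme see its last grid value; this is what the path has moved since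
    then. *)
Definition path_err M k j w := X k (dy M j) w - e k (coarse M k j) w.

Lemma path_errE M k j w : (k <= M)%N -> (j < k * 2 ^ M)%N ->
  path_err M k j w =
    D k (e k (coarse M k j) w) (dy k (coarse M k j)) * (dy M j - dy k (coarse M k j))
    + g (e k (coarse M k j) w) * (B (dy M j) w - B (dy k (coarse M k j)) w).
Proof.
move=> kM jk; have [h1 h2] := coarse_itv j kM.
have qk := coarse_lt kM jk.
have h3 := ltW (dy_lt R M j).
rewrite /path_err (@euler_path_local _ _ _ _ _ _ _ k (coarse M k j))//.
  by ring.
by rewrite h1 (le_trans h3).
Qed.

Lemma path_err_mw M k j : (k <= M)%N -> mw (dy M j) (path_err M k j).
Proof.
move=> kM; have [h1 h2] := coarse_itv j kM.
apply: (mwB PF (dy_ge0 R M j)).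
  exact: (euler_path_adapted x0 PF BM f_continuous g_continuous k (dy_ge0 R M j)).
by apply: (mw_mono PF _ h1); [exact: dy_ge0|exact: e_mw].
Qed.

(** By [(p + q)^2 <= 2 (p^2 + q^2)] the truncated drift contributes [2 k^2 mesh^2 <= 4 mesh] and the
    noise [2 G^2 mesh]. *)
Lemma path_err_sqr M k j : (k <= M)%N -> (j < k * 2 ^ M)%N ->
  (\int[P]_w (path_err M k j w ^+ 2)%:E <= ((4 + 2 * G ^+ 2) * mesh k)%:E)%E.
Proof.
move=> kM jk; have [h1 h2] := coarse_itv j kM.
have d0 := dy_ge0 R M j; have dk0 := dy_ge0 R k (coarse M k j).
pose u := dy M j - dy k (coarse M k j).
have u0 : 0 <= u by rewrite subr_ge0.
have uh : u <= mesh k.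
  by rewrite /u lerBlDr addrC -dyS (le_trans _ h2)// ltW// dy_lt.
pose W w := B (dy M j) w - B (dy k (coarse M k j)) w.
have mW : measurable_fun setT W.
  by apply: (mw_fun PF d0); exact: (increment_mw PF BM).
have merr := mw_fun PF d0 (path_err_mw j kM).
apply: (@le_trans _ _ (\int[P]_w ((2 * G ^+ 2) * W w ^+ 2 + 4 * mesh k)%:E)%E).
  apply: integral_le => //.
  - exact: measurable_funX.
  - by apply: measurable_funD => //; apply: measurable_funM => //; exact: measurable_funX.
  - by move=> w _; exact: sqr_ge0.
  - move=> w _; rewrite path_errE// -/u -/(W w).
    have := drift_sqr k (e k (coarse M k j) w) (dy k (coarse M k j)).
    have := g_sqr (e k (coarse M k j) w).
    move: (D _ _ _) (g _) (W w) => a b z bG ak.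
    have h3 : a ^+ 2 * u ^+ 2 <= 2 * mesh k.
      apply: (@le_trans _ _ (k%:R ^+ 2 * (mesh k * mesh k))).
        rewrite ler_pM ?sqr_ge0// expr2 ler_pM//.
      by rewrite mulrA ler_wpM2r ?mesh_ge0// sqr_mesh_le.
    have h4 : b ^+ 2 * z ^+ 2 <= G ^+ 2 * z ^+ 2 by rewrite ler_wpM2r ?sqr_ge0.
    have : 0 <= (a * u - b * z) ^+ 2 by exact: sqr_ge0.
    by nra.
rewrite integral_affine//; last 4 first.
- exact: measurable_funX.
- by move=> w; exact: sqr_ge0.
- by rewrite mulr_ge0// sqr_ge0.
- by rewrite mulr_ge0// mesh_ge0.
rewrite probability_setT mule1.
have h5 := @increment_sqr R d Omega P F B PF BM _ _ dk0 h1.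
apply: (@le_trans _ _ ((2 * G ^+ 2)%:E * (mesh k)%:E + (4 * mesh k)%:E)%E).
  rewrite leeD2r//; apply: lee_wpmul2l.
    by rewrite lee_fin; apply: mulr_ge0 => //; exact: sqr_ge0.
  by apply: le_trans h5 _; rewrite lee_fin.
by rewrite -EFinM -EFinD lee_fin; lra.
Qed.

Section difference.
Context (n m M T : nat) (N L : R).
Hypothesis nm : (n <= m)%N.
Hypothesis mM : (m <= M)%N.
Hypothesis Tn : (T <= n)%N.
Hypothesis TN : T%:R <= N.
Hypothesis L0 : 0 < L.
Hypothesis fL : forall x y s t,
  `|x| <= N -> `|y| <= N -> 0 <= s <= N -> 0 <= t <= N ->
  `|f (x, s) - f (y, t)| <= L * (`|x - y| + `|s - t|).
Hypothesis gL : forall x y, `|x| <= N -> `|y| <= N -> `|g x - g y| <= L * `|x - y|.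
Hypothesis fn : forall x t, `|x| <= N -> 0 <= t <= N -> `|f (x, t)| <= n%:R.

Let nM : (n <= M)%N := leq_trans nm mM.
Let Tm : (T <= m)%N := leq_trans Tn nm.

Let H j := [set w | (forall i, (i <= coarse M n j)%N -> `|e n i w| <= N) /\
                    (forall i, (i <= coarse M m j)%N -> `|e m i w| <= N)].

Let FHk k j : (k <= M)%N ->
  F (dy M j) [set w | forall i, (i <= coarse M k j)%N -> `|e k i w| <= N].
Proof.
move=> kM; have d0 := dy_ge0 R M j.
rewrite (_ : [set w | _] = \bigcap_(i in [set i | (i <= coarse M k j)%N])
    [set w | `|e k i w| <= N]); last by apply/seteqP; split.
apply: (filt_bigcap PF d0) => i /= ij; apply: (filt_le _ d0).
apply: (mw_norm d0); have [h1 _] := coarse_itv j kM.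
apply: (@mw_mono _ _ _ _ _ PF (dy k i)); [exact: dy_ge0| |exact: e_mw].
by apply: le_trans h1; exact: dy_homo.
Qed.

Let FH j : F (dy M j) (H j).
Proof. by apply: (filtI PF (dy_ge0 R M j)); exact: FHk. Qed.

Let H_mono i j w : (i <= j)%N -> H j w -> H i w.
Proof.
by move=> ij [h1 h2]; split => k kq; [apply: h1|apply: h2];
  apply: leq_trans kq _; exact: coarse_homo.
Qed.

Let a j w := D n (e n (coarse M n j) w) (dy n (coarse M n j))
           - D m (e m (coarse M m j) w) (dy m (coarse M m j)).
Let b j w := g (e n (coarse M n j) w) - g (e m (coarse M m j) w).
Let chi j w : R := \1_(H j) w.

Let a_mw j : mw (dy M j) (a j).
Proof.
have d0 := dy_ge0 R M j; have [h1 _] := coarse_itv j nM; have [h2 _] := coarse_itv j mM.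
apply: (mwB PF d0); apply: (drift_mw f_continuous) => //; try exact: dy_ge0.
- by apply: (mw_mono PF _ h1); [exact: dy_ge0|exact: e_mw].
- by apply: (mw_mono PF _ h2); [exact: dy_ge0|exact: e_mw].
Qed.

Let b_mw j : mw (dy M j) (b j).
Proof.
have d0 := dy_ge0 R M j; have [h1 _] := coarse_itv j nM; have [h2 _] := coarse_itv j mM.
apply: (mwB PF d0).
- by apply: (mw_mono PF _ h1); [exact: dy_ge0|exact: ge_mw].
- by apply: (mw_mono PF _ h2); [exact: dy_ge0|exact: ge_mw].
Qed.

Let chi_mw j : mw (dy M j) (chi j).
Proof. by apply: (mw_indic PF); [exact: dy_ge0|exact: FH]. Qed.

(** The difference of the two schemes, stopped when one of them leaves [[-N, N]]: the events [H]
    decrease with time, so [chi] switches the increments off for good, and it is known at the left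
    end of each cell. *)
Let S j w : R := \sum_(i < j)
  chi i w * (a i w * mesh M + b i w * (B (dy M i.+1) w - B (dy M i) w)).

Let SS j w : S j.+1 w = (S j w + chi j w * a j w * mesh M)
  + chi j w * b j w * (B (dy M j.+1) w - B (dy M j) w).
Proof. by rewrite /S big_ord_recr/= mulrDr !mulrA addrA. Qed.

Let S_mw j : mw (dy M j) (S j).
Proof.
elim: j => [|j ih].
  rewrite (_ : S 0 = fun=> 0); first exact/(mw_cst PF)/dy_ge0.
  by apply/funext => w; rewrite /S big_ord0.
have d0 := dy_ge0 R M j; have d1 := dy_ge0 R M j.+1; have dd := ltW (dy_lt R M j).
rewrite (_ : S j.+1 = fun w => (S j w + chi j w * a j w * mesh M)
  + chi j w * b j w * (B (dy M j.+1) w - B (dy M j) w)); last first.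
  by apply/funext => w; exact: SS.
apply: (mwD PF d1).
  apply: (mw_mono PF d0 dd); apply: (mwD PF d0) => //.
  by apply: (mwM PF d0); [exact: (mwM PF d0)|exact: (mw_cst PF)].
apply: (mwM PF d1); last exact: (increment_mw PF BM).
by apply: (mw_mono PF d0 dd); exact: (mwM PF d0).
Qed.

Let S_eq j w : (j <= T * 2 ^ M)%N -> (forall i, (i < j)%N -> H i w) ->
  S j w = X n (dy M j) w - X m (dy M j) w.
Proof.
elim: j => [|j ih] jT Hw.
  by rewrite /S big_ord0 dy0 !euler_path0 subrr.
have jn : (j < n * 2 ^ M)%N by apply: leq_trans jT _; rewrite leq_mul2r Tn orbT.
have jm : (j < m * 2 ^ M)%N by apply: leq_trans jT _; rewrite leq_mul2r Tm orbT.
rewrite SS ih ?(ltnW jT)//; last by move=> i ij; apply: Hw; exact: ltnW.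
have -> : chi j w = 1 by rewrite /chi indicE mem_set//; exact: Hw.
by rewrite !path_step// /a /b !mul1r; ring.
Qed.

Let dy_coarse_le k j : (k <= M)%N -> (j < T * 2 ^ M)%N -> 0 <= dy k (coarse M k j) <= N.
Proof.
move=> kM jT; rewrite dy_ge0/=; apply: le_trans TN.
rewrite -(dy_nat R k T) dy_le; exact/ltnW/(coarse_lt kM).
Qed.

(** The arguments of the coefficients differ by [S] and the two interpolation errors, and the two
    grid times by at most [2 * mesh n]; the Lipschitz constant on [[-N, N]] does the rest. *)
Let coefs_le j w : (j < T * 2 ^ M)%N -> H j w ->
  a j w ^+ 2 <= 4 * L ^+ 2 * (S j w ^+ 2 + path_err M n j w ^+ 2
     + path_err M m j w ^+ 2 + 4 * mesh n) /\
  b j w ^+ 2 <= 4 * L ^+ 2 * (S j w ^+ 2 + path_err M n j w ^+ 2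
     + path_err M m j w ^+ 2 + 4 * mesh n).
Proof.
move=> jT Hw.
have en : `|e n (coarse M n j) w| <= N by case: Hw => h _; exact: h.
have em : `|e m (coarse M m j) w| <= N by case: Hw => _ h; exact: h.
have tn := dy_coarse_le nM jT; have tm := dy_coarse_le mM jT.
have Sj : S j w = X n (dy M j) w - X m (dy M j) w.
  by apply: S_eq => [|i ij]; [exact: ltnW|exact: H_mono (ltnW ij) Hw].
set Q := _ + _ + _ + _.
have [h1 h2] := coarse_itv j nM; have [h3 h4] := coarse_itv j mM.
have mn : mesh m <= mesh n := mesh_nincr R nm.
have dt : `|dy n (coarse M n j) - dy m (coarse M m j)| <= 2 * mesh n.
  have := dy_lt R M j; rewrite !dyS in h2 h4 *.
  by rewrite ler_norml; lra.
have de : `|e n (coarse M n j) w - e m (coarse M m j) w| <=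
    `|S j w| + `|path_err M n j w| + `|path_err M m j w|.
  have -> : e n (coarse M n j) w - e m (coarse M m j) w =
     S j w - path_err M n j w + path_err M m j w.
    by rewrite Sj /path_err; ring.
  by apply: le_trans (ler_normD _ _) _; rewrite lerD2r; exact: ler_normB.
(* A square of four summands is at most four times the sum of squares, and [(2 h)^2 <= 4 h] because
   a mesh is at most 1. *)
have key (c : R) : `|c| <= L * (`|S j w| + `|path_err M n j w| + `|path_err M m j w|
     + 2 * mesh n) -> c ^+ 2 <= 4 * L ^+ 2 * Q.
  move=> /sqr_le_norm/le_trans; apply.
  rewrite exprMn (_ : 4 * L ^+ 2 * Q = L ^+ 2 * (4 * Q)); last by ring.
  rewrite ler_wpM2l ?sqr_ge0// /Q.
  rewrite -!(real_normK (num_real (S j w))) -(real_normK (num_real (path_err M n j w)))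
    -(real_normK (num_real (path_err M m j w))).
  move: (`|S j w|) (`|path_err M n j w|) (`|path_err M m j w|) => s r r'.
  have h0 := mesh_ge0 R n; have h5 := mesh_le1 R n.
  move: (mesh n) h0 h5 => h h0 h5.
  have hh : h ^+ 2 <= h by rewrite expr2 ler_piMr.
  have : 0 <= (s - r) ^+ 2 + (s - r') ^+ 2 + (s - 2 * h) ^+ 2 + (r - r') ^+ 2
    + (r - 2 * h) ^+ 2 + (r' - 2 * h) ^+ 2 by rewrite !addr_ge0 ?sqr_ge0.
  by nra.
split; apply: key.
  (* Inside [[-N, N]] the truncation is inactive at both levels, by the choice of [n]. *)
  rewrite /a /drift clamp_id; last exact: fn.
  rewrite clamp_id; last first.
    by apply: le_trans (fn em tm) _; rewrite ler_nat.
  apply: le_trans (fL en em tn tm) _.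
  by rewrite ler_wpM2l ?(ltW L0)// lerD.
apply: le_trans (gL en em) _; rewrite ler_wpM2l ?(ltW L0)//.
by apply: le_trans de _; rewrite lerDl mulr_ge0// mesh_ge0.
Qed.

(** From [(s + x h)^2 + y^2 h <= (1 + h) s^2 + (2 x^2 + y^2) h] and [coefs_le] comes the factor
    [12 L^2]. Two interpolation errors of [4 + 2 G^2] and the time lag 4 add up to [12 + 4 G^2]. *)
Let alpha := (1 + 12 * L ^+ 2) * mesh M.
Let cc := 12 * L ^+ 2 * (12 + 4 * G ^+ 2) * mesh n * mesh M.

Let S_step j A : (j < T * 2 ^ M)%N -> F (dy M j) A ->
  (\int[P]_(w in A) (S j.+1 w ^+ 2)%:E <=
   (1 + alpha)%:E * \int[P]_(w in A) (S j w ^+ 2)%:E + cc%:E)%E.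
Proof.
move=> jT FA.
have d0 := dy_ge0 R M j; have dd := ltW (dy_lt R M j).
have mA := filt_measurable PF d0 FA.
have mS := mw_fun PF d0 (S_mw j).
have m1 : mw (dy M j) (fun w => S j w + chi j w * a j w * mesh M).
  by apply: (mwD PF d0) => //; apply: (mwM PF d0); [exact: (mwM PF d0)|exact: (mw_cst PF)].
have m2 : mw (dy M j) (fun w => chi j w * b j w) by exact: (mwM PF d0).
have mm1 := mw_fun PF d0 m1; have mm2 := mw_fun PF d0 m2.
have jn : (j < n * 2 ^ M)%N by apply: leq_trans jT _; rewrite leq_mul2r Tn orbT.
have jm : (j < m * 2 ^ M)%N by apply: leq_trans jT _; rewrite leq_mul2r Tm orbT.
have mrn := mw_fun PF d0 (path_err_mw j nM).
have mrm := mw_fun PF d0 (path_err_mw j mM).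
under eq_integral do rewrite SS.
apply: le_trans (step_sqr PF BM d0 (dy_lt R M j) FA m1 m2) _.
rewrite dyS_sub; pose K := 12 * L ^+ 2 * mesh M.
have h0 := mesh_ge0 R M; have h1 := mesh_le1 R M.
have K0 : 0 <= K by apply: mulr_ge0 => //; apply: mulr_ge0 => //; exact: sqr_ge0.
have alpha0 : 0 <= 1 + alpha.
  rewrite addr_ge0// mulr_ge0// addr_ge0//; apply: mulr_ge0 => //; exact: sqr_ge0.
have n0 := mesh_ge0 R n.
apply: (@le_trans _ _ (\int[P]_(w in A) ((1 + alpha) * S j w ^+ 2 +
   (K * path_err M n j w ^+ 2 + (K * path_err M m j w ^+ 2 + K * (4 * mesh n))))%:E)%E).
  apply: integral_le => //.
  - apply: measurable_funD; first exact: measurable_funX.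
    by apply: measurable_funM => //; exact: measurable_funX.
  - apply: measurable_funD; first by apply: measurable_funM => //; exact: measurable_funX.
    apply: measurable_funD; first by apply: measurable_funM => //; exact: measurable_funX.
    apply: measurable_funD => //; by apply: measurable_funM => //; exact: measurable_funX.
  - by move=> w _; rewrite addr_ge0 ?sqr_ge0// mulr_ge0 ?sqr_ge0.
  - move=> w _; have [Hw|Hw] := pselect (H j w); last first.
      have -> : chi j w = 0 by rewrite /chi indicE memNset.
      rewrite !mul0r addr0 expr0n/= mul0r addr0.
      have := sqr_ge0 (S j w); have := sqr_ge0 (path_err M n j w).
      have := sqr_ge0 (path_err M m j w).
      move: (_ ^+ 2) => p p0; move: (_ ^+ 2) => q q0; move: (_ ^+ 2) => s s0'.
      have al0 : 0 <= alpha by rewrite mulr_ge0// addr_ge0//; apply: mulr_ge0 => //; exact: sqr_ge0.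
      have := mulr_ge0 al0 s0'; have := mulr_ge0 K0 p0; have := mulr_ge0 K0 q0.
      by have := mulr_ge0 K0 n0; lra.
    have -> : chi j w = 1 by rewrite /chi indicE mem_set.
    rewrite !mul1r; have [] := coefs_le jT Hw; rewrite /alpha /K.
    move: (a j w) (b j w) (S j w) => x y s.
    move: (path_err M n j w ^+ 2) (path_err M m j w ^+ 2) => p q.
    set Q := s ^+ 2 + _ + _ + _ => hx hy.
    have hx2 : (s + x * mesh M) ^+ 2 <= s ^+ 2 * (1 + mesh M) + 2 * (x ^+ 2 * mesh M).
      have e1 : 0 <= (s - x) ^+ 2 * mesh M by rewrite mulr_ge0// sqr_ge0.
      have e2 : x ^+ 2 * mesh M ^+ 2 <= x ^+ 2 * mesh M.
        by rewrite ler_wpM2l ?sqr_ge0// expr2 ler_piMr.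
      rewrite sqrrD exprMn; nra.
    have hx3 : x ^+ 2 * mesh M <= 4 * L ^+ 2 * Q * mesh M by rewrite ler_wpM2r.
    have hy3 : y ^+ 2 * mesh M <= 4 * L ^+ 2 * Q * mesh M by rewrite ler_wpM2r.
    by rewrite /Q in hx3 hy3; lra.
have sq0 Y : forall w : Omega, 0 <= (Y w : R) ^+ 2 by move=> w; exact: sqr_ge0.
have msq Y : measurable_fun [set: Omega] Y -> measurable_fun [set: Omega] (fun w => (Y w : R) ^+ 2).
  by move=> mY; exact: measurable_funX.
rewrite integral_addR//; last 4 first.
- by apply: measurable_funM => //; exact: msq.
- apply: measurable_funD; first by apply: measurable_funM => //; exact: msq.
  by apply: measurable_funD => //; apply: measurable_funM => //; exact: msq.
- by move=> w; rewrite mulr_ge0.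
- move=> w; apply: addr_ge0; first by apply: mulr_ge0.
  by apply: addr_ge0; apply: mulr_ge0 => //; exact: mulr_ge0.
rewrite integral_scale//; last exact: msq.
rewrite leeD2l// integral_addR//; last 4 first.
- by apply: measurable_funM => //; exact: msq.
- by apply: measurable_funD => //; apply: measurable_funM => //; exact: msq.
- by move=> w; rewrite mulr_ge0.
- by move=> w; apply: addr_ge0; apply: mulr_ge0 => //; exact: mulr_ge0.
rewrite integral_scale//; last exact: msq.
rewrite integral_affine//; [|exact: msq|by apply: mulr_ge0 => //; exact: mulr_ge0].
have en := le_trans (integral_subset P mA (msq _ mrn) (sq0 _)) (path_err_sqr nM jn).
have em := le_trans (integral_subset P mA (msq _ mrm) (sq0 _)) (path_err_sqr mM jm).
have KE : (0 <= K%:E)%E by rewrite lee_fin.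
apply: le_trans (leeD (lee_wpmul2l KE en) (leeD (lee_wpmul2l KE em)
  (lee_wpmul2l _ (probability_le1 P mA)))) _; first by rewrite lee_fin; apply: mulr_ge0 => //; exact: mulr_ge0.
rewrite mule1 -!EFinM -!EFinD lee_fin /cc.
have mn : mesh m <= mesh n := mesh_nincr R nm.
have : K * ((4 + 2 * G ^+ 2) * mesh m) <= K * ((4 + 2 * G ^+ 2) * mesh n).
  by rewrite ler_wpM2l// ler_wpM2l// addr_ge0// mulr_ge0// sqr_ge0.
by rewrite /K; lra.
Qed.

Lemma euler_diff_maximal (y : R) : 0 < y ->
  (P [set w | exists2 j, (j <= T * 2 ^ M)%N & (y <= S j w ^+ 2)%R] <=
   (expR ((1 + 12 * L ^+ 2) * T%:R) *
     (T%:R * (12 * L ^+ 2 * (12 + 4 * G ^+ 2))) * mesh n / y)%:E)%E.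
Proof.
move=> y0.
have al0 : 0 <= alpha.
  by rewrite mulr_ge0 ?mesh_ge0// addr_ge0//; apply: mulr_ge0 => //; exact: sqr_ge0.
have LG0 : 0 <= 12 * L ^+ 2 * (12 + 4 * G ^+ 2).
  apply: mulr_ge0; first by apply: mulr_ge0 => //; exact: sqr_ge0.
  by apply: addr_ge0 => //; apply: mulr_ge0 => //; exact: sqr_ge0.
have cc0 : 0 <= cc.
  by apply: mulr_ge0; [apply: mulr_ge0 => //|]; exact: mesh_ge0.
have Td : (T * 2 ^ M)%:R * mesh M = T%:R :> R by exact: dy_nat.
have := @almost_supermartingale_maximal R d Omega P F PF (fun j => dy M j)
  (fun j w => S j w ^+ 2) alpha cc y 0 (T * 2 ^ M)%N.
move=> H1; apply: le_trans (H1 _ _ _ _ _ _ _ _ _) _ => //.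
- by move=> k; exact: dy_ge0.
- by move=> k; exact/ltW/dy_lt.
- by move=> k w; exact: sqr_ge0.
- by move=> k _; apply: (mwX _ (dy_ge0 R M k)); exact: S_mw.
- under eq_integral => w _ do rewrite /S big_ord0 expr0n/=.
  by rewrite integral0.
- rewrite lee_fin ler_pM2r ?invr_gt0// add0r -!mulrA.
  apply: ler_pM => //.
  + by rewrite exprn_ge0// addr_ge0.
  + by rewrite mulr_ge0.
  + apply: (@le_trans _ _ (expR alpha ^+ (T * 2 ^ M))).
      by rewrite lerXn2r ?nnegrE ?addr_ge0 ?expR_ge0// expR_ge1Dx.
    rewrite -expRM_natl ler_expR /alpha mulrCA Td lexx//.
  + by rewrite /cc mulrCA Td; lra.
Qed.

Lemma euler_diff_prob (eps : R) : 0 < N -> 0 < eps ->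
  (P [set w | exists2 j, (j <= T * 2 ^ M)%N &
       (eps <= `|X n (dy M j) w - X m (dy M j) w|)%R] <=
   (2 * ((x0 ^+ 2 + T%:R * (2 * rho + 2 + G ^+ 2)) / N ^+ 2) +
    expR ((1 + 12 * L ^+ 2) * T%:R) *
     (T%:R * (12 * L ^+ 2 * (12 + 4 * G ^+ 2))) * mesh n / eps ^+ 2)%:E)%E.
Proof.
move=> N0 eps0.
pose E k := [set w | exists2 i, (i <= T * 2 ^ k)%N & N <= `|e k i w|].
pose E3 := [set w | exists2 j, (j <= T * 2 ^ M)%N & eps ^+ 2 <= S j w ^+ 2].
have mE k : measurable (E k).
  apply: measurable_ex_le => i _.
  by apply: (mw_fun PF (dy_ge0 R k i)); apply: (mw_norm (dy_ge0 R k i)); exact: e_mw.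
have mE3 : measurable E3.
  apply: measurable_ex_le => j _.
  by apply: (mw_fun PF (dy_ge0 R M j)); apply: (mwX _ (dy_ge0 R M j)); exact: S_mw.
have PE k : (P (E k) <= ((x0 ^+ 2 + T%:R * (2 * rho + 2 + G ^+ 2)) / N ^+ 2)%:E)%E.
  have := @euler_exit k (T * 2 ^ k) N N0.
  have Td : (T * 2 ^ k)%:R * mesh k = T%:R :> R by exact: dy_nat.
  by rewrite mulrCA Td [_ * T%:R]mulrC.
have PE3 := euler_diff_maximal (exprn_gt0 2 eps0).
(* Off the two exit events nothing has been stopped, so [S] is the true difference of the
   schemes. *)
apply: (@le_trans _ _ (P ((E n `|` E m) `|` E3))).
  apply: le_measure; rewrite ?inE.
  - apply: measurable_ex_le => j _.
    apply: (mw_fun PF (dy_ge0 R M j)); apply: (mw_norm (dy_ge0 R M j)).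
    apply: (mwB PF (dy_ge0 R M j)).
      exact: (euler_path_adapted x0 PF BM f_continuous g_continuous n (dy_ge0 R M j)).
    exact: (euler_path_adapted x0 PF BM f_continuous g_continuous m (dy_ge0 R M j)).
  - by apply: measurableU => //; exact: measurableU.
  - move=> w [j jT Hj]; have [En|nEn] := pselect (E n w); first by left; left.
    have [Em|nEm] := pselect (E m w); first by left; right.
    right; exists j => //; rewrite S_eq// ?norm_ge_sqr ?(ltW eps0)//.
    move=> i ij; have iT : (i < T * 2 ^ M)%N by exact: leq_trans jT.
    have cn := coarse_lt nM iT; have cm := coarse_lt mM iT.
    split=> l lc; rewrite leNgt; apply/negP => /ltW h; [apply: nEn|apply: nEm];
      exists l => //; exact/ltnW/(leq_ltn_trans lc).
apply: le_trans (@measureU2 _ _ _ P _ _ (measurableU _ _ (mE n) (mE m)) mE3) _.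
apply: le_trans (leeD (@measureU2 _ _ _ P _ _ (mE n) (mE m)) PE3) _.
apply: le_trans (leeD (leeD (PE n) (PE m)) (lexx _)) _.
by rewrite -!EFinD lee_fin; set u := _ / N ^+ 2; set v := _ / eps ^+ 2; lra.
Qed.

End difference.

(** The order of choices matters: [N] first, to make the exits unlikely; then [n], because the
    constant in front of [mesh n] is exponential in the Lipschitz constant on [[-N, N]]. The bound
    does not involve the observation grid [M], so it passes to the increasing union over all finer
    grids. *)
Lemma euler_cauchy (T : nat) (eps delta : R) : 0 < eps -> 0 < delta ->
  exists n0, forall n m, (n0 <= n)%N -> (n <= m)%N ->
  (P [set w | exists M j, [/\ (m <= M)%N, (j <= T * 2 ^ M)%N &
       (eps <= `|X n (dy M j) w - X m (dy M j) w|)%R]] <= delta%:E)%E.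
Proof.
move=> eps0 delta0.
pose Q := x0 ^+ 2 + T%:R * (2 * rho + 2 + G ^+ 2).
have Q0 : 0 <= Q.
  apply: addr_ge0; first exact: sqr_ge0.
  apply: mulr_ge0 => //; apply: addr_ge0; last exact: sqr_ge0.
  by apply: addr_ge0 => //; apply: mulr_ge0 => //; exact: ltW.
(* Since [N >= 1], [2 Q / N^2 <= 2 Q / N <= delta / 2]. *)
pose N := 1 + T%:R + 4 * Q / delta.
have QD : 0 <= 4 * Q / delta by apply: divr_ge0; [exact: mulr_ge0|exact: ltW].
have T0 : 0 <= T%:R :> R by [].
have N1 : 1 <= N by rewrite /N; lra.
have N0 : 0 < N by lra.
have TN : T%:R <= N by rewrite /N; lra.
have QN : 2 * (Q / N ^+ 2) <= delta / 2.
  rewrite mulrA ler_pdivrMr ?exprn_gt0//.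
  have h : 4 * Q <= delta * N.
    have : delta * (4 * Q / delta) <= delta * N.
      by rewrite ler_wpM2l ?(ltW delta0)// /N; lra.
    by rewrite mulrCA divff ?mulr1// gt_eqF.
  have : N <= N ^+ 2 by rewrite expr2 ler_peMr// ltW.
  move=> /(ler_wpM2l (ltW delta0)); lra.
have [L1 L10 HL1] := f_lip N; have [L2 L20 HL2] := g_lip N.
pose L := Num.max L1 L2.
have L0 : 0 < L by rewrite lt_max L10.
have fL x y s t : `|x| <= N -> `|y| <= N -> 0 <= s <= N -> 0 <= t <= N ->
    `|f (x, s) - f (y, t)| <= L * (`|x - y| + `|s - t|).
  move=> xN yN sN tN; apply: le_trans (HL1 _ _ _ _ xN yN sN tN) _.
  by rewrite ler_wpM2r ?addr_ge0// le_max lexx.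
have gL x y : `|x| <= N -> `|y| <= N -> `|g x - g y| <= L * `|x - y|.
  move=> xN yN; apply: le_trans (HL2 _ _ xN yN) _.
  by rewrite ler_wpM2r// le_max lexx orbT.
(* A bound for [|f|] on the compact region in question: from this level on the truncation is not
   felt there. *)
pose n1 := (Num.truncn (`|f (0, 0)| + L * (N + N))).+1.
have fn1 x t : `|x| <= N -> 0 <= t <= N -> `|f (x, t)| <= n1%:R.
  move=> xN tN; apply: le_trans (_ : `|f (0, 0)| + L * (N + N) <= _).
    have -> : f (x, t) = f (0, 0) + (f (x, t) - f (0, 0)) by ring.
    apply: le_trans (ler_normD _ _) _; rewrite lerD2l.
    apply: le_trans (fL _ _ _ _ xN _ tN _) _; rewrite ?normr0 ?lexx ?(ltW N0)//.
    rewrite !subr0 ler_wpM2l ?(ltW L0)// lerD//.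
    by rewrite ger0_norm; case/andP: tN.
  by apply/ltW; rewrite truncnS_gt.
pose C := expR ((1 + 12 * L ^+ 2) * T%:R) * (T%:R * (12 * L ^+ 2 * (12 + 4 * G ^+ 2))).
have C0 : 0 <= C.
  apply: mulr_ge0; first exact: expR_ge0.
  apply: mulr_ge0 => //; apply: mulr_ge0.
    by apply: mulr_ge0 => //; exact: sqr_ge0.
  by apply: addr_ge0 => //; apply: mulr_ge0 => //; exact: sqr_ge0.
have e20 : 0 < delta / 2 * eps ^+ 2 / (C + 1).
  by apply: divr_gt0; [rewrite mulr_gt0 ?divr_gt0 ?exprn_gt0//|lra].
have [n2 _ Hn2] : \forall k \near \oo, mesh k <= delta / 2 * eps ^+ 2 / (C + 1).
  have /cvgrPdist_le/(_ _ e20) := @mesh_cvg0 R.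
  by apply: filterS => k; rewrite sub0r normrN ger0_norm// mesh_ge0.
exists (maxn n1 (maxn n2 T)) => n m; rewrite !geq_max => /and3P[n1n n2n Tn] nm.
pose U k := [set w | exists2 j, (j <= T * 2 ^ (m + k))%N &
       (eps <= `|X n (dy (m + k) j) w - X m (dy (m + k) j) w|)%R].
rewrite (_ : [set w | _] = \bigcup_k U k); last first.
  apply/seteqP; split => w /=.
    move=> [M [j [mM jT h]]]; exists (M - m)%N => //.
    by exists j; rewrite subnKC.
  by move=> [k _ [j jT h]]; exists (m + k)%N, j; rewrite leq_addr.
apply: measure_union_le.
- move=> k; apply: measurable_ex_le => j _.
  have d0 := dy_ge0 R (m + k) j.
  apply: (mw_fun PF d0); apply: (mw_norm d0); apply: (mwB PF d0).
    exact: (euler_path_adapted x0 PF BM f_continuous g_continuous n d0).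
  exact: (euler_path_adapted x0 PF BM f_continuous g_continuous m d0).
- move=> k w [j jT h]; exists (j * 2 ^ 1)%N.
    by rewrite addnS (expnSr 2 (m + k)) mulnA leq_mul2r jT orbT.
  rewrite (_ : dy (m + k.+1) (j * 2 ^ 1) = dy (m + k) j)//.
  rewrite (@dy_refine R (m + k) (m + k.+1)) ?leq_add2l ?leqnSn//.
  by rewrite addnS subSnn.
- move=> k.
  have fnn x t : `|x| <= N -> 0 <= t <= N -> `|f (x, t)| <= n%:R.
    by move=> xN tN; apply: le_trans (fn1 _ _ xN tN) _; rewrite ler_nat.
  have := @euler_diff_prob n m (m + k) T N L nm (leq_addr _ _) Tn TN L0 fL gL fnn eps N0 eps0.
  move=> /le_trans; apply; rewrite lee_fin -/Q -/C.
  have : C * mesh n / eps ^+ 2 <= delta / 2.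
    rewrite ler_pdivrMr ?exprn_gt0//.
    have h : mesh n <= delta / 2 * eps ^+ 2 / (C + 1) by exact: Hn2.
    have : (C + 1) * mesh n <= delta / 2 * eps ^+ 2.
      by rewrite mulrC -ler_pdivlMr//; lra.
    have := mesh_ge0 R n; lra.
  lra.
Qed.

End euler_estimates.

(** * Step functions, dominated convergence and Riemann sums *)

Section path_integrals.
Context (R : realType).
Implicit Types (h : R -> R) (s t e r u C : R).
Local Notation mu := (@lebesgue_measure R).

Definition stepf (J : nat) (a c : nat -> R) (s : R) : R :=
  \sum_(i < J) c i * \1_(`]a i, a i.+1]) s.

Lemma measurable_stepf J (a c : nat -> R) :
  measurable_fun (setT : set (measurableTypeR R)) (stepf J a c).
Proof.
by apply: measurable_sum => i; apply: measurable_funM.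
Qed.

Section step.
Context (J : nat) (a c : nat -> R).
Hypothesis a_homo : {homo a : i j / (i <= j)%N >-> i <= j}.

Lemma stepf_at k s : (k < J)%N -> a k < s <= a k.+1 -> stepf J a c s = c k.
Proof.
move=> kJ /andP[ks sk]; rewrite /stepf (bigD1 (Ordinal kJ))//= big1 ?addr0.
  by rewrite indicE mem_set ?mulr1//= in_itv/= ks sk.
move=> i ik; rewrite indicE memNset ?mulr0//= in_itv/= => /andP[h1 h2].
have {}ik : (i : nat) != k by apply: contra ik => /eqP e; apply/eqP/val_inj.
case: (ltngtP i k) ik => // ik _.
  by have := le_lt_trans h2 (le_lt_trans (a_homo ik) ks); rewrite ltxx.
by have := lt_le_trans h1 (le_trans sk (a_homo ik)); rewrite ltxx.
Qed.

Lemma stepf_out s : s <= a 0%N \/ a J < s -> stepf J a c s = 0.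
Proof.
move=> hs; rewrite /stepf big1// => i _.
rewrite indicE memNset ?mulr0//= in_itv/= => /andP[h1 h2]; case: hs => hs.
  by have := lt_le_trans h1 (le_trans hs (a_homo (leq0n i))); rewrite ltxx.
by have := lt_le_trans hs (le_trans h2 (a_homo (ltn_ord i))); rewrite ltxx.
Qed.

Lemma step_locate s : a 0%N < s <= a J -> exists2 k, (k < J)%N & a k < s <= a k.+1.
Proof.
move=> /andP[h0]; elim: J => [h|j ih h].
  by have := lt_le_trans h0 h; rewrite ltxx.
have [sj|js] := leP s (a j).
  by have [k kj ks] := ih sj; exists k => //; exact: ltnW.
by exists j; rewrite ?js.
Qed.

Lemma stepf_bounded M s : (forall i, (i < J)%N -> `|c i| <= M) -> 0 <= M ->
  `|stepf J a c s| <= M.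
Proof.
move=> cM M0; have [h|h] := leP s (a 0%N).
  by rewrite stepf_out ?normr0//; left.
have [h2|h2] := leP s (a J); last by rewrite stepf_out ?normr0//; right.
have [k kJ ks] := step_locate (introT andP (conj h h2)).
by rewrite (stepf_at kJ ks) cM.
Qed.

Lemma stepf_leftcont s : exists2 e, 0 < e &
  forall u, u <= s -> s - u < e -> stepf J a c u = stepf J a c s.
Proof.
have [h|h] := leP s (a 0%N).
  exists 1 => // u us _; rewrite !stepf_out//; left => //.
  exact: le_trans us h.
have [h2|h2] := leP s (a J); last first.
  exists (s - a J); first by rewrite subr_gt0.
  by move=> u us su; rewrite !stepf_out//; right => //; lra.
have [k kJ /andP[ks sk]] := step_locate (introT andP (conj h h2)).
exists (s - a k); first by rewrite subr_gt0.
move=> u us su; have -> : stepf J a c u = c k.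
  by apply: (stepf_at kJ); apply/andP; split; lra.
by rewrite (stepf_at kJ)// ks sk.
Qed.

Hypothesis a0 : 0 <= a 0%N.

Lemma integral_stepf t : 0 <= t ->
  (\int[mu]_(s in `[0%R, t]) (stepf J a c s)%:E)%E =
  (\sum_(i < J) c i * (Num.min (a i.+1) t - Num.min (a i) t))%:E.
Proof.
move=> t0; have mD : measurable (`[0%R, t]%classic : set (measurableTypeR R)).
  exact: measurable_itv.
have fin : (mu (`[0%R, t]%classic : set (measurableTypeR R)) < +oo)%E.
  by rewrite lebesgue_measure_itv/=; case: ifP => _; rewrite ?ltry// -EFinD ltry.
have mI i : measurable (`]a i, a i.+1]%classic : set (measurableTypeR R)).
  exact: measurable_itv.
have int1 i : mu.-integrable (`[0%R, t]%classic : set (measurableTypeR R))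
    (fun s => (\1_(`]a i, a i.+1]) s)%:E).
  apply: (@integrableS _ _ _ _ setT) => //.
  exact: (@integrable_indic_itv R (a i) (a i.+1) false false).
under eq_integral do rewrite /stepf -sumEFin.
rewrite integral_sum//; last first.
  move=> i; rewrite [X in _.-integrable _ X](_ : _ =
    (fun s => (c i)%:E * (\1_(`]a i, a i.+1]) s)%:E)%E)//.
  exact: integrableZl.
rewrite -sumEFin; apply: eq_bigr => i _.
rewrite (@integralZl _ _ _ mu _ mD (fun s => (\1_(`]a i, a i.+1]) s)%:E))//.
rewrite EFinM; congr (_ * _)%E.
rewrite integral_indic//.
have ai0 : 0 <= a i by apply: le_trans a0 _; exact: a_homo.
have aii : a i <= a i.+1 by exact: a_homo.
have -> : (`]a i, a i.+1] `&` `[0%R, t])%classic = `]a i, Num.min (a i.+1) t]%classic.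
  apply/seteqP; split => s /=; rewrite !in_itv/= le_min.
    by move=> [/andP[-> ->] /andP[_ ->]].
  move=> /and3P[h1 h2 h3]; rewrite h1 h2 h3; split => //; rewrite andbT.
  exact: le_trans ai0 (ltW h1).
apply: (etrans (lebesgue_measure_itv _)); rewrite /= lte_fin; case: ltP => h.
  by rewrite -EFinB (min_idPl (_ : a i <= t))//; move: h; rewrite lt_min => /andP[_ /ltW].
have [ti|it] := leP t (a i).
  by rewrite (min_idPr _) ?subrr//; exact: le_trans ti aii.
move: h; rewrite ge_min leNgt [t <= _]leNgt it orbF => /negP/negP.
rewrite -leNgt => h; have -> : a i.+1 = a i by apply/eqP; rewrite eq_le h aii.
by rewrite (min_idPl (ltW it)) subrr.
Qed.

End step.

(** The conditions leave out time 0, where step functions on left-open intervals vanish whatever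
    [h 0] is; that point is negligible for the integral. *)
Lemma dct_itv (hn : nat -> R -> R) h t C : 0 <= t -> 0 <= C ->
  (forall n, measurable_fun (`[0, t]%classic : set (measurableTypeR R)) (hn n)) ->
  (forall n s, 0 < s <= t -> `|hn n s| <= C) ->
  (forall s, 0 < s <= t -> hn n s @[n --> \oo] --> h s) ->
  mu.-integrable `[0, t] (EFin \o h) /\
  ((\int[mu]_(s in `[0%R, t]) (hn n s)%:E)%E @[n --> \oo] -->
   (\int[mu]_(s in `[0%R, t]) (h s)%:E)%E).
Proof.
move=> t0 C0 mhn hC hcvg.
pose D : set (measurableTypeR R) := `]0, t]%classic.
have mD : measurable D by exact: measurable_itv.
have sub : D `<=` `[0, t]%classic by move=> s; rewrite /D/= !in_itv/= => /andP[s0 st]; rewrite ltW.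
have mhD n : measurable_fun D (hn n) by apply: measurable_funS (mhn n) => //; exact: measurable_itv.
have mh : measurable_fun D h.
  by apply: (@measurable_fun_cvg _ _ _ D hn) => // s; rewrite /D/= in_itv/=; exact: hcvg.
have fin : (mu D < +oo)%E.
  by rewrite lebesgue_measure_itv/=; case: ifP => _; rewrite ?ltry// -EFinD ltry.
have intC : mu.-integrable D (cst C%:E).
  by apply: measurable_bounded_integrable => //;
    exists C; split; [exact: num_real|move=> M CM s _; rewrite ger0_norm// ltW].
have [] := @dominated_convergence _ _ _ mu D mD (fun n s => (hn n s)%:E)
   (EFin \o h) (cst C%:E).
- by move=> n; exact/measurable_EFinP.
- exact/measurable_EFinP.
- apply: aeW => s; rewrite /D/= in_itv/= => st.
  by apply: cvg_EFin; [exact: nearW|exact: hcvg].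
- exact: intC.
- apply: aeW => s n; rewrite /D/= in_itv/= => st.
  by rewrite lee_fin; exact: hC.
move=> ih _ cv.
have mc : measurable_fun (`[0, t]%classic : set (measurableTypeR R)) h.
  have -> : `[0, t]%classic = [set 0] `|` D.
    apply/seteqP; split => s /=; rewrite /D/= !in_itv/=.
      move=> /andP[s0 st]; have [->|ns] := eqVneq s 0; first by left.
      by right; rewrite lt_neqAle eq_sym ns s0.
    by move=> [->|/andP[/ltW-> ->]]; rewrite ?lexx ?t0.
  apply/measurable_funU => //; split => //.
  exact: measurable_fun_set1.
have E k : measurable_fun (`[0, t]%classic : set (measurableTypeR R)) k ->
    (\int[mu]_(s in `[0%R, t]) (k s)%:E = \int[mu]_(s in D) (k s)%:E)%E.
  move=> mk; rewrite -[in LHS]integral_itv_obnd_cbnd//.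
  by apply/measurable_EFinP; apply: measurable_funS mk => //; exact: measurable_itv.
split; last first.
  rewrite (E _ mc); move: cv; rewrite (_ : [sequence _]_n =
    (fun n => \int[mu]_(s in `[0%R, t]) (hn n s)%:E)%E)//.
  by apply/funext => n; rewrite (E _ (mhn n)).
apply/integrableP; split; first exact/measurable_EFinP.
move/integrableP : ih => [_]; rewrite -integral_itv_obnd_cbnd//.
by apply: measurableT_comp => //; exact/measurable_EFinP.
Qed.

(** The grid with [2 ^ M] cells on [[0, t]], scaled so that an arbitrary [t] is a grid point. *)
Definition tdy t M j : R := t * dy R M j.

Lemma tdy_homo t M : 0 <= t -> {homo tdy t M : i j / (i <= j)%N >-> i <= j}.
Proof. by move=> t0 i j ij; rewrite ler_wpM2l// dy_homo. Qed.

Lemma tdy_le t M j : 0 <= t -> (j <= 2 ^ M)%N -> 0 <= tdy t M j <= t.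
Proof.
move=> t0 jM; rewrite mulr_ge0 ?dy_ge0//= -[leRHS]mulr1 ler_wpM2l//.
by rewrite -[1](dy_nat R M 1) mul1n dy_le.
Qed.

Lemma tdy_end t M : tdy t M (2 ^ M) = t.
Proof. by rewrite /tdy -{1}[(2 ^ M)%N]mul1n dy_nat mulr1. Qed.

Lemma tdyS t M j : tdy t M j.+1 - tdy t M j = t * mesh R M.
Proof. by rewrite /tdy -mulrBr dyS_sub. Qed.

(** Sampling at the left end of each cell approaches every time from the left, so left continuity
    gives pointwise convergence of the step functions, and the bound [C] dominates them. *)
Lemma riemann_cvg h t C : 0 <= t -> 0 <= C ->
  (forall s, 0 <= s <= t -> `|h s| <= C) ->
  (forall s, 0 <= s <= t -> forall e, 0 < e -> exists2 r, 0 < r &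
    forall u, 0 <= u <= s -> s - u < r -> `|h s - h u| < e) ->
  mu.-integrable `[0, t] (EFin \o h) /\
  ((\sum_(j < 2 ^ M) h (tdy t M j) * (t * mesh R M))%:E @[M --> \oo] -->
   (\int[mu]_(s in `[0%R, t]) (h s)%:E)%E).
Proof.
move=> t0 C0 hC hl.
pose hn M := stepf (2 ^ M) (tdy t M) (fun j => h (tdy t M j)).
have E M : (\int[mu]_(s in `[0%R, t]) (hn M s)%:E)%E =
    (\sum_(j < 2 ^ M) h (tdy t M j) * (t * mesh R M))%:E.
  rewrite integral_stepf//; last 2 first.
  - exact: tdy_homo.
  - by case/andP: (@tdy_le t M 0 t0 (leq0n _)).
  congr EFin; apply: eq_bigr => j _.
  have /andP[_ h1] := tdy_le t0 (ltnW (ltn_ord j)).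
  have /andP[_ h2] := tdy_le t0 (ltn_ord j).
  by rewrite (min_idPl h1) (min_idPl h2) tdyS.
have -> : (fun M => (\sum_(j < 2 ^ M) h (tdy t M j) * (t * mesh R M))%:E) =
    (fun M => \int[mu]_(s in `[0%R, t]) (hn M s)%:E)%E.
  by apply/funext => M; rewrite E.
apply: (dct_itv (C := C)) => //.
- by move=> n; apply: measurable_funTS; exact: measurable_stepf.
- move=> n s _; apply: stepf_bounded => //; first exact: tdy_homo.
  by move=> i iM; apply: hC; apply: tdy_le => //; exact: ltnW.
- move=> s /andP[s0 st]; apply/cvgrPdist_lt => e e0.
  have [r r0 Hr] := hl s (introT andP (conj (ltW s0) st)) e e0.
  have t1 : 0 < t by exact: lt_le_trans s0 st.
  have [N _ HN] : \forall k \near \oo, mesh R k < r / t.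
    have /cvgrPdist_lt/(_ _ (divr_gt0 r0 t1)) := @mesh_cvg0 R.
    by apply: filterS => k; rewrite sub0r normrN ger0_norm// mesh_ge0.
  exists N => // M NM; have hs : tdy t M 0 < s <= tdy t M (2 ^ M).
    by rewrite tdy_end st /tdy dy0 mulr0 s0.
  have [k kM /andP[ks sk]] := step_locate hs.
  rewrite /hn /= (stepf_at _ (tdy_homo M t0) kM); last by rewrite ks sk.
  have /andP[k0 kt] := tdy_le t0 (ltnW kM).
  apply: Hr; first by rewrite k0 ltW.
  have := HN M NM; rewrite ltr_pdivlMr// mulrC => h1.
  by have := tdyS t M k; lra.
Qed.

End path_integrals.

(** * Paths determined by dyadic times *)

Section continuous_paths.
Context (R : realType).
Implicit Types (x h : R -> R) (s t e u C : R).
Local Notation mu := (@lebesgue_measure R).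
Local Notation pc x := {within [set t : R | 0 <= t], continuous x}.

Lemma geometric_cvg (u : nat -> R) J :
  (forall j, (J <= j)%N -> `|u j - u j.+1| <= mesh R j) ->
  exists2 l, u j @[j --> \oo] --> l &
    forall j, (J <= j)%N -> `|u j - l| <= 2 * mesh R j.
Proof.
move=> hu; have hmesh j : mesh R j = 2 * mesh R j.+1.
  by rewrite (@mesh_mul R j j.+1)// subSnn.
have H j k : (J <= j)%N -> `|u j - u (j + k)%N| <= 2 * mesh R j - 2 * mesh R (j + k).
  move=> Jj; elim: k => [|k ih]; first by rewrite addn0 !subrr normr0.
  rewrite addnS; have := ler_distD (u (j + k)%N) (u j) (u (j + k).+1).
  have := hu (j + k)%N (leq_trans Jj (leq_addr _ _)).
  by have := hmesh (j + k)%N; lra.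
have H2 j k : (J <= j)%N -> (j <= k)%N -> `|u j - u k| <= 2 * mesh R j.
  by move=> Jj jk; have := H j (k - j)%N Jj; rewrite subnKC//; have := mesh_ge0 R k; lra.
have cu : cvgn u.
  apply/cauchy_cvgP/cauchy_exP => e e0.
  have e2 : 0 < e / 2 by lra.
  have [N _ HN] : \forall k \near \oo, mesh R k < e / 2.
    have /cvgrPdist_lt/(_ _ e2) := @mesh_cvg0 R.
    by apply: filterS => k; rewrite sub0r normrN ger0_norm// mesh_ge0.
  exists (u (maxn J N)); exists (maxn J N) => // k /= hk.
  apply: le_lt_trans (H2 _ _ (leq_maxl _ _) hk) _.
  by have := HN (maxn J N) (leq_maxr _ _); lra.
exists (limn u) => // j Jj.
have : `|u j - u k| @[k --> \oo] --> `|u j - limn u|.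
  by apply: cvg_norm; apply: cvgB => //; exact: cvg_cst.
move/cvg_lim => <- //; apply: limr_le.
  by apply: is_cvg_norm; apply: is_cvgB => //; exact: is_cvg_cst.
by exists j => // k /= jk; exact: H2.
Qed.

Lemma path_bounded x t : pc x -> 0 <= t ->
  exists2 C, 0 <= C & forall s, 0 <= s <= t -> `|x s| <= C.
Proof.
move=> cx t0; have : {within `[0, t], continuous (fun s => `|x s|)}.
  apply: (continuous_subspaceW _ (_ : pc (fun s => `|x s|))).
    by move=> s /=; rewrite in_itv/= => /andP[].
  by move=> s; apply: continuous_comp; [exact: cx|exact: norm_continuous].
move/(EVT_max t0) => [c _ hc]; exists `|x c| => //.
Qed.

Lemma dyadic_approx t e : 0 <= t -> 0 < e -> forall M0, exists M i, (M0 <= M)%N /\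
  dy R M i <= t /\ t - dy R M i < e.
Proof.
move=> t0 e0 M0; have [N _ HN] : \forall k \near \oo, mesh R k < e.
  have /cvgrPdist_lt/(_ _ e0) := @mesh_cvg0 R.
  by apply: filterS => k; rewrite sub0r normrN ger0_norm// mesh_ge0.
have [i /andP[i1 i2]] := dyadic_floor (maxn M0 N) t0.
exists (maxn M0 N), i; rewrite leq_maxl i1; split=> //; split=> //.
by have := HN (maxn M0 N) (leq_maxr _ _); rewrite dyS in i2; lra.
Qed.

(** The dyadic approximations are taken from the left, so they stay below [t0], and their level can
    be as fine as desired. *)
Lemma dyadic_closure x t0 c M0 : pc x ->
  (forall M i, (M0 <= M)%N -> dy R M i <= t0 -> `|x (dy R M i)| <= c) ->
  forall t, 0 <= t <= t0 -> `|x t| <= c.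
Proof.
move=> /within_ge0_continuous_epsP cx hc t /andP[tge tle].
apply/ler_addgt0Pr => e e0; have [a a0 ha] := cx t tge e e0.
have [M [i [hM [h1 h2]]]] := dyadic_approx tge a0 M0.
have := ha (dy R M i) (dy_ge0 _ _ _); rewrite ger0_norm ?subr_ge0// => /(_ h2).
have := hc M i hM (le_trans h1 tle).
by have := ler_normD (x t - x (dy R M i)) (x (dy R M i)); rewrite subrK; lra.
Qed.

Lemma pc_sub x1 x2 : pc x1 -> pc x2 -> pc (fun t => x1 t - x2 t).
Proof. by move=> h1 h2 t; apply: continuousB; [exact: h1|exact: h2]. Qed.

Lemma uniform_pc (xs : nat -> R -> R) x : (forall j, pc (xs j)) ->
  (forall t e, 0 <= t -> 0 < e -> exists j, forall s, 0 <= s <= t -> `|xs j s - x s| <= e) ->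
  pc x.
Proof.
move=> cxs H; apply/within_ge0_continuous_epsP => t t0 e e0.
have e4 : 0 < e / 4 by lra.
have [j hj] := H (t + 1) (e / 4) (ltac:(lra)) e4.
have /within_ge0_continuous_epsP/(_ t t0 _ e4)[a a0 ha] := cxs j.
exists (Num.min a 1); first by rewrite lt_min a0 ltr01.
move=> s s0; rewrite lt_min => /andP[h1 h2].
have := ha s s0 h1; move: h2; rewrite ltr_norml => /andP[h2 _] h3.
have := hj t; have := hj s; rewrite t0 s0/= => /(_ ltac:(lra)) h4 /(_ ltac:(lra)) h5.
have := ler_distD (xs j t) (x t) (x s); have := ler_distD (xs j s) (xs j t) (x s).
by rewrite (distrC (x t) (xs j t)); lra.
Qed.

(** Bounded and left-continuous on [[0, t]]: a class closed under differences and products that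
    contains both continuous paths and paths of simple processes, hence the integrand of their
    squared distance. *)
Definition lcb h t := exists2 C, 0 <= C &
  (forall s, 0 <= s <= t -> `|h s| <= C) /\
  (forall s, 0 <= s <= t -> forall e, 0 < e -> exists2 r, 0 < r &
    forall u, 0 <= u <= s -> s - u < r -> `|h s - h u| < e).

Lemma lcb_path x t : pc x -> 0 <= t -> lcb x t.
Proof.
move=> cx t0; have [C C0 hC] := path_bounded cx t0.
exists C => //; split=> // s /andP[s0 st] e e0.
have /within_ge0_continuous_epsP/(_ s s0 e e0)[a a0 ha] := cx.
exists a => // u /andP[u0 us] su; apply: ha => //.
by rewrite ger0_norm// subr_ge0.
Qed.

Lemma lcb_step J (a c : nat -> R) t :
  {homo a : i j / (i <= j)%N >-> i <= j} -> lcb (stepf J a c) t.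
Proof.
move=> ah; exists (\sum_(i < J) `|c i|); first exact: sumr_ge0.
split=> [s _|s _ e e0].
  apply: stepf_bounded => //; last exact: sumr_ge0.
  move=> i iJ; rewrite (bigD1 (Ordinal iJ))//= lerDl; exact: sumr_ge0.
have [r r0 hr] := @stepf_leftcont R J a c ah s; exists r => // u /andP[_ us] su.
by rewrite hr// subrr normr0.
Qed.

Lemma lcbB h1 h2 t : lcb h1 t -> lcb h2 t -> lcb (fun s => h1 s - h2 s) t.
Proof.
move=> [C1 C10 [b1 l1]] [C2 C20 [b2 l2]]; exists (C1 + C2); first exact: addr_ge0.
split=> [s st|s st e e0].
  by apply: le_trans (ler_normB _ _) _; apply: lerD; [exact: b1|exact: b2].
have e2 : 0 < e / 2 by lra.
have [r1 r10 H1] := l1 s st _ e2; have [r2 r20 H2] := l2 s st _ e2.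
exists (Num.min r1 r2); first by rewrite lt_min r10.
move=> u us; rewrite lt_min => /andP[/(H1 _ us) k1 /(H2 _ us) k2].
rewrite (_ : _ - _ = (h1 s - h1 u) - (h2 s - h2 u)); last by ring.
by have := ler_normB (h1 s - h1 u) (h2 s - h2 u); lra.
Qed.

Lemma lcbM h1 h2 t : lcb h1 t -> lcb h2 t -> lcb (fun s => h1 s * h2 s) t.
Proof.
move=> [C1 C10 [b1 l1]] [C2 C20 [b2 l2]]; exists (C1 * C2); first exact: mulr_ge0.
split=> [s st|s st e e0].
  by rewrite normrM; apply: ler_pM => //; [exact: b1|exact: b2].
have e2 : 0 < e / (C1 + C2 + 1) by apply: divr_gt0 => //; lra.
have [r1 r10 H1] := l1 s st _ e2; have [r2 r20 H2] := l2 s st _ e2.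
exists (Num.min r1 r2); first by rewrite lt_min r10.
move=> u us; rewrite lt_min => /andP[/(H1 _ us) k1 /(H2 _ us) k2].
rewrite (_ : _ - _ = h1 s * (h2 s - h2 u) + h2 u * (h1 s - h1 u)); last by ring.
apply: le_lt_trans (ler_normD _ _) _; rewrite !normrM.
have ut : 0 <= u <= t by case/andP: us => -> /le_trans; apply; case/andP: st.
have n1 := b1 _ st; have n2 := b2 _ ut.
have ee : e = C1 * (e / (C1 + C2 + 1)) + C2 * (e / (C1 + C2 + 1)) + e / (C1 + C2 + 1).
  by field; lra.
have m1 : `|h1 s| * `|h2 s - h2 u| <= C1 * (e / (C1 + C2 + 1)).
  by apply: ler_pM => //; exact: ltW.
have m2 : `|h2 u| * `|h1 s - h1 u| <= C2 * (e / (C1 + C2 + 1)).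
  by apply: ler_pM => //; exact: ltW.
lra.
Qed.

Lemma lcb_sqr h t : lcb h t -> lcb (fun s => h s ^+ 2) t.
Proof. by move=> hh; have := lcbM hh hh. Qed.

Lemma lcb_riemann h t : 0 <= t -> lcb h t ->
  mu.-integrable `[0, t] (EFin \o h) /\
  ((\sum_(j < 2 ^ M) h (tdy t M j) * (t * mesh R M))%:E @[M --> \oo] -->
   (\int[mu]_(s in `[0%R, t]) (h s)%:E)%E).
Proof. by move=> t0 [C C0 [hC hl]]; exact: riemann_cvg hC hl. Qed.

Lemma integral_EFin h t : 0 <= t -> lcb h t ->
  (\int[mu]_(s in `[0%R, t]) (h s)%:E)%E = (\int[mu]_(s in `[0, t]) h s)%:E.
Proof.
move=> t0 /(lcb_riemann t0)[ih _]; rewrite fineK//.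
by apply: integrable_fin_num => //; exact: measurable_itv.
Qed.

Lemma integral_pc h : pc h -> pc (fun t => \int[mu]_(s in `[0, t]) h s).
Proof.
move=> ch; apply/within_ge0_continuous_epsP => t t0 e e0.
have t1 : 0 <= t + 1 by lra.
have [ih _] := lcb_riemann t1 (lcb_path ch t1).
have /subspace_continuousP/(_ t) := parameterized_integral_continuous t1 ih.
rewrite /= in_itv/= => /(_ ltac:(lra))/cvgrPdist_lt/(_ e e0).
rewrite near_withinE => -[a /= a0 ha].
exists (Num.min a 1); first by rewrite lt_min a0 ltr01.
move=> s s0; rewrite lt_min => /andP[h1 h2]; apply: ha => //.
by move: h2; rewrite in_itv/= s0 ltr_norml; lra.
Qed.

End continuous_paths.

Lemma lip_small (R : realType) (L a p q : R) : 0 < L -> 0 < a ->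
  p < a / (3 * (1 + L)) -> q < a / (3 * (1 + L)) -> L * (p + q) < a.
Proof.
move=> L0 a0; have L1 : 0 < 3 * (1 + L) by lra.
have : a / (3 * (1 + L)) * (3 * (1 + L)) = a by rewrite divfK// gt_eqF.
have : 0 < a / (3 * (1 + L)) by exact: divr_gt0.
move: (a / _) => b b0 ab pb qb.
have : L * (p + q) <= L * (b + b) by rewrite ler_pM2l//; lra.
by have := mulr_gt0 L0 b0; lra.
Qed.

(** * Measurability of limits and convergence in probability *)

Section limits_in_probability.
Context (R : realType) (d : measure_display) (Omega : measurableType d).
Context (P : probability Omega R) (F : R -> set_system Omega).
Hypothesis PF : complete_filtered_probability_space P F.
Local Notation mw t := (measurable_wrt (F t)).
Local Notation mu := (@lebesgue_measure R).

Lemma mw_lim t (Y : nat -> Omega -> R) Y' : 0 <= t -> (forall n, mw t (Y n)) ->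
  (forall w, Y n w @[n --> \oo] --> Y' w) -> mw t Y'.
Proof.
move=> t0 mY cY; apply/measurable_wrtP; first exact: (filt_salg PF).
apply: (@measurable_fun_cvg _ (g_sigma_algebraType (F t)) R setT Y) => // n.
by apply/measurable_wrtP; [exact: (filt_salg PF)|exact: mY].
Qed.

Lemma measurable_integral_lcb (h : R -> Omega -> R) t : 0 <= t ->
  (forall s, 0 <= s <= t -> measurable_fun setT (h s)) ->
  (forall w, lcb (h ^~ w) t) ->
  measurable_fun setT (fun w => (\int[mu]_(s in `[0%R, t]) (h s w)%:E)%E).
Proof.
move=> t0 mh lh.
apply: (@emeasurable_fun_cvg _ _ _ setT (fun M w =>
  (\sum_(j < 2 ^ M) h (tdy t M j) w * (t * mesh R M))%:E)).
  move=> M; apply/measurable_EFinP; apply: measurable_sum => j.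
  apply: measurable_funM; last exact: measurable_cst.
  by apply: mh; apply: tdy_le => //; exact: ltnW.
by move=> w _; have [_] := lcb_riemann t0 (lh w).
Qed.

Lemma mw_integral_lcb (h : R -> Omega -> R) t : 0 <= t ->
  (forall s, 0 <= s <= t -> mw t (h s)) ->
  (forall w, lcb (h ^~ w) t) ->
  mw t (fun w => \int[mu]_(s in `[0, t]) h s w).
Proof.
move=> t0 mh lh.
apply: (@mw_lim t (fun M w => \sum_(j < 2 ^ M) h (tdy t M j) w * (t * mesh R M))) => //.
  move=> M; pose T (j : 'I_(2 ^ M)) w := h (tdy t M j) w * (t * mesh R M).
  apply: (@mw_sum _ _ _ _ _ PF t _ _ _ T) => // j _.
  apply: (mwM PF t0); last exact: (mw_cst PF).
  by apply: mh; apply: tdy_le => //; exact: ltnW.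
move=> w; have [_] := lcb_riemann t0 (lh w).
by rewrite integral_EFin// => /fine_cvg.
Qed.

(** The tail unions [U n] decrease to a subset of [N]; continuity of [P] from above makes their
    probabilities tend to 0. *)
Lemma cvg_ae_in_probability0 (Y : nat -> Omega -> \bar R) (N : set Omega) :
  (forall n, measurable_fun setT (Y n)) -> measurable N -> P N = 0%E ->
  (forall w, ~ N w -> Y n w @[n --> \oo] --> 0%E) -> cvg_in_probability0 P Y.
Proof.
move=> mY mN PN cY; split=> // e e0.
pose V n := [set w | (e%:E <= Y n w)%E].
have mV n : measurable (V n).
  rewrite /V -[X in measurable X]setTI; apply: emeasurable_fun_c_infty => //.
pose U n := \bigcup_(k in [set k | (n <= k)%N]) V k.
have mU n : measurable (U n) by exact: bigcup_measurable.
have UN : \bigcap_n U n `<=` N.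
  move=> w Uw; apply: contrapT => Nw.
  have : \forall n \near \oo, (Y n w < e%:E)%E.
    by apply: (cY w Nw [set y | (y < e%:E)%E]); exact: open_ereal_lt'.
  move=> [n _ Hn]; have [k nk] := Uw n I.
  by rewrite /V/= leNgt => /negP; apply; exact: Hn.
have mcap : measurable (\bigcap_n U n) by exact: bigcap_measurableType.
have PU : P (\bigcap_n U n) = 0%E.
  by apply/eqP; rewrite eq_le measure_ge0 andbT -PN le_measure// inE.
have cU : P (U n) @[n --> \oo] --> 0%E.
  rewrite -PU; apply: nonincreasing_cvg_mu => //.
    by apply: le_lt_trans (probability_le1 P (mU 0%N)) _; rewrite ltry.
  move=> n m nm; apply/subsetPset => w [k /= mk Vk].
  by exists k => //=; exact: leq_trans nm mk.
apply: (squeeze_cvge _ (@cvg_cst _ _ _ _ _) cU).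
apply: nearW => n; rewrite measure_ge0/= le_measure ?inE//.
  exact: mV.
by move=> w Vw; exists n => /=.
Qed.

End limits_in_probability.

(** * Existence of a solution *)

Section existence.
Context (R : realType) (d : measure_display) (Omega : measurableType d).
Context (P : probability Omega R) (F : R -> set_system Omega).
Context (B : R -> Omega -> R) (f : R * R -> R) (g : R -> R) (x0 G rho : R).
Implicit Types (n m k i j : nat) (t s : R) (w : Omega).

Hypothesis PF : complete_filtered_probability_space P F.
Hypothesis BM : brownian_motion P F B.
Hypothesis f_lip : forall N : R, exists2 L : R, 0 < L & forall x y s t,
  `|x| <= N -> `|y| <= N -> 0 <= s <= N -> 0 <= t <= N ->
  `|f (x, s) - f (y, t)| <= L * (`|x - y| + `|s - t|).
Hypothesis g_lip : forall N : R, exists2 L : R, 0 < L & forall x y,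
  `|x| <= N -> `|y| <= N -> `|g x - g y| <= L * `|x - y|.
Hypothesis gG : forall x, `|g x| <= G.
Hypothesis rho0 : 0 < rho.
Hypothesis xf_le : forall x t, 0 <= t -> x * f (x, t) <= rho.

Local Notation mw t := (measurable_wrt (F t)).
Local Notation e := (euler B f g x0).
Local Notation EX := (euler_path B f g x0).
Local Notation dy := (dy R).
Local Notation mesh := (mesh R).
Local Notation mu := (@lebesgue_measure R).
Local Notation pc x := {within [set t : R | 0 <= t], continuous x}.

Lemma pc_f x : pc x -> pc (fun s => f (x s, s)).
Proof.
move=> /within_ge0_continuous_epsP cx; apply/within_ge0_continuous_epsP => t t0 c c0.
have [L L0 hL] := f_lip (`|x t| + 1 + (t + 1)).
have L1 : 0 < 1 + L by lra.
pose b := Num.min 1 (c / (3 * (1 + L))).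
have b0 : 0 < b by rewrite /b lt_min ltr01/= divr_gt0// mulr_gt0.
have [a a0 ha] := cx t t0 b b0.
exists (Num.min a b) => [|s s0]; first by rewrite lt_min a0.
rewrite lt_min => /andP[/(ha s s0) h1 h2].
have [b1 b2] : b <= 1 /\ b <= c / (3 * (1 + L)) by rewrite /b !ge_min !lexx ?orbT.
have h3 : `|x s| <= `|x t| + 1.
  by have := lerB_dist (x s) (x t); rewrite distrC; lra.
have h4 : s <= t + 1 by move: h2; rewrite ltr_norml; lra.
have := normr_ge0 (x t) => n0.
apply: le_lt_trans (hL _ _ _ _ _ _ _ _) _.
- by rewrite -addrA lerDl !addr_ge0.
- by apply: le_trans h3 _; rewrite lerDl addr_ge0.
- rewrite t0/=; apply: (@le_trans _ _ (t + 1)); first by rewrite lerDl.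
  by rewrite lerDr addr_ge0.
- by rewrite s0/=; apply: le_trans h4 _; rewrite lerDr addr_ge0.
by apply: lip_small => //; apply: lt_le_trans b2; rewrite // distrC.
Qed.

Lemma pc_g x : pc x -> pc (fun s => g (x s)).
Proof.
by move=> cx s; apply: continuous_comp; [exact: cx|exact: (g_continuous g_lip)].
Qed.

Let EXad n : adapted F (EX n) := euler_path_adapted x0 PF BM
  (fun t (h : 0 <= t) => f_continuous f_lip h) (g_continuous g_lip) n.

(** Tolerance and probability are both [mesh j]: the probabilities are summable for Borel-Cantelli,
    the tolerances for uniform convergence. *)
Lemma fast_subsequence : exists nn : nat -> nat,
  [/\ forall j, (j <= nn j)%N, forall j, (nn j <= nn j.+1)%N &
   forall j, (P [set w | exists M i, [/\ (nn j.+1 <= M)%N, (i <= j * 2 ^ M)%N &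
       (mesh j <= `|EX (nn j) (dy M i) w - EX (nn j.+1) (dy M i) w|)%R]]
      <= (mesh j)%:E)%E].
Proof.
have /choice[N0 hN0] := fun j => euler_cauchy x0 PF BM f_lip g_lip gG rho0 xf_le
  j (mesh_gt0 R j) (mesh_gt0 R j).
exists (fun j => \sum_(i < j.+1) (N0 i).+1)%N; split.
- by elim=> [//|j ih]; rewrite big_ord_recr -[leqLHS]addn1; apply: leq_add.
- by move=> j; rewrite [leqRHS]big_ord_recr/= leq_addr.
- move=> j; apply: hN0; last by rewrite [leqRHS]big_ord_recr/= leq_addr.
  by rewrite big_ord_recr/= (leq_trans (leqnSn _))// leq_addl.
Qed.

(** The subsequence, the null set and the rate are recorded because the estimates for the law of the
    iterated logarithm are also transferred from the schemes to [X]. *)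
Lemma exists_euler_limit : exists (X : R -> Omega -> R) (nn : nat -> nat)
    (NB : set Omega),
  [/\ continuous_process X, adapted F X, forall j, (j <= nn j)%N,
      measurable NB /\ P NB = 0%E &
      forall w, ~ NB w -> exists J, forall j, (J <= j)%N ->
        forall t, 0 <= t <= j%:R -> `|EX (nn j) t w - X t w| <= 2 * mesh j].
Proof.
have [nn [nnj nnS nnP]] := fast_subsequence.
pose V j := [set w | exists M i, [/\ (nn j.+1 <= M)%N, (i <= j * 2 ^ M)%N &
       (mesh j <= `|EX (nn j) (dy M i) w - EX (nn j.+1) (dy M i) w|)%R]].
have mV j : measurable (V j).
  rewrite [X in measurable X](_ : _ = \bigcup_(M in [set M | (nn j.+1 <= M)%N])
    [set w | exists2 i, (i <= j * 2 ^ M)%N &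
      (mesh j <= `|EX (nn j) (dy M i) w - EX (nn j.+1) (dy M i) w|)%R]).
    apply: bigcup_measurable => M _; apply: measurable_ex_le => i _.
    have d0 := dy_ge0 R M i.
    apply: (mw_fun PF d0); apply: (mw_norm d0); apply: (mwB PF d0); exact: EXad.
  apply/seteqP; split => w.
    by move=> [M [i [h1 h2 h3]]]; exists M => //; exists i.
  by move=> [M /= h1 [i h2 h3]]; exists M, i.
pose NB := lim_sup_set V.
have mNB : measurable NB.
  by apply: bigcap_measurableType => k _; apply: bigcup_measurable.
have PNB : P NB = 0%E.
  apply: lim_sup_set_cvg0 => //.
  apply: (@le_lt_trans _ _ (\sum_(0 <= n <oo) (mesh n)%:E)%E).
    by apply: lee_nneseries => // n _; exact: nnP.
  have -> : (\sum_(0 <= n <oo) (mesh n)%:E = 2%:E)%E; last by rewrite ltry.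
  apply/cvg_lim => //.
  have := @cvg_geometric_series R 1 2^-1 (ltac:(rewrite ger0_norm; lra)).
  rewrite (_ : 1 / (1 - 2^-1) = 2); last by field.
  move=> h; rewrite (_ : (fun n => _) = EFin \o series (geometric 1 2^-1)).
    by apply: cvg_EFin => //; exact: nearW.
  apply/funext => n /=; rewrite sumEFin /series/=; congr EFin.
  by apply: eq_bigr => k _; rewrite mul1r exprVn.
(* On the null set [NB] the paths are reset to [x0], which makes the limit exist and be continuous
   for every [w]. Completeness puts [NB] into each [F t], so adaptedness is preserved. *)
pose Z j t w := x0 + \1_(~` NB) w * (EX (nn j) t w - x0).
have Zc j w : pc (fun t => Z j t w).
  apply/within_ge0_continuousP => t.
  have /within_ge0_continuousP ce := @euler_path_continuous _ _ _ _ _ _ f g x0 BM (nn j) w.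
  rewrite /continuous_at /Z; apply: cvgD; first exact: cvg_cst.
  apply: cvgM; first exact: cvg_cst.
  by apply: cvgB; [exact: ce|exact: cvg_cst].
have Zad j t : 0 <= t -> mw t (Z j t).
  move=> t0; apply: (mwD PF t0); first exact: (mw_cst PF).
  apply: (mwM PF t0).
    apply: (mw_indic PF) => //; apply: (filtC PF) => //; apply: (filt_negligible PF) => //.
    by exists NB; split.
  by apply: (mwB PF t0); [exact: EXad|exact: (mw_cst PF)].
have ZJ w : exists J, forall j, (J <= j)%N -> forall t, 0 <= t <= j%:R ->
    `|Z j t w - Z j.+1 t w| <= mesh j.
  have [NBw|NBw] := pselect (NB w).
    exists 0%N => j _ t _; rewrite /Z indicE memNset ?mul0r ?subrr ?normr0 ?mesh_ge0//.
  have [J HJ] : exists J, forall j, (J <= j)%N -> ~ V j w.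
    apply: contrapT => /forallNP H; apply: NBw => J _.
    apply: contrapT => H2; apply: (H J) => j Jj Vj; apply: H2.
    by exists j.
  (* The schemes were compared only at dyadic times of level at least [nn j.+1]; continuity extends
     the bound to all times. *)
  exists J => j Jj; apply: (dyadic_closure (M0 := nn j.+1)).
    by apply: pc_sub; exact: Zc.
  move=> M i hM; rewrite -(dy_nat R M j) dy_le => hi.
  rewrite /Z indicE mem_set// !mul1r.
  rewrite (_ : _ - _ = EX (nn j) (dy M i) w - EX (nn j.+1) (dy M i) w); last by ring.
  rewrite leNgt; apply/negP => /ltW h.
  by apply: (HJ j Jj); exists M, i.
have ZT w t : 0 <= t -> exists J, t <= J%:R /\
    forall j, (J <= j)%N -> `|Z j t w - Z j.+1 t w| <= mesh j.
  move=> t0; have [J hJ] := ZJ w.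
  exists (maxn J (Num.truncn t).+1); split.
    by apply: ltW; apply: lt_le_trans (truncnS_gt t) _; rewrite ler_nat leq_maxr.
  move=> j; rewrite geq_max => /andP[h1 h2]; apply: hJ => //; rewrite t0/=.
  by apply: ltW; apply: lt_le_trans (truncnS_gt t) _; rewrite ler_nat.
pose X t w := limn (fun j => Z j t w).
have Xcv w t : 0 <= t -> Z j t w @[j --> \oo] --> X t w.
  move=> t0; have [J [_ hJ]] := ZT w t t0.
  have [l cl _] := geometric_cvg hJ.
  by rewrite /X (cvg_lim _ cl).
have XJ w : exists J, forall j, (J <= j)%N -> forall t, 0 <= t <= j%:R ->
    `|Z j t w - X t w| <= 2 * mesh j.
  have [J hJ] := ZJ w; exists J => j Jj t /andP[t0 tj].
  have [|l cl hl] := @geometric_cvg R (fun j => Z j t w) j.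
    move=> k jk; apply: hJ; first exact: leq_trans jk.
    by rewrite t0 (le_trans tj)// ler_nat.
  by rewrite /X (cvg_lim _ cl)//; exact: hl.
exists X, nn, NB; split => //.
- move=> w; apply: (uniform_pc (xs := fun j t => Z j t w)) => // t c t0 c0.
  have [J hJ] := XJ w.
  have c2 : 0 < c / 2 by lra.
  have [N _ HN] : \forall k \near \oo, mesh k < c / 2.
    have /cvgrPdist_lt/(_ _ c2) := @mesh_cvg0 R.
    by apply: filterS => k; rewrite sub0r normrN ger0_norm// mesh_ge0.
  exists (maxn N (maxn J (Num.truncn t).+1)) => s /andP[s0 st].
  have h : `|Z (maxn N (maxn J (Num.truncn t).+1)) s w - X s w| <=
      2 * mesh (maxn N (maxn J (Num.truncn t).+1)).
    apply: hJ; first by rewrite !leq_max leqnn orbT.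
    rewrite s0/=; apply: ltW; apply: le_lt_trans st _.
    by apply: lt_le_trans (truncnS_gt t) _; rewrite ler_nat !leq_max leqnn !orbT.
  by have := HN _ (leq_maxl N (maxn J (Num.truncn t).+1)); lra.
- move=> t t0; apply: (mw_lim PF t0 (fun j => Zad j t t0)) => w; exact: Xcv.
- move=> w NBw; have [J hJ] := XJ w; exists J => j Jj t tj.
  by have := hJ j Jj t tj; rewrite /Z indicE mem_set// mul1r (addrC x0) subrK.
Qed.


Section solution.
Variables (X : R -> Omega -> R) (nn : nat -> nat) (NB : set Omega).
Hypothesis cX : continuous_process X.
Hypothesis aX : adapted F X.
Hypothesis nnj : forall j, (j <= nn j)%N.
Hypothesis mNB : measurable NB.
Hypothesis PNB : P NB = 0%E.
Hypothesis near_X : forall w, ~ NB w -> exists J, forall j, (J <= j)%N ->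
  forall t, 0 <= t <= j%:R -> `|EX (nn j) t w - X t w| <= 2 * mesh j.

Let sz j := (nn j * 2 ^ nn j)%N.
Let dhomo n : {homo dy n : i j / (i <= j)%N >-> i <= j} := @dy_homo R n.

Lemma nn_ge t j : t <= j%:R -> t <= (nn j)%:R.
Proof. by move=> h; apply: le_trans h _; rewrite ler_nat. Qed.

Lemma grid_locate j s t : 0 < s <= t -> t <= j%:R ->
  exists2 k, (k < sz j)%N & dy (nn j) k < s <= dy (nn j) k.+1.
Proof.
move=> /andP[s0 st] tj; apply: (@step_locate R (sz j) (dy (nn j))).
by rewrite dy0 s0/= /sz dy_nat (le_trans st)// nn_ge.
Qed.

Lemma euler_near w s c : ~ NB w -> 0 < s -> 0 < c -> exists J, forall j k, (J <= j)%N ->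
  (k < sz j)%N -> dy (nn j) k < s <= dy (nn j) k.+1 ->
  `|e (nn j) k w - X s w| < c /\ `|dy (nn j) k - s| < c.
Proof.
move=> NBw s0 c0; have [J hJ] := near_X NBw.
have c4 : 0 < c / 4 by lra.
have /within_ge0_continuous_epsP/(_ s (ltW s0) _ c4)[a a0 ha] := cX (w := w).
pose b := Num.min a (c / 4); have b0 : 0 < b by rewrite lt_min a0.
have [N _ HN] : \forall k \near \oo, mesh k < b.
  have /cvgrPdist_lt/(_ _ b0) := @mesh_cvg0 R.
  by apply: filterS => k; rewrite sub0r normrN ger0_norm// mesh_ge0.
exists (maxn (maxn J N) (Num.truncn s).+1) => j k.
rewrite !geq_max -andbA => /and3P[Jj Nj sj] ksz /andP[ks sk].
have sj' : s <= j%:R.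
  by apply: ltW; apply: lt_le_trans (truncnS_gt s) _; rewrite ler_nat.
have hm : mesh (nn j) < b by apply: HN; exact: leq_trans Nj (nnj j).
have hm2 : mesh j < b by exact: HN.
have [ba bc] : b <= a /\ b <= c / 4 by rewrite /b !ge_min !lexx orbT.
have h1 : `|s - dy (nn j) k| < b.
  by rewrite ger0_norm ?subr_ge0 ?(ltW ks)//; rewrite dyS in sk; lra.
split; last by rewrite distrC; lra.
have := ha _ (dy_ge0 _ _ _) (lt_le_trans h1 ba).
have h0 : 0 <= dy (nn j) k <= j%:R by rewrite dy_ge0/=; lra.
have := hJ j Jj _ h0; rewrite (@euler_path_dy _ _ _ B f g x0 _ k w)//.
have := ler_distD (X (dy (nn j) k) w) (e (nn j) k w) (X s w).
by rewrite (distrC (X s w)); lra.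
Qed.

Lemma step_cvg (phi : nat -> R -> R -> R) w s l : ~ NB w -> 0 < s ->
  (forall c, 0 < c -> exists2 b, 0 < b & exists J, forall j x u, (J <= j)%N -> 0 <= u ->
     `|x - X s w| < b -> `|u - s| < b -> `|phi j x u - l| < c) ->
  stepf (sz j) (dy (nn j)) (fun i => phi j (e (nn j) i w) (dy (nn j) i)) s
    @[j --> \oo] --> l.
Proof.
move=> NBw s0 hphi; apply/cvgrPdist_lt => c c0.
have [b b0 [J1 hb]] := hphi c c0; have [J2 hJ2] := euler_near NBw s0 b0.
exists (maxn (maxn J1 J2) (Num.truncn s).+1) => // j /=.
rewrite !geq_max -andbA => /and3P[Jj Nj sj].
have sj' : s <= j%:R.
  by apply: ltW; apply: lt_le_trans (truncnS_gt s) _; rewrite ler_nat.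
have ss : 0 < s <= s by rewrite s0 lexx.
have [k ksz ks] := grid_locate ss sj'.
rewrite (stepf_at _ (@dhomo (nn j)) ksz ks) distrC.
by have [h1 h2] := hJ2 j k Nj ksz ks; apply: hb => //; exact: dy_ge0.
Qed.

(** The noise coefficients of the schemes themselves serve as approximating simple processes: they
    are bounded because [g] is, and their integral is exactly the noise part of the scheme. *)
Let S j : simple_process F := @SimpleProcess R Omega F (sz j) (dy (nn j))
  (fun i w => g (e (nn j) i w)) (dy_ge0 R (nn j) 0) (@dhomo (nn j))
  (ge_mw x0 PF BM f_lip g_lip (nn j)) (fun i => ex_intro _ G (fun w => gG (e (nn j) i w))).

Let G0 : 0 <= G := le_trans (normr_ge0 _) (gG 0).

Let lcbS t j w : 0 <= t -> lcb (fun s => (simple_value (S j) s w - g (X s w)) ^+ 2) t.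
Proof.
move=> t0; apply: lcb_sqr; apply: lcbB.
  exact: (@lcb_step R (sz j) (dy (nn j)) (fun i => g (e (nn j) i w)) t (@dhomo (nn j))).
by apply: lcb_path => //; apply: pc_g; exact: cX.
Qed.

Lemma approx_integrand t : 0 <= t ->
  cvg_in_probability0 P (fun n w =>
    \int[mu]_(s in `[0%R, t]) ((simple_value (S n) s w - g (X s w)) ^+ 2)%:E)%E.
Proof.
move=> t0; apply: (cvg_ae_in_probability0 (N := NB)) => //.
  move=> n; apply: measurable_integral_lcb => // [s /andP[s0 st]|w]; last exact: lcbS.
  apply: measurable_funX; apply: measurable_funB.
    apply: measurable_sum => i; apply: measurable_funM; last exact: measurable_cst.
    exact: (mw_fun PF (dy_ge0 R (nn n) i) (ge_mw x0 PF BM f_lip g_lip (nn n) i)).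
  by apply: (mw_fun PF s0); apply: mw_ccomp => //; [exact: g_continuous|exact: aX].
move=> w NBw.
have C0 : 0 <= (2 * G) ^+ 2 by exact: sqr_ge0.
case: (@dct_itv R (fun j s => (simple_value (S j) s w - g (X s w)) ^+ 2)
  (fun=> 0) t _ t0 C0) => [| | |_]; last by rewrite integral0.
- by move=> j; have [/integrableP[/measurable_EFinP]] := lcb_riemann t0 (lcbS j w t0).
- move=> j s _; rewrite ger0_norm ?sqr_ge0//; apply: sqr_le_norm.
  apply: le_trans (ler_normB _ _) _; rewrite mulrDl mul1r; apply: lerD => //.
  exact: (@stepf_bounded R (sz j) (dy (nn j)) (fun i => g (e (nn j) i w)) (@dhomo (nn j))
    G s (fun i _ => gG _) G0).
- move=> s /andP[s0 st].
  rewrite -[X in _ --> X](_ : (g (X s w) - g (X s w)) ^+ 2 = 0); last first.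
    by rewrite subrr expr0n.
  apply: (@cvg_comp _ _ _ _ (fun x => x ^+ 2) _ (nbhs (g (X s w) - g (X s w)))); last first.
    exact: exprn_continuous.
  apply: cvgB; last exact: cvg_cst.
  apply: (@step_cvg (fun j x u => g x)) => // c c0.
  have /cvgrPdist_lt/(_ c c0)[b /= b0 hb] := g_continuous g_lip (x := X s w).
  exists b => //; exists 0%N => j x u _ _ h1 _; rewrite distrC; apply: hb => /=.
  by rewrite distrC.
Qed.

(** Defined through the equation, which then holds for every path; the content is that this process
    is the Ito integral. *)
Let I t w := X t w - x0 - \int[mu]_(s in `[0, t]) f (X s w, s).

Let I_adapted : adapted F I.
Proof.
move=> t t0; apply: (mwB PF t0).
  by apply: (mwB PF t0); [exact: aX|exact: (mw_cst PF)].
apply: (mw_integral_lcb PF) => // [s /andP[s0 st]|w].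
  apply: (mw_mono PF s0 st); apply: (mw_ccomp (k := fun x => f (x, s))) => //.
    exact: f_continuous.
  exact: aX.
by apply: lcb_path => //; apply: pc_f; exact: cX.
Qed.

(** Dominated convergence along one path: the schemes are eventually within 2 of a bounded path,
    which dominates [f], and at each time the truncation becomes inactive as [nn j] grows. *)
Let drift_cvg w t : ~ NB w -> 0 <= t ->
  \sum_(i < sz j) drift f (nn j) (e (nn j) i w) (dy (nn j) i)
       * (Num.min (dy (nn j) i.+1) t - Num.min (dy (nn j) i) t)
    @[j --> \oo] --> \int[mu]_(s in `[0, t]) f (X s w, s).
Proof.
move=> NBw t0; have [J hJ] := near_X NBw.
have [C C0 hC] := path_bounded (cX (w := w)) t0.
have [L L0 hL] := f_lip (C + 2 + t).
have hf x u : `|x| <= C + 2 -> 0 <= u <= t ->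
    `|f (x, u)| <= `|f (0, 0)| + L * (C + 2 + t).
  move=> hx /andP[u0 ut].
  have : `|f (x, u) - f (0, 0)| <= L * (`|x - 0| + `|u - 0|).
    by apply: hL; rewrite ?normr0 ?lexx ?u0//; lra.
  rewrite !subr0 (ger0_norm u0).
  have : L * (`|x| + u) <= L * (C + 2 + t) by rewrite ler_pM2l//; lra.
  by have := ler_normD (f (x, u) - f (0, 0)) (f (0, 0)); rewrite subrK; lra.
set K := `|f (0, 0)| + _ in hf.
have K0 : 0 <= K by rewrite addr_ge0// mulr_ge0 ?(ltW L0)//; lra.
pose J1 := maxn J (Num.truncn t).+1.
pose c j i := drift f (nn j) (e (nn j) i w) (dy (nn j) i).
have drift_le n x u : `|drift f n x u| <= `|f (x, u)|.
  by have := clamp_lip n%:R (f (x, u)) 0; rewrite subr0 (@clamp_id R n%:R 0) ?normr0// subr0.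
have E j : (\sum_(i < sz j) c j i * (Num.min (dy (nn j) i.+1) t - Num.min (dy (nn j) i) t))%:E
    = (\int[mu]_(s in `[0%R, t]) (stepf (sz j) (dy (nn j)) (c j) s)%:E)%E.
  by rewrite (integral_stepf _ _ (@dhomo (nn j)) (dy_ge0 R (nn j) 0)).
(* The domination only holds once the schemes are close to [X] on [[0, t]], so the first [J1] terms
   are dropped. *)
rewrite -(cvg_shiftn J1).
case: (@dct_itv R (fun j s => stepf (sz (j + J1)) (dy (nn (j + J1))) (c (j + J1)%N) s)
  (fun s => f (X s w, s)) t K t0 K0) => [| | |_].
- by move=> j; apply: measurable_funTS; exact: measurable_stepf.
- move=> j s /andP[s0 st].
  have [Jj tj] : (J <= j + J1)%N /\ t <= (j + J1)%:R.
    split; first exact: leq_trans (leq_maxl J _) (leq_addl j J1).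
    apply: ltW; apply: lt_le_trans (truncnS_gt t) _.
    by rewrite ler_nat; exact: leq_trans (leq_maxr J _) (leq_addl j J1).
  have ss : 0 < s <= t by rewrite s0.
  have [k ksz ks] := grid_locate ss tj.
  rewrite (stepf_at _ (@dhomo (nn _)) ksz ks); apply: le_trans (drift_le _ _ _) _.
  case/andP: ks => ks _.
  have kt : dy (nn (j + J1)) k <= t by rewrite (le_trans (ltW ks)).
  have k0 := dy_ge0 R (nn (j + J1)) k.
  apply: hf; last by rewrite k0.
  have := hJ _ Jj (dy (nn (j + J1)) k) (introT andP (conj k0 (le_trans kt tj))).
  rewrite euler_path_dy//; have := hC (dy (nn (j + J1)) k) (introT andP (conj k0 kt)).
  have := mesh_le1 R (j + J1).
  have := ler_normD (e (nn (j + J1)) k w - X (dy (nn (j + J1)) k) w) (X (dy (nn (j + J1)) k) w).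
  by rewrite subrK; lra.
- move=> s /andP[s0 st].
  rewrite (cvg_shiftn J1 (fun j => stepf (sz j) (dy (nn j)) (c j) s)).
  apply: (@step_cvg (fun j x u => drift f (nn j) x u)) => // a a0.
  have [L' L'0 hL'] := f_lip (`|X s w| + 1 + (s + 1)).
  have nX := normr_ge0 (X s w).
  have L1 : 0 < 1 + L' by exact: addr_gt0.
  have a2 : 0 < a / (3 * (1 + L')) by rewrite divr_gt0// mulr_gt0.
  exists (Num.min 1 (a / (3 * (1 + L')))); first by rewrite lt_min ltr01.
  exists (Num.truncn (`|f (X s w, s)| + a)).+1 => j x u jj u0.
  rewrite !lt_min => /andP[h1 h2] /andP[h3 h4].
  have hx : `|x| <= `|X s w| + 1.
    by have := ler_normD (x - X s w) (X s w); rewrite subrK; lra.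
  have hu : u <= s + 1 by move: h3; rewrite ltr_norml ltrBlDl => /andP[_ /ltW].
  have h5 : `|f (x, u) - f (X s w, s)| < a.
    apply: le_lt_trans (hL' _ _ _ _ _ _ _ _) _.
    - by apply: le_trans hx _; rewrite lerDl addr_ge0// ltW.
    - by rewrite -addrA lerDl !addr_ge0// ltW.
    - by rewrite u0/=; apply: le_trans hu _; rewrite lerDr addr_ge0.
    - rewrite (ltW s0)/=; apply: (@le_trans _ _ (s + 1)); first by rewrite lerDl.
      by rewrite lerDr addr_ge0.
    exact: lip_small.
  rewrite /drift clamp_id//.
  have h6 : `|f (X s w, s)| + a < j%:R.
    by apply: lt_le_trans (truncnS_gt _) _; rewrite ler_nat.
  have h7 : j%:R <= (nn j)%:R :> R by rewrite ler_nat.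
  rewrite -(subrK (f (X s w, s)) (f (x, u))); apply: le_trans (ler_normD _ _) _.
  by apply: le_trans h7; apply: ltW; apply: lt_trans h6; rewrite addrC ltrD2l.
move=> h; have lcbf : lcb (fun s => f (X s w, s)) t.
  by apply: lcb_path => //; apply: pc_f; exact: cX.
move: h; rewrite integral_EFin//; under eq_fun do rewrite -E.
by move/fine_cvg.
Qed.

Lemma approx_integral t : 0 <= t ->
  cvg_in_probability0 P (fun n w => `|simple_integral B (S n) t w - I t w|%:E).
Proof.
move=> t0; apply: (cvg_ae_in_probability0 (N := NB)) => //.
  move=> n; apply/measurable_EFinP; apply: measurableT_comp => //.
  apply: measurable_funB; last exact: (mw_fun PF t0 (I_adapted t0)).
  apply: measurable_sum => i; apply: measurable_funM.
    exact: (mw_fun PF (dy_ge0 R (nn n) i) (ge_mw x0 PF BM f_lip g_lip (nn n) i)).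
  have mB u : 0 <= u -> measurable_fun setT (B u).
    by move=> u0; exact: (mw_fun PF u0 (brownian_mw BM u0)).
  by apply: measurable_funB; apply: mB; rewrite le_min t0 dy_ge0.
move=> w NBw; apply: cvg_EFin; first exact: nearW.
rewrite -(normr0 R); apply: cvg_norm.
(* Subtracting the two equations expresses the error of the noise by the errors of the path and of
   the drift. *)
have E j : simple_integral B (S j) t w - I t w = (EX (nn j) t w - X t w) -
    (\sum_(i < sz j) drift f (nn j) (e (nn j) i w) (dy (nn j) i)
       * (Num.min (dy (nn j) i.+1) t - Num.min (dy (nn j) i) t)
     - \int[mu]_(s in `[0, t]) f (X s w, s)).
  by rewrite /I /euler_path big_split/= /simple_integral/=; ring.
rewrite (_ : (fun j => _) = (fun j => (EX (nn j) t w - X t w) -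
    (\sum_(i < sz j) drift f (nn j) (e (nn j) i w) (dy (nn j) i)
       * (Num.min (dy (nn j) i.+1) t - Num.min (dy (nn j) i) t)
     - \int[mu]_(s in `[0, t]) f (X s w, s)))); last exact/funext.
rewrite -[X in _ --> X](_ : 0 - (\int[mu]_(s in `[0, t]) f (X s w, s) -
  \int[mu]_(s in `[0, t]) f (X s w, s)) = 0); last by rewrite subrr subr0.
apply: cvgB; last by apply: cvgB; [exact: drift_cvg|exact: cvg_cst].
have [J hJ] := near_X NBw.
apply/cvgrPdist_le => c c0.
have c2 : 0 < c / 2 by lra.
have [N _ HN] : \forall k \near \oo, mesh k < c / 2.
  have /cvgrPdist_lt/(_ _ c2) := @mesh_cvg0 R.
  by apply: filterS => k; rewrite sub0r normrN ger0_norm// mesh_ge0.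
exists (maxn (maxn J N) (Num.truncn t).+1) => // j /=.
rewrite !geq_max -andbA => /and3P[Jj Nj sj]; rewrite sub0r normrN.
have tj : 0 <= t <= j%:R.
  by rewrite t0/=; apply: ltW; apply: lt_le_trans (truncnS_gt t) _; rewrite ler_nat.
by have := hJ j Jj t tj; have := HN j Nj; lra.
Qed.

Lemma limit_solution : sde_solution P F B f g x0 X.
Proof.
split => //; exists I; last by apply: aeW => w t t0; rewrite /I; ring.
split => //.
- by move=> t t0; apply: mw_ccomp => //; [exact: g_continuous|exact: aX].
- move=> w; apply: pc_sub; last by apply: integral_pc; apply: pc_f; exact: cX.
  by apply: pc_sub; [exact: cX|move=> t; exact: cst_continuous].
- by exists S => t t0; split; [exact: approx_integrand|exact: approx_integral].
Qed.

End solution.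

End existence.

(** * Sums of Brownian increments with adapted coefficients *)

Section stochastic_sums.
Context (R : realType) (d : measure_display) (Omega : measurableType d).
Context (P : probability Omega R) (F : R -> set_system Omega).
Context (B : R -> Omega -> R).
Hypothesis PF : complete_filtered_probability_space P F.
Hypothesis BM : brownian_motion P F B.
Local Notation mw t := (measurable_wrt (F t)).
Implicit Types (w : Omega) (t s : R).

(** Cauchy-Schwarz against the constant sequence 1. *)
Lemma sqr_sum_le (a : nat -> R) K :
  (\sum_(j < K) a j) ^+ 2 <= K%:R * \sum_(j < K) a j ^+ 2.
Proof.
elim: K => [|K ih]; first by rewrite !big_ord0 expr0n/= mul0r.
rewrite !big_ord_recr/= -natr1; move: ih.
set S := \sum_(j < K) a j; set Q := \sum_(j < K) a j ^+ 2 => ih.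
have Q0 : 0 <= Q by apply: sumr_ge0 => j _; exact: sqr_ge0.
have K0 : 0 <= K%:R :> R by [].
have := sqr_ge0 (S - K%:R * a K).
case: (posnP K) => [K1|K1].
  by move: ih; rewrite K1 mul0r => ih; have := sqr_ge0 S; nra.
have k1 : 0 < K%:R :> R by rewrite ltr0n.
move=> h; have h2 : 2 * S * a K <= Q + K%:R * a K ^+ 2.
  rewrite -(ler_pM2l k1); nra.
nra.
Qed.

Lemma chebyshev_sqr (N : Omega -> R) (c eps : R) : measurable_fun setT N -> 0 < eps ->
  (\int[P]_w (N w ^+ 2)%:E <= c%:E)%E ->
  (P [set w | (eps <= `|N w|)%R] <= (c / eps ^+ 2)%:E)%E.
Proof.
move=> mN eps0 hN.
have e2 : 0 < eps ^+ 2 by rewrite exprn_gt0.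
have := @markov_split _ _ _ P setT (fun w => N w ^+ 2) (eps ^+ 2) measurableT
  (measurable_funX 2 mN) (fun w => sqr_ge0 _) e2.
rewrite setTI (_ : [set w | eps ^+ 2 <= N w ^+ 2] = [set w | eps <= `|N w|]); last first.
  by apply/seteqP; split => w /=; rewrite norm_ge_sqr// ltW.
move=> h; rewrite EFinM lee_pdivlMr// muleC.
apply: le_trans hN; apply: le_trans h; rewrite leeDl//.
by apply: integral_ge0 => w _; rewrite lee_fin sqr_ge0.
Qed.

Section grid.
Variable u : nat -> R.
Hypothesis u0 : 0 <= u 0%N.
Hypothesis uS : forall j, u j < u j.+1.

Let u_homo : {homo u : i j / (i <= j)%N >-> i <= j}.
Proof. by apply/nondecreasing_seqP => j; exact: ltW. Qed.

Let u_ge0 j : 0 <= u j. Proof. by apply: le_trans u0 _; exact: u_homo. Qed.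

Lemma stochastic_sum_mw (H : nat -> Omega -> R) K :
  (forall j, (j < K)%N -> mw (u j) (H j)) ->
  mw (u K) (fun w => \sum_(j < K) H j w * (B (u j.+1) w - B (u j) w)).
Proof.
move=> mH; pose T (j : 'I_K) w := H j w * (B (u j.+1) w - B (u j) w).
apply: (@mw_sum _ _ _ _ _ PF _ _ _ _ T) => // j _; apply: (mwM PF (u_ge0 K)).
  by apply: (mw_mono PF (u_ge0 j)); [apply: u_homo; exact: ltnW|exact: mH].
apply: (mw_mono PF (u_ge0 j.+1)); first exact: u_homo.
by apply: (increment_mw PF BM) => //; exact: ltW.
Qed.

Lemma stochastic_sum_sqr (H : nat -> Omega -> R) K :
  (forall j, (j < K)%N -> mw (u j) (H j)) ->
  (\int[P]_w ((\sum_(j < K) H j w * (B (u j.+1) w - B (u j) w)) ^+ 2)%:E <=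
   \int[P]_w (\sum_(j < K) H j w ^+ 2 * (u j.+1 - u j))%:E)%E.
Proof.
elim: K => [|K ih] mH.
  by under eq_integral do rewrite big_ord0 expr0n/=; under [leRHS]eq_integral do rewrite big_ord0.
have mHK j : (j < K)%N -> mw (u j) (H j) by move=> jK; apply: mH; exact: ltnW.
have mS := stochastic_sum_mw mHK.
have mHS : measurable_fun setT (fun w => \sum_(j < K) H j w ^+ 2 * (u j.+1 - u j)).
  apply: measurable_sum => j; apply: measurable_funM; last exact: measurable_cst.
  by apply: measurable_funX; apply: (mw_fun PF (u_ge0 j)); exact: mHK.
have mHH : measurable_fun setT (fun w => H K w ^+ 2 * (u K.+1 - u K)).
  apply: measurable_funM; last exact: measurable_cst.
  by apply: measurable_funX; apply: (mw_fun PF (u_ge0 K)); exact: mH.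
under eq_integral do rewrite big_ord_recr/=.
apply: le_trans (step_sqr PF BM (u_ge0 K) (uS K) (filtT PF (u_ge0 K)) mS (mH K (ltnSn K))) _.
rewrite integral_addR//; last 3 first.
- by apply: measurable_funX; exact: (mw_fun PF (u_ge0 K) mS).
- by move=> w; exact: sqr_ge0.
- by move=> w; rewrite mulr_ge0 ?sqr_ge0// subr_ge0 ltW.
under [leRHS]eq_integral do rewrite big_ord_recr/=.
rewrite integral_addR//; last 2 first.
- by move=> w; apply: sumr_ge0 => j _; rewrite mulr_ge0 ?sqr_ge0// subr_ge0 ltW.
- by move=> w; rewrite mulr_ge0 ?sqr_ge0// subr_ge0 ltW.
by apply: leeD => //; exact: ih.
Qed.

(* Stopping the sum once the accumulated quadratic variation exceeds [delta]
   makes its second moment at most [delta]. *)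
Lemma stochastic_sum_prob (H : nat -> Omega -> R) K (eps delta : R) :
  (forall j, (j < K)%N -> mw (u j) (H j)) -> 0 < eps -> 0 < delta ->
  (P [set w | (eps <= `|\sum_(j < K) H j w * (B (u j.+1) w - B (u j) w)|)%R] <=
   P [set w | (delta < \sum_(j < K) H j w ^+ 2 * (u j.+1 - u j))%R]
   + (delta / eps ^+ 2)%:E)%E.
Proof.
move=> mH eps0 delta0.
pose Q k w := \sum_(j < k) H j w ^+ 2 * (u j.+1 - u j).
pose A k := [set w | Q k.+1 w <= delta].
have HD j w : 0 <= H j w ^+ 2 * (u j.+1 - u j).
  by rewrite mulr_ge0 ?sqr_ge0// subr_ge0 ltW.
(* The shift by one is essential: [Q k.+1] contains the coefficient of index [k] and no later one,
   so it is known at [u k], when the decision to stop is made. *)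
have mQ k : (k <= K)%N -> mw (u k.-1) (Q k).
  move=> kK; pose T (j : 'I_k) w := H j w ^+ 2 * (u j.+1 - u j).
  apply: (@mw_sum _ _ _ _ _ PF _ _ _ _ T) => // j _; apply: (mwM PF (u_ge0 _)).
    apply: mwX => //; apply: (mw_mono PF (u_ge0 j)); last by apply: mH; exact: leq_trans kK.
    by apply: u_homo; rewrite -ltnS prednK// (leq_ltn_trans _ (ltn_ord j)).
  exact: (mw_cst PF).
have Qh w : {homo Q^~ w : i j / (i <= j)%N >-> i <= j}.
  by apply/nondecreasing_seqP => j; rewrite /Q big_ord_recr/= lerDl.
pose H' j w := \1_(A j) w * H j w.
have mH' j : (j < K)%N -> mw (u j) (H' j).
  move=> jK; apply: (mwM PF) => //; last exact: mH.
  by apply: (mw_indic PF) => //; apply: filt_le => //; exact: (mQ j.+1).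
have Q'le k w : (k <= K)%N -> \sum_(j < k) H' j w ^+ 2 * (u j.+1 - u j) <= delta.
  elim: k => [|k ih] kK; first by rewrite big_ord0 ltW.
  rewrite big_ord_recr/= {2}/H' indicE.
  have [h|h] := pselect (A k w); last first.
    by rewrite memNset// mul0r expr0n/= mul0r addr0 ih// ltnW.
  rewrite mem_set// mul1r; apply: le_trans (h : Q k.+1 w <= delta).
  rewrite /Q [leRHS]big_ord_recr/= lerD2r; apply: ler_sum => j _.
  apply: ler_wpM2r; first by rewrite subr_ge0; exact: ltW.
  by rewrite /H' indicE; case: (_ \in _); rewrite ?mul1r// mul0r expr0n/= sqr_ge0.
have mN := mw_fun PF (u_ge0 K) (stochastic_sum_mw mH).
have mN' := mw_fun PF (u_ge0 K) (stochastic_sum_mw mH').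
have mQK : measurable [set w | delta < Q K w].
  rewrite (_ : [set w | _] = ~` [set w | Q K w <= delta]).
    apply: measurableC; apply: (filt_measurable PF (u_ge0 K.-1)).
    exact: (filt_le _ (u_ge0 _) (mQ K (leqnn K))).
  by apply/seteqP; split => w /=; rewrite ltNge => /negP.
have m1 (N : Omega -> R) : measurable_fun setT N ->
    measurable [set w | eps <= `|N w|].
  move=> h; rewrite -[X in measurable X]setTI; apply: measurable_fun_le => //.
  exact: measurableT_comp.
apply: (@le_trans _ _ (P ([set w | (delta < Q K w)%R] `|`
    [set w | (eps <= `|\sum_(j < K) H' j w * (B (u j.+1) w - B (u j) w)|)%R]))%E).
  rewrite le_measure ?inE//; [exact: m1|apply: measurableU => //; exact: m1|].
  move=> w /= h; have [|h2] := ltP delta (Q K w); first by left.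
  right; rewrite (eq_bigr (fun j : 'I_K => H j w * (B (u j.+1) w - B (u j) w)))// => j _.
  by rewrite /H' indicE mem_set ?mul1r//; apply: le_trans h2; exact: Qh.
apply: le_trans (measureU2 _ _ _) _ => //; first exact: m1.
apply: leeD => //; apply: chebyshev_sqr => //.
apply: le_trans (stochastic_sum_sqr mH') _.
apply: (@le_trans _ _ (\int[P]_w delta%:E)%E); last first.
  by rewrite integral_const// probability_setT mule1.
apply: integral_le => //.
- apply: measurable_sum => j; apply: measurable_funM; last exact: measurable_cst.
  by apply: measurable_funX; apply: (mw_fun PF (u_ge0 j)); exact: mH'.
- move=> w _; apply: sumr_ge0 => j _; rewrite mulr_ge0 ?sqr_ge0// subr_ge0.
  exact: ltW.
- by move=> w _; exact: Q'le.
Qed.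

End grid.
End stochastic_sums.

(** * The Ito integral as a limit of Riemann sums *)

Section ito_riemann.
Context (R : realType) (d : measure_display) (Omega : measurableType d).
Context (P : probability Omega R) (F : R -> set_system Omega).
Context (B : R -> Omega -> R).
Hypothesis PF : complete_filtered_probability_space P F.
Hypothesis BM : brownian_motion P F B.
Local Notation mw t := (measurable_wrt (F t)).
Local Notation mu := (@lebesgue_measure R).
Implicit Types (w : Omega) (t s : R).

Lemma cvg_in_probability0_le (Y : nat -> Omega -> \bar R) (e delta : R) :
  cvg_in_probability0 P Y -> 0 < e -> 0 < delta ->
  exists n0, forall n, (n0 <= n)%N -> (P [set w | (e%:E <= Y n w)%E] <= delta%:E)%E.
Proof.
move=> [_ /(_ e) cY] e0 delta0.
have [n0 _ H] := cY e0 [set y | (y < delta%:E)%E] (open_ereal_lt' (delta0 : (0 < delta%:E)%E)).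
by exists n0 => n nn; exact/ltW/H.
Qed.

Lemma cvg_probability_le (Y : nat -> Omega -> R) (Z : Omega -> R) (e delta : R) :
  (forall n, measurable_fun setT (Y n)) -> measurable_fun setT Z ->
  (forall w, Y n w @[n --> \oo] --> Z w) -> 0 < e -> 0 < delta ->
  exists n0, forall n, (n0 <= n)%N ->
    (P [set w | (e <= `|Y n w - Z w|)%R] <= delta%:E)%E.
Proof.
move=> mY mZ cY e0 delta0.
have := @cvg_in_probability0_le (fun n w => `|Y n w - Z w|%:E) e delta _ e0 delta0.
apply; apply: (cvg_ae_in_probability0 (N := set0)) => //.
  move=> n; apply/measurable_EFinP; apply: measurableT_comp => //.
  exact: measurable_funB.
move=> w _; apply: cvg_EFin; first exact: nearW.
rewrite -(normr0 R) -(subrr (Z w)); apply: cvg_norm.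
by apply: cvgB; [exact: cY|exact: cvg_cst].
Qed.

Lemma simple_value_mw (S : simple_process F) s : 0 <= s -> mw s (simple_value S s).
Proof.
move=> s0; pose T (i : 'I_(sp_size S)) w :=
  sp_coef S i w * \1_(`]sp_time S i, sp_time S i.+1]) s.
apply: (@mw_sum _ _ _ _ _ PF _ _ _ _ T) => // i _.
have ti : 0 <= sp_time S i.
  by apply: le_trans (sp_time_ge0 S) _; exact: sp_time_le.
rewrite /T indicE; case: (boolP (s \in _)) => [|_].
  rewrite inE/= in_itv/= => /andP[h _]; apply: (mwM PF s0); last exact: (mw_cst PF).
  by apply: (mw_mono PF ti (ltW h)); exact: sp_coef_measurable.
by under eq_fun do rewrite mulr0; exact: (mw_cst PF).
Qed.

Lemma simple_integral_measurable (S : simple_process F) t : 0 <= t ->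
  measurable_fun setT (simple_integral B S t).
Proof.
move=> t0; apply: measurable_sum => i.
have ti k : 0 <= sp_time S k.
  by apply: le_trans (sp_time_ge0 S) _; exact: sp_time_le.
have mB u : 0 <= u -> measurable_fun setT (B u).
  by move=> u0; exact: (mw_fun PF u0 (brownian_mw BM u0)).
apply: measurable_funM; first exact: (mw_fun PF (ti i) (sp_coef_measurable S i)).
by apply: measurable_funB; apply: mB; rewrite le_min t0 ti.
Qed.

Section fixed_time.
Variable t : R.
Hypothesis t0 : 0 < t.
Local Notation u M := (tdy t M).
Local Notation dB M j w := (B (u M (nat_of_ord j).+1) w - B (u M j) w).

Lemma tdy_strict M j : u M j < u M j.+1.
Proof. by rewrite -subr_gt0 tdyS mulr_gt0// mesh_gt0. Qed.

Lemma tdy_ge0 M j : 0 <= u M j.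
Proof. by rewrite mulr_ge0 ?dy_ge0// ltW. Qed.

(** For [a < t] the cells starting strictly after [a] telescope to [B t - B (u k.+1)], with [u k.+1]
    the first grid point beyond [a], and [B] is continuous at [a]. The strict inequality matches the
    left-open intervals of simple processes. *)
Lemma brownian_tail_cvg a w : 0 <= a ->
  \sum_(j < 2 ^ M) (a < u M j)%R%:R * dB M j w @[M --> \oo] -->
  B t w - B (Num.min a t) w.
Proof.
move=> a0; have [ta|at'] := leP t a.
  rewrite subrr (_ : (fun M => _) = fun=> 0); first exact: cvg_cst.
  apply/funext => M; rewrite big1// => j _.
  have /andP[_ h] := tdy_le (ltW t0) (ltnW (ltn_ord j)).
  by rewrite ltNge (le_trans h ta) mul0r.
apply/cvgrPdist_lt => c c0.
have cB : continuous_process B by case: BM.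
have /within_ge0_continuous_epsP/(_ a a0 c c0)[r r0 hr] := cB w.
have [N _ HN] : \forall k \near \oo, mesh R k < r / t.
  have /cvgrPdist_lt/(_ _ (divr_gt0 r0 t0)) := @mesh_cvg0 R.
  by apply: filterS => k; rewrite sub0r normrN ger0_norm// mesh_ge0.
exists N => // M /= NM.
have [k /andP[k1 k2]] := dyadic_floor M (divr_ge0 a0 (ltW t0)).
have h1 : u M k <= a by rewrite /tdy mulrC -ler_pdivlMr.
have h2 : a < u M k.+1 by rewrite /tdy mulrC -ltr_pdivrMr.
have kM : (k < 2 ^ M)%N.
  rewrite -(tdy_end t M) in at'; have := le_lt_trans h1 at'.
  by rewrite /tdy ltr_pM2l// /dy ltr_pM2r ?mesh_gt0// ltr_nat.
have -> : \sum_(j < 2 ^ M) (a < u M j)%R%:R * dB M j w = B t w - B (u M k.+1) w.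
  rewrite -(big_mkord xpredT (fun j => (a < u M j)%R%:R * (B (u M j.+1) w - B (u M j) w))).
  rewrite (@big_cat_nat _ _ _ k.+1)//= big_nat big1 ?add0r; last first.
    move=> j /andP[_ jk]; rewrite ltNge (le_trans _ h1) ?mul0r//.
    by apply: tdy_homo; [exact: ltW|rewrite -ltnS].
  rewrite big_nat (eq_bigr (fun j => B (u M j.+1) w - B (u M j) w)).
    by rewrite -big_nat telescope_sumr// tdy_end.
  move=> j /andP[kj _]; rewrite (lt_le_trans h2) ?mul1r//.
  by apply: tdy_homo => //; exact: ltW.
rewrite (_ : _ - _ = - (B a w - B (u M k.+1) w)); last by ring.
rewrite normrN; apply: hr; first exact: tdy_ge0.
rewrite distrC ger0_norm ?subr_ge0 1?ltW//.
have := HN M NM; rewrite ltr_pdivlMr// mulrC => h3.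
by have := tdyS t M k; lra.
Qed.

(** The indicator of []a, b]] is the difference of those of []a, +oo[] and []b, +oo[], so the sum
    splits into tails of the preceding kind. *)
Lemma riemann_simple (S : simple_process F) w :
  \sum_(j < 2 ^ M) simple_value S (u M j) w * dB M j w @[M --> \oo] -->
  simple_integral B S t w.
Proof.
have ti k : 0 <= sp_time S k.
  by apply: le_trans (sp_time_ge0 S) _; exact: sp_time_le.
pose phi a M := \sum_(j < 2 ^ M) (a < u M j)%R%:R * dB M j w.
have cphi a : 0 <= a -> phi a M @[M --> \oo] --> B t w - B (Num.min a t) w.
  exact: brownian_tail_cvg.
have -> : (fun M => \sum_(j < 2 ^ M) simple_value S (u M j) w * dB M j w) =
  (fun M => \sum_(i < sp_size S)
     sp_coef S i w * (phi (sp_time S i) M - phi (sp_time S i.+1) M)).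
  apply/funext => M; rewrite /simple_value; under eq_bigr do rewrite mulr_suml.
  rewrite exchange_big; apply: eq_bigr => i _ /=.
  rewrite /phi -sumrB mulr_sumr; apply: eq_bigr => j _.
  rewrite -mulrA; congr (_ * _); rewrite -mulrBl; congr (_ * _).
  have hh : sp_time S i <= sp_time S i.+1 by exact: sp_time_le.
  rewrite indicE; case: (boolP (sp_time S i < u M j <= sp_time S i.+1)) => [/andP[k1 k2]|].
    by rewrite mem_set/= ?in_itv/= ?k1// ltNge k2 subr0.
  rewrite negb_and -leNgt -ltNge => h; rewrite memNset; last first.
    by rewrite /= in_itv/= => /andP[k1 k2]; case/orP: h; rewrite ?leNgt ?k1// ltNge k2.
  case/orP: h => h; first by rewrite !ltNge h (le_trans h hh) subrr.
  by rewrite h (le_lt_trans hh h) subrr.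
rewrite /simple_integral; elim: (sp_size S) => [|k ih].
  by under eq_fun do rewrite big_ord0; rewrite big_ord0; exact: cvg_cst.
under eq_fun do rewrite big_ord_recr/=; rewrite big_ord_recr/=.
apply: cvgD => //; apply: cvgM; first exact: cvg_cst.
rewrite (_ : B _ w - B _ w = (B t w - B (Num.min (sp_time S k) t) w)
  - (B t w - B (Num.min (sp_time S k.+1) t) w)); last by ring.
by apply: cvgB; exact: cphi.
Qed.

Variables H I : R -> Omega -> R.
Hypothesis cH : continuous_process H.
Hypothesis itoI : is_ito_integral P F B H I.

(** A simple process [S] from the definition of the integral mediates. The sum of [(S - H) dB] is
    small by [stochastic_sum_prob], since its quadratic variation [Q M] tends to the small integral
    [J] of [(S - H)^2]; the sum of [S dB] tends to the integral of [S], which is close to [I t]. *)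
Lemma ito_riemann (eps delta : R) : 0 < eps -> 0 < delta ->
  exists M0, forall M, (M0 <= M)%N ->
  (P [set w | (eps <= `|\sum_(j < 2 ^ M) H (u M j) w * dB M j w - I t w|)%R] <= delta%:E)%E.
Proof.
move=> eps0 delta0; case: itoI => aH _ aI [Sn /(_ t (ltW t0))[S1 S2]].
have e3 : 0 < eps / 3 by lra.
have d8 : 0 < delta / 8 by lra.
(* Makes the Chebyshev term [q / (eps / 3)^2] equal to [delta / 8]; five errors of that size occur
   in all. *)
pose q := delta / 8 * (eps / 3) ^+ 2.
have q0 : 0 < q by rewrite mulr_gt0// exprn_gt0.
have q2 : 0 < q / 2 by lra.
have [n1 h1] := cvg_in_probability0_le S1 q2 d8.
have [n2 h2] := cvg_in_probability0_le S2 e3 d8.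
pose S := Sn (maxn n1 n2).
have {h1} := h1 _ (leq_maxl n1 n2); have {h2} := h2 _ (leq_maxr n1 n2).
rewrite -/S => h2 h1.
have mI : measurable_fun setT (I t) by apply: (mw_fun PF (ltW t0)); apply: aI; exact: ltW.
have msi := simple_integral_measurable S (ltW t0).
have mS s : 0 <= s -> mw s (simple_value S s) by exact: simple_value_mw.
have lS w : lcb (fun s => (simple_value S s w - H s w) ^+ 2) t.
  apply: lcb_sqr; apply: lcbB.
    exact: (@lcb_step R (sp_size S) (sp_time S) (sp_coef S ^~ w) t (sp_time_le S)).
  by apply: lcb_path; [exact: cH|exact: ltW].
have mHS s : 0 <= s -> mw s (fun w => simple_value S s w - H s w).
  by move=> s0; apply: (mwB PF s0); [exact: mS|exact: aH].
pose J w := \int[mu]_(s in `[0, t]) ((simple_value S s w - H s w) ^+ 2).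
have mJ : measurable_fun setT J.
  apply: (mw_fun PF (ltW t0)); apply: (mw_integral_lcb PF) => //; first exact: ltW.
  by move=> s /andP[s0 st]; apply: (mw_mono PF s0 st); apply: mwX => //; exact: mHS.
pose Q M w := \sum_(j < 2 ^ M) (simple_value S (u M j) w - H (u M j) w) ^+ 2
   * (u M j.+1 - u M j).
have mQ M : measurable_fun setT (Q M).
  apply: measurable_sum => j; apply: measurable_funM; last exact: measurable_cst.
  by apply: measurable_funX; exact: (mw_fun PF (tdy_ge0 M j) (mHS _ (tdy_ge0 M j))).
have cQ w : Q M w @[M --> \oo] --> J w.
  have [_] := lcb_riemann (ltW t0) (lS w); rewrite integral_EFin//; last exact: ltW.
  move=> /fine_cvg /=; rewrite (_ : Q ^~ w = fun M => \sum_(j < 2 ^ M)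
    (simple_value S (tdy t M j) w - H (tdy t M j) w) ^+ 2 * (t * mesh R M))//.
  by apply/funext => M; apply: eq_bigr => j _; rewrite tdyS.
pose RS M w := \sum_(j < 2 ^ M) simple_value S (u M j) w * dB M j w.
pose RH M w := \sum_(j < 2 ^ M) H (u M j) w * dB M j w.
have mRS M : measurable_fun setT (RS M).
  apply: (mw_fun PF (tdy_ge0 M (2 ^ M))).
  apply: (stochastic_sum_mw PF BM (tdy_ge0 M 0) (tdy_strict M)
    (H := fun j w => simple_value S (u M j) w)) => j _; exact/mS/tdy_ge0.
have mRH M : measurable_fun setT (RH M).
  apply: (mw_fun PF (tdy_ge0 M (2 ^ M))).
  apply: (stochastic_sum_mw PF BM (tdy_ge0 M 0) (tdy_strict M)
    (H := fun j w => H (u M j) w)) => j _; exact/aH/tdy_ge0.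
have [M1 H1] := cvg_probability_le mQ mJ cQ q2 d8.
have [M2 H2] := cvg_probability_le mRS msi (riemann_simple (S := S)) e3 d8.
exists (maxn M1 M2) => M; rewrite geq_max => /andP[MM1 MM2].
have {H1} := H1 M MM1; have {H2} := H2 M MM2 => H2 H1.
have mge (Y : Omega -> R) c : measurable_fun setT Y -> measurable [set w | c <= `|Y w|].
  move=> h; rewrite -[X in measurable X]setTI; apply: measurable_fun_le => //.
  exact: measurableT_comp.
have h1' : (P [set w | (q / 2 <= `|J w|)%R] <= (delta / 8)%:E)%E.
  rewrite (_ : [set w | _] = [set w | ((q / 2)%:E <=
    \int[mu]_(s in `[0%R, t]) ((simple_value S s w - H s w) ^+ 2)%:E)%E])//.
  have J0 w : 0 <= J w by apply: Rintegral_ge0 => s _; exact: sqr_ge0.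
  apply/seteqP; split => w /=; rewrite integral_EFin ?lee_fin ?ger0_norm//; exact: ltW.
have h2' : (P [set w | (eps / 3 <= `|simple_integral B S t w - I t w|)%R] <= (delta / 8)%:E)%E.
  by [].
pose D M w := \sum_(j < 2 ^ M) (simple_value S (u M j) w - H (u M j) w) * dB M j w.
have DE w : D M w = RS M w - RH M w.
  by rewrite /D /RS /RH -sumrB; apply: eq_bigr => j _; rewrite mulrBl.
have mD : measurable_fun setT (D M).
  by rewrite (_ : D M = fun w => RS M w - RH M w); [exact: measurable_funB|exact/funext].
have hD : (P [set w | (eps / 3 <= `|D M w|)%R] <= (3 * (delta / 8))%:E)%E.
  have := stochastic_sum_prob PF BM (tdy_ge0 M 0) (tdy_strict M) (K := (2 ^ M)%N)
    (H := fun j w => simple_value S (u M j) w - H (u M j) w)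
    (fun j _ => mHS _ (tdy_ge0 M j)) e3 q0.
  move=> /le_trans; apply.
  have -> : q / (eps / 3) ^+ 2 = delta / 8 by rewrite /q mulfK// gt_eqF// exprn_gt0.
  have -> : (3 * (delta / 8))%:E = ((delta / 8 + delta / 8)%:E + (delta / 8)%:E)%E.
    by rewrite -EFinD; congr EFin; ring.
  apply: leeD => //; rewrite EFinD; apply: le_trans (leeD H1 h1').
  apply: le_trans (measureU2 _ _ _); [|exact: mge (measurable_funB _ _)|exact: mge].
  have mset : measurable [set w | q < Q M w].
    rewrite (_ : [set w | _] = ~` [set w | Q M w <= q]).
      apply: measurableC; rewrite -[X in measurable X]setTI.
      exact: measurable_fun_le.
    by apply/seteqP; split => w /=; rewrite ltNge => /negP.
  rewrite le_measure ?inE//.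
    by apply: measurableU; [apply: mge; exact: measurable_funB|exact: mge].
  move=> w /= hq; have [h|h] := leP (q / 2) `|J w|; first by right.
  left; move: hq; rewrite -/(Q M w) => hq.
  have := ler_norm (J w); have := ler_norm (Q M w - J w); lra.
apply: (@le_trans _ _ (P ([set w | (eps / 3 <= `|D M w|)%R] `|`
   [set w | (eps / 3 <= `|RS M w - simple_integral B S t w|)%R] `|`
   [set w | (eps / 3 <= `|simple_integral B S t w - I t w|)%R]))%E).
  rewrite le_measure ?inE//.
  - exact: mge (measurable_funB (mRH M) mI).
  - apply: measurableU; last by apply: mge; exact: measurable_funB.
    by apply: measurableU; apply: mge => //; exact: measurable_funB.
  move=> w /= h; apply: contrapT => /not_orP[/not_orP[]].
  move=> /negP + /negP + /negP; rewrite -!ltNge => k1 k2 k3.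
  have : RH M w - I t w = - D M w + (RS M w - simple_integral B S t w) +
    (simple_integral B S t w - I t w) by rewrite DE; ring.
  move=> E; move: h; rewrite -/(RH M w) E.
  have := ler_normD (- D M w + (RS M w - simple_integral B S t w)) (simple_integral B S t w - I t w).
  by have := ler_normD (- D M w) (RS M w - simple_integral B S t w); rewrite normrN; lra.
apply: le_trans (measureU2 _ _ _) _.
- by apply: measurableU; apply: mge => //; exact: measurable_funB.
- by apply: mge; exact: measurable_funB.
apply: (@le_trans _ _ ((3 * (delta / 8))%:E + (delta / 8)%:E + (delta / 8)%:E)%E).
  apply: leeD => //; apply: le_trans (measureU2 _ _ _) _.
  - exact: mge.
  - by apply: mge; exact: measurable_funB.
  exact: leeD.
by rewrite -!EFinD lee_fin; lra.
Qed.

End fixed_time.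
End ito_riemann.

(** * Pathwise uniqueness *)

Section uniqueness.
Context (R : realType) (d : measure_display) (Omega : measurableType d).
Context (P : probability Omega R) (F : R -> set_system Omega).
Context (B : R -> Omega -> R) (f : R * R -> R) (g : R -> R) (x0 : R).
Implicit Types (w : Omega) (t s N : R).
Hypothesis PF : complete_filtered_probability_space P F.
Hypothesis BM : brownian_motion P F B.
Hypothesis f_lip : forall N : R, exists2 L : R, 0 < L & forall x y s t,
  `|x| <= N -> `|y| <= N -> 0 <= s <= N -> 0 <= t <= N ->
  `|f (x, s) - f (y, t)| <= L * (`|x - y| + `|s - t|).
Hypothesis g_lip : forall N : R, exists2 L : R, 0 < L & forall x y,
  `|x| <= N -> `|y| <= N -> `|g x - g y| <= L * `|x - y|.
Local Notation mw t := (measurable_wrt (F t)).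
Local Notation mu := (@lebesgue_measure R).
Local Notation dB t M j w := (B (tdy t M (nat_of_ord j).+1) w - B (tdy t M j) w).

Let mge (Y : Omega -> R) c : measurable_fun setT Y -> measurable [set w | c <= `|Y w|].
Proof.
move=> h; rewrite -[X in measurable X]setTI; apply: measurable_fun_le => //.
exact: measurableT_comp.
Qed.

(** The Riemann sum of the equation: its coefficients are sampled along the given process [X], not
    along a scheme. *)
Definition euler_sum X t M w := \sum_(j < 2 ^ M)
  (f (X (tdy t M j) w, tdy t M j) * (t * mesh R M) + g (X (tdy t M j) w) * dB t M j w).

Lemma f_process_mw X s : adapted F X -> 0 <= s -> mw s (fun w => f (X s w, s)).
Proof.
move=> aX s0; apply: (mw_ccomp (k := fun x => f (x, s))) => //.
  exact: f_continuous.
exact: aX.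
Qed.

Lemma g_process_mw X s : adapted F X -> 0 <= s -> mw s (fun w => g (X s w)).
Proof. by move=> aX s0; apply: mw_ccomp => //; [exact: g_continuous|exact: aX]. Qed.

Lemma euler_sum_measurable X t M : adapted F X -> 0 < t ->
  measurable_fun setT (euler_sum X t M).
Proof.
move=> aX t0; apply: measurable_sum => j; apply: measurable_funD.
  apply: measurable_funM; last exact: measurable_cst.
  by apply: (mw_fun PF (tdy_ge0 t0 M j)); apply: f_process_mw => //; exact: tdy_ge0.
apply: measurable_funM.
  by apply: (mw_fun PF (tdy_ge0 t0 M j)); apply: g_process_mw => //; exact: tdy_ge0.
apply: (mw_fun PF (tdy_ge0 t0 M j.+1)); apply: (increment_mw PF BM).
  exact: tdy_ge0.
exact/ltW/tdy_strict.
Qed.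

Lemma euler_sum_cvg X t (eps delta : R) : sde_solution P F B f g x0 X ->
  0 < t -> 0 < eps -> 0 < delta ->
  exists M0, forall M, (M0 <= M)%N ->
  (P [set w | (eps <= `|euler_sum X t M w - (X t w - x0)|)%R] <= delta%:E)%E.
Proof.
move=> [cX aX [I itoI eqX]] t0 eps0 delta0.
have e2 : 0 < eps / 2 by lra.
have d2 : 0 < delta / 2 by lra.
have cgX : continuous_process (fun s w => g (X s w)) by move=> w; apply: (pc_g g_lip).
have [M1 H1] := ito_riemann PF BM t0 cgX itoI e2 d2.
pose Rf M w := \sum_(j < 2 ^ M) f (X (tdy t M j) w, tdy t M j) * (t * mesh R M).
pose J w := \int[mu]_(s in `[0, t]) f (X s w, s).
have lf w : lcb (fun s => f (X s w, s)) t.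
  by apply: lcb_path; [apply: (pc_f f_lip); exact: cX|exact: ltW].
have mRf M : measurable_fun setT (Rf M).
  apply: measurable_sum => j; apply: measurable_funM; last exact: measurable_cst.
  by apply: (mw_fun PF (tdy_ge0 t0 M j)); apply: f_process_mw => //; exact: tdy_ge0.
have mJ : measurable_fun setT J.
  apply: (mw_fun PF (ltW t0)); apply: (mw_integral_lcb PF) => //; first exact: ltW.
  by move=> s /andP[s0 st]; apply: (mw_mono PF s0 st); exact: f_process_mw.
have cRf w : Rf M w @[M --> \oo] --> J w.
  have [_] := lcb_riemann (ltW t0) (lf w); rewrite integral_EFin//; last exact: ltW.
  by move=> /fine_cvg.
have [M2 H2] := cvg_probability_le P mRf mJ cRf e2 d2.
exists (maxn M1 M2) => M; rewrite geq_max => /andP[MM1 MM2].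
have {H1} := H1 M MM1; have {H2} := H2 M MM2 => H2 H1.
pose ND := ~` [set w | forall t, 0 <= t -> X t w = x0 + \int[mu]_(s in `[0, t]) f (X s w, s) + I t w].
have mND : measurable ND.
  by apply: (filt_measurable PF (lexx 0)); apply: (filt_negligible PF) => //; exact: eqX.
have PND : P ND = 0%E by exact: measure_negligible.
have mI : measurable_fun setT (I t).
  by case: itoI => _ _ aI _; apply: (mw_fun PF (ltW t0)); apply: aI; exact: ltW.
have mX : measurable_fun setT (X t) by apply: (mw_fun PF (ltW t0)); apply: aX; exact: ltW.
pose RB M w := \sum_(j < 2 ^ M) g (X (tdy t M j) w) * dB t M j w.
have mRB : measurable_fun setT (RB M).
  apply: (mw_fun PF (tdy_ge0 t0 M (2 ^ M))).
  apply: (stochastic_sum_mw PF BM (tdy_ge0 t0 M 0) (tdy_strict t0 M)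
    (H := fun j w => g (X (tdy t M j) w))) => j _.
  by apply: g_process_mw => //; exact: tdy_ge0.
apply: (@le_trans _ _ (P (ND `|` [set w | (eps / 2 <= `|Rf M w - J w|)%R]
   `|` [set w | (eps / 2 <= `|RB M w - I t w|)%R]))%E).
  rewrite le_measure ?inE//.
  - apply: mge; apply: measurable_funB; first exact: euler_sum_measurable.
    exact: measurable_funB.
  - apply: measurableU; last by apply: mge; exact: measurable_funB.
    by apply: measurableU => //; apply: mge; exact: measurable_funB.
  move=> w /= h; have [ndw|] := pselect (ND w); first by left; left.
  move=> /contrapT/(_ t (ltW t0)) Xt.
  have [h1|h1] := leP (eps / 2) `|Rf M w - J w|; first by left; right.
  right; move: h; rewrite Xt /euler_sum big_split/= -/(Rf M w) -/(RB M w) -/(J w).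
  rewrite (_ : Rf M w + RB M w - _ = (Rf M w - J w) + (RB M w - I t w)); last by ring.
  by have := ler_normD (Rf M w - J w) (RB M w - I t w); lra.
apply: le_trans (measureU2 _ _ _) _.
- by apply: measurableU => //; apply: mge; exact: measurable_funB.
- by apply: mge; exact: measurable_funB.
rewrite [X in (_ <= X%:E)%E](_ : delta = delta / 2 + delta / 2) ?EFinD; last by lra.
apply: leeD => //; apply: le_trans (measureU2 _ _ _) _ => //.
  by apply: mge; exact: measurable_funB.
rewrite -[X in (_ <= X)%E]add0e; apply: leeD => //.
by rewrite le_eqVlt; apply/orP; left; apply/eqP; exact: PND.
Qed.

Section two_solutions.
Variables X Y : R -> Omega -> R.
Hypothesis solX : sde_solution P F B f g x0 X.
Hypothesis solY : sde_solution P F B f g x0 Y.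

Let cX : continuous_process X. Proof. by case: solX. Qed.
Let cY : continuous_process Y. Proof. by case: solY. Qed.
Let aX : adapted F X. Proof. by case: solX. Qed.
Let aY : adapted F Y. Proof. by case: solY. Qed.

(** Only dyadic times are constrained, which makes this a countable intersection in [F s]; by
    continuity both paths are then bounded on all of [[0, s]]. *)
Definition bounded_until N s := [set w | forall M i, dy R M i <= s ->
  `|X (dy R M i) w| <= N /\ `|Y (dy R M i) w| <= N].

Lemma bounded_until_filt N s : 0 <= s -> F s (bounded_until N s).
Proof.
move=> s0; rewrite [X in F s X](_ : _ = \bigcap_(M in setT) \bigcap_(i in [set i | dy R M i <= s])
    ([set w | `|X (dy R M i) w| <= N] `&` [set w | `|Y (dy R M i) w| <= N])).
  apply: (filt_bigcap PF) => // M _; apply: (filt_bigcap PF) => // i /= hi.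
  apply: (filt_mono PF (dy_ge0 R M i) hi); apply: (filtI PF); first exact: dy_ge0.
    by apply: filt_le; [exact: dy_ge0|apply: mw_norm; [exact: dy_ge0|exact/aX/dy_ge0]].
  by apply: filt_le; [exact: dy_ge0|apply: mw_norm; [exact: dy_ge0|exact/aY/dy_ge0]].
apply/seteqP; split => w h; first by move=> M _ i /= hi; exact: h.
by move=> M i hi; exact: (h M I i hi).
Qed.

Lemma bounded_untilP N s w r : bounded_until N s w -> 0 <= r <= s ->
  `|X r w| <= N /\ `|Y r w| <= N.
Proof.
move=> h rs; split.
  apply: (dyadic_closure (x := X ^~ w) (M0 := 0%N) (cX (w := w)) _ rs) => M i _ hi.
  by have [] := h M i hi.
apply: (dyadic_closure (x := Y ^~ w) (M0 := 0%N) (cY (w := w)) _ rs) => M i _ hi.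
by have [] := h M i hi.
Qed.

Lemma bounded_until_anti N r s : r <= s -> bounded_until N s `<=` bounded_until N r.
Proof. by move=> rs w h M i ir; apply: h; exact: le_trans rs. Qed.

Let sqd N s w : R := \1_(bounded_until N s) w * (X s w - Y s w) ^+ 2.

Let sqd_ge0 N s w : 0 <= sqd N s w.
Proof. by rewrite mulr_ge0 ?sqr_ge0. Qed.

Let sqd_mw N s : 0 <= s -> mw s (sqd N s).
Proof.
move=> s0; apply: (mwM PF s0); first by apply: (mw_indic PF) => //; exact: bounded_until_filt.
by apply: mwX => //; apply: (mwB PF s0); [exact: aX|exact: aY].
Qed.

Let sqd_le N s w : 0 <= s -> 0 <= N -> sqd N s w <= 4 * N ^+ 2.
Proof.
move=> s0 N0; rewrite /sqd indicE; have [h|h] := pselect (bounded_until N s w); last first.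
  by rewrite memNset// mul0r mulr_ge0 ?sqr_ge0.
rewrite mem_set// mul1r (_ : 4 * N ^+ 2 = (2 * N) ^+ 2); last by ring.
have [h1 h2] := bounded_untilP h (introT andP (conj s0 (lexx s))).
by apply: sqr_le_norm; have := ler_normB (X s w) (Y s w); lra.
Qed.

(** Lower Riemann sums of the power [n] stay below its primitive; this supplies the factor
    [1 / n.+1] in the iteration. *)
Lemma powS_diff_ge (u v : R) n : 0 <= u -> u <= v ->
  n.+1%:R * u ^+ n * (v - u) <= v ^+ n.+1 - u ^+ n.+1.
Proof.
move=> u0 uv; elim: n => [|n ih]; first by rewrite expr0 !expr1 mulr1 mul1r.
have -> : v ^+ n.+2 - u ^+ n.+2 = v * (v ^+ n.+1 - u ^+ n.+1) + u ^+ n.+1 * (v - u).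
  by rewrite !exprS; ring.
have h0 : 0 <= n.+1%:R * u ^+ n * (v - u).
  by rewrite mulr_ge0 ?subr_ge0// mulr_ge0// exprn_ge0.
have : u * (n.+1%:R * u ^+ n * (v - u)) <= v * (v ^+ n.+1 - u ^+ n.+1) by apply: ler_pM.
rewrite (_ : u * _ = n.+1%:R * u ^+ n.+1 * (v - u)); last by rewrite exprS; ring.
by rewrite -[n.+2%:R]natr1 !mulrDl mul1r; lra.
Qed.

Let norm_sub_le (p q y z a : R) : `|p - y| < a / 2 -> `|q - z| < a / 2 ->
  `|y - z| <= `|p - q| + a.
Proof.
move=> h1 h2; have := ler_normB (p - q) ((p - y) - (q - z)).
have := ler_normB (p - y) (q - z).
by rewrite (_ : p - q - (p - y - (q - z)) = y - z); [lra|ring].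
Qed.

Let sqr_split_le (z u v a q : R) : `|z| <= `|u + v| + a -> u ^+ 2 <= q ->
  z ^+ 2 <= 4 * q + 4 * v ^+ 2 + 2 * a ^+ 2.
Proof.
move=> /sqr_le_norm h uq; have := real_normK (num_real (u + v)).
have := sqr_ge0 (`|u + v| - a); have := sqr_ge0 (u - v).
by nra.
Qed.

(** Gronwall's inequality as one Picard step on monomial bounds, so that the mean of [sqd] is never
    integrated in time. Both equations are replaced by Riemann sums off an unlikely event [bad], on
    which [sqd] is still at most [4 N^2]. The indicators in [df] and [dg] are known at the left end
    of each cell. *)
Lemma gronwall_step N T : 0 <= N -> 0 <= T -> exists2 C, 0 <= C &
  forall t c n, 0 < t <= T -> 0 <= c ->
  (forall s, 0 < s <= t -> (\int[P]_w (sqd N s w)%:E <= (c * s ^+ n)%:E)%E) ->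
  (\int[P]_w (sqd N t w)%:E <= (C * c * t ^+ n.+1 / n.+1%:R)%:E)%E.
Proof.
move=> N0 T0; have [Lf Lf0 hLf] := f_lip (N + T); have [Lg Lg0 hLg] := g_lip N.
(* [T * Lf^2] comes from Cauchy-Schwarz in time for the drift sum, [Lg^2] from the second moment of
   the stochastic sum; doubling [C1] accounts for the factor 4 in [sqr_split_le]. *)
pose C1 := 2 * T * Lf ^+ 2 + 2 * Lg ^+ 2.
have C10 : 0 <= C1 by rewrite addr_ge0// mulr_ge0 ?sqr_ge0// mulr_ge0.
exists (2 * C1) => [|t c n /andP[t0 tT] c0 hc]; first exact: mulr_ge0.
apply/lee_addgt0Pr => e e0.
pose K := 4 * N ^+ 2.
have K0 : 0 <= K by rewrite mulr_ge0// sqr_ge0.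
pose eta := Num.min 1 (e / 8).
have eta0 : 0 < eta by rewrite lt_min ltr01/=; lra.
have eta2 : 2 * eta ^+ 2 <= e / 4.
  have h1 : eta <= 1 by rewrite ge_min lexx.
  have h2 : eta <= e / 8 by rewrite ge_min lexx orbT.
  by nra.
pose dl := e / 8 / (K + 1).
have dl0 : 0 < dl by rewrite divr_gt0//; lra.
have Kdl : K * dl <= e / 8.
  have : (K + 1) * dl = e / 8 by rewrite /dl mulrC divfK// gt_eqF//; lra.
  by lra.
have eta20 : 0 < eta / 2 by lra.
have [M1 H1] := euler_sum_cvg solX t0 eta20 dl0.
have [M2 H2] := euler_sum_cvg solY t0 eta20 dl0.
have ee : 0 < e / 4 / (2 * C1 * K + 1) / t.
  by apply: divr_gt0 => //; apply: divr_gt0; [lra|rewrite ltr_wpDl// !mulr_ge0].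
have [M3 _ H3] : \forall k \near \oo, mesh R k < e / 4 / (2 * C1 * K + 1) / t.
  have /cvgrPdist_lt/(_ _ ee) := @mesh_cvg0 R.
  by apply: filterS => k; rewrite sub0r normrN ger0_norm// mesh_ge0.
pose M := maxn (maxn M1 M2) M3.
have {H1} := H1 M (leq_trans (leq_maxl M1 M2) (leq_maxl _ _)).
have {H2} := H2 M (leq_trans (leq_maxr M1 M2) (leq_maxl _ _)).
have {H3} := H3 M (leq_maxr _ _) => H3 H2 H1.
pose u := tdy t M; pose h := t * mesh R M.
have h0 : 0 < h by rewrite mulr_gt0// mesh_gt0.
have u0 j : 0 <= u j by exact: tdy_ge0.
have uS j : u j < u j.+1 by exact: tdy_strict.
have uh j : u j.+1 - u j = h by exact: tdyS.
have ut j : (j <= 2 ^ M)%N -> u j <= t by move=> jM; have /andP[] := tdy_le (ltW t0) jM.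
pose chi j : Omega -> R := \1_(bounded_until N (u j)).
have mchi j : mw (u j) (chi j) by apply: (mw_indic PF) => //; exact: bounded_until_filt.
pose df j w := chi j w * (f (X (u j) w, u j) - f (Y (u j) w, u j)).
pose dg j w := chi j w * (g (X (u j) w) - g (Y (u j) w)).
have mdf j : mw (u j) (df j).
  by apply: (mwM PF) => //; apply: (mwB PF) => //; exact: f_process_mw.
have mdg j : mw (u j) (dg j).
  by apply: (mwM PF) => //; apply: (mwB PF) => //; exact: g_process_mw.
have df_le j w : (j < 2 ^ M)%N -> df j w ^+ 2 <= Lf ^+ 2 * sqd N (u j) w.
  move=> jM; rewrite /df /chi /sqd indicE.
  have [a|a] := pselect (bounded_until N (u j) w); last first.
    by rewrite memNset// !mul0r mulr0 expr0n.
  rewrite mem_set// !mul1r -exprMn -[leRHS]real_normK ?num_real//; apply: sqr_le_norm.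
  have [k1 k2] := bounded_untilP a (introT andP (conj (u0 j) (lexx (u j)))).
  have uT : u j <= N + T by apply: le_trans (ut j (ltnW jM)) _; lra.
  apply: le_trans (hLf _ _ _ _ _ _ _ _) _; rewrite ?u0 ?uT//.
  - by apply: le_trans k1 _; rewrite lerDl.
  - by apply: le_trans k2 _; rewrite lerDl.
  by rewrite subrr normr0 addr0 normrM (gtr0_norm Lf0).
have dg_le j w : dg j w ^+ 2 <= Lg ^+ 2 * sqd N (u j) w.
  rewrite /dg /chi /sqd indicE.
  have [a|a] := pselect (bounded_until N (u j) w); last first.
    by rewrite memNset// !mul0r mulr0 expr0n.
  rewrite mem_set// !mul1r -exprMn -[leRHS]real_normK ?num_real//; apply: sqr_le_norm.
  have [k1 k2] := bounded_untilP a (introT andP (conj (u0 j) (lexx (u j)))).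
  by apply: le_trans (hLg _ _ k1 k2) _; rewrite normrM (gtr0_norm Lg0).
pose Z k w := \sum_(j < k) sqd N (u j) w * h.
have Z0 k w : 0 <= Z k w by apply: sumr_ge0 => j _; rewrite mulr_ge0// ltW.
have msqd s : 0 <= s -> measurable_fun setT (sqd N s).
  by move=> s0; apply: (mw_fun PF s0); exact: sqd_mw.
have mZ k : measurable_fun setT (Z k).
  by apply: measurable_sum => j; apply: measurable_funM => //; exact: msqd.
have ZS k w : Z k.+1 w = Z k w + h * sqd N (u k) w.
  by rewrite /Z big_ord_recr/= [h * _]mulrC.
(* The bound [hc] concerns positive times only; the cell starting at 0 is estimated by [K * h],
   which vanishes with the mesh. *)
have EZ k : (k < 2 ^ M)%N ->
    (\int[P]_w (Z k.+1 w)%:E <= (c * u k.+1 ^+ n.+1 / n.+1%:R + K * h)%:E)%E.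
  elim: k => [_|k ih kM].
    apply: (@le_trans _ _ (\int[P]_w (K * h)%:E)%E).
      apply: integral_le => // w _.
      by rewrite ZS /Z big_ord0 add0r mulrC ler_pM2r//; exact: sqd_le.
    rewrite integral_const// probability_setT mule1 lee_fin lerDr.
    by rewrite divr_ge0// mulr_ge0// exprn_ge0.
  under eq_integral do rewrite ZS.
  rewrite integral_addR//; last 2 first.
  - by apply: measurable_funM => //; exact: msqd.
  - by move=> w; rewrite mulr_ge0// ltW.
  rewrite integral_scale//; [|exact: msqd|exact: ltW].
  have uk : 0 < u k.+1 <= t by rewrite (le_lt_trans (u0 k))// ut// ltnW.
  apply: (@le_trans _ _ ((c * u k.+1 ^+ n.+1 / n.+1%:R + K * h)%:E +
     h%:E * (c * u k.+1 ^+ n)%:E)%E).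
    apply: leeD; first exact: ih (ltnW kM).
    by apply: lee_wpmul2l; [rewrite lee_fin ltW|exact: hc].
  rewrite -EFinM -EFinD lee_fin.
  have := powS_diff_ge n (u0 k.+1) (ltW (uS k.+1)); rewrite uh => pw.
  have n0 : 0 < n.+1%:R :> R by [].
  have : c * (u k.+1 ^+ n * h) <= c * ((u k.+2 ^+ n.+1 - u k.+1 ^+ n.+1) / n.+1%:R).
    by apply: ler_wpM2l => //; rewrite ler_pdivlMr//; lra.
  set p := u k.+2 ^+ n.+1; set q := u k.+1 ^+ n.+1; set r := u k.+1 ^+ n.
  by set m := n.+1%:R^-1; nra.
have K1 : (0 < 2 ^ M)%N by rewrite expn_gt0.
have := EZ (2 ^ M).-1; rewrite (prednK K1) => /(_ (leqnn _)).
have -> : u (2 ^ M)%N = t by exact: tdy_end.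
move=> {}EZ.
have hN : (2 ^ M)%:R * h = t by rewrite /h mulrCA -/(dy R M (2 ^ M)) -[RHS](tdy_end t M).
pose U w := \sum_(j < 2 ^ M) df j w * h.
pose V w := \sum_(j < 2 ^ M) dg j w * (B (u j.+1) w - B (u j) w).
have mU : measurable_fun setT U.
  by apply: measurable_sum => j; apply: measurable_funM => //; exact: (mw_fun PF (u0 j)).
have mV : measurable_fun setT V.
  by apply: (mw_fun PF (u0 (2 ^ M)%N)); exact: (stochastic_sum_mw PF BM (u0 0%N) uS).
have U_le w : U w ^+ 2 <= T * Lf ^+ 2 * Z (2 ^ M)%N w.
  apply: le_trans (sqr_sum_le (fun j => df j w * h) (2 ^ M)) _.
  rewrite (eq_bigr (fun j : 'I_(2 ^ M) => (df j w ^+ 2 * h) * h)); last first.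
    by move=> j _; rewrite exprMn expr2 !mulrA.
  rewrite -mulr_suml mulrCA mulrC -mulrA hN mulrC.
  rewrite [leLHS]mulrC; apply: ler_pM => //; first exact: ltW.
    by apply: sumr_ge0 => j _; rewrite mulr_ge0 ?sqr_ge0// ltW.
  rewrite /Z mulr_sumr; apply: ler_sum => j _.
  by rewrite [leRHS]mulrA ler_pM2r//; exact: df_le.
have EV : (\int[P]_w (V w ^+ 2)%:E <= \int[P]_w (Lg ^+ 2 * Z (2 ^ M)%N w)%:E)%E.
  apply: le_trans (stochastic_sum_sqr PF BM (u0 0%N) uS (fun j _ => mdg j)) _.
  apply: integral_le => //.
  - apply: measurable_sum => j; apply: measurable_funM; last exact: measurable_cst.
    by apply: measurable_funX; exact: (mw_fun PF (u0 j)).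
  - by apply: measurable_funM.
  - by move=> w _; apply: sumr_ge0 => j _; rewrite uh mulr_ge0 ?sqr_ge0// ltW.
  - move=> w _; rewrite /Z mulr_sumr; apply: ler_sum => j _.
    by rewrite uh [leRHS]mulrA ler_pM2r//; exact: dg_le.
pose bad := [set w | (eta / 2 <= `|euler_sum X t M w - (X t w - x0)|)%R] `|`
            [set w | (eta / 2 <= `|euler_sum Y t M w - (Y t w - x0)|)%R].
have mbad : measurable bad.
  apply: measurableU; apply: mge; apply: measurable_funB; try exact: euler_sum_measurable;
  apply: measurable_funB => //; apply: (mw_fun PF (ltW t0)); [apply: aX|apply: aY]; exact: ltW.
have Pbad : (P bad <= (2 * dl)%:E)%E.
  apply: le_trans (measureU2 _ _ _) _.
  - by apply: mge; apply: measurable_funB; [exact: euler_sum_measurable|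
      apply: measurable_funB => //; apply: (mw_fun PF (ltW t0)); apply: aX; exact: ltW].
  - by apply: mge; apply: measurable_funB; [exact: euler_sum_measurable|
      apply: measurable_funB => //; apply: (mw_fun PF (ltW t0)); apply: aY; exact: ltW].
  by rewrite mulrDl mul1r EFinD; exact: leeD.
have main w : sqd N t w <= (4 * (T * Lf ^+ 2) * Z (2 ^ M)%N w + 4 * V w ^+ 2)
    + (2 * eta ^+ 2 + K * \1_bad w).
  have W0 : 0 <= 4 * (T * Lf ^+ 2) * Z (2 ^ M)%N w + 4 * V w ^+ 2.
    by rewrite addr_ge0// mulr_ge0// ?sqr_ge0// mulr_ge0// mulr_ge0// sqr_ge0.
  have e20 := sqr_ge0 eta.
  have [bw|bw] := pselect (bad w).
    rewrite indicE mem_set// mulr1.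
    apply: le_trans (@sqd_le N t w (ltW t0) N0) _.
    by rewrite addrA lerDr addr_ge0// mulr_ge0.
  rewrite indicE memNset// mulr0 addr0 /sqd indicE.
  have [a|a] := pselect (bounded_until N t w); last first.
    by rewrite memNset// mul0r; apply: addr_ge0 => //; apply: mulr_ge0.
  rewrite mem_set// mul1r.
  move: bw => /not_orP[/negP + /negP]; rewrite -!ltNge => b1 b2.
  (* [bounded_until] decreases in time, so on [bounded_until N t] every earlier indicator [chi j]
     equals 1. *)
  have E : euler_sum X t M w - euler_sum Y t M w = U w + V w.
    rewrite /euler_sum -sumrB /U /V -big_split/=; apply: eq_bigr => j _.
    have cj : chi j w = 1.
      rewrite /chi indicE mem_set//; apply: bounded_until_anti a; apply: ut.
      exact: ltnW.
    by rewrite /df /dg cj -/h; rewrite -/(u j.+1) -/(u j); ring.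
  have hd : `|X t w - Y t w| <= `|U w + V w| + eta.
    rewrite -E; have := norm_sub_le b1 b2.
    by rewrite opprB addrA subrK.
  by apply: le_trans (sqr_split_le hd (U_le w)) _; rewrite !mulrA.
apply: (@le_trans _ _ (\int[P]_w ((4 * (T * Lf ^+ 2) * Z (2 ^ M)%N w + 4 * V w ^+ 2)
    + (2 * eta ^+ 2 + K * \1_bad w))%:E)%E).
  apply: integral_le => //.
  - exact/msqd/ltW.
  - apply: measurable_funD; last first.
      by apply: measurable_funD => //; apply: measurable_funM => //; exact: measurable_indic.
    apply: measurable_funD; first exact: measurable_funM.
    by apply: measurable_funM => //; exact: measurable_funX.
have TL0 : 0 <= 4 * (T * Lf ^+ 2) by do 2?[apply: mulr_ge0 => //]; exact: sqr_ge0.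
have mV2 : measurable_fun setT (fun w => V w ^+ 2) by exact: measurable_funX.
have mB1 : measurable_fun setT (\1_bad : Omega -> R) by exact: measurable_indic.
rewrite integral_addR//; last 4 first.
- by apply: measurable_funD; apply: measurable_funM.
- by apply: measurable_funD => //; apply: measurable_funM.
- by move=> w; rewrite addr_ge0// mulr_ge0// sqr_ge0.
- by move=> w; rewrite addr_ge0// mulr_ge0// sqr_ge0.
rewrite integral_addR//; last 4 first.
- exact: measurable_funM.
- exact: measurable_funM.
- by move=> w; rewrite mulr_ge0.
- by move=> w; rewrite mulr_ge0// sqr_ge0.
rewrite integral_addR//; last 3 first.
- exact: measurable_funM.
- by move=> w; rewrite mulr_ge0// sqr_ge0.
- by move=> w; rewrite mulr_ge0.
rewrite integral_const// probability_setT mule1.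
rewrite !integral_scale//; last by move=> w; exact: sqr_ge0.
rewrite integral_indic// setIT.
have EV' := EV; rewrite integral_scale// ?sqr_ge0// in EV'.
apply: (@le_trans _ _ ((4 * (T * Lf ^+ 2))%:E * (c * t ^+ n.+1 / n.+1%:R + K * h)%:E
   + 4%:E * ((Lg ^+ 2)%:E * (c * t ^+ n.+1 / n.+1%:R + K * h)%:E)
   + ((2 * eta ^+ 2)%:E + K%:E * (2 * dl)%:E))%E).
  apply: leeD; last by apply: leeD => //; apply: lee_wpmul2l => //; rewrite lee_fin.
  apply: leeD; first by apply: lee_wpmul2l => //; rewrite lee_fin.
  apply: lee_wpmul2l => //; apply: le_trans EV' _; apply: lee_wpmul2l => //.
  by rewrite lee_fin sqr_ge0.
rewrite -!EFinM -!EFinD lee_fin.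
have Kh : 2 * C1 * (K * h) <= e / 4.
  move: H3; rewrite ltr_pdivlMr// mulrC -/h ltr_pdivlMr; last first.
    by rewrite ltr_wpDl// !mulr_ge0.
  by have := ltW h0; nra.
rewrite (_ : 2 * C1 * c * t ^+ n.+1 / n.+1%:R = 2 * C1 * (c * t ^+ n.+1 / n.+1%:R)); last by ring.
set q := c * t ^+ n.+1 / n.+1%:R.
rewrite [leLHS](_ : _ = 2 * C1 * q + 2 * C1 * (K * h) + (2 * eta ^+ 2 + 2 * (K * dl))).
  by lra.
by rewrite /C1; ring.
Qed.

(** Iterating the Picard step from the trivial bound [4 N^2] produces the terms of the series of
    [4 N^2 expR (C t)], which tend to 0. *)
Lemma integral_sqd_eq0 N t : 0 <= N -> 0 < t -> (\int[P]_w (sqd N t w)%:E = 0)%E.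
Proof.
move=> N0 t0; have [C C0 hC] := gronwall_step N0 (ltW t0).
pose K := 4 * N ^+ 2; have K0 : 0 <= K by rewrite mulr_ge0// sqr_ge0.
have H n s : 0 < s <= t -> (\int[P]_w (sqd N s w)%:E <= (K * C ^+ n / n`!%:R * s ^+ n)%:E)%E.
  elim: n s => [|n ih] s /andP[s0 st].
    rewrite !expr0 fact0 divr1 !mulr1.
    apply: (@le_trans _ _ (\int[P]_w K%:E)%E).
      apply: integral_le => //; first by apply: (mw_fun PF (ltW s0)); exact/sqd_mw/ltW.
      by move=> w _; apply: sqd_le => //; exact: ltW.
    by rewrite integral_const// probability_setT mule1.
  have Kn : 0 <= K * C ^+ n / n`!%:R by rewrite divr_ge0// mulr_ge0// exprn_ge0.
  have ss : 0 < s <= t by rewrite s0.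
  apply: le_trans (hC s _ n ss Kn _) _.
    by move=> r /andP[r0 rs]; apply: ih; rewrite r0 (le_trans rs).
  rewrite lee_fin le_eqVlt; apply/orP; left; apply/eqP.
  rewrite factS natrM invfM; set a := n.+1%:R^-1; set b := n`!%:R^-1.
  by rewrite !exprS; ring.
apply/eqP; rewrite eq_le; apply/andP; split; last first.
  by apply: integral_ge0 => w _; rewrite lee_fin sqd_ge0.
apply/lee_addgt0Pr => e e0; rewrite add0e.
have Ke : 0 < e / (K + 1) by rewrite divr_gt0//; lra.
have [n _ /(_ n (leqnn n))] : \forall n \near \oo, `|exp_coeff (C * t) n| < e / (K + 1).
  have := cvg_series_cvg_0 (@is_cvg_series_exp_coeff R (C * t)).
  move=> /cvgrPdist_lt/(_ _ Ke); apply: filterS => n.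
  by rewrite sub0r normrN.
rewrite /exp_coeff/= => h; have tt : 0 < t <= t by rewrite t0 lexx.
apply: le_trans (H n t tt) _; rewrite lee_fin.
have h2 : (C * t) ^+ n / n`!%:R <= e / (K + 1) by apply: le_trans (ler_norm _) (ltW h).
rewrite (_ : _ * _ = K * ((C * t) ^+ n / n`!%:R)); last by rewrite exprMn; ring.
apply: le_trans (ler_wpM2l K0 h2) _.
by rewrite mulrCA ler_piMr ?ltW// ltr_pdivrMr; lra.
Qed.

Lemma solution_eq_ae t : 0 < t -> P.-negligible [set w | X t w != Y t w].
Proof.
move=> t0; apply: (@negligibleS _ _ _ _ (\bigcup_N [set w | sqd N%:R t w != 0])).
  move=> w /= XY.
  have [C1 C10 h1] := path_bounded (cX (w := w)) (ltW t0).
  have [C2 C20 h2] := path_bounded (cY (w := w)) (ltW t0).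
  exists (Num.truncn (C1 + C2)).+1 => //=.
  have hN := ltW (truncnS_gt (C1 + C2)).
  rewrite /sqd indicE mem_set ?mul1r ?sqrf_eq0 ?subr_eq0// => M i it.
  have di : 0 <= dy R M i <= t by rewrite dy_ge0.
  by split; [have := h1 _ di|have := h2 _ di]; lra.
apply: negligible_bigcup => N.
have mN : measurable_fun setT (fun w => (sqd N%:R t w)%:E).
  by apply/measurable_EFinP; apply: (mw_fun PF (ltW t0)); exact/sqd_mw/ltW.
have := @ae_eq_integral_abs _ _ _ P setT measurableT (fun w => (sqd N%:R t w)%:E) mN.
rewrite (_ : (\int[P]_x `|_| = 0)%E); last first.
  rewrite -[RHS](integral_sqd_eq0 (ler0n R N) t0); apply: eq_integral => w _.
  by rewrite abse_EFin ger0_norm.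
move=> [+ _] => /(_ erefl); apply: negligibleS => w /= /eqP h h2.
by apply: h; have [] := h2 I.
Qed.

Lemma pathwise_unique : indistinguishable P X Y.
Proof.
pose V := \bigcup_M \bigcup_i [set w | X (dy R M i.+1) w != Y (dy R M i.+1) w].
apply: (@negligibleS _ _ _ _ V); last first.
  apply: negligible_bigcup => M; apply: negligible_bigcup => i.
  by apply: solution_eq_ae; rewrite mulr_gt0 ?mesh_gt0.
move=> w; apply: contra_notP => nV t t0.
have E M i : (0 < i)%N -> X (dy R M i) w = Y (dy R M i) w.
  case: i => // i _; apply/eqP; apply: contrapT => /negP h.
  by apply: nV; exists M => //; exists i.
have cD := pc_sub (cX (w := w)) (cY (w := w)).
(* The almost sure equality was obtained for positive times; time 0 follows by continuity along
   [dy R N 1]. *)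
have D0 : X 0 w - Y 0 w = 0.
  apply/eqP; rewrite -normr_eq0 eq_le normr_ge0 andbT.
  apply/ler_addgt0Pr => e e0; rewrite add0r.
  move/within_ge0_continuous_epsP : cD => /(_ 0 (lexx 0) e e0)[a a0 ha].
  have [N _ HN] : \forall k \near \oo, mesh R k < a.
    have /cvgrPdist_lt/(_ _ a0) := @mesh_cvg0 R.
    by apply: filterS => k; rewrite sub0r normrN ger0_norm// mesh_ge0.
  have := ha (dy R N 1) (dy_ge0 R N 1); rewrite E// subrr subr0 => h; apply: ltW; apply: h.
  by rewrite sub0r normrN ger0_norm ?dy_ge0// /dy mul1r; exact: (HN N (leqnn N)).
apply/eqP; rewrite -subr_eq0 -normr_eq0 eq_le normr_ge0 andbT.
have tt : 0 <= t <= t by rewrite t0 lexx.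
apply: (dyadic_closure (M0 := 0%N) cD _ tt) => M [|i] _ _.
  by rewrite dy0 D0 normr0.
by rewrite E// subrr normr0.
Qed.

End two_solutions.
End uniqueness.

(** * One-step inequalities for [cosh] and [y sinh y] *)

Lemma abs_sinh_le (R : realType) (x : R) : `|sinh x| <= `|x| * cosh x.
Proof.
have [->|x0] := eqVneq x 0; first by rewrite sinh0 normr0 mul0r.
have nx : 0 < `|x| by rewrite normr_gt0.
rewrite -(ler_pM2l nx) -normrM ger0_norm ?mul_sinh_ge0//.
by rewrite [leRHS]mulrA -expr2 real_normK ?num_real// mul_sinh_le_cosh.
Qed.

Lemma sinh_mul_le0 (R : realType) (x y : R) : x * y <= 0 -> sinh x * sinh y <= 0.
Proof.
rewrite le_eqVlt => /orP[/eqP/eqP|xy].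
  by rewrite mulf_eq0 => /orP[]/eqP->; rewrite sinh0 ?mul0r ?mulr0.
have := mul_sinh_ge0 x; have := mul_sinh_ge0 y => hy hx.
rewrite -(nmulr_rge0 _ xy) (_ : x * y * _ = (x * sinh x) * (y * sinh y)); last by ring.
exact: mulr_ge0.
Qed.

(** In [cosh y cosh b + sinh y sinh b] the first term costs order [b^2]. The second matters only
    when [y b > 0]: for [|y| >= 6 rho / e] the bound [y b <= z rho] gives [|b| <= z e / 6], a small
    relative loss; for smaller [|y|], [|sinh y| <= |y| cosh y] turns it into the additive
    constant. *)
Lemma cosh_shift (R : realType) (rho e y b z : R) : 0 < rho -> 0 < e -> `|b| <= 1 -> 0 <= z ->
  b ^+ 2 <= z * e / 4 -> y * b <= z * rho ->
  cosh (y + b) <= cosh y + z * (e * cosh y + 3 * rho * cosh (6 * rho / e)).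
Proof.
move=> r0 e0 b1 z0 b2 yb; rewrite coshD.
have c0 := cosh_gt0 y; have cb := cosh_le_sqr b1.
have C0 := cosh_gt0 (6 * rho / e).
have h1 : cosh y * cosh b <= cosh y + z * e / 2 * cosh y.
  have : cosh y * cosh b <= cosh y * (1 + 2 * b ^+ 2) by rewrite ler_pM2l.
  have : cosh y * b ^+ 2 <= cosh y * (z * e / 4) by rewrite ler_pM2l.
  by lra.
suff h2 : sinh y * sinh b <= z * e / 2 * cosh y + z * (3 * rho * cosh (6 * rho / e)) by lra.
have zr0 : 0 <= z * (3 * rho * cosh (6 * rho / e)) by rewrite !mulr_ge0// ltW.
have ze0 : 0 <= z * e / 2 * cosh y by rewrite !mulr_ge0// ltW.
have [yb0|yb0] := leP (y * b) 0.
  by have := sinh_mul_le0 yb0; lra.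
have sb : `|sinh b| <= 3 * `|b|.
  apply: le_trans (abs_sinh_le b) _; rewrite mulrC ler_wpM2r//.
  apply: le_trans cb _; have : b ^+ 2 <= 1 by rewrite -[leRHS](expr1n _ 2) sqr_le_norm.
  by lra.
apply: le_trans (ler_norm _) _; rewrite normrM.
apply: (@le_trans _ _ (`|sinh y| * (3 * `|b|))); first by rewrite ler_wpM2l.
have yb' : `|y| * `|b| <= z * rho by rewrite -normrM gtr0_norm.
have nb := normr_ge0 b; have ny := normr_ge0 y.
have [hy|hy] := leP (6 * rho / e) `|y|.
  have : `|b| * (6 * rho / e) <= z * rho.
    by apply: le_trans yb'; rewrite mulrC ler_wpM2r.
  have -> : `|b| * (6 * rho / e) = (6 * `|b| / e) * rho by ring.
  rewrite ler_pM2r// ler_pdivrMr// => hb.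
  have : `|sinh y| * (3 * `|b|) <= cosh y * (3 * `|b|).
    by rewrite ler_wpM2r ?mulr_ge0// abs_sinh_le_cosh.
  have : cosh y * (6 * `|b|) <= cosh y * (z * e) by rewrite ler_pM2l.
  by lra.
have hc : cosh y <= cosh (6 * rho / e).
  by apply: ler_cosh; rewrite [leRHS]ger0_norm ?(ltW hy)// ltW// divr_gt0// mulr_gt0.
have : `|sinh y| * (3 * `|b|) <= `|y| * cosh (6 * rho / e) * (3 * `|b|).
  rewrite ler_wpM2r ?mulr_ge0//; apply: le_trans (abs_sinh_le y) _.
  by rewrite ler_wpM2l.
have : `|y| * `|b| * (3 * cosh (6 * rho / e)) <= z * rho * (3 * cosh (6 * rho / e)).
  by rewrite ler_wpM2r// mulr_ge0// ltW.
by lra.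
Qed.

Lemma expR_le_quad (R : realType) (x : R) : 0 <= x -> x <= 2^-1 -> expR x <= 1 + x + 2 * x ^+ 2.
Proof.
move=> x0 x1; have h1 := expR_ge1Dx (- x).
have x2 : 0 < 1 - x by lra.
rewrite -(ler_pM2r x2).
have : expR x * (1 - x) <= expR x * expR (- x) by rewrite ler_wpM2l ?expR_ge0.
rewrite -expRD subrr expR0; have := mulr_ge0 (sqr_ge0 x) (_ : 0 <= 1 - 2 * x).
by move=> /(_ ltac:(lra)); nra.
Qed.

Lemma mul_sinh_sign (R : realType) (x y : R) : 0 <= x * y -> 0 <= x * sinh y.
Proof.
move=> xy; have [->|y0] := eqVneq y 0; first by rewrite sinh0 mulr0.
have y2 : 0 < y ^+ 2 by rewrite lt_neqAle eq_sym sqrf_eq0 y0 sqr_ge0.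
rewrite -(pmulr_rge0 _ y2) (_ : y ^+ 2 * _ = (x * y) * (y * sinh y)); last by ring.
by rewrite mulr_ge0// mul_sinh_ge0.
Qed.

(** For [|x| <= K] only [v <= G^2] is known, but there [cosh (l x) <= cosh K] since [l <= 1], so the
    excess goes into the additive constant instead of the rate. *)
Lemma cosh_step (R : realType) (rho G K S e : R) : 0 < rho -> 0 <= K -> 0 <= S -> 0 < e ->
  exists C, exists2 h0, 0 <= C /\ 0 < h0 &
  forall l x a v h, 0 < l <= 1 -> 0 < h <= h0 -> a ^+ 2 * h <= h0 -> x * a <= rho ->
    0 <= v <= G ^+ 2 -> (K < `|x| -> v <= S + e) ->
    cosh (l * (x + a * h)) * expR (l ^+ 2 * h * v / 2) <=
    (1 + l ^+ 2 * h * (S / 2 + 4 * e)) * cosh (l * x) + C * (l ^+ 2 * h).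
Proof.
move=> r0 K0 S0 e0.
pose C1 := 3 * rho * cosh (6 * rho / e).
have C10 : 0 <= C1.
  by apply: mulr_ge0; [rewrite mulr_ge0// ltW|exact/ltW/cosh_gt0].
(* With [h0 = q / D] each of [4 h0], [h0 G^2], [h0 G^4] and [h0 e] is at most [min 1 e], which
   covers all second-order terms below. *)
pose D := 4 + G ^+ 2 + G ^+ 4 + e; pose q := Num.min 1 e.
have G2 : 0 <= G ^+ 2 by exact: sqr_ge0.
have G4 : G ^+ 4 = G ^+ 2 * G ^+ 2 by rewrite -exprD.
have G40 : 0 <= G ^+ 4 by rewrite G4 mulr_ge0.
have D0 : 0 < D by rewrite /D; lra.
have q0 : 0 < q by rewrite lt_min ltr01.
have [q1 qe] : q <= 1 /\ q <= e by rewrite !ge_min !lexx orbT.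
pose h0 := q / D.
have h00 : 0 < h0 by rewrite divr_gt0.
have hD : h0 * 4 + h0 * G ^+ 2 + h0 * G ^+ 4 + h0 * e = q.
  by rewrite -!mulrDr -/D /h0 divfK// gt_eqF.
have p2 : 0 <= h0 * G ^+ 2 by rewrite mulr_ge0// ltW.
have p4 : 0 <= h0 * G ^+ 4 by rewrite mulr_ge0// ltW.
have pe : 0 < h0 * e by rewrite mulr_gt0.
exists (G ^+ 2 * cosh K + 2 * C1), h0.
  by split=> //; rewrite addr_ge0// mulr_ge0// ltW// cosh_gt0.
move=> l x a v h /andP[l0 l1] /andP[h_0 hh] ah xa /andP[v0 vG] vS.
pose z := l ^+ 2 * h.
have l2 : l ^+ 2 <= 1 by rewrite expr_le1// ltW.
have z0 : 0 < z by rewrite mulr_gt0// exprn_gt0.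
have zh : z <= h0 by apply: le_trans hh; rewrite ger_pMl.
pose b := l * (a * h); pose y := l * x.
have bE : b ^+ 2 = z * (a ^+ 2 * h) by rewrite /b /z; ring.
have b2 : b ^+ 2 <= z * e / 4 by rewrite bE -mulrA; apply: ler_wpM2l; [exact: ltW|clear -ah hD q1 qe h00 p2 p4 pe; lra].
have b1 : `|b| <= 1.
  have : b ^+ 2 <= 1 ^+ 2.
    rewrite bE expr1n; apply: mulr_ile1; [exact: ltW| |clear -zh hD q1 qe h00 p2 p4 pe; lra|clear -ah hD q1 qe h00 p2 p4 pe; lra].
    by rewrite mulr_ge0 ?sqr_ge0// ltW.
  by rewrite -(real_normK (num_real b)) ler_pXn2r ?nnegrE.
have yb : y * b <= z * rho.
  rewrite (_ : y * b = z * (x * a)); last by rewrite /y /b /z; ring.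
  by rewrite ler_pM2l.
have := cosh_shift r0 e0 b1 (ltW z0) b2 yb; rewrite -/C1.
have -> : l * (x + a * h) = y + b by rewrite mulrDr.
rewrite -/z -/y; set c := cosh y => hc.
have c1 : 1 <= c by exact: cosh_ge1.
have c0 : 0 <= c by exact: le_trans c1.
have Se0 : 0 <= S + e by exact: addr_ge0 (ltW e0).
have zv0 : 0 <= z * v by rewrite mulr_ge0// ltW.
have zv : z * v <= h0 * G ^+ 2 by apply: ler_pM => //; exact: ltW.
have hE : expR (z * v / 2) <= 1 + z * (v / 2 + e).
  apply: le_trans (expR_le_quad _ _) _; [by rewrite divr_ge0|clear -zv hD q1 qe h00 p2 p4 pe; lra|].
  have : z * v * v <= h0 * G ^+ 2 * G ^+ 2 by apply: ler_pM.
  rewrite -(mulrA h0) -G4 => zvv; have zvv' : z * v * v <= e by clear -zvv hD q1 qe h00 p2 p4 pe; lra.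
  have := ler_wpM2l (ltW z0) zvv'; have := mulr_gt0 z0 e0; clear; lra.
have vc : v * c <= (S + e) * c + G ^+ 2 * cosh K.
  have gk : 0 <= G ^+ 2 * cosh K by rewrite mulr_ge0// ltW// cosh_gt0.
  have [/vS kx|kx] := ltP K `|x|.
    by have := ler_wpM2r c0 kx; clear -gk; lra.
  have : c <= cosh K.
    apply: ler_cosh; rewrite /y normrM (gtr0_norm l0) (ger0_norm K0).
    by apply: le_trans kx; rewrite ler_piMl.
  have : 0 <= (S + e) * c by exact: mulr_ge0.
  move=> k1 k2; have : v * c <= G ^+ 2 * cosh K by exact: ler_pM.
  by clear -k1; lra.
set t := v / 2 + e in hE.
have t0 : 0 <= t by rewrite addr_ge0// ?divr_ge0// ltW.
have ec0 : 0 <= e * c by rewrite mulr_ge0// ltW.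
have zt : z * t <= 1.
  have ze : z * e <= h0 * e by rewrite ler_pM2r.
  by rewrite /t mulrDr; clear -ze zv hD q1 h00 p2 p4 pe; lra.
have cc0 := cosh_gt0 (y + b).
apply: (@le_trans _ _ ((c + z * (e * c + C1)) * (1 + z * t))).
  by apply: ler_pM => //; exact: ltW.
have k1 : z * (e * c) * (z * t) <= z * (e * c).
  by rewrite ler_piMr// mulr_ge0// ltW.
have k2 : z * C1 * (z * t) <= z * C1 by rewrite ler_piMr// mulr_ge0// ltW.
have k3 : z * (v * c) <= z * ((S + e) * c + G ^+ 2 * cosh K) by rewrite ler_pM2l.
have k4 : 0 <= z * (e * c) by rewrite mulr_ge0// ltW.
have k5 : 0 <= z * (G ^+ 2 * cosh K).
  by apply: mulr_ge0; [exact: ltW|rewrite mulr_ge0// ltW// cosh_gt0].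
have k6 : c * (z * t) = z * (v * c) / 2 + z * (e * c) by rewrite /t; field.
by clear -hc k1 k2 k3 k4 k5 k6; lra.
Qed.

(** The tangent bound and [|sinh y| <= |y| cosh y] limit the cost of the drift to [2 m z v cosh y],
    with [z = l^2 h], while the Gaussian step gains about [z v cosh y]. Half of the margin
    [1 - 2 m], called [k0], survives the second-order terms. It yields the additive gain [k] and
    pays for [|x| <= K], where [v] may be below [S - e]. *)
Lemma xsinh_step (R : realType) (m G K S e g0 : R) : 0 <= m -> m < 2^-1 -> 0 <= K -> 0 < e -> e <= S / 2 ->
  0 < g0 ->
  exists l0, exists h0, exists2 k, [/\ 0 < l0, l0 <= 1, 0 < h0 & 0 < k] &
  forall l x a v h, 0 < l <= l0 -> 0 < h <= h0 -> a ^+ 2 * h <= h0 -> - (m * v) <= x * a ->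
    g0 <= v <= G ^+ 2 -> (K < `|x| -> S - e <= v) ->
    expR (l ^+ 2 * h * (S / 2 - e)) * xsinh (l * x) + k * (l ^+ 2 * h) <=
    xsinh (l * (x + a * h)) * expR (l ^+ 2 * h * v / 2)
    + 2 * (expR (l ^+ 2 * h * v / 2) - 1) * cosh (l * (x + a * h)).
Proof.
move=> m0 m1 K0 e0 eS g00.
pose k0 := (1 - 2 * m) / 2; have k00 : 0 < k0 by rewrite /k0; lra.
have G2 : 0 <= G ^+ 2 by exact: sqr_ge0.
have S0 : 0 < S by lra.
pose D := 1 + G ^+ 2 + S + S ^+ 2; pose q := Num.min 2^-1 (Num.min k0 e).
have S2 : 0 <= S ^+ 2 by exact: sqr_ge0.
have D0 : 0 < D by rewrite /D; lra.
have q0 : 0 < q by rewrite !lt_min k00 e0 invr_gt0 ltr0n.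
have [q1 qk qe] : [/\ q <= 2^-1, q <= k0 & q <= e] by rewrite !ge_min !lexx !orbT.
pose h0 := q / D.
have h00 : 0 < h0 by rewrite divr_gt0.
have hD : h0 + h0 * G ^+ 2 + h0 * S + h0 * S ^+ 2 = q.
  by rewrite -{1}[h0]mulr1 -!mulrDr -/D /h0 divfK// gt_eqF.
have p2 : 0 <= h0 * G ^+ 2 by rewrite mulr_ge0// ltW.
have p3 : 0 < h0 * S by rewrite mulr_gt0.
have p4 : 0 <= h0 * S ^+ 2 by rewrite mulr_ge0// ltW.
have KS0 : 0 <= K ^+ 2 * S by rewrite mulr_ge0 ?sqr_ge0// ltW.
(* On [|x| <= K] one has [xsinh (l x) <= l^2 K^2 cosh (l x)]; for such tilts [S] times this is at
   most [k0 g0 cosh (l x)]. *)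
pose l0 := Num.min 1 (k0 * g0 / (K ^+ 2 * S + 1)).
have l00 : 0 < l0 by rewrite lt_min ltr01 divr_gt0// ?mulr_gt0//; lra.
have l01 : l0 <= 1 by rewrite ge_min lexx.
have l0K : l0 * (K ^+ 2 * S) <= k0 * g0.
  have : l0 <= k0 * g0 / (K ^+ 2 * S + 1) by rewrite ge_min lexx orbT.
  by rewrite ler_pdivlMr; lra.
exists l0, h0, (k0 * g0 / 2); first by split=> //; rewrite divr_gt0// mulr_gt0.
move=> l x a v h /andP[l_0 ll] /andP[h_0 hh] ah xa /andP[gv vG] vS.
pose z := l ^+ 2 * h.
have l1 : l <= 1 by exact: le_trans l01.
have l2 : l ^+ 2 <= l by rewrite expr2 ger_pMr.
have z0 : 0 < z by rewrite mulr_gt0// exprn_gt0.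
have zh : z <= h0 by apply: le_trans hh; rewrite ger_pMl// (le_trans l2).
pose b := l * (a * h); pose y := l * x.
have bE : b ^+ 2 = z * (a ^+ 2 * h) by rewrite /b /z; ring.
have b1 : `|b| <= h0.
  have : b ^+ 2 <= h0 ^+ 2.
    rewrite bE expr2; apply: ler_pM => //; first exact: ltW.
    by rewrite mulr_ge0 ?sqr_ge0// ltW.
  by rewrite -(real_normK (num_real b)) ler_pXn2r ?nnegrE// ltW.
have v0 : 0 < v by exact: lt_le_trans gv.
have yb : - (z * (m * v)) <= y * b.
  rewrite (_ : y * b = z * (x * a)); last by rewrite /y /b /z; ring.
  by rewrite -mulrN ler_pM2l.
have -> : l * (x + a * h) = y + b by rewrite mulrDr.
rewrite -/z -/y; have := cosh_ge1 y; have := xsinh_ge0 y.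
have := xsinh_ge_tangent y b; have := cosh_ge_tangent y b.
set xs := xsinh y; set c := cosh y => t1 t2 xs0 c1.
have c0 : 0 < c by exact: lt_le_trans c1.
have zmv0 : 0 <= z * (m * v) by rewrite !mulr_ge0// ltW.
have bs : - (z * (m * v) * c) <= b * sinh y.
  have [hb|hb] := leP 0 (b * y).
    by apply: le_trans (mul_sinh_sign hb); rewrite oppr_le0 mulr_ge0// ltW.
  have := ler_norm (- (b * sinh y)); rewrite normrN normrM.
  have : `|b| * `|sinh y| <= `|b| * (`|y| * c) by rewrite ler_wpM2l// abs_sinh_le.
  rewrite mulrA -(normrM b y) (ltr0_norm hb) => n1 n2.
  have : - (b * y) * c <= z * (m * v) * c by rewrite ler_pM2r//; clear -yb; lra.
  by clear -n1 n2; lra.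
have bc : - (z * (m * v) * c) <= b * (y * c).
  by rewrite mulrA -mulNr (mulrC b) ler_pM2r.
have T1 : xs - 2 * (z * (m * v) * c) <= xsinh (y + b) by clear -t1 t2 bs bc; lra.
have T2 : c * (1 - h0) <= cosh (y + b).
  have := ler_norm (- (b * sinh y)); rewrite normrN normrM.
  have : `|b| * `|sinh y| <= h0 * c by apply: ler_pM => //; exact: abs_sinh_le_cosh.
  by clear -t1 t2; lra.
pose s := z * v / 2.
have s0 : 0 < s by rewrite /s divr_gt0// mulr_gt0.
have sh : s <= h0 * G ^+ 2 / 2 by rewrite /s ler_pM2r//; apply: ler_pM => //; exact: ltW.
have Es := expR_ge1Dx s.
have X0 := xsinh_ge0 (y + b); have cc0 := cosh_gt0 (y + b).
apply: (@le_trans _ _ (xsinh (y + b) * (1 + s) + 2 * s * cosh (y + b))); last first.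
  rewrite -/s; apply: lerD; first by rewrite ler_wpM2l.
  by rewrite ler_pM2r//; clear -Es; lra.
apply: (@le_trans _ _ ((xs - 2 * (z * (m * v) * c)) * (1 + s) + 2 * s * (c * (1 - h0)))); last first.
  apply: lerD; first by rewrite ler_wpM2r//; clear -s0; lra.
  by rewrite ler_wpM2l//; clear -s0; lra.
have zvc : 0 < z * v * c by apply: mulr_gt0 => //; apply: mulr_gt0.
have R1 : xs + z * v * (xs / 2 + k0 * c) <=
    (xs - 2 * (z * (m * v) * c)) * (1 + s) + 2 * s * (c * (1 - h0)).
  have k1 : k0 <= 1 - h0 - 2 * m * (1 + s).
    have : m * s <= 2^-1 * s by rewrite ler_pM2r//; exact: ltW.
    by clear -hD qk m0 m1 h00 p2 p3 p4 sh s0; rewrite /k0 in qk *; lra.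
  have : z * v * c * k0 <= z * v * c * (1 - h0 - 2 * m * (1 + s)) by rewrite ler_pM2l.
  by rewrite /s; clear; lra.
apply: le_trans R1.
set w := S / 2 - e.
have w0 : 0 <= w by rewrite /w subr_ge0.
have zw0 : 0 <= z * w by rewrite mulr_ge0// ltW.
have zw : z * w <= h0 * S by apply: ler_pM => //; [exact: ltW|rewrite /w; clear -e0 S0; lra].
have hE : expR (z * w) <= 1 + z * (S / 2 - e / 2).
  apply: le_trans (expR_le_quad zw0 _) _; first by clear -zw hD q1 h00 p2 p4; lra.
  have : w ^+ 2 <= S ^+ 2 / 4.
    rewrite (_ : S ^+ 2 / 4 = (S / 2) ^+ 2); last by field.
    by apply: sqr_le_norm; rewrite ger0_norm// /w; clear -e0; lra.
  have : z * w ^+ 2 <= h0 * (S ^+ 2 / 4).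
    apply: ler_pM => //; [exact: ltW|exact: sqr_ge0|].
    rewrite (_ : S ^+ 2 / 4 = (S / 2) ^+ 2); last by field.
    by apply: sqr_le_norm; rewrite ger0_norm// /w; clear -e0; lra.
  move=> j1 _; have := ler_wpM2l (ltW z0) j1.
  have : z * (h0 * S ^+ 2) <= z * e by rewrite ler_pM2l//; clear -hD qe h00 p2 p3; lra.
  have wE : z * w = z * (S / 2) - z * e by rewrite /w; ring.
  by clear -wE; lra.
apply: (@le_trans _ _ ((1 + z * (S / 2 - e / 2)) * xs + k0 * g0 / 2 * z)).
  by rewrite lerD2r ler_wpM2r.
have kg : 0 < k0 * g0 by rewrite mulr_gt0.
have kvc : k0 * g0 * c <= k0 * v * c.
  by rewrite (ler_pM2r c0) (ler_pM2l k00).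
suff main : (S / 2 - e / 2) * xs + k0 * g0 / 2 <= v * (xs / 2 + k0 * c).
  by have := ler_wpM2l (ltW z0) main; clear; lra.
have kgc : k0 * g0 <= k0 * g0 * c by rewrite ler_pMr.
have [/vS kx|kx] := ltP K `|x|.
  have : (S - e) * xs <= v * xs by rewrite ler_wpM2r.
  by clear -kvc kgc kg; lra.
have xsl : xs * S <= k0 * g0 * c.
  have h1 : xs <= y ^+ 2 * c by exact: mul_sinh_le_cosh.
  have h2 : y ^+ 2 <= l0 * K ^+ 2.
    rewrite /y exprMn; apply: ler_pM; rewrite ?sqr_ge0//; first exact: le_trans ll.
    by rewrite sqr_le_norm.
  have h3 : y ^+ 2 * c * S <= l0 * K ^+ 2 * c * S.
    by rewrite ler_pM2r// ler_pM2r.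
  have h4 : l0 * (K ^+ 2 * S) * c <= k0 * g0 * c by rewrite ler_pM2r.
  have h5 : xs * S <= y ^+ 2 * c * S by rewrite ler_pM2r.
  by clear -h3 h4 h5; lra.
have : 0 <= v * xs by rewrite mulr_ge0// ltW.
have : 0 <= e * xs by rewrite mulr_ge0// ltW.
by clear -xsl kvc kgc kg; lra.
Qed.

(** * Exponential moments of the scheme *)

Section exponential_moments.
Context (R : realType) (d : measure_display) (Omega : measurableType d).
Context (P : probability Omega R) (F : R -> set_system Omega).
Context (B : R -> Omega -> R) (f : R * R -> R) (g : R -> R) (x0 G rho S : R).
Implicit Types (n k j : nat) (t l eps : R) (w : Omega) (A : set Omega).

Hypothesis PF : complete_filtered_probability_space P F.
Hypothesis BM : brownian_motion P F B.
Hypothesis f_lip : forall N : R, exists2 L : R, 0 < L & forall x y s t,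
  `|x| <= N -> `|y| <= N -> 0 <= s <= N -> 0 <= t <= N ->
  `|f (x, s) - f (y, t)| <= L * (`|x - y| + `|s - t|).
Hypothesis g_lip : forall N : R, exists2 L : R, 0 < L & forall x y,
  `|x| <= N -> `|y| <= N -> `|g x - g y| <= L * `|x - y|.
Hypothesis gG : forall x, `|g x| <= G.
Hypothesis rho0 : 0 < rho.
Hypothesis xf_le : forall x t, 0 <= t -> x * f (x, t) <= rho.
Hypothesis S0 : 0 < S.
Hypothesis g_tail : forall eps, 0 < eps -> exists2 K, 0 <= K &
  forall x, K < `|x| -> S - eps <= g x ^+ 2 <= S + eps.

Local Notation mw t := (measurable_wrt (F t)).
Local Notation e := (euler B f g x0).
Local Notation D := (drift f).
Local Notation dy := (dy R).
Local Notation mesh := (mesh R).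

Let eM n k : mw (dy n k) (e n k) := e_mw x0 PF BM f_lip g_lip n k.
Let geM n k : mw (dy n k) (fun w => g (e n k w)) := ge_mw x0 PF BM f_lip g_lip n k.
Let eSM n k : mw (dy n k) (fun w => e n k w + D n (e n k w) (dy n k) * mesh n) :=
  eS_mw x0 PF BM f_lip g_lip n k.

Lemma cube_le_exp2 n : n%:R ^+ 3 <= 16 * 2 ^+ n :> R.
Proof.
elim: n => [|n ih]; first by rewrite expr0 expr0n/=; lra.
have [n4|n4] := leqP 4 n; last first.
  by move: n n4 {ih} => [|[|[|[|n]]]]//= _; rewrite !exprS !expr0; lra.
have n4' : 4 <= n%:R :> R by rewrite ler_nat.
rewrite (exprS 2 n) -natr1; move: ih n4'.
move: (n%:R : R) (2 ^+ n : R) => x y ih x4.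
have h : 3 * x ^+ 2 + 3 * x + 1 <= x ^+ 3.
  have : 4 * x ^+ 2 <= x ^+ 3 by rewrite (exprS x 2) ler_wpM2r ?sqr_ge0.
  have : 4 * x <= x ^+ 2 by rewrite expr2 ler_wpM2r//; lra.
  by lra.
rewrite (_ : (x + 1) ^+ 3 = x ^+ 3 + (3 * x ^+ 2 + 3 * x + 1)); last by ring.
by lra.
Qed.

(** The quadratic estimate only bounds [n^2 * mesh n]; the cubic one gives [16 / n], which makes a
    squared drift step an arbitrarily small multiple of the mesh. *)
Lemma mesh_small h0 : 0 < h0 -> exists n0, forall n, (n0 <= n)%N ->
  mesh n <= h0 /\ n%:R ^+ 2 * mesh n <= h0.
Proof.
move=> h00; exists (Num.truncn (16 / h0)).+1 => n hn.
have n0 : 16 / h0 < n%:R by apply: lt_le_trans (truncnS_gt _) _; rewrite ler_nat.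
have n1 : 1 <= n%:R :> R by rewrite ler1n; exact: leq_ltn_trans hn.
have h16 : 16 < h0 * n%:R by rewrite mulrC -ltr_pdivrMr.
have h2 : n%:R ^+ 2 * mesh n <= h0.
  have : n%:R * (n%:R ^+ 2 * mesh n) <= 16.
    by rewrite mulrA -exprS ler_pdivrMr ?exprn_gt0// cube_le_exp2.
  move=> h; have : n%:R * (n%:R ^+ 2 * mesh n) <= n%:R * h0 by lra.
  by rewrite ler_pM2l//; lra.
split=> //; apply: le_trans h2; rewrite ler_peMl ?mesh_ge0//.
by rewrite exprn_ege1.
Qed.

Lemma measurable_cosh_comp (Y : Omega -> R) : measurable_fun setT Y ->
  measurable_fun setT (fun w => cosh (Y w)).
Proof. exact: (measurableT_comp (continuous_measurable_fun (@continuous_cosh R))). Qed.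

Lemma measurable_xsinh_comp (Y : Omega -> R) : measurable_fun setT Y ->
  measurable_fun setT (fun w => xsinh (Y w)).
Proof. exact: (measurableT_comp (continuous_measurable_fun (@continuous_xsinh R))). Qed.

Let eSE n k l w : l * e n k.+1 w = l * (e n k w + D n (e n k w) (dy n k) * mesh n)
  + l * g (e n k w) * (B (dy n k.+1) w - B (dy n k) w).
Proof. by rewrite /=; ring. Qed.

Let lh_ge0 C l n : 0 <= C -> 0 <= C * (l ^+ 2 * mesh n).
Proof. by move=> C0; apply: mulr_ge0 => //; rewrite mulr_ge0 ?sqr_ge0 ?mesh_ge0. Qed.

Let lY1 l n k : mw (dy n k) (fun w => l * (e n k w + D n (e n k w) (dy n k) * mesh n)).
Proof.
have d0 := dy_ge0 R n k.
by apply: (mwM PF d0); [exact: (mw_cst PF)|exact: eSM].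
Qed.

Let lY2 l n k : mw (dy n k) (fun w => l * g (e n k w)).
Proof.
have d0 := dy_ge0 R n k.
by apply: (mwM PF d0); [exact: (mw_cst PF)|exact: geM].
Qed.

Lemma cosh_growth eps : 0 < eps -> exists C n0, 0 <= C /\
  forall n l k A, (n0 <= n)%N -> 0 < l <= 1 -> F (dy n k) A ->
  (\int[P]_(w in A) (cosh (l * e n k.+1 w))%:E <=
   (1 + l ^+ 2 * mesh n * (S / 2 + eps))%:E * \int[P]_(w in A) (cosh (l * e n k w))%:E
   + (C * (l ^+ 2 * mesh n))%:E * P A)%E.
Proof.
have S0' := S0.
move=> eps0; have e4 : 0 < eps / 4 by lra.
have [K K0 gK] := g_tail e4.
have [C [h0 [C0 h00] H]] := cosh_step G rho0 K0 (ltW S0) e4.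
have [n0 hn0] := mesh_small h00.
exists C, n0; split=> // n l k A nn l01 FA.
have [m1 m2] := hn0 n nn.
have d0 := dy_ge0 R n k; have mA := filt_measurable PF d0 FA.
have me := mw_fun PF d0 (eM n k).
under eq_integral do rewrite eSE.
apply: le_trans (step_cosh PF BM d0 (dy_lt R n k) FA (lY1 l n k) (lY2 l n k)) _.
have mY1 := mw_fun PF d0 (lY1 l n k); have mY2 := mw_fun PF d0 (lY2 l n k).
have l0 : 0 < l by case/andP: l01.
have a0 : 0 <= l ^+ 2 * mesh n * (S / 2 + eps).
  by rewrite mulr_ge0 ?mulr_ge0 ?mesh_ge0 ?sqr_ge0//; lra.
apply: (@le_trans _ _ (\int[P]_(w in A) ((1 + l ^+ 2 * mesh n * (S / 2 + eps)) *
    cosh (l * e n k w) + C * (l ^+ 2 * mesh n))%:E)%E).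
  apply: integral_le => //.
  - apply: measurable_funM; first exact: measurable_cosh_comp.
    apply: (measurableT_comp (@measurable_expR R)).
    by do 2 apply: measurable_funM => //; exact: measurable_funX.
  - apply: measurable_funD => //; apply: measurable_funM => //.
    by apply: measurable_cosh_comp; exact: measurable_funM.
  - by move=> w _; rewrite mulr_ge0 ?expR_ge0// ltW// cosh_gt0.
  move=> w _; rewrite dyS_sub.
  have := H l (e n k w) (D n (e n k w) (dy n k)) (g (e n k w) ^+ 2) (mesh n) l01.
  rewrite mesh_gt0 m1 => /(_ erefl).
  have -> : (l * g (e n k w)) ^+ 2 * mesh n / 2 = l ^+ 2 * mesh n * g (e n k w) ^+ 2 / 2.
    by rewrite exprMn; ring.
  have -> : 4 * (eps / 4) = eps by field.
  apply.
  - by apply: le_trans m2; rewrite ler_wpM2r ?mesh_ge0// drift_sqr.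
  - by apply: clamp_mul_le => //; [exact: ltW|exact/xf_le/dy_ge0].
  - by rewrite sqr_ge0 (g_sqr gG).
  - by move=> /gK/andP[_ h]; lra.
rewrite integral_affine//.
- by apply: measurable_cosh_comp; exact: measurable_funM.
- by move=> w; exact/ltW/cosh_gt0.
- by rewrite addr_ge0.
- exact: lh_ge0.
Qed.

(** Evenness of [cosh] treats both signs at once, and [1 + a <= expR a] converts the product of the
    step factors into an exponential of the elapsed time. *)
Lemma euler_tail eps : 0 < eps -> exists C n0, 0 <= C /\
  forall n l b K, (n0 <= n)%N -> 0 < l <= 1 -> 0 < b ->
  (P [set w | exists2 k, (k <= K)%N & (b <= `|e n k w|)%R] <=
   (2 * expR (l ^+ 2 * (S / 2 + eps) * (K%:R * mesh n)) *
    (cosh (l * x0) + C * l ^+ 2 * (K%:R * mesh n)) * expR (- (l * b)))%:E)%E.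
Proof.
have S0' := S0.
move=> eps0; have [C [n0 [C0 H]]] := cosh_growth eps0.
exists C, n0; split=> // n l b K nn l01 b0.
have l0 : 0 < l by case/andP: l01.
set a := l ^+ 2 * mesh n * (S / 2 + eps).
have a0 : 0 <= a by rewrite mulr_ge0 ?mulr_ge0 ?mesh_ge0 ?sqr_ge0//; lra.
set c := C * (l ^+ 2 * mesh n).
have c0 : 0 <= c by exact: lh_ge0.
have mel k : measurable_fun setT (fun w => cosh (l * e n k w)).
  by apply: measurable_cosh_comp; apply: measurable_funM => //; exact: (mw_fun PF (dy_ge0 R n k)).
apply: (@le_trans _ _ (P [set w | exists2 k, (k <= K)%N &
    (cosh (l * b) <= cosh (l * e n k w))%R])).
  rewrite le_measure ?inE//.
  - apply: measurable_ex_le => k _; apply: measurableT_comp => //.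
    exact: (mw_fun PF (dy_ge0 R n k)).
  - exact: measurable_ex_le.
  move=> w [k kK h]; exists k => //; apply: ler_cosh.
  by rewrite !normrM (gtr0_norm l0) (gtr0_norm b0) ler_pM2l.
have := @almost_supermartingale_maximal R d Omega P F PF (fun k => dy n k)
  (fun k w => cosh (l * e n k w)) a c (cosh (l * b)) (cosh (l * x0)) K.
move=> /(_ (fun k => dy_ge0 R n k) (fun k => ltW (dy_lt R n k)) (fun k w => ltW (cosh_gt0 _))).
move=> H2; apply: le_trans (H2 _ a0 c0 (cosh_gt0 _) _ _) _.
- move=> k _; have d0 := dy_ge0 R n k.
  apply: (@mw_ccomp _ _ _ F (dy n k) (fun x => cosh (l * x))) => //.
  by move=> x; apply: continuous_comp; [exact: mulrl_continuous|exact: continuous_cosh].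
- by rewrite /= integral_const// probability_setT mule1.
- move=> k A kK FA; apply: le_trans (H n l k A nn l01 FA) _; apply: leeD => //.
  have mA := filt_measurable PF (dy_ge0 R n k) FA.
  by rewrite -[leRHS]mule1 lee_wpmul2l// probability_le1.
rewrite lee_fin.
have h1 : (1 + a) ^+ K <= expR (l ^+ 2 * (S / 2 + eps) * (K%:R * mesh n)).
  rewrite (_ : _ * (K%:R * _) = K%:R * a); last by rewrite /a; ring.
  by rewrite expRM_natl// lerXn2r ?nnegrE ?expR_ge0 ?addr_ge0// expR_ge1Dx.
have h2 : (cosh (l * b))^-1 <= 2 * expR (- (l * b)).
  have lb0 : 0 <= l * b by rewrite mulr_ge0// ltW.
  have := expR_norm_le_cosh (l * b); rewrite ger0_norm// => hb.
  have cb := cosh_gt0 (l * b).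
  by rewrite expRN -[leLHS]mul1r ler_pdivrMr// mulrAC ler_pdivlMr ?expR_gt0// mul1r.
have -> : K%:R * c = C * l ^+ 2 * (K%:R * mesh n) by rewrite /c; ring.
set v := cosh (l * x0) + _.
have v0 : 0 <= v.
  rewrite addr_ge0 ?(ltW (cosh_gt0 _))//.
  by apply: mulr_ge0; rewrite mulr_ge0 ?sqr_ge0 ?mesh_ge0.
rewrite (_ : 2 * _ * v * _ = expR (l ^+ 2 * (S / 2 + eps) * (K%:R * mesh n)) * v *
  (2 * expR (- (l * b)))); last by ring.
apply: ler_pM => //.
- by rewrite mulr_ge0// exprn_ge0// addr_ge0.
- by rewrite invr_ge0 ltW// cosh_gt0.
- by rewrite ler_wpM2r.
Qed.

Lemma cosh_moment eps : 0 < eps -> exists C n0, 0 <= C /\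
  forall n l k j A N, (n0 <= n)%N -> 0 < l <= 1 -> F (dy n k) A ->
  (forall w, A w -> `|e n k w| <= N) ->
  (\int[P]_(w in A) (cosh (l * e n (k + j) w))%:E <=
   (expR (l ^+ 2 * (S / 2 + eps) * (j%:R * mesh n)) *
    (cosh (l * N) + C * l ^+ 2 * (j%:R * mesh n)))%:E * P A)%E.
Proof.
have S0' := S0.
move=> eps0; have [C [n0 [C0 H]]] := cosh_growth eps0.
exists C, n0; split=> // n l k j A N nn l01 FA AN.
have l0 : 0 < l by case/andP: l01.
have d0 := dy_ge0 R n k; have mA := filt_measurable PF d0 FA.
set a := S / 2 + eps; have a0 : 0 < a by rewrite /a; lra.
set h := mesh n; have h0 : 0 < h by exact: mesh_gt0.
have l2h : 0 < l ^+ 2 * h by rewrite mulr_gt0// exprn_gt0.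
pose p := fine (P A).
have PA : P A = p%:E by rewrite fineK// fin_num_measure.
have p0 : 0 <= p by rewrite fine_ge0.
rewrite PA; elim: j => [|j ih].
  rewrite addn0 mul0r !mulr0 expR0 mul1r addr0 -PA -integral_const//.
  have me := mw_fun PF d0 (eM n k).
  apply: integral_le => //.
  - by apply: measurable_cosh_comp; exact: measurable_funM.
  - by move=> w _; exact/ltW/cosh_gt0.
  move=> w Aw; apply: ler_cosh; rewrite !normrM ler_wpM2l//.
  by apply: le_trans (AN w Aw) _; exact: ler_norm.
rewrite addnS; apply: le_trans (H n l (k + j)%N A nn l01 _) _.
  by apply: (filt_mono PF d0) FA; apply: dy_homo; exact: leq_addr.
rewrite -/h -/a PA -[in X in (_ + X)%E]EFinM.
set E := expR _ in ih; set Cj := C * l ^+ 2 * _ in ih.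
have c1 := cosh_gt0 (l * N).
have Cj0 : 0 <= Cj.
  by apply: mulr_ge0; [rewrite mulr_ge0 ?sqr_ge0|rewrite mulr_ge0// ltW].
have lha : 0 <= l ^+ 2 * h * a by rewrite mulr_ge0// ltW.
apply: (@le_trans _ _ ((1 + l ^+ 2 * h * a)%:E * ((E * (cosh (l * N) + Cj))%:E * p%:E)
    + (C * (l ^+ 2 * h) * p)%:E)%E).
  by apply: leeD => //; apply: lee_wpmul2l => //; rewrite lee_fin addr_ge0.
rewrite -!EFinM -EFinD lee_fin.
have E1 : 1 <= E.
  by rewrite /E -expR0 ler_expR mulr_ge0// ?mulr_ge0// ?sqr_ge0// ltW.
have -> : expR (l ^+ 2 * a * (j.+1%:R * h)) = expR (l ^+ 2 * h * a) * E.
  by rewrite /E -expRD -natr1; congr expR; ring.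
have -> : C * l ^+ 2 * (j.+1%:R * h) = Cj + C * (l ^+ 2 * h).
  by rewrite /Cj -natr1; ring.
rewrite (mulrA _ _ p) -mulrDl; apply: ler_wpM2r => //.
have X1 := expR_ge1Dx (l ^+ 2 * h * a).
have Cl : 0 <= C * (l ^+ 2 * h) by rewrite mulr_ge0// ltW.
have V0 : 0 <= cosh (l * N) + Cj by rewrite addr_ge0// ltW.
have k1 : (1 + l ^+ 2 * h * a) * (E * (cosh (l * N) + Cj)) <=
    expR (l ^+ 2 * h * a) * (E * (cosh (l * N) + Cj)).
  by rewrite ler_wpM2r// mulr_ge0//; lra.
have k2 : C * (l ^+ 2 * h) <= expR (l ^+ 2 * h * a) * E * (C * (l ^+ 2 * h)).
  by rewrite ler_peMl// mulr_ege1//; lra.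
rewrite [leRHS](_ : _ = expR (l ^+ 2 * h * a) * (E * (cosh (l * N) + Cj)) +
  expR (l ^+ 2 * h * a) * E * (C * (l ^+ 2 * h))); last by ring.
exact: lerD.
Qed.

Section lower.
Context (m g0 : R).
Hypothesis m0 : 0 <= m.
Hypothesis m1 : m < 2^-1.
Hypothesis g00 : 0 < g0.
Hypothesis g_ge : forall x, g0 <= g x ^+ 2.
Hypothesis xf_ge : forall x t, 0 <= t -> - (m * g x ^+ 2) <= x * f (x, t).

Lemma xsinh_growth eps : 0 < eps -> eps <= S / 2 ->
  exists l0 kap n0, [/\ 0 < l0, l0 <= 1, 0 < kap &
  forall n l k A, (n0 <= n)%N -> 0 < l <= l0 -> F (dy n k) A ->
  ((expR (l ^+ 2 * mesh n * (S / 2 - eps)))%:E * \int[P]_(w in A) (xsinh (l * e n k w))%:E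
   + (kap * (l ^+ 2 * mesh n))%:E * P A <=
   \int[P]_(w in A) (xsinh (l * e n k.+1 w))%:E)%E].
Proof.
have S0' := S0.
move=> eps0 epsS; have [K K0 gK] := g_tail eps0.
have [l0 [h0 [kap [l00 l01 h00 kap0] H]]] := xsinh_step G m0 m1 K0 eps0 epsS g00.
have [n0 hn0] := mesh_small h00.
exists l0, kap, n0; split=> // n l k A nn ll FA.
have [m1' m2] := hn0 n nn.
have d0 := dy_ge0 R n k; have mA := filt_measurable PF d0 FA.
have me := mw_fun PF d0 (eM n k).
under [leRHS]eq_integral do rewrite eSE.
apply: le_trans (step_xsinh PF BM d0 (dy_lt R n k) FA (lY1 l n k) (lY2 l n k)).
have mY1 := mw_fun PF d0 (lY1 l n k); have mY2 := mw_fun PF d0 (lY2 l n k).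
have mE : measurable_fun setT (fun w => expR ((l * g (e n k w)) ^+ 2 * (dy n k.+1 - dy n k) / 2)).
  apply: (measurableT_comp (@measurable_expR R)).
  by do 2 apply: measurable_funM => //; exact: measurable_funX.
have mX : measurable_fun setT (fun w => xsinh (l * e n k w)).
  by apply: measurable_xsinh_comp; exact: measurable_funM.
rewrite -integral_affine//; last 2 first.
- by move=> w; exact: xsinh_ge0.
- exact/lh_ge0/ltW.
apply: integral_le => //.
- by apply: measurable_funD => //; exact: measurable_funM.
- apply: measurable_funD.
    by apply: measurable_funM => //; exact: measurable_xsinh_comp.
  apply: measurable_funM; last exact: measurable_cosh_comp.
  by apply: measurable_funM => //; exact: measurable_funB.
- move=> w _; rewrite addr_ge0//.
    by rewrite mulr_ge0 ?expR_ge0 ?xsinh_ge0.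
  exact/lh_ge0/ltW.
move=> w _; rewrite dyS_sub.
have := H l (e n k w) (D n (e n k w) (dy n k)) (g (e n k w) ^+ 2) (mesh n) ll.
rewrite mesh_gt0 m1' => /(_ erefl).
have -> : (l * g (e n k w)) ^+ 2 * mesh n / 2 = l ^+ 2 * mesh n * g (e n k w) ^+ 2 / 2.
  by rewrite exprMn; ring.
apply.
- by apply: le_trans m2; rewrite ler_wpM2r ?mesh_ge0// drift_sqr.
- apply: clamp_mul_ge => //; first by rewrite mulr_ge0// sqr_ge0.
  exact/xf_ge/dy_ge0.
- by rewrite g_ge (g_sqr gG).
- by move=> /gK/andP[h _].
Qed.

(** The starting value is discarded, so the bound is uniform in the starting point and holds even
    from 0: the growth is seeded by the additive gain of each step, summed as a geometric series. *)
Lemma xsinh_moment eps : 0 < eps -> eps < S / 2 ->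
  exists l0 kap n0, [/\ 0 < l0, l0 <= 1, 0 < kap &
  forall n l k j A, (n0 <= n)%N -> 0 < l <= l0 -> F (dy n k) A ->
  ((kap * (expR (l ^+ 2 * (S / 2 - eps) * (j%:R * mesh n)) - 1))%:E * P A <=
   \int[P]_(w in A) (xsinh (l * e n (k + j) w))%:E)%E].
Proof.
have S0' := S0.
move=> eps0 epsS; have [l0 [kap [n1 [l00 l01 kap0 H]]]] := xsinh_growth eps0 (ltW epsS).
set a := S / 2 - eps in H *; have a0 : 0 < a by rewrite /a; lra.
(* For meshes below this, [q <= 1 + 2 l^2 h a], so the gain [kap * (l^2 h)] of a step covers
   [kap / (2 a) * (q - 1)]. *)
have a2 : 0 < (2 * a)^-1 by rewrite invr_gt0; lra.
have [n2 hn2] := mesh_small a2.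
exists l0, (kap / (2 * a)), (maxn n1 n2); split=> //; first by rewrite divr_gt0//; lra.
move=> n l k j A; rewrite geq_max => /andP[nn1 nn2] ll FA.
have [hm _] := hn2 n nn2; have /andP[l_0 ll0] := ll.
have d0 := dy_ge0 R n k; have mA := filt_measurable PF d0 FA.
set h := mesh n; have h0 : 0 < h by exact: mesh_gt0.
have l2h : 0 < l ^+ 2 * h by rewrite mulr_gt0// exprn_gt0.
pose p := fine (P A).
have PA : P A = p%:E by rewrite fineK// fin_num_measure.
have p0 : 0 <= p by rewrite fine_ge0.
rewrite PA; elim: j => [|j ih].
  rewrite mul0r mulr0 expR0 subrr mulr0 mul0e.
  by apply: integral_ge0 => w _; rewrite lee_fin xsinh_ge0.
rewrite addnS; apply: le_trans (H n l (k + j)%N A nn1 ll _); last first.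
  by apply: (filt_mono PF d0) FA; apply: dy_homo; exact: leq_addr.
rewrite -/h PA; set E := expR _ in ih; set q := expR (l ^+ 2 * h * a).
apply: (@le_trans _ _ (q%:E * ((kap / (2 * a) * (E - 1))%:E * p%:E)
    + (kap * (l ^+ 2 * h))%:E * p%:E)%E); last first.
  by apply: leeD => //; apply: lee_wpmul2l => //; rewrite lee_fin expR_ge0.
rewrite -!EFinM -EFinD lee_fin.
have -> : expR (l ^+ 2 * a * (j.+1%:R * h)) = q * E.
  by rewrite /q /E -expRD -natr1; congr expR; ring.
have w0 : 0 <= l ^+ 2 * h * a by rewrite mulr_ge0// ltW.
have w1 : l ^+ 2 * h * a <= 2^-1.
  have : l ^+ 2 * h <= (2 * a)^-1.
    apply: le_trans hm; rewrite ler_piMl ?(ltW h0)// expr_le1 ?(ltW l_0)//.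
    exact: le_trans l01.
  by rewrite -(ler_pM2r a0) invfM mulrVK// unitfE gt_eqF.
have q2 : q <= 1 + 2 * (l ^+ 2 * h * a).
  apply: le_trans (expR_le_quad w0 w1) _; rewrite expr2.
  have := ler_wpM2l w0 w1; lra.
rewrite (mulrA q) -mulrDl; apply: ler_wpM2r => //.
rewrite -lerBlDl (_ : _ - _ = kap / (2 * a) * (q - 1)); last by ring.
rewrite [leRHS](_ : _ = kap / (2 * a) * (2 * (l ^+ 2 * h * a))); last first.
  by field; rewrite gt_eqF.
by rewrite ler_wpM2l//; [rewrite divr_ge0// ?ltW//; lra|lra].
Qed.

End lower.
End exponential_moments.

(** * The upper bound in the law of the iterated logarithm *)

Section upper_lil.
Context (R : realType) (d : measure_display) (Omega : measurableType d).
Context (P : probability Omega R) (F : R -> set_system Omega).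
Context (B : R -> Omega -> R) (f : R * R -> R) (g : R -> R) (x0 G rho S : R).
Implicit Types (n k j : nat) (t l eps : R) (w : Omega) (A : set Omega).

Hypothesis PF : complete_filtered_probability_space P F.
Hypothesis BM : brownian_motion P F B.
Hypothesis f_lip : forall N : R, exists2 L : R, 0 < L & forall x y s t,
  `|x| <= N -> `|y| <= N -> 0 <= s <= N -> 0 <= t <= N ->
  `|f (x, s) - f (y, t)| <= L * (`|x - y| + `|s - t|).
Hypothesis g_lip : forall N : R, exists2 L : R, 0 < L & forall x y,
  `|x| <= N -> `|y| <= N -> `|g x - g y| <= L * `|x - y|.
Hypothesis gG : forall x, `|g x| <= G.
Hypothesis rho0 : 0 < rho.
Hypothesis xf_le : forall x t, 0 <= t -> x * f (x, t) <= rho.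
Hypothesis S0 : 0 < S.
Hypothesis g_tail : forall eps, 0 < eps -> exists2 K, 0 <= K &
  forall x, K < `|x| -> S - eps <= g x ^+ 2 <= S + eps.

Local Notation mw t := (measurable_wrt (F t)).
Local Notation e := (euler B f g x0).
Local Notation EX := (euler_path B f g x0).
Local Notation dy := (dy R).
Local Notation mesh := (mesh R).

Variables (X : R -> Omega -> R) (nn : nat -> nat) (NB : set Omega).
Hypothesis cX : continuous_process X.
Hypothesis aX : adapted F X.
Hypothesis nnj : forall j, (j <= nn j)%N.
Hypothesis mNB : measurable NB.
Hypothesis PNB : P NB = 0%E.
Hypothesis near_X : forall w, ~ NB w -> exists J, forall j, (J <= j)%N ->
  forall t, 0 <= t <= j%:R -> `|EX (nn j) t w - X t w| <= 2 * mesh j.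

Lemma mesh_lt (c : R) : 0 < c -> exists N, forall n, (N <= n)%N -> mesh n < c.
Proof.
move=> c0; have [N _ HN] : \forall k \near \oo, mesh k < c.
  have /cvgrPdist_lt/(_ _ c0) := @mesh_cvg0 R.
  by apply: filterS => k; rewrite sub0r normrN ger0_norm// mesh_ge0.
by exists N.
Qed.

Definition exceeds T (b : R) : set Omega :=
  [set w | exists M i, dy M i <= T /\ b < `|X (dy M i) w|].

Lemma exceeds_measurable T b : measurable (exceeds T b).
Proof.
rewrite [X in measurable X](_ : _ = \bigcup_M \bigcup_(i in [set i | dy M i <= T])
   ~` [set w | `|X (dy M i) w| <= b]).
  apply: bigcup_measurable => M _; apply: bigcup_measurable => i _.
  apply: measurableC; apply: (filt_measurable PF (dy_ge0 R M i)).
  apply: filt_le; first exact: dy_ge0.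
  by apply: mw_norm; [exact: dy_ge0|exact/aX/dy_ge0].
apply/seteqP; split => w.
  by move=> [M [i [h1 h2]]]; exists M => //; exists i => //=; apply/negP; rewrite -ltNge.
by move=> [M _ [i /= h1 /negP]]; rewrite -ltNge => h2; exists M, i.
Qed.

(** The strict inequality in [exceeds] leaves room: if [X] exceeds [b] at a dyadic time, all late
    schemes reach [b] there. Up to [NB] the event therefore lies in the lower limit of the events
    [V j], and their common bound passes to it. *)
Lemma path_tail eps : 0 < eps -> exists2 C, 0 <= C & forall l b T,
  0 < l <= 1 -> 0 < b -> 0 <= T ->
  (P (exceeds T b) <= (2 * expR (l ^+ 2 * (S / 2 + eps) * T) *
    (cosh (l * x0) + C * l ^+ 2 * T) * expR (- (l * b)))%:E)%E.
Proof.
move=> eps0; have S0' := S0.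
have [C [n0 [C0 H]]] := euler_tail x0 PF BM f_lip g_lip gG rho0 xf_le S0 g_tail eps0.
exists C => // l b T l01 b0 T0; set bd := (_%:E : \bar R).
have l0 : 0 < l by case/andP: l01.
pose K j := Num.truncn (T * 2 ^+ nn j).
pose V j := [set w | exists2 k, (k <= K j)%N & (b <= `|e (nn j) k w|)%R].
have mV j : measurable (V j).
  apply: measurable_ex_le => k _; apply: measurableT_comp => //.
  apply: (mw_fun PF (dy_ge0 R (nn j) k)); exact: (e_mw x0 PF BM f_lip g_lip).
have KT j : (K j)%:R * mesh (nn j) <= T.
  by rewrite ler_pdivrMr ?exprn_gt0// truncn_le mulr_ge0// exprn_ge0.
have PV j : (n0 <= j)%N -> (P (V j) <= bd)%E.
  move=> nj; apply: le_trans (H (nn j) l b (K j) (leq_trans nj (nnj j)) l01 b0) _.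
  have a0 : 0 <= l ^+ 2 * (S / 2 + eps) by rewrite mulr_ge0 ?sqr_ge0//; lra.
  have K0 : 0 <= (K j)%:R * mesh (nn j) by rewrite mulr_ge0// mesh_ge0.
  have Cl : 0 <= C * l ^+ 2 by rewrite mulr_ge0// sqr_ge0.
  rewrite lee_fin; apply: ler_wpM2r; first exact: expR_ge0.
  apply: ler_pM.
  - by rewrite mulr_ge0// expR_ge0.
  - by apply: addr_ge0; [exact/ltW/cosh_gt0|exact: mulr_ge0].
  - by rewrite ler_pM2l// ler_expR ler_wpM2l.
  - by rewrite lerD2l ler_wpM2l.
pose U J := \bigcap_(j in [set j | (J <= j)%N]) V j.
have mU J : measurable (U J) by apply: bigcap_measurableType => j _; exact: mV.
have PU : (P (\bigcup_J U J) <= bd)%E.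
  apply: measure_union_le => //.
    by move=> J w h j /= Jj; apply: h; exact: ltnW.
  move=> J; apply: le_trans (PV (maxn J n0) (leq_maxr _ _)).
  by rewrite le_measure ?inE// => w h; apply: h; exact: leq_maxl.
have mUU : measurable (\bigcup_J U J) by exact: bigcup_measurable.
apply: (@le_trans _ _ (P (NB `|` \bigcup_J U J))).
  rewrite le_measure ?inE//; [exact: exceeds_measurable|exact: measurableU|].
  move=> w [M [i [iT bX]]]; have [NBw|NBw] := pselect (NB w); first by left.
  right; have [J hJ] := near_X NBw.
  have s0 : 0 < (`|X (dy M i) w| - b) / 2 by lra.
  have [N HN] := mesh_lt s0.
  exists (maxn (maxn J N) (maxn M (Num.truncn (dy M i)).+1)) => // j /=.
  rewrite !geq_max => /andP[/andP[Jj Nj] /andP[Mj tj]].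
  have tj' : dy M i < j%:R by apply: lt_le_trans (truncnS_gt _) _; rewrite ler_nat.
  have Mn : (M <= nn j)%N by exact: leq_trans Mj (nnj j).
  exists (i * 2 ^ (nn j - M))%N.
    rewrite /K truncn_ge_nat; last by rewrite mulr_ge0// exprn_ge0.
    by rewrite -ler_pdivrMr ?exprn_gt0//; rewrite (dy_refine R i Mn) in iT.
  have kn : (i * 2 ^ (nn j - M) < nn j * 2 ^ nn j)%N.
    rewrite -(ltr_nat R) -(ltr_pM2r (mesh_gt0 R (nn j))) -/(dy (nn j) _) -(dy_refine R i Mn).
    rewrite -/(dy (nn j) _) dy_nat; apply: lt_le_trans tj' _.
    by rewrite ler_nat.
  have := hJ j Jj (dy M i); rewrite dy_ge0 (ltW tj') => /(_ erefl).
  rewrite {1}(dy_refine R i Mn) euler_path_dy// => h.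
  have hm := HN j Nj.
  have := ler_normB (e (nn j) (i * 2 ^ (nn j - M)) w)
    (e (nn j) (i * 2 ^ (nn j - M)) w - X (dy M i) w).
  by rewrite subKr; lra.
apply: le_trans (measureU2 _ _ _) _ => //.
rewrite -[leRHS]add0e; apply: leeD => //.
by rewrite le_eqVlt; apply/orP; left; apply/eqP; exact: PNB.
Qed.

Lemma ln_succ_ge n : (n.+2%:R : R)^-1 <= ln n.+2%:R - ln n.+1%:R.
Proof.
have n1 : 0 < n.+1%:R :> R by [].
have n2 : 0 < n.+2%:R :> R by [].
rewrite -ln_div ?posrE//.
have := @le_ln1Dx R (- n.+2%:R^-1).
have h1 : n.+2%:R^-1 < 1 :> R by rewrite invf_lt1 ?posrE// ltr1n.
rewrite ltrN2 h1 => /(_ erefl).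
have -> : 1 + - n.+2%:R^-1 = n.+1%:R / n.+2%:R :> R.
  by rewrite -[n.+2%:R]natr1 in n2 *; field; rewrite gt_eqF.
have -> : n.+2%:R / n.+1%:R = (n.+1%:R / n.+2%:R)^-1 :> R by rewrite invf_div.
by rewrite lnV ?posrE ?divr_gt0// lerNr.
Qed.

(* Telescoping: [n^-(1+y)] is at most [1/y] times the increment of [- n^-y]. *)
Lemma power_sum_bound (r y : R) n1 N : 0 < r -> 0 < y ->
  \sum_(n < N) expR (- ((1 + y) * ln (r * (n + n1).+2%:R))) <=
  expR (- (y * ln (r * n1.+1%:R))) / (r * y).
Proof.
move=> r0 y0; pose phi n := expR (- (y * ln (r * n.+1%:R))).
have step n : expR (- ((1 + y) * ln (r * n.+2%:R))) <= (phi n - phi n.+1) / (r * y).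
  have p1 : 0 < r * n.+1%:R by rewrite mulr_gt0.
  have p2 : 0 < r * n.+2%:R by rewrite mulr_gt0.
  have E : phi n = phi n.+1 * expR (y * (ln n.+2%:R - ln n.+1%:R)).
    rewrite /phi -expRD; congr expR.
    by rewrite !lnM ?posrE//; ring.
  have h := expR_ge1Dx (y * (ln n.+2%:R - ln n.+1%:R)).
  have ph : 0 < phi n.+1 by exact: expR_gt0.
  have -> : expR (- ((1 + y) * ln (r * n.+2%:R))) = phi n.+1 / (r * n.+2%:R).
    rewrite mulrDl mul1r opprD expRD [expR (- ln _)]expRN lnK ?posrE// mulrC.
    by [].
  rewrite ler_pdivlMr ?mulr_gt0//.
  have -> : phi n.+1 / (r * n.+2%:R) * (r * y) = phi n.+1 * (y / n.+2%:R).
    by field; rewrite !gt_eqF.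
  have k1 := ln_succ_ge n.
  have : phi n.+1 * (y / n.+2%:R) <= phi n.+1 * (y * (ln n.+2%:R - ln n.+1%:R)).
    by rewrite ler_pM2l// ler_pM2l.
  have : phi n.+1 * (1 + y * (ln n.+2%:R - ln n.+1%:R)) <= phi n.
    by rewrite E ler_pM2l.
  set q := y / n.+2%:R; set z := y * (ln n.+2%:R - ln n.+1%:R).
  by rewrite mulrDr mulr1; lra.
have ry : 0 < r * y by rewrite mulr_gt0.
apply: (@le_trans _ _ ((phi n1 - phi (N + n1)%N) / (r * y))); last first.
  by rewrite ler_pM2r ?invr_gt0// gerBl expR_ge0.
elim: N => [|N ih]; first by rewrite big_ord0 add0n subrr mul0r.
rewrite big_ord_recr/=; apply: le_trans (lerD ih (step _)) _.
by rewrite -mulrDl addSn addrA subrK.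
Qed.

Lemma nneseries_bounded (a : nat -> R) (M : R) : (forall n, 0 <= a n) ->
  (forall N, \sum_(n < N) a n <= M) -> (\sum_(n <oo) (a n)%:E < +oo)%E.
Proof.
move=> a0 aM; apply: (@le_lt_trans _ _ M%:E); last by rewrite ltry.
apply: lime_le; first by apply: is_cvg_nneseries => n _ _; rewrite lee_fin.
by apply: nearW => N; rewrite /= sumEFin big_mkord lee_fin.
Qed.

(** On the block from [T n] to [T n.+1] the path is compared with the level at the start of the
    block. The ratio [1 + x] of the times, the rate [beta] and the required exponent each cost a
    factor [1 + x], and the choice of [x] affords all three. *)
Lemma upper_lil (c : R) : 0 < c -> S < c ^+ 2 ->
  {ae P, forall w, exists T0, forall t, T0 <= t ->
    `|X t w| <= c * Num.sqrt (2 * t * ln (ln t))}.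
Proof.
move=> c0 Sc; have S0' := S0.
(* For [x <= 1] one has [(1 + x)^3 <= 1 + 7 x], hence the 7. *)
pose x := Num.min 1 ((c ^+ 2 / S - 1) / 7).
have cS : 1 < c ^+ 2 / S by rewrite ltr_pdivlMr// mul1r.
have x_gt0 : 0 < x by rewrite lt_min ltr01/= divr_gt0//; lra.
have [x1 xc] : x <= 1 /\ x <= (c ^+ 2 / S - 1) / 7 by rewrite /x !ge_min !lexx orbT.
have x3 : S * (1 + x) ^+ 3 <= c ^+ 2.
  rewrite -ler_pdivlMl// mulrC; apply: (@le_trans _ _ (1 + 7 * x)); last by lra.
  have x2 : x ^+ 2 <= x by rewrite expr2 ger_pMr.
  have x3' : x ^+ 3 <= x by rewrite exprS (le_trans _ x2)// expr2 ler_pM2l// (le_trans x2).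
  rewrite (_ : (1 + x) ^+ 3 = 1 + 3 * x + 3 * x ^+ 2 + x ^+ 3); last by ring.
  by lra.
pose r := ln (1 + x); have r0 : 0 < r by rewrite ln_gt0//; lra.
have er : expR r = 1 + x by rewrite lnK// posrE; lra.
pose eps := x * S / 2; have eps0 : 0 < eps by rewrite divr_gt0// mulr_gt0.
have [C C0 HC] := path_tail eps0.
pose beta := S / 2 + eps.
have betaE : beta = (1 + x) * S / 2 by rewrite /beta /eps; field.
have beta0 : 0 < beta by rewrite betaE divr_gt0// mulr_gt0//; lra.
pose T n := expR (r * n%:R); pose L n := ln (r * n%:R).
have T0 n : 0 < T n by exact: expR_gt0.
have TS n : T n.+1 = (1 + x) * T n by rewrite /T -natr1 mulrDr mulr1 expRD er mulrC.
pose b n := c * Num.sqrt (2 * T n * L n).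
(* From [n1] on, [L n >= 1] and [T n] is large enough against [L n] for the tilt [l] below to be at
   most 1, as [path_tail] requires. *)
pose n1 := (Num.truncn (Num.max (expR 1) (c ^+ 2 / beta ^+ 2) / r)).+1.
have hn1 n : (n1 <= n)%N -> expR 1 <= r * n%:R /\ c ^+ 2 / beta ^+ 2 <= r * n%:R.
  move=> hn; have : Num.max (expR 1) (c ^+ 2 / beta ^+ 2) / r < n%:R.
    by apply: lt_le_trans (truncnS_gt _) _; rewrite ler_nat.
  by rewrite ltr_pdivrMr// gt_max mulrC => /andP[/ltW ? /ltW ?].
have e1 : 1 < expR 1 :> R by rewrite -expR0 ltr_expR.
have L1 n : (n1 <= n)%N -> 1 <= L n.
  move=> /hn1[h _]; rewrite -[1]expRK ler_ln ?posrE ?expR_gt0//.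
  by apply: lt_le_trans h; exact: expR_gt0.
(* Half of the surplus exponent is spent on the prefactor, which grows like [L n]; the other half
   makes the series converge. *)
pose y := x / 2; have y0 : 0 < y by rewrite /y; lra.
pose C' := C * c ^+ 2 / (2 * beta ^+ 2).
have C'0 : 0 <= C' by apply: divr_ge0; rewrite mulr_ge0 ?sqr_ge0.
pose M := 2 * (cosh x0 + C' / y).
have M0 : 0 <= M.
  by apply: mulr_ge0 => //; apply: addr_ge0; [exact/ltW/cosh_gt0|rewrite divr_ge0// ltW].
have PU n : (n1 <= n)%N ->
    (P (exceeds (T n.+1) (b n)) <= (M * expR (- ((1 + y) * L n)))%:E)%E.
  move=> nn1; have [h1 h2] := hn1 n nn1; have Ln := L1 n nn1.
  have rn0 : 0 < r * n%:R by exact: lt_le_trans (expR_gt0 _) h1.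
  have Ln0 : 0 < L n by exact: lt_le_trans Ln.
  have TL0 : 0 < 2 * T n * L n by rewrite !mulr_gt0.
  have x10 : 0 < 1 + x by exact: addr_gt0.
  have b0 : 0 < b n by rewrite mulr_gt0// sqrtr_gt0.
  have b2 : b n ^+ 2 = c ^+ 2 * (2 * T n * L n) by rewrite exprMn sqr_sqrtr// ltW.
  have TT0 := T0 n.+1; have Tn0 := T0 n.
  (* The minimizer of [l^2 beta T n.+1 - l b n], with value [- c^2 L n / (S (1 + x)^2)]. *)
  pose l := b n / (2 * beta * T n.+1).
  have l0 : 0 < l by rewrite divr_gt0// !mulr_gt0.
  have LT : c ^+ 2 * L n <= 2 * beta ^+ 2 * T n.
    have k1 : L n <= r * n%:R by exact/ltW/ln_sublinear.
    have k2 : (r * n%:R) ^+ 2 / 2 <= T n.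
      have := @expR_ge1Dxn R (r * n%:R) 1 (ltW rn0).
      by rewrite (_ : 2`!%:R = 2 :> R)// /T; lra.
    have k3 : c ^+ 2 <= beta ^+ 2 * (r * n%:R).
      by rewrite mulrC -ler_pdivrMr// exprn_gt0.
    have k4 : c ^+ 2 * L n <= c ^+ 2 * (r * n%:R) by rewrite ler_wpM2l// sqr_ge0.
    have k5 : c ^+ 2 * (r * n%:R) <= beta ^+ 2 * (r * n%:R) * (r * n%:R).
      by rewrite ler_wpM2r// ltW.
    have k6 : beta ^+ 2 * ((r * n%:R) ^+ 2 / 2) <= beta ^+ 2 * T n.
      by rewrite ler_pM2l// exprn_gt0.
    by rewrite expr2 in k6; lra.
  have Tle : T n <= T n.+1 by rewrite TS ler_peMl ?(ltW Tn0)// lerDl ltW.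
  have l1 : l <= 1.
    rewrite ler_pdivrMr ?mul1r ?mulr_gt0//.
    rewrite -[leLHS]ger0_norm ?(ltW b0)// -[leRHS]ger0_norm; last by rewrite !mulr_ge0// ltW.
    rewrite -ler_sqr ?nnegrE// !real_normK ?num_real// b2.
    have k1 : c ^+ 2 * L n * (2 * T n) <= 2 * beta ^+ 2 * T n * (2 * T n).
      by rewrite ler_pM2r// mulr_gt0.
    have k2 : beta ^+ 2 * (T n ^+ 2) <= beta ^+ 2 * T n.+1 ^+ 2.
      by rewrite ler_pM2l ?exprn_gt0// sqr_le_norm// gtr0_norm.
    rewrite (_ : (2 * beta * T n.+1) ^+ 2 = 4 * (beta ^+ 2 * T n.+1 ^+ 2)); last by ring.
    by rewrite expr2 in k2; lra.
  apply: le_trans (HC l (b n) (T n.+1) (introT andP (conj l0 l1)) b0 (ltW TT0)) _.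
  rewrite lee_fin -/beta.
  have lb : l ^+ 2 * beta * T n.+1 - l * b n <= - ((1 + x) * L n).
    have -> : l ^+ 2 * beta * T n.+1 - l * b n = - (c ^+ 2 * L n / (S * (1 + x) ^+ 2)).
      rewrite /l exprMn (_ : b n / _ * b n = b n ^+ 2 / (2 * beta * T n.+1)); last first.
        by rewrite expr2; ring.
      rewrite b2 TS betaE; field.
      by rewrite !gt_eqF// ?addr_gt0// ?ltr0n//; lra.
    rewrite lerN2 ler_pdivlMr; last by rewrite mulr_gt0// exprn_gt0.
    rewrite (_ : _ * (S * _) = S * (1 + x) ^+ 3 * L n); last by ring.
    by rewrite ler_pM2r.
  have lT : C * l ^+ 2 * T n.+1 <= C' * L n.
    have -> : C * l ^+ 2 * T n.+1 = C' * L n / (1 + x).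
      rewrite /l exprMn b2 TS /C'; field.
      by rewrite !gt_eqF.
    rewrite ler_pdivrMr// mulrDr mulr1 lerDl.
    by apply: mulr_ge0; [apply: mulr_ge0 => //; exact: ltW|exact: ltW].
  have cl : cosh (l * x0) <= cosh x0.
    by apply: ler_cosh; rewrite normrM gtr0_norm// ler_piMl.
  have Ey : 1 + y * L n <= expR (y * L n) by exact: expR_ge1Dx.
  have yL : 0 <= y * L n by apply: mulr_ge0; exact: ltW.
  have pre : cosh (l * x0) + C * l ^+ 2 * T n.+1 <= (cosh x0 + C' / y) * expR (y * L n).
    rewrite mulrDl; apply: lerD.
      by apply: le_trans cl _; rewrite ler_peMr ?(ltW (cosh_gt0 _))// (le_trans _ Ey)// lerDl.
    apply: le_trans lT _; rewrite (_ : C' * L n = C' / y * (y * L n)); last first.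
      by field; rewrite gt_eqF.
    by apply: ler_wpM2l; [rewrite divr_ge0// ltW|apply: le_trans Ey; rewrite lerDr].
  rewrite (_ : 2 * _ * _ * expR _ = 2 * (cosh (l * x0) + C * l ^+ 2 * T n.+1) *
    expR (l ^+ 2 * beta * T n.+1 - l * b n)); last by rewrite expRD; ring.
  rewrite (_ : M * _ = 2 * ((cosh x0 + C' / y) * expR (y * L n)) * expR (- ((1 + x) * L n))).
    apply: ler_pM.
    - rewrite mulr_ge0// addr_ge0 ?(ltW (cosh_gt0 _))// mulr_ge0 ?(ltW TT0)//.
      by rewrite mulr_ge0// sqr_ge0.
    - exact: expR_ge0.
    - by rewrite ler_pM2l.
    - by rewrite ler_expR.
  rewrite /M -!mulrA -expRD; congr (_ * (_ * expR _)).
  by rewrite /y; field.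
pose V n := exceeds (T (n + n1).+3) (b (n + n1).+2).
have PV : P (lim_sup_set V) = 0%E.
  apply: lim_sup_set_cvg0; first by move=> n; exact: exceeds_measurable.
  pose a n := M * expR (- ((1 + y) * L (n + n1).+2)).
  apply: (@le_lt_trans _ _ (\sum_(n <oo) (a n)%:E)%E).
    apply: lee_nneseries => // n _; apply: PU.
    by rewrite -addn2 -addnA addnC -addnA leq_addr.
  apply: (@nneseries_bounded a (M * (expR (- (y * ln (r * n1.+1%:R))) / (r * y)))).
    by move=> n; rewrite mulr_ge0// expR_ge0.
  move=> N; rewrite /a -mulr_sumr ler_wpM2l//; exact: power_sum_bound.
exists (lim_sup_set V); split => //.
  apply: bigcap_measurableType => k _; apply: bigcup_measurable => j _.
  exact: exceeds_measurable.
move=> w; apply: contra_notP => nV.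
have [n2 hn2] : exists n2, forall n, (n2 <= n)%N -> ~ V n w.
  apply: contrapT => /forallNP H; apply: nV => J _.
  apply: contrapT => H2; apply: (H J) => j Jj Vj; apply: H2.
  by exists j.
exists (T (n2 + n1).+2) => t Tt.
have t0 : 0 < t by apply: lt_le_trans Tt.
have lnt : r * (n2 + n1).+2%:R <= ln t.
  by rewrite -[leLHS]expRK ler_ln ?posrE ?expR_gt0.
have lt0 : 0 <= ln t / r.
  by rewrite divr_ge0 ?(ltW r0)//; apply: le_trans lnt; rewrite mulr_ge0// ltW.
pose n := Num.truncn (ln t / r).
have /andP[nl ln1] := Num.Theory.truncn_itv lt0; rewrite -/n in nl ln1.
have nge : ((n2 + n1).+2 <= n)%N.
  by rewrite /n truncn_ge_nat// ler_pdivlMr// mulrC.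
have [k nE] : exists k, n = (n2 + k + n1).+2.
  by exists (n - (n2 + n1).+2)%N; rewrite -[LHS](subnKC nge) !addSn addnAC.
have := hn2 (n2 + k)%N (leq_addr _ _); rewrite /V -nE => nVw.
rewrite ler_pdivlMr// mulrC in nl; rewrite ltr_pdivrMr// mulrC in ln1.
have tT : t <= T n.+1.
  by rewrite -[t]lnK ?posrE// ler_expR ltW.
have Tn : T n <= t by rewrite -[t]lnK ?posrE// ler_expR.
apply: (@le_trans _ _ (b n)).
  apply: (@dyadic_closure R (fun t => X t w) (T n.+1) (b n) 0 (cX (w := w)) _ t).
    move=> M' i _ iT; rewrite leNgt; apply/negP => h.
    by apply: nVw; exists M', i.
  by rewrite (ltW t0).
rewrite /b ler_pM2l//; apply: ler_wsqrtr.
have nn1 : (n1 <= n)%N by rewrite nE (leq_trans (leq_addl (n2 + k) n1))// -addn2 leq_addr.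
have [h1 _] := hn1 n nn1; have Ln := L1 n nn1.
have rn0 : 0 < r * n%:R by exact: lt_le_trans (expR_gt0 _) h1.
rewrite ler_pM//; [by rewrite mulr_ge0// ltW|exact: le_trans Ln|by rewrite ler_pM2l|].
by rewrite /L ler_ln ?posrE//; exact: lt_le_trans nl.
Qed.

End upper_lil.

(** * Comparison of three tilts *)

Lemma xsinh_le_expR (R : realType) (y : R) : xsinh y <= `|y| * expR `|y|.
Proof.
rewrite -(ger0_norm (xsinh_ge0 y)) normrM ler_wpM2l//.
by apply: le_trans (abs_sinh_le_cosh y) _; exact: cosh_le_expR_norm.
Qed.

Lemma expR_norm_le_cosh2 (R : realType) (l x : R) : 0 <= l -> expR (l * `|x|) <= 2 * cosh (l * x).
Proof. by move=> l0; have := expR_norm_le_cosh (l * x); rewrite normrM (ger0_norm l0). Qed.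

(** Below [b] the smaller tilt [l1] dominates, above [b1] the larger tilt [l2], and between them the
    indicator is kept. The condition [1 <= (l2 - l) * b1] makes [v expR (- (l2 - l) v)] decrease
    beyond [b1]. *)
Lemma xsinh_split (R : realType) (l1 l l2 b b1 x : R) : 0 < l1 -> l1 <= l -> l <= l2 ->
  0 < b -> b <= b1 -> 1 <= (l2 - l) * b1 ->
  xsinh (l * x) <= l * b1 * expR (l * b1) * (b <= `|x|)%R%:R
    + (2 * (l * b) * expR ((l - l1) * b) * cosh (l1 * x)
       + 2 * (l * b1) * expR (- ((l2 - l) * b1)) * cosh (l2 * x)).
Proof.
move=> l10 l1l ll2 b0 bb1 hb1.
have l0 : 0 < l by exact: lt_le_trans l1l.
have l20 : 0 < l2 by exact: lt_le_trans ll2.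
have b10 : 0 < b1 by exact: lt_le_trans bb1.
have nx := normr_ge0 x; set v := `|x| in nx *.
apply: le_trans (xsinh_le_expR _) _; rewrite normrM (gtr0_norm l0) -/v.
have c1 := cosh_gt0 (l1 * x); have c2 := cosh_gt0 (l2 * x).
have t1 : 0 <= 2 * (l * b) * expR ((l - l1) * b) * cosh (l1 * x).
  by apply: mulr_ge0; [rewrite !mulr_ge0 ?expR_ge0// ltW|exact: ltW].
have t2 : 0 <= 2 * (l * b1) * expR (- ((l2 - l) * b1)) * cosh (l2 * x).
  by apply: mulr_ge0; [rewrite !mulr_ge0 ?expR_ge0// ltW|exact: ltW].
have [bv|vb] := leP b v; last first.
  rewrite mulr0 add0r -[leLHS]addr0; apply: lerD => //.
  have E := expR_norm_le_cosh2 x (ltW l10); rewrite -/v in E.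
  have -> : l * v = (l - l1) * v + l1 * v by ring.
  rewrite expRD [leLHS]mulrA [leRHS](_ : _ =
    (l * b) * expR ((l - l1) * b) * (2 * cosh (l1 * x))); last by ring.
  apply: ler_pM => //; first by rewrite mulr_ge0 ?expR_ge0// -mulrDl subrK mulr_ge0// ltW.
  rewrite -mulrDl subrK; apply: ler_pM; rewrite ?expR_ge0//.
  - by rewrite mulr_ge0// ltW.
  - by rewrite ler_pM2l// ltW.
  - by rewrite ler_expR ler_wpM2l ?subr_ge0// ltW.
rewrite mulr1; have [vb1|b1v] := leP v b1.
  rewrite -[leLHS]addr0; apply: lerD; last exact: addr_ge0.
  apply: ler_pM; rewrite ?expR_ge0//.
  - by rewrite mulr_ge0// ltW.
  - by rewrite ler_pM2l.
  - by rewrite ler_expR ler_pM2l.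
have t3 : 0 <= l * b1 * expR (l * b1) by rewrite !mulr_ge0 ?expR_ge0// ltW.
suff : l * v * expR (l * v) <= 2 * (l * b1) * expR (- ((l2 - l) * b1)) * cosh (l2 * x) by lra.
have E := expR_norm_le_cosh2 x (ltW l20); rewrite -/v in E.
have -> : l * v = - ((l2 - l) * v) + l2 * v by ring.
rewrite expRD [leLHS]mulrA [leRHS](_ : _ =
  (l * b1) * expR (- ((l2 - l) * b1)) * (2 * cosh (l2 * x))); last by ring.
have -> : (- ((l2 - l) * v) + l2 * v) = l * v by ring.
apply: ler_pM => //; rewrite ?expR_ge0//.
  by rewrite !mulr_ge0 ?expR_ge0// ltW.
have -> : - ((l2 - l) * v) = - ((l2 - l) * b1) - (l2 - l) * (v - b1) by ring.
rewrite expRD mulrA mulrAC ler_pM2r ?expR_gt0//.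
rewrite expRN ler_pdivrMr ?expR_gt0// -mulrA ler_pM2l//.
have h := expR_ge1Dx ((l2 - l) * (v - b1)).
apply: (@le_trans _ _ (b1 * (1 + (l2 - l) * (v - b1)))); last by rewrite ler_pM2l.
have : 1 * (v - b1) <= (l2 - l) * b1 * (v - b1) by rewrite ler_wpM2r// subr_ge0 ltW.
lra.
Qed.

Lemma sqr_le_expR (R : realType) (M c : R) : 0 < c -> exists2 L0, 1 <= L0 &
  forall L, L0 <= L -> M * L ^+ 2 <= expR (c * L).
Proof.
move=> c0; exists (Num.max 1 (6 * M / c ^+ 3)); first by rewrite le_max lexx.
move=> L; rewrite ge_max => /andP[L1 LM].
have L0 : 0 < L by lra.
have c3 : 0 < c ^+ 3 by rewrite exprn_gt0.
have := @expR_ge1Dxn R (c * L) 2 (ltW (mulr_gt0 c0 L0)).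
rewrite (_ : 3`!%:R = 6 :> R)// => h; apply: le_trans h.
rewrite ler_pdivrMr// in LM.
have : 6 * M * L ^+ 2 <= L * c ^+ 3 * L ^+ 2 by rewrite ler_pM2r ?exprn_gt0.
rewrite (_ : L * c ^+ 3 * L ^+ 2 = (c * L) ^+ 3); last by ring.
lra.
Qed.

(* With [l = zeta r] and [b = c * bb], where [r * bb = 2 L], all exponents become
   multiples of [L]; the choices [zeta = 1 - 2 eta], [c = 1 - 4 eta] and the
   neighbouring tilts [1 - 3 eta], [1 - eta] leave a gap of order [eta ^+ 2]. *)
Lemma lower_parameters (R : realType) (eta S kap C : R) : 0 < eta -> eta <= 5^-1 ->
  0 < S -> 0 < kap -> 0 <= C ->
  exists2 L0, 1 <= L0 & forall L D T r bb N,
    let dl := eta ^+ 2 / 14 in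
    let l := (1 - 2 * eta) * r in let l1 := (1 - 3 * eta) * r in
    let l2 := (1 - eta) * r in
    let b := (1 - 4 * eta) * bb in let b1 := (1 - eta) * bb in
    let be := S / 2 + dl * S / 2 in let al := S / 2 - dl * S / 2 in
    L0 <= L -> 0 < r -> 0 < bb -> r * bb = 2 * L -> r ^+ 2 * (S * T) = 2 * L ->
    (1 - dl) * T <= D <= T -> 0 <= N <= 2 * dl * b ->
    1 <= (l2 - l) * b1 /\
    2 * (l * b) * expR ((l - l1) * b) *
       (expR (l1 ^+ 2 * be * D) * (cosh (l1 * N) + C * l1 ^+ 2 * D))
    + 2 * (l * b1) * expR (- ((l2 - l) * b1)) *
       (expR (l2 ^+ 2 * be * D) * (cosh (l2 * N) + C * l2 ^+ 2 * D))
    + expR (- L) * (l * b1 * expR (l * b1)) <=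
    kap * (expR (l ^+ 2 * al * D) - 1).
Proof.
move=> eta0 eta5 S0 kap0 C0.
have gam0 : 0 < eta ^+ 2 / 2 by rewrite divr_gt0// exprn_gt0.
have [L1 L11 HL1] := sqr_le_expR (2 / kap * (10 + 16 * C / S)) gam0.
exists (Num.max L1 (4 / eta ^+ 2)); first by rewrite le_max L11.
move=> L D T r bb N dl l l1 l2 b b1 be al.
rewrite ge_max => /andP[hL1 hL2] r0 bb0 rbb rST /andP[D1 D2] /andP[N0 N1].
have Lge1 : 1 <= L by lra.
have L0 : 0 < L by lra.
have e2 : 0 < eta ^+ 2 by rewrite exprn_gt0.
have e2' : eta ^+ 2 <= eta / 5 by rewrite expr2; have := ler_wpM2l (ltW eta0) eta5; lra.
have dl0 : 0 < dl by rewrite divr_gt0.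
have hdl : 14 * dl = eta ^+ 2 by rewrite /dl; field.
have e2L : 4 <= L * eta ^+ 2 by rewrite -ler_pdivrMr.
have T0 : 0 < T.
  have : 0 < r ^+ 2 * (S * T) by rewrite rST; lra.
  by rewrite pmulr_rgt0 ?exprn_gt0// pmulr_rgt0.
have D0 : 0 < D by apply: lt_le_trans D1; rewrite mulr_gt0//; lra.
pose V := r ^+ 2 * S * D.
have V1 : (1 - dl) * (2 * L) <= V.
  rewrite -rST /V (_ : _ * (r ^+ 2 * _) = r ^+ 2 * S * ((1 - dl) * T)); last by ring.
  by rewrite ler_wpM2l// mulr_ge0 ?sqr_ge0// ltW.
have V2 : V <= 2 * L.
  by rewrite -rST /V mulrA ler_wpM2l// mulr_ge0 ?sqr_ge0// ltW.
have V0 : 0 < V by rewrite /V !mulr_gt0// exprn_gt0.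
have lb : l * b = (1 - 2 * eta) * (1 - 4 * eta) * (2 * L) by rewrite /l /b -rbb; ring.
have lb1 : l * b1 = (1 - 2 * eta) * (1 - eta) * (2 * L) by rewrite /l /b1 -rbb; ring.
have llb : (l - l1) * b = eta * (1 - 4 * eta) * (2 * L) by rewrite /l /l1 /b -rbb; ring.
have llb1 : (l2 - l) * b1 = eta * (1 - eta) * (2 * L) by rewrite /l /l2 /b1 -rbb; ring.
have eL : 0 <= eta * L by rewrite mulr_ge0// ltW.
have z1 : 0 <= 1 - 3 * eta by clear -eta0 eta5 dl0 hdl e2'; lra.
have z2 : 0 <= 1 - eta by clear -eta0 eta5 dl0 hdl e2'; lra.
have z3 : 0 <= 1 - 2 * eta by clear -eta0 eta5 dl0 hdl e2'; lra.
have z4 : 0 <= 1 - 4 * eta by clear -eta0 eta5 dl0 hdl e2'; lra.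
have z6 : 0 <= 1 - dl by clear -eta0 eta5 dl0 hdl e2'; lra.
have z5 : 0 <= 1 + dl by clear -eta0 eta5 dl0 hdl e2'; lra.
have L0' := ltW L0; have eta0' := ltW eta0.
have zN z : 0 <= z -> z <= 1 -> cosh (z * r * N) <= expR (4 * dl * L).
  move=> z0 zz1; have zr0 : 0 <= z * r by rewrite mulr_ge0// ltW.
  apply: le_trans (cosh_le_expR_norm _) _; rewrite ler_expR ger0_norm ?mulr_ge0 ?(ltW r0)//.
  apply: (@le_trans _ _ (r * (2 * dl * bb))).
    apply: ler_pM => //; first by rewrite ler_piMl// ltW.
    apply: le_trans N1 _; apply: ler_wpM2l; first by rewrite mulr_ge0// ltW.
    by rewrite /b ler_piMl ?(ltW bb0)//; clear -eta0; lra.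
  rewrite [leLHS](_ : _ = 2 * dl * (r * bb)); first by rewrite rbb; clear; lra.
  by ring.
have zD z : 0 <= z -> z <= 1 -> C * (z * r) ^+ 2 * D <= 2 * C / S * L.
  move=> z0 zz1.
  rewrite (_ : C * _ * D = C / S * (z ^+ 2 * V)); last by rewrite /V; field; rewrite gt_eqF.
  rewrite (_ : 2 * C / S * L = C / S * (2 * L)); last by ring.
  rewrite ler_wpM2l ?divr_ge0 ?(ltW S0)//; apply: le_trans V2.
  by apply: ler_piMl; [exact: ltW|rewrite expr_le1].
have zbe z : (z * r) ^+ 2 * be * D = z ^+ 2 * (1 + dl) * (V / 2).
  by rewrite /be /V; field.
pose W := expR (4 * dl * L) * (1 + 2 * C / S * L).
have CS0 : 0 <= 2 * C / S by rewrite divr_ge0 ?mulr_ge0// ltW.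
have zW z : 0 <= z -> z <= 1 -> cosh (z * r * N) + C * (z * r) ^+ 2 * D <= W.
  move=> z0 zz1; rewrite /W mulrDr mulr1; apply: lerD; first exact: zN.
  apply: le_trans (zD z z0 zz1) _; apply: ler_peMl; first by apply: mulr_ge0 => //; exact: ltW.
  by rewrite -expR0 ler_expR; apply: mulr_ge0; [rewrite mulr_ge0// ltW|exact: ltW].
have zW0 z : 0 <= cosh (z * r * N) + C * (z * r) ^+ 2 * D.
  apply: addr_ge0; first exact/ltW/cosh_gt0.
  by apply: mulr_ge0; [rewrite mulr_ge0 ?sqr_ge0|exact: ltW].
have W0 : 0 <= W.
  by rewrite mulr_ge0 ?expR_ge0// addr_ge0// mulr_ge0// ltW.
(* The main term has exponent at least [q L], each error at most [(q - 7 dl) L], and the gap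
   [7 dl = eta^2 / 2] beats the factor [L^2]. Besides the 2 in [q], [dl] is spent 7 times on this
   gap, 4 times on the starting value and once on [be]; the total 14 exhausts the reserve [eta^2] at
   the tilt [l2]. *)
pose q := (1 - 2 * eta) ^+ 2 - 2 * dl.
pose E := expR ((q - 12 * dl) * L).
split.
  rewrite llb1; have : eta * (4 / 5) * L <= eta * (1 - eta) * L.
    by rewrite ler_pM2r// ler_pM2l//; clear -eta5; lra.
  have : eta ^+ 2 * L <= eta / 5 * L by rewrite ler_pM2r.
  by clear -e2L; lra.
have z4' : 1 - 4 * eta <= 1 by clear -eta0; lra.
have z1' : 1 - 3 * eta <= 1 by clear -eta0; lra.
have z2' : 1 - eta <= 1 by clear -eta0; lra.
have z3' : 1 - 2 * eta <= 1 by clear -eta0; lra.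
have B1 : 2 * (l * b) * expR ((l - l1) * b) *
    (expR (l1 ^+ 2 * be * D) * (cosh (l1 * N) + C * l1 ^+ 2 * D)) <=
    4 * L * (1 + 2 * C / S * L) * expR ((q - 7 * dl) * L).
  rewrite lb llb /l1 zbe.
  have -> : (q - 7 * dl) * L = (q - 11 * dl) * L + 4 * dl * L by ring.
  rewrite (expRD ((q - 11 * dl) * L)).
  rewrite (_ : 4 * L * _ * _ = (4 * L) * expR ((q - 11 * dl) * L) * W); last by rewrite /W; ring.
  rewrite [leLHS]mulrA; apply: ler_pM => //; last exact: zW.
  - by rewrite !mulr_ge0 ?expR_ge0.
  - rewrite -mulrA -expRD; apply: ler_pM; rewrite ?expR_ge0//.
    + by rewrite !mulr_ge0.
    + rewrite (_ : 4 * L = 2 * (1 * (2 * L))); last by ring.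
      rewrite ler_pM2l// ler_wpM2r//; first by clear -L0'; lra.
      exact: mulr_ile1.
    rewrite ler_expR; apply: (@le_trans _ _ (eta * (1 - 4 * eta) * (2 * L) +
       (1 - 3 * eta) ^+ 2 * (1 + dl) * L)).
      rewrite lerD2l; apply: ler_wpM2l; last by clear -V2; lra.
      by rewrite mulr_ge0 ?sqr_ge0.
    rewrite (_ : eta * _ * _ + _ =
      (2 * eta * (1 - 4 * eta) + (1 - 3 * eta) ^+ 2 * (1 + dl)) * L); last by ring.
    rewrite ler_pM2r// /q.
    have : (1 - 3 * eta) ^+ 2 * dl <= dl.
      by apply: ler_piMl; [exact: ltW|rewrite expr_le1].
    clear -hdl e2 e2' eta0 eta5 dl0; rewrite !sqrrB; lra.
have B2 : 2 * (l * b1) * expR (- ((l2 - l) * b1)) *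
    (expR (l2 ^+ 2 * be * D) * (cosh (l2 * N) + C * l2 ^+ 2 * D)) <=
    4 * L * (1 + 2 * C / S * L) * expR ((q - 7 * dl) * L).
  rewrite lb1 llb1 /l2 zbe.
  have -> : (q - 7 * dl) * L = (q - 11 * dl) * L + 4 * dl * L by ring.
  rewrite (expRD ((q - 11 * dl) * L)).
  rewrite (_ : 4 * L * _ * _ = (4 * L) * expR ((q - 11 * dl) * L) * W); last by rewrite /W; ring.
  rewrite [leLHS]mulrA; apply: ler_pM => //; last exact: zW.
  - by rewrite !mulr_ge0 ?expR_ge0.
  - rewrite -mulrA -expRD; apply: ler_pM; rewrite ?expR_ge0//.
    + by rewrite !mulr_ge0.
    + rewrite (_ : 4 * L = 2 * (1 * (2 * L))); last by ring.
      rewrite ler_pM2l// ler_wpM2r//; first by clear -L0'; lra.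
      exact: mulr_ile1.
    rewrite ler_expR; apply: (@le_trans _ _ (- (eta * (1 - eta) * (2 * L)) +
       (1 - eta) ^+ 2 * (1 + dl) * L)).
      rewrite lerD2l; apply: ler_wpM2l; last by clear -V2; lra.
      by rewrite mulr_ge0 ?sqr_ge0.
    rewrite (_ : - _ + _ =
      ((1 - eta) ^+ 2 * (1 + dl) - 2 * eta * (1 - eta)) * L); last by ring.
    rewrite ler_pM2r// /q.
    have : (1 - eta) ^+ 2 * dl <= dl.
      by apply: ler_piMl; [exact: ltW|rewrite expr_le1].
    clear -hdl e2 e2' eta0 eta5 dl0; rewrite !sqrrB; lra.
have B3 : expR (- L) * (l * b1 * expR (l * b1)) <= 2 * L * expR ((q - 7 * dl) * L).
  rewrite mulrCA -expRD lb1; apply: ler_pM; rewrite ?expR_ge0//.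
  - by rewrite !mulr_ge0.
  - by rewrite -[leRHS]mul1r ler_wpM2r//; [clear -L0'; lra|exact: mulr_ile1].
  rewrite ler_expR (_ : - L + _ = ((1 - 2 * eta) * (1 - eta) * 2 - 1) * L); last by ring.
  by rewrite ler_pM2r// /q; clear -hdl e2 e2' eta0 eta5 dl0; rewrite sqrrB; lra.
have q0 : 1 / 5 <= q by rewrite /q sqrrB; clear -e2 hdl eta5; lra.
have L5 : 5 <= L.
  have : L * eta ^+ 2 <= L * 25^-1 by apply: ler_wpM2l => //; clear -e2' eta5; lra.
  by clear -e2L; lra.
have A1 : expR (q * L) <= expR (l ^+ 2 * al * D).
  rewrite ler_expR (_ : l ^+ 2 * al * D = (1 - 2 * eta) ^+ 2 * (1 - dl) * (V / 2)); last first.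
    by rewrite /l /al /V; field.
  apply: (@le_trans _ _ ((1 - 2 * eta) ^+ 2 * (1 - dl) * ((1 - dl) * L))); last first.
    by apply: ler_wpM2l; [rewrite mulr_ge0 ?sqr_ge0|clear -V1; lra].
  rewrite mulrA ler_pM2r// /q.
  have : (1 - 2 * eta) ^+ 2 * (2 * dl) <= 2 * dl.
    by apply: ler_piMl; [exact: mulr_ge0 (ltW dl0)|rewrite expr_le1].
  have : 0 <= (1 - 2 * eta) ^+ 2 * dl ^+ 2 by rewrite mulr_ge0 ?sqr_ge0.
  clear; by rewrite (_ : _ * (1 - dl) * (1 - dl) = (1 - 2 * eta) ^+ 2 - (1 - 2 * eta) ^+ 2 * (2 * dl)
     + (1 - 2 * eta) ^+ 2 * dl ^+ 2); [lra|ring].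
have A2 : 2 <= expR (q * L).
  have := expR_ge1Dx (q * L).
  have : 1 / 5 * 5 <= q * L by apply: ler_pM.
  by set X := q * L; clear; lra.
have := HL1 L hL1; set X := expR (_ * L) => hX.
have Eq : expR (q * L) = expR ((q - 7 * dl) * L) * X.
  by rewrite /X -expRD; congr expR; rewrite -hdl; field.
have hX' : (10 * L + 16 * C / S * L ^+ 2) <= kap / 2 * X.
  have h : 10 * L <= 10 * L ^+ 2 by rewrite expr2 ler_pM2l// ler_peMl// ltW.
  have k2 : 0 < kap / 2 by exact: divr_gt0.
  have := ler_wpM2l (ltW k2) hX.
  rewrite [leLHS](_ : _ = 10 * L ^+ 2 + 16 * C / S * L ^+ 2).
    exact/le_trans/lerD.
  by clear -kap0 S0; field; rewrite !gt_eqF.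
have E0 := expR_ge0 ((q - 7 * dl) * L).
have := ler_wpM2r E0 hX'; set Y := expR ((q - 7 * dl) * L) in Eq B1 B2 B3 * => hY.
have k1 : kap / 2 * expR (q * L) <= kap * (expR (l ^+ 2 * al * D) - 1).
  have := ler_wpM2l (ltW kap0) A1; have := ler_wpM2l (ltW kap0) A2.
  by clear; lra.
apply: le_trans k1; rewrite Eq.
apply: le_trans (lerD (lerD B1 B2) B3) _.
apply: (@le_trans _ _ ((10 * L + 16 * C / S * L ^+ 2) * Y)); last by rewrite (mulrC Y) [leRHS]mulrA; exact: hY.
by clear; rewrite le_eqVlt; apply/orP; left; apply/eqP; ring.
Qed.

Lemma measurable_ge_set (R : realType) (d : measure_display) (T : measurableType d)
  (Y : T -> R) (c : R) : measurable_fun setT Y -> measurable [set w | c <= Y w].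
Proof.
move=> mY; rewrite (_ : [set w | _] = Y @^-1` `[c, +oo[%classic).
  by rewrite -[X in measurable X]setTI; exact: mY.
by apply/seteqP; split => w /=; rewrite in_itv/= andbT.
Qed.

(** * The lower bound in the law of the iterated logarithm *)

Section lower_lil.
Context (R : realType) (d : measure_display) (Omega : measurableType d).
Context (P : probability Omega R) (F : R -> set_system Omega).
Context (B : R -> Omega -> R) (f : R * R -> R) (g : R -> R) (x0 G rho S m g0 : R).
Implicit Types (n k j : nat) (t l eps : R) (w : Omega) (A : set Omega).

Hypothesis PF : complete_filtered_probability_space P F.
Hypothesis BM : brownian_motion P F B.
Hypothesis f_lip : forall N : R, exists2 L : R, 0 < L & forall x y s t,
  `|x| <= N -> `|y| <= N -> 0 <= s <= N -> 0 <= t <= N ->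
  `|f (x, s) - f (y, t)| <= L * (`|x - y| + `|s - t|).
Hypothesis g_lip : forall N : R, exists2 L : R, 0 < L & forall x y,
  `|x| <= N -> `|y| <= N -> `|g x - g y| <= L * `|x - y|.
Hypothesis gG : forall x, `|g x| <= G.
Hypothesis rho0 : 0 < rho.
Hypothesis xf_le : forall x t, 0 <= t -> x * f (x, t) <= rho.
Hypothesis S0 : 0 < S.
Hypothesis g_tail : forall eps, 0 < eps -> exists2 K, 0 <= K &
  forall x, K < `|x| -> S - eps <= g x ^+ 2 <= S + eps.

Hypothesis m0 : 0 <= m.
Hypothesis m1 : m < 2^-1.
Hypothesis g00 : 0 < g0.
Hypothesis g_ge : forall x, g0 <= g x ^+ 2.
Hypothesis xf_ge : forall x t, 0 <= t -> - (m * g x ^+ 2) <= x * f (x, t).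

Local Notation mw t := (measurable_wrt (F t)).
Local Notation e := (euler B f g x0).
Local Notation EX := (euler_path B f g x0).
Local Notation dy := (dy R).
Local Notation mesh := (mesh R).


Let mA n k A : F (dy n k) A -> measurable A .
Proof. by apply: (filt_measurable PF); exact: dy_ge0. Qed.

Let me n k : measurable_fun setT (e n k).
Proof. exact: (mw_fun PF (dy_ge0 R n k) (e_mw x0 PF BM f_lip g_lip n k)). Qed.

(** [xsinh_split] is integrated over [A], with [xsinh_moment] bounding the left side from below and
    [cosh_moment] the two [cosh] terms from above. The indicator term, at most [Y * P (A and V)],
    must account for the remainder, which the parameters keep above [expR (- L) * Y * P A]. *)
Lemma euler_lower eta : 0 < eta -> eta <= 5^-1 ->
  exists L0 r0 n0, [/\ 1 <= L0, 0 < r0 & forall n L T r bb k j A,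
    let dl := eta ^+ 2 / 14 in let b := (1 - 4 * eta) * bb in
    (n0 <= n)%N -> L0 <= L -> 0 < r <= r0 -> 0 < bb ->
    r * bb = 2 * L -> r ^+ 2 * (S * T) = 2 * L -> (1 - dl) * T <= j%:R * mesh n <= T ->
    F (dy n k) A -> (forall w, A w -> `|e n k w| <= 2 * dl * b) ->
    ((expR (- L))%:E * P A <= P (A `&` [set w | (b <= `|e n (k + j) w|)%R]))%E].
Proof.
move=> eta0 eta5; have S0' := S0.
have [e4 e3 e10] : [/\ 0 < 1 - 4 * eta, 0 < 1 - 3 * eta & 1 - eta <= 1] by split; lra.
have [e32 e21 e41] : [/\ 1 - 3 * eta <= 1 - 2 * eta, 1 - 2 * eta <= 1 - eta &
    1 - 4 * eta <= 1 - eta] by split; lra.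
have e1 : eta ^+ 2 <= 1 by rewrite expr_le1//; lra.
have dl0 : 0 < eta ^+ 2 / 14 by rewrite divr_gt0// exprn_gt0.
have dl1 : eta ^+ 2 / 14 <= 14^-1 by lra.
pose eps := eta ^+ 2 / 14 * S / 2.
have eps0 : 0 < eps by rewrite divr_gt0// mulr_gt0.
have epsS : eps < S / 2.
  have : eta ^+ 2 / 14 * S <= 14^-1 * S by rewrite ler_pM2r.
  by rewrite /eps; lra.
have [C [n1 [C0 HC]]] := cosh_moment x0 PF BM f_lip g_lip gG rho0 xf_le S0 g_tail eps0.
have [r0 [kap [n2 [r00 r01 kap0 HX]]]] :=
  xsinh_moment x0 PF BM f_lip g_lip gG S0 g_tail m0 m1 g00 g_ge xf_ge eps0 epsS.
have [L0 L01 HL] := lower_parameters eta0 eta5 S0 kap0 C0.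
exists L0, r0, (maxn n1 n2); split => // n L T r bb k j A dl b.
rewrite geq_max => /andP[nn1 nn2] LL /andP[r_0 rr] bb0 rbb rST DT FA Ae.
have dlE : eta ^+ 2 / 14 = dl by [].
have b0 : 0 < b by exact: mulr_gt0.
have N01 : 0 <= 2 * dl * b <= 2 * dl * b.
  by rewrite lexx andbT; apply: mulr_ge0; [rewrite mulr_ge0// ltW|exact: ltW].
pose l := (1 - 2 * eta) * r; pose l1 := (1 - 3 * eta) * r.
pose l2 := (1 - eta) * r; pose b1 := (1 - eta) * bb.
have l10 : 0 < l1 by exact: mulr_gt0.
have l1l : l1 <= l by rewrite ler_pM2r.
have ll2 : l <= l2 by rewrite ler_pM2r.
have l2r : l2 <= r by rewrite ler_piMl ?(ltW r_0).
have l0 : 0 < l by exact: lt_le_trans l1l.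
have bb1 : b <= b1 by rewrite ler_pM2r.
have b10 : 0 < b1 by exact: lt_le_trans bb1.
have l11 : l1 <= 1 by exact: le_trans (le_trans l1l ll2) (le_trans l2r (le_trans rr r01)).
have l21 : l2 <= 1 by exact: le_trans l2r (le_trans rr r01).
have l20 : 0 < l2 by exact: lt_le_trans ll2.
have [H1 H2] := HL L (j%:R * mesh n) T r bb (2 * dl * b) LL r_0 bb0 rbb rST DT N01.
rewrite dlE -/b -/eps -/l -/l1 -/l2 -/b1 in H1 H2.
have mAA := mA FA.
set V := [set w | _]; have mV : measurable V.
  by apply: measurable_ge_set; apply: measurableT_comp => //; exact: me.
set c1 := 2 * (l * b) * expR ((l - l1) * b) in H2.
set c2 := 2 * (l * b1) * expR (- ((l2 - l) * b1)) in H2.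
set Y := l * b1 * expR (l * b1) in H2.
have Y0 : 0 < Y by apply: mulr_gt0; [exact: mulr_gt0|exact: expR_gt0].
have c0 c b' q : 0 < c -> 0 < b' -> 0 <= 2 * (c * b') * expR q :> R.
  by move=> h1 h2; apply: mulr_ge0; [rewrite mulr_ge0// ltW// mulr_gt0|exact: expR_ge0].
have c10 : 0 <= c1 by exact: c0.
have c20 : 0 <= c2 by exact: c0.
set K1 := expR (l1 ^+ 2 * _ * _) * _ in H2.
set K2 := expR (l2 ^+ 2 * _ * _) * _ in H2.
pose z w := e n (k + j) w.
have mz : measurable_fun setT z by exact: me.
have mlz c : measurable_fun setT (fun w => c * z w) by exact: measurable_funM.
have mc c : measurable_fun setT (fun w => cosh (c * z w)) by exact: measurable_cosh_comp.
have c_ge0 c w : 0 <= cosh (c * z w) by exact/ltW/cosh_gt0.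
have I1 : (\int[P]_(w in A) (cosh (l1 * z w))%:E <= K1%:E * P A)%E.
  by apply: HC => //; rewrite l10.
have I2 : (\int[P]_(w in A) (cosh (l2 * z w))%:E <= K2%:E * P A)%E.
  by apply: HC => //; rewrite l20.
have I0 := HX n l k j A nn2 (introT andP (conj l0 (le_trans ll2 (le_trans l2r rr)))) FA.
rewrite -/(z _) in I0.
pose W w : R := Y * \1_V w + (c1 * cosh (l1 * z w) + c2 * cosh (l2 * z w)).
have mW2 : measurable_fun setT (fun w => c1 * cosh (l1 * z w) + c2 * cosh (l2 * z w)).
  by apply: measurable_funD; exact: measurable_funM.
have mW1 : measurable_fun setT (fun w => Y * \1_V w).
  by apply: measurable_funM => //; exact: measurable_indic.
have IW : (\int[P]_(w in A) (xsinh (l * z w))%:E <= \int[P]_(w in A) (W w)%:E)%E.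
  apply: integral_le => //.
  - exact: measurable_xsinh_comp.
  - exact: measurable_funD.
  - by move=> w _; exact: xsinh_ge0.
  move=> w _; rewrite /W indicE.
  rewrite (_ : (w \in V) = (b <= `|z w|)); last first.
    by apply/idP/idP => [/set_mem|h]; [|exact: mem_set].
  exact: xsinh_split.
have EW : (\int[P]_(w in A) (W w)%:E = Y%:E * P (A `&` V) +
    (c1%:E * \int[P]_(w in A) (cosh (l1 * z w))%:E +
     c2%:E * \int[P]_(w in A) (cosh (l2 * z w))%:E))%E.
  rewrite integral_addR//; last 2 first.
  - by move=> w; rewrite mulr_ge0// ltW.
  - by move=> w; rewrite addr_ge0// mulr_ge0.
  rewrite (@integral_scale _ _ _ _ A (\1_V) Y)//; last exact: ltW.
  rewrite integral_indic// setIC integral_addR//.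
  - by rewrite !integral_scale.
  - exact: measurable_funM.
  - exact: measurable_funM.
  - by move=> w; rewrite mulr_ge0.
  - by move=> w; rewrite mulr_ge0.
have c10' : (0 <= c1%:E)%E by rewrite lee_fin.
have c20' : (0 <= c2%:E)%E by rewrite lee_fin.
rewrite EW in IW; have := le_trans (le_trans I0 IW)
  (leeD (lexx _) (leeD (lee_wpmul2l c10' I1) (lee_wpmul2l c20' I2))).
have PAE : P A = (fine (P A))%:E by rewrite fineK// fin_num_measure.
have PVE : P (A `&` V) = (fine (P (A `&` V)))%:E.
  by rewrite fineK// fin_num_measure//; exact: measurableI.
have p0 : 0 <= fine (P A) by rewrite fine_ge0.
rewrite PAE PVE; move: (fine (P A)) (fine (P (A `&` V))) p0 => p v p0.
rewrite -!EFinM -!EFinD !lee_fin => h.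
have := ler_wpM2r p0 H2; set K0 := kap * _ in h * => h2.
rewrite -(ler_pM2l Y0) mulrA (mulrC Y) -(lerD2l (c1 * (K1 * p) + c2 * (K2 * p))).
rewrite [leRHS]addrC; apply: le_trans h; apply: le_trans h2.
by rewrite !mulrDl !mulrA.
Qed.
Variables (X : R -> Omega -> R) (nn : nat -> nat) (NB : set Omega).
Hypothesis cX : continuous_process X.
Hypothesis aX : adapted F X.
Hypothesis nnj : forall j, (j <= nn j)%N.
Hypothesis mNB : measurable NB.
Hypothesis PNB : P NB = 0%E.
Hypothesis near_X : forall w, ~ NB w -> exists J, forall j, (J <= j)%N ->
  forall t, 0 <= t <= j%:R -> `|EX (nn j) t w - X t w| <= 2 * mesh j.


Let aE n : adapted F (EX n).
Proof.
apply: (euler_path_adapted x0 PF BM) => //.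
  by move=> t t0; exact: (f_continuous f_lip).
exact: (g_continuous g_lip).
Qed.

(** Transfer from the scheme to [X] at integer times, which are grid points of every level. The
    estimate is applied to the part [Aj] of [A] on which the scheme itself starts small; [Aj] fills
    [A] up to the event [Bj] of a discrepancy between scheme and path, whose probability vanishes in
    the limit. *)
Lemma path_lower eta : 0 < eta -> eta <= 5^-1 ->
  exists L0 r0, [/\ 1 <= L0, 0 < r0 & forall L r bb (s T : nat) A,
    let dl := eta ^+ 2 / 14 in let b := (1 - 4 * eta) * bb in
    L0 <= L -> 0 < r <= r0 -> 0 < bb ->
    r * bb = 2 * L -> r ^+ 2 * (S * T%:R) = 2 * L -> (s <= T)%N -> s%:R <= dl * T%:R ->
    F s%:R A -> (forall w, A w -> `|X s%:R w| <= dl * b) ->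
    ((expR (- L))%:E * P A <= P (A `&` [set w | ((1 - eta) * b <= `|X T%:R w|)%R]))%E].
Proof.
move=> eta0 eta5; have [L0 [r0 [n0 [L01 r00 H]]]] := euler_lower eta0 eta5.
exists L0, r0; split => // L r bb s T A dl b LL rr bb0 rbb rST sT sdT FA Ab.
have dl0 : 0 < dl by rewrite /dl divr_gt0// exprn_gt0.
have b0 : 0 < b by rewrite mulr_gt0//; lra.
(* A discrepancy below [c] at most doubles the starting bound [dl * b] and lowers the final level
   [b] by at most [eta * b]. *)
pose c := Num.min dl eta * b.
have c0 : 0 < c by rewrite mulr_gt0// lt_min dl0.
have cdl : c <= dl * b by rewrite ler_pM2r// ge_min lexx.
have ceta : c <= eta * b by rewrite ler_pM2r// ge_min lexx orbT.
pose Y j w := (`|EX (nn j) s%:R w - X s%:R w| + `|EX (nn j) T%:R w - X T%:R w|)%:E.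
have mX (t : nat) : measurable_fun setT (X t%:R).
  by apply: (@mw_fun _ _ _ _ _ PF t%:R) => //; exact: aX.
have mE n (t : nat) : measurable_fun setT (EX n t%:R).
  by apply: (@mw_fun _ _ _ _ _ PF t%:R) => //; exact: aE.
have mY j : measurable_fun setT (Y j).
  apply/measurable_EFinP; apply: measurable_funD; apply: measurableT_comp => //;
    exact: measurable_funB.
have cY w : ~ NB w -> Y j w @[j --> \oo] --> 0%E.
  move=> NBw; have [J hJ] := near_X NBw.
  have cm : (4 * mesh j)%:E @[j --> \oo] --> (0%:E : \bar R).
    apply: cvg_EFin; first exact: nearW.
    by rewrite -(mulr0 4); apply: cvgMl_tmp; exact: mesh_cvg0.
  apply: (squeeze_cvge _ (@cvg_cst _ _ _ _ _) cm).
  exists (maxn J T) => // j /=; rewrite geq_max => /andP[Jj Tj].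
  have Tj' : T%:R <= j%:R :> R by rewrite ler_nat.
  have sT' : s%:R <= T%:R :> R by rewrite ler_nat.
  have h1 := hJ j Jj s%:R; rewrite ler0n (le_trans sT' Tj') in h1.
  have h2 := hJ j Jj T%:R; rewrite ler0n Tj' in h2.
  rewrite /Y !lee_fin addr_ge0//=.
  by apply: le_trans (lerD (h1 _) (h2 _)) _ => //; lra.
have [_ pY] := cvg_ae_in_probability0 mY mNB PNB cY.
set Q := A `&` [set w | _].
have mA0 : measurable A by apply: (filt_measurable PF) FA.
have mQ : measurable Q.
  by apply: measurableI => //; apply: measurable_ge_set; exact: measurableT_comp.
apply/lee_addgt0Pr => a a0.
have [J _ HJ] : \forall j \near \oo, (P [set w | (c%:E <= Y j w)%E] < (a / 2)%:E)%E.
  apply: (pY c c0 [set y | (y < (a / 2)%:E)%E]); apply: open_ereal_lt'.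
  by rewrite lte_fin divr_gt0.
pose j := maxn J (maxn n0 T.+1); pose N := nn j.
have jN : (j <= N)%N by exact: nnj.
have Jj : (J <= j)%N by exact: leq_maxl.
have nN : (n0 <= N)%N by apply: leq_trans jN; rewrite /j !leq_max leqnn !orbT.
have TN : (T < N)%N by apply: leq_trans jN; rewrite /j !leq_max leqnn !orbT.
have eE (t : nat) w : (t <= T)%N -> EX N t%:R w = e N (t * 2 ^ N) w.
  move=> tT; rewrite -(dy_nat R N t) euler_path_dy// ltn_pmul2r ?expn_gt0//.
  exact: leq_ltn_trans TN.
have PB := HJ j Jj; set Bj := [set w | _] in PB.
have mBj : measurable Bj.
  rewrite /Bj -[X in measurable X]setTI; apply: emeasurable_fun_c_infty => //.
have notB w : ~ Bj w -> `|e N (s * 2 ^ N) w - X s%:R w| < c /\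
    `|e N (T * 2 ^ N) w - X T%:R w| < c.
  move=> /negP; rewrite -ltNge lte_fin -/N !eE// => h.
  by split; apply: le_lt_trans h; [rewrite lerDl|rewrite lerDr].
pose Aj := A `&` [set w | `|e N (s * 2 ^ N) w| <= 2 * dl * b].
have FAj : F (dy N (s * 2 ^ N)) Aj.
  apply: (filtI PF (dy_ge0 R _ _)); first by rewrite dy_nat.
  apply: filt_le; first exact: dy_ge0.
  by apply: mw_norm; [exact: dy_ge0|exact: (e_mw x0 PF BM f_lip g_lip)].
have DT : (1 - dl) * T%:R <= ((T - s) * 2 ^ N)%:R * mesh N <= T%:R.
  rewrite -/(dy N _) dy_nat natrB//; have : 0 <= s%:R :> R by exact: ler0n.
  by move=> s0; rewrite mulrBl mul1r lerD2l lerN2 sdT/= gerBl.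
have := H N L T%:R r bb (s * 2 ^ N)%N ((T - s) * 2 ^ N)%N Aj nN LL rr bb0 rbb rST DT FAj.
rewrite -mulnDl subnKC// -/dl -/b => /(_ (fun w => @proj2 _ _)).
set V := [set w | _]; have mV : measurable V.
  by apply: measurable_ge_set; apply: measurableT_comp => //; exact: me.
have mAj := mA FAj; move=> hA.
have h1 : (P A <= P Aj + P Bj)%E.
  apply: le_trans (measureU2 _ _ _) => //; rewrite le_measure ?inE//; first exact: measurableU.
  move=> w Aw; have [Bw|/notB[h _]] := pselect (Bj w); [by right|left; split => //=].
  rewrite -(subrK (X s%:R w) (e N (s * 2 ^ N) w)); apply: le_trans (ler_normD _ _) _.
  by rewrite -mulrA mulr_natl mulr2n lerD ?Ab// (le_trans (ltW h)).
have h2 : (P (Aj `&` V) <= P Q + P Bj)%E.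
  apply: le_trans (measureU2 _ _ _) => //; rewrite le_measure ?inE//.
    exact: measurableI.
  - exact: measurableU.
  move=> w [[Aw _] Vw]; have [Bw|/notB[_ h]] := pselect (Bj w); [by right|left; split => //=].
  rewrite /V/= in Vw; have := ler_normD (e N (T * 2 ^ N) w - X T%:R w) (X T%:R w).
  by rewrite subrK; lra.
have fE D : measurable D -> P D = (fine (P D))%:E.
  by move=> mD; rewrite fineK// fin_num_measure.
have mAV := measurableI _ _ mAj mV.
move: hA h1 h2 PB; rewrite (fE _ mAj) (fE _ mA0) (fE _ mBj) (fE _ mQ) (fE _ mAV).
rewrite -!EFinM -!EFinD !lee_fin lte_fin => h3 h4 h5 h6.
have B0 : 0 <= fine (P Bj) by rewrite fine_ge0.
have E0 := expR_ge0 (- L).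
have E1 : expR (- L) <= 1.
  by rewrite -expR0 ler_expR oppr_le0; exact: le_trans (le_trans ler01 L01) LL.
have h7 := ler_wpM2l E0 h4.
have h8 : expR (- L) * fine (P Bj) <= fine (P Bj) by rewrite ler_piMl.
apply: (le_trans h7); rewrite mulrDr; apply: (le_trans (lerD h3 h8)).
apply: (le_trans (lerD h5 (lexx _))).
by rewrite -addrA lerD2l [leRHS]splitr lerD// ltW.
Qed.

Let mX (t : nat) : measurable_fun setT (X t%:R).
Proof. by apply: (@mw_fun _ _ _ _ _ PF t%:R) => //; exact: aX. Qed.

(* Each [T i.+1] gives a conditional chance at least [expR (- L i.+1) = 1 / (i.+1 * a)] to
   exceed the level, and these chances have a divergent sum. *)
Lemma never_exceeds0 (T : nat -> nat) (b : nat -> R) (a : R) n1 : 0 < a ->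
  {homo T : i j / (i <= j)%N} ->
  (forall n A, (n1 <= n)%N -> F (T n)%:R A -> (forall w, A w -> `|X (T n)%:R w| <= b n) ->
    ((n.+1%:R * a)^-1%:E * P A <= P (A `&` [set w | (b n.+1 <= `|X (T n.+1)%:R w|)%R]))%E) ->
  P.-negligible [set w | forall n, (n1 <= n)%N -> `|X (T n)%:R w| < b n].
Proof.
move=> a0 T_homo step.
pose C n := [set w | forall i, (n1 <= i <= n)%N -> `|X (T i)%:R w| < b i].
have FC n : F (T n)%:R (C n).
  rewrite (_ : C n = \bigcap_(i in [set i | (n1 <= i <= n)%N]) [set w | `|X (T i)%:R w| < b i]).
    apply: (filt_bigcap PF) => // i /= /andP[_ ni]; apply: filt_lt => //.
    apply: (mw_mono (s := (T i)%:R) PF) => //; first by rewrite ler_nat T_homo.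
    by apply: mw_norm => //; exact: aX.
  by apply/seteqP; split => w h i; exact: h.
have mC n : measurable (C n) by exact: (filt_measurable PF _ (FC n)).
pose Cinf := \bigcap_n C (n1 + n)%N.
have mCinf : measurable Cinf by exact: bigcap_measurableType.
have fE D : measurable D -> P D = (fine (P D))%:E.
  by move=> mD; rewrite fineK// fin_num_measure.
set p := fine (P Cinf); have p0 : 0 <= p by rewrite fine_ge0.
have Cp n : p <= fine (P (C (n1 + n)%N)).
  rewrite fine_le ?fin_num_measure// le_measure ?inE//.
  by move=> w h; exact: h.
(* Each step removes at least [p / (a (n1 + n + 1))], where [p] is the limiting probability, and the
   harmonic terms dominate the increments of [ln]. *)
have decr n : fine (P (C (n1 + n)%N)) + p / a * (ln (n1 + n).+1%:R - ln n1.+1%:R) <= 1.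
  elim: n => [|n ih].
    by rewrite addn0 subrr mulr0 addr0 -lee_fin -fE// probability_le1.
  pose Q := [set w | b (n1 + n).+1 <= `|X (T (n1 + n).+1)%:R w|].
  have mQ : measurable Q by apply: measurable_ge_set; exact: measurableT_comp.
  have CS : C (n1 + n.+1)%N = C (n1 + n)%N `\` Q.
    rewrite addnS; apply/seteqP; split => w.
      move=> h; split => [i /andP[h1 h2]|]; first by apply: h; rewrite h1 leqW.
      by apply/negP; rewrite -ltNge; apply: h; rewrite leqnn -addnS leq_addr.
    move=> [h /negP]; rewrite -ltNge => hQ i /andP[h1].
    by rewrite leq_eqVlt => /orP[/eqP->//|h2]; apply: h; rewrite h1.
  have mCQ := measurableI _ _ (mC (n1 + n)%N) mQ.
  have E : fine (P (C (n1 + n.+1)%N)) = fine (P (C (n1 + n)%N)) - fine (P (C (n1 + n)%N `&` Q)).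
    rewrite CS measureD// ?fineB ?fin_num_measure//.
    by rewrite ltey_eq fin_num_measure.
  have := step (n1 + n)%N (C (n1 + n)%N) (leq_addr _ _) (FC _).
  have Cb w : C (n1 + n)%N w -> `|X (T (n1 + n)%N)%:R w| <= b (n1 + n)%N.
    by move=> h; apply: ltW; apply: h; rewrite leqnn leq_addr.
  move=> /(_ Cb); rewrite -/Q (fE _ (mC _)) (fE _ mCQ) -EFinM lee_fin => h.
  have ha : (((n1 + n).+1%:R * a)^-1 : R) = (n1 + n).+1%:R^-1 / a by rewrite invfM.
  have h1 : (n1 + n).+1%:R^-1 / a * p <= fine (P (C (n1 + n)%N `&` Q)).
    rewrite -ha; apply: le_trans h; apply: ler_wpM2l; last exact: Cp.
    by rewrite invr_ge0 mulr_ge0// ltW.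
  have h2 : ln (n1 + n).+2%:R - ln (n1 + n).+1%:R <= (n1 + n).+1%:R^-1 :> R.
    rewrite -ln_div ?posrE// -[_.+2%:R]natr1 mulrDl divff// mul1r.
    by apply: le_ln1Dx; apply: (@lt_le_trans _ _ 0); rewrite ?ltrN10// invr_ge0.
  have h3 := ler_wpM2l (divr_ge0 p0 (ltW a0)) h2.
  rewrite E addnS.
  rewrite (_ : _ / a * p = p / a * (n1 + n).+1%:R^-1) in h1; last by ring.
  by move: h1 h3 ih; set x1 := p / a * _; set x2 := ln _; set x3 := ln _; set x4 := ln _;
    rewrite !mulrBr; lra.
exists Cinf; split => //; last first.
  by move=> w h n _ i /andP[h1 _]; exact: h.
rewrite (fE _ mCinf) -/p; congr EFin; apply/eqP; rewrite eq_le p0 andbT leNgt.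
apply/negP => p_gt0.
(* By this index the logarithm has grown by at least [2 a / p], so [decr] would give
   [p + 2 <= 1]. *)
pose M := expR (ln n1.+1%:R + 2 * (a / p)).
have := decr (Num.truncn M).
have : ln M <= ln (n1 + Num.truncn M).+1%:R.
  rewrite ler_ln ?posrE ?expR_gt0//; apply: ltW; apply: lt_le_trans (truncnS_gt _) _.
  by rewrite ler_nat ltnS leq_addl.
rewrite expRK => h1; have h2 := Cp (Num.truncn M).
have : p / a * (2 * (a / p)) <= p / a * (ln (n1 + Num.truncn M).+1%:R - ln n1.+1%:R).
  by apply: ler_wpM2l; [rewrite divr_ge0// ltW|lra].
rewrite (_ : p / a * _ = 2); last by field; rewrite !gt_eqF.
lra.
Qed.

(** [bb n] is [sqrt S] times the norming function at [T n = q^n], and [r n] is the conjugate tilt: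
    [r bb = 2 L] and [r^2 S T = 2 L] with [L = ln (ln T)]. Missing the level [b n] at [T n] provides
    the small starting value for the next block. *)
Lemma lower_lil (c : R) : 0 < c -> c ^+ 2 < S ->
  {ae P, forall w, forall T0, exists2 t, T0 <= t &
    c * Num.sqrt (2 * t * ln (ln t)) <= `|X t w|}.
Proof.
move=> c0 cS; have S0' := S0.
pose x := c / Num.sqrt S; have sS : 0 < Num.sqrt S by rewrite sqrtr_gt0.
have x1 : x < 1.
  rewrite ltr_pdivrMr// mul1r -(ger0_norm (ltW c0)) -sqrtr_sqr.
  by rewrite ltr_sqrt.
(* Ensures [x <= 1 - 5 eta <= (1 - eta) (1 - 4 eta)], the total loss in the level. *)
pose eta := Num.min 5^-1 ((1 - x) / 5).
have eta0 : 0 < eta by rewrite lt_min; apply/andP; split; lra.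
have eta5 : eta <= 5^-1 by rewrite ge_min lexx.
have etax : eta <= (1 - x) / 5 by rewrite ge_min lexx orbT.
have e4 : 0 < 1 - 4 * eta by lra.
have xe : x <= (1 - eta) * (1 - 4 * eta).
  by have := sqr_ge0 eta; rewrite expr2; lra.
have [L0 [r0 [L01 r00 H]]] := path_lower eta0 eta5.
pose dl := eta ^+ 2 / 14; have dl0 : 0 < dl by rewrite /dl divr_gt0// exprn_gt0.
have e1 : eta ^+ 2 <= 1 by rewrite expr_le1//; lra.
have dl1 : dl <= 1 by rewrite /dl; lra.
(* [1 / q <= dl^2] serves twice: levels scale like the square root of time, so [b n] is at most [dl]
   times the level of the next block, and [T n <= dl * T n.+1] makes the block almost the whole
   time. *)
pose q := (Num.truncn (dl ^+ 2)^-1).+2.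
have q2 : 1 < q%:R :> R by rewrite ltr1n.
have q0 : 0 < q%:R :> R by rewrite ltr0n.
have qdl : q%:R^-1 <= dl ^+ 2.
  rewrite -[leRHS]invrK lef_pV2 ?posrE// ?invr_gt0 ?exprn_gt0//; apply: ltW.
  by apply: lt_trans (truncnS_gt _) _; rewrite ltr_nat.
pose a := ln q%:R : R; have a0 : 0 < a by rewrite ln_gt0.
pose T n := (q ^ n)%N; pose u n : R := n%:R * a; pose L n := ln (u n).
have Tpos n : 0 < (T n)%:R :> R by rewrite ltr0n expn_gt0.
have TE n : (T n)%:R = expR (u n) :> R.
  by rewrite /u expRM_natl lnK ?posrE// natrX.
have TS n : (T n)%:R = q%:R^-1 * (T n.+1)%:R :> R.
  by rewrite /T expnS natrM mulKf// lt0r_neq0.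
have T_homo : {homo T : i j / (i <= j)%N} by move=> i j; rewrite /T leq_exp2l.
pose bb n := Num.sqrt (2 * S * (T n)%:R * L n).
pose r n := Num.sqrt (2 * L n / (S * (T n)%:R)).
pose U := Num.max (expR L0) (4 / (S * r0 ^+ 2)).
pose n1 := (Num.truncn (U / a)).+1.
have hU n : (n1 <= n)%N -> expR L0 <= u n /\ 4 / (S * r0 ^+ 2) <= u n.
  move=> hn; have : U / a < n%:R.
    by apply: lt_le_trans (truncnS_gt _) _; rewrite ler_nat.
  by rewrite ltr_pdivrMr// gt_max => /andP[/ltW ? /ltW ?].
have u0 n : (n1 <= n)%N -> 0 < u n.
  by move=> /hU[h _]; apply: lt_le_trans h; exact: expR_gt0.
have LL n : (n1 <= n)%N -> L0 <= L n.
  move=> hn; have [h _] := hU n hn.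
  by rewrite -[L0]expRK /L ler_ln ?posrE ?expR_gt0 ?u0.
have Lpos n : (n1 <= n)%N -> 0 < L n by move=> /LL; lra.
have rpos n : (n1 <= n)%N -> 0 < r n.
  by move=> /Lpos h; rewrite sqrtr_gt0 divr_gt0// ?mulr_gt0.
have bpos n : (n1 <= n)%N -> 0 < bb n.
  by move=> /Lpos h; rewrite sqrtr_gt0 !mulr_gt0.
have rle n : (n1 <= n)%N -> r n <= r0.
  move=> hn; have Ln := Lpos n hn; have un := u0 n hn; have [_ h] := hU n hn.
  rewrite -[leRHS](ger0_norm (ltW r00)) -sqrtr_sqr; apply: ler_wsqrtr.
  rewrite ler_pdivrMr ?mulr_gt0// TE.
  rewrite ler_pdivrMr in h; last by rewrite mulr_gt0// exprn_gt0.
  have h1 : L n <= u n by exact/ltW/ln_sublinear.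
  have := @expR_ge1Dxn R (u n) 1 (ltW un).
  rewrite (_ : 2`!%:R = 2 :> R)// => h2.
  have h3 : r0 ^+ 2 * S * (u n ^+ 2 / 2) <= r0 ^+ 2 * S * expR (u n).
    apply: ler_wpM2l; first by rewrite mulr_ge0 ?sqr_ge0// ltW.
    by apply: le_trans h2; rewrite lerDr.
  have h4 : 4 * u n <= u n * (S * r0 ^+ 2) * u n by rewrite ler_wpM2r// ltW.
  by rewrite expr2 in h3; lra.
have rbb n : (n1 <= n)%N -> r n * bb n = 2 * L n.
  move=> hn; have Ln := Lpos n hn.
  rewrite /r /bb -sqrtrM; last by rewrite divr_ge0 ?mulr_ge0// ltW.
  have -> : 2 * L n / (S * (T n)%:R) * (2 * S * (T n)%:R * L n) = (2 * L n) ^+ 2.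
    by field; rewrite !gt_eqF.
  by rewrite sqrtr_sqr ger0_norm// mulr_ge0// ltW.
have rST n : (n1 <= n)%N -> r n ^+ 2 * (S * (T n)%:R) = 2 * L n.
  move=> hn; have Ln := Lpos n hn.
  rewrite sqr_sqrtr; last by rewrite divr_ge0 ?mulr_ge0// ltW.
  by field; rewrite !gt_eqF.
pose b n := (1 - eta) * ((1 - 4 * eta) * bb n).
have bS n : (n1 <= n)%N -> b n <= dl * ((1 - 4 * eta) * bb n.+1).
  move=> hn; have hn' := leqW hn; have Ln := Lpos n hn; have Ln' := Lpos n.+1 hn'.
  have Bn := bpos n hn.
  have h : bb n <= dl * bb n.+1.
    rewrite -[dl](ger0_norm (ltW dl0)) -sqrtr_sqr -sqrtrM ?sqr_ge0//.
    apply: ler_wsqrtr.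
    have LS : L n <= L n.+1.
      by rewrite /L ler_ln ?posrE ?u0// /u ler_pM2r// ler_nat.
    have TdS : (T n)%:R <= dl ^+ 2 * (T n.+1)%:R by rewrite TS ler_wpM2r.
    rewrite [leRHS](_ : _ = 2 * S * (dl ^+ 2 * (T n.+1)%:R * L n.+1)); last by ring.
    rewrite -mulrA ler_pM2l ?mulr_gt0//; apply: ler_pM => //; exact: ltW.
  have k : 0 <= (1 - 4 * eta) * bb n by exact: mulr_ge0 (ltW e4) (ltW Bn).
  apply: (@le_trans _ _ ((1 - 4 * eta) * bb n)).
    by rewrite /b ler_piMl// gerBl ltW.
  by rewrite mulrCA ler_wpM2l// ltW.
have step n A : (n1 <= n)%N -> F (T n)%:R A -> (forall w, A w -> `|X (T n)%:R w| <= b n) ->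
    ((n.+1%:R * a)^-1%:E * P A <= P (A `&` [set w | (b n.+1 <= `|X (T n.+1)%:R w|)%R]))%E.
  move=> hn FA Ab; have hn' := leqW hn.
  have -> : (n.+1%:R * a)^-1 = expR (- L n.+1).
    by rewrite expRN lnK// posrE u0.
  apply: (H (L n.+1) (r n.+1) (bb n.+1) (T n) (T n.+1)) => //.
  - exact: LL.
  - by rewrite rpos//= rle.
  - exact: bpos.
  - exact: rbb.
  - exact: rST.
  - exact: T_homo.
  - rewrite TS; apply: ler_wpM2r => //; apply: le_trans qdl _.
    by rewrite -/dl expr2 ler_piMl// ltW.
  - by move=> w Aw; apply: le_trans (Ab w Aw) _; exact: bS.
(* Starting the count at every [n1 + k] covers all paths with finitely many exceedances. *)
have N0 k : P.-negligible [set w | forall n, (n1 + k <= n)%N -> `|X (T n)%:R w| < b n].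
  apply: (@never_exceeds0 T b a) => // n A hn; apply: step.
  exact: leq_trans (leq_addr _ _) hn.
apply: negligibleS (negligible_bigcup N0) => w nP.
apply: contrapT => nU; apply: nP => T0.
pose k := Num.truncn T0.
have [n [nk bX]] : exists n, (n1 + k < n)%N /\ b n <= `|X (T n)%:R w|.
  apply: contrapT => h; apply: nU; exists k.+1 => // n nk /=.
  by rewrite ltNge; apply/negP => h2; apply: h; exists n; rewrite -addnS.
exists (T n)%:R.
  apply: ltW; apply: lt_le_trans (truncnS_gt _) _; rewrite ler_nat.
  apply: leq_trans (ltnW (ltn_expl n (isT : (1 < q)%N))).
  by apply: leq_trans nk; rewrite ltnS leq_addl.
apply: le_trans bX; have hn : (n1 <= n)%N.
  by apply: leq_trans (ltnW nk); exact: leq_addr.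
rewrite (_ : ln (ln _) = L n); last by rewrite TE expRK.
have bbE : bb n = Num.sqrt S * Num.sqrt (2 * (T n)%:R * L n).
  by rewrite -sqrtrM ?ltW// /bb; congr Num.sqrt; ring.
rewrite /b bbE !mulrA ler_wpM2r ?sqrtr_ge0//.
have -> : c = x * Num.sqrt S by rewrite /x mulfVK// gt_eqF.
by rewrite ler_pM2r.
Qed.

End lower_lil.

(** * Assembly *)

Lemma limf_esup_lil (R : realType) (y : R -> R) (s : R) : 0 <= s ->
  (forall p : nat, exists T0, forall t, T0 <= t ->
     `|y t| <= (s + p.+1%:R^-1) * Num.sqrt (2 * t * ln (ln t))) ->
  (forall (p : nat) T0, exists2 t, T0 <= t &
     s * (1 - p.+2%:R^-1) * Num.sqrt (2 * t * ln (ln t)) <= `|y t|) ->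
  limf_esup (fun t : R => (`|y t| / Num.sqrt (2 * t * ln (ln t)))%:E) (pinfty_nbhs R) = s%:E.
Proof.
move=> s0 up low.
(* From here on the iterated logarithm is at least 1, so the norming function is positive and
   division by it is meaningful. *)
pose T1 : R := expR (expR 1).
have phi0 t : T1 <= t -> 0 < Num.sqrt (2 * t * ln (ln t)).
  move=> Tt; have t0 : 0 < t by apply: lt_le_trans Tt; exact: expR_gt0.
  have h : expR 1 <= ln t by rewrite -[leLHS]expRK ler_ln ?posrE ?expR_gt0.
  rewrite sqrtr_gt0 !mulr_gt0// ln_gt0//; apply: lt_le_trans h.
  by rewrite -expR0 ltr_expR.
have small (e : R) : 0 < e -> exists p : nat, p.+1%:R^-1 <= e.
  move=> e0; exists (Num.truncn e^-1); rewrite -[leRHS]invrK lef_pV2 ?posrE ?invr_gt0//.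
  exact/ltW/truncnS_gt.
apply/eqP; rewrite eq_le; apply/andP; split.
  apply/lee_addgt0Pr => e e0; have [p pe] := small e e0; have [T0 HT] := up p.
  pose T := Num.max T0 T1.
  apply: ge_ereal_inf; eexists.
    exists [set t | T < t] => //; exists T; split => //; exact: num_real.
  apply: ge_ereal_sup => _ [t /= Tt <-].
  move: Tt; rewrite /T gt_max => /andP[/ltW h0 /ltW h1].
  rewrite -EFinD lee_fin ler_pdivrMr ?phi0//; apply: le_trans (HT t h0) _.
  by rewrite ler_wpM2r ?sqrtr_ge0// lerD2l.
apply: le_ereal_inf_tmp => _ [V [M [_ HM]] <-].
apply/lee_addgt0Pr => e e0.
have [p pe] : exists p : nat, s * p.+2%:R^-1 <= e.
  have e1 : 0 < e / (s + 1) by rewrite divr_gt0// ltr_wpDl.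
  have [p hp] := small _ e1; exists p.
  apply: (@le_trans _ _ (s * p.+1%:R^-1)).
    by rewrite ler_wpM2l// lef_pV2 ?posrE// ler_nat.
  apply: (le_trans (ler_wpM2l s0 hp)).
  by rewrite mulrCA ler_piMr ?(ltW e0)// ler_pdivrMr ?ltr_wpDl// mul1r lerDl.
have [t Tt yt] := low p (Num.max (M + 1) T1).
move: Tt; rewrite ge_max => /andP[Mt Tt].
rewrite -leeBlDr//; apply: le_ereal_sup_tmp.
exists (`|y t| / Num.sqrt (2 * t * ln (ln t)))%:E.
  by exists t => //; apply: HM; lra.
rewrite -EFinB lee_fin ler_pdivlMr ?phi0//; apply: le_trans yt.
by rewrite ler_wpM2r ?sqrtr_ge0// mulrBr mulr1 lerD2l lerN2.
Qed.

Theorem theorem2p2 (R : realType) (d : measure_display)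
    (Omega : measurableType d) (P : probability Omega R)
    (F : R -> set_system Omega) (B : R -> Omega -> R) (x0 : R)
    (f : R * R -> R) (g : R -> R) (sigma rho : R)
    (PF_complete : complete_filtered_probability_space P F)
    (B_brownian : brownian_motion P F B)
    (f_lipschitz : [locally [lipschitz f p | p in space_time R]])
    (g_lipschitz : [locally [lipschitz g x | x in [set: R]]])
    (g_even : forall x, g (- x) = g x)
    (g_neq0 : forall x, g x != 0)
    (sigma_neq0 : sigma != 0)
    (g_cvg_pinfty : g x @[x --> +oo] --> sigma)
    (g_cvg_ninfty : g x @[x --> -oo] --> sigma)
    (rho_gt0 : 0 < rho)
    (xf_sup : (ereal_sup [set (p.1 * f p)%:E | p in space_time R] <= rho%:E)%E) :
  [/\ exists X : R -> Omega -> R, sde_solution P F B f g x0 X,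
      forall X Y : R -> Omega -> R,
        sde_solution P F B f g x0 X -> sde_solution P F B f g x0 Y ->
        indistinguishable P X Y &
      ((- 2^-1)%:E
        < ereal_inf [set (p.1 * f p / g p.1 ^+ 2)%:E | p in space_time R])%E ->
      forall X : R -> Omega -> R, sde_solution P F B f g x0 X ->
        {ae P, forall w,
          limf_esup (fun t : R =>
            (`|X t w| / Num.sqrt (2 * t * ln (ln t)))%:E) (pinfty_nbhs R)
          = `|sigma|%:E}].
Proof.
have f_lip := drift_lipschitz f_lipschitz; have g_lip := diffusion_lipschitz g_lipschitz.
have [G G0 gG] := diffusion_bounded g_lip g_cvg_pinfty g_cvg_ninfty.
have xf_le x t : 0 <= t -> x * f (x, t) <= rho.
  move=> t0; rewrite -lee_fin; apply: le_trans xf_sup; apply: ereal_sup_ubound.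
  by exists (x, t).
have [X [nn [NB [cX aX nnj [mNB PNB] near_X]]]] :=
  exists_euler_limit x0 PF_complete B_brownian f_lip g_lip gG rho_gt0 xf_le.
have solX : sde_solution P F B f g x0 X.
  exact: (limit_solution PF_complete B_brownian f_lip g_lip gG cX aX nnj mNB PNB near_X).
have uniq Y Z : sde_solution P F B f g x0 Y -> sde_solution P F B f g x0 Z ->
    indistinguishable P Y Z by exact: pathwise_unique.
split; [by exists X|exact: uniq|move=> mu_gt Y solY].
have S0 : 0 < sigma ^+ 2 by rewrite exprn_even_gt0//= sigma_neq0 orbT.
have g_tail eps : 0 < eps -> exists2 K, 0 <= K &
    forall x, K < `|x| -> sigma ^+ 2 - eps <= g x ^+ 2 <= sigma ^+ 2 + eps.
  move=> eps0; have [K K0 HK] := diffusion_sqr_tail g_lip g_cvg_pinfty g_cvg_ninfty eps0.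
  by exists K => //; exact: ltW.
have [g0 g00 g_ge] := diffusion_sqr_lower g_lip sigma_neq0 g_neq0 g_cvg_pinfty g_cvg_ninfty.
have [m [m0 m1 xf_ge]] : exists m, [/\ 0 <= m, m < 2^-1 &
    forall x t, 0 <= t -> - (m * g x ^+ 2) <= x * f (x, t)].
  (* The point [x = 0] contributes the value 0, so the infimum is finite and at most 0, and [m] can
     be its opposite. *)
  move: mu_gt; set I := ereal_inf _ => mu_gt.
  have I0 : (I <= 0)%E.
    apply: ereal_inf_lbound; exists (0, 0) => /=; first by split => /=.
    by rewrite mul0r mul0r.
  have If : I \is a fin_num.
    rewrite fin_numE -ltNye -ltey (le_lt_trans I0) ?ltry// andbT.
    by apply: lt_trans mu_gt; rewrite ltNyr.
  exists (- fine I); rewrite oppr_ge0 -lee_fin fineK//.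
  split => // [|x t t0]; first by rewrite ltrNl -lte_fin fineK.
  rewrite mulNr opprK -ler_pdivlMr; last by rewrite exprn_even_gt0//= g_neq0 orbT.
  by rewrite -lee_fin fineK//; apply: ereal_inf_lbound; exists (x, t).
have s0 : 0 < `|sigma| by rewrite normr_gt0.
(* Both bounds are used along sequences of levels tending to [|sigma|], so only countably many null
   sets arise; [p.+2] in the lower one keeps its level positive at [p = 0]. *)
have up (p : nat) : {ae P, forall w, exists T0, forall t, T0 <= t ->
    `|X t w| <= (`|sigma| + p.+1%:R^-1) * Num.sqrt (2 * t * ln (ln t))}.
  have p0 : 0 < p.+1%:R^-1 :> R by rewrite invr_gt0.
  apply: (upper_lil PF_complete B_brownian f_lip g_lip gG rho_gt0 xf_le S0 g_tail
    cX aX nnj mNB PNB near_X); first exact: addr_gt0.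
  by rewrite -(real_normK (num_real sigma)) ltr_pXn2r ?nnegrE ?addr_ge0 ?ltrDl// ltW.
have low (p : nat) : {ae P, forall w, forall T0, exists2 t, T0 <= t &
    `|sigma| * (1 - p.+2%:R^-1) * Num.sqrt (2 * t * ln (ln t)) <= `|X t w|}.
  have p0 : 0 < p.+2%:R^-1 :> R by rewrite invr_gt0.
  have p1 : p.+2%:R^-1 < 1 :> R by rewrite invf_lt1 ?posrE// ltr1n.
  have c0 : 0 < `|sigma| * (1 - p.+2%:R^-1) by rewrite mulr_gt0// subr_gt0.
  apply: (lower_lil PF_complete B_brownian f_lip g_lip gG rho_gt0 xf_le S0 g_tail
    m0 m1 g00 g_ge xf_ge aX nnj mNB PNB near_X) => //.
  rewrite -(real_normK (num_real sigma)) ltr_pXn2r ?nnegrE ?(ltW c0) ?(ltW s0)//.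
  by rewrite gtr_pMr// gtrBl.
have N1 := negligible_bigcup up; have N2 := negligible_bigcup low.
apply: negligibleS (negligibleU (negligibleU N1 N2) (uniq _ _ solX solY)) => w /= nw.
apply: contrapT => h; apply: nw.
have XY t : 0 <= t -> X t w = Y t w.
  by apply: contrapT => h2; apply: h; right => h3; apply: h2; exact: h3.
have h1 p : exists T0, forall t, T0 <= t ->
    `|X t w| <= (`|sigma| + p.+1%:R^-1) * Num.sqrt (2 * t * ln (ln t)).
  by apply: contrapT => h2; apply: h; left; left; exists p.
have h2 (p : nat) T0 : exists2 t, T0 <= t &
    `|sigma| * (1 - p.+2%:R^-1) * Num.sqrt (2 * t * ln (ln t)) <= `|X t w|.
  by move: T0; apply: contrapT => h3; apply: h; left; right; exists p.
apply: limf_esup_lil => // [p|p T0].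
- have [T0 HT] := h1 p; exists (Num.max 0 T0) => t; rewrite ge_max => /andP[t0 Tt].
  by rewrite -XY//; exact: HT.
- have [t Tt Xt] := h2 p (Num.max 0 T0); move: Tt; rewrite ge_max => /andP[t0 Tt].
  by exists t => //; rewrite -XY.
Qed.
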